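(* Let $c_1,c_2\in\mathbb{R}$. For $s>\frac12$, $a<\min\left(\frac12,\,s-\frac12\right)$ and $b=\frac12+\epsilon$ with $\epsilon>0$ sufficiently small, we have $$\big\|(c_1I+c_2K)(u\overline v)\,w\big\|_{X^{s+a,b-1}}\lesssim\|u\|_{X^{s,b}}\|v\|_{X^{s,b}}\|w\|_{X^{s,b}}$$ for all $u,v,w\in X^{s,b}$, with an implicit constant independent of $u,v,w$.
   Context: For functions $u$ on $\mathbb{R}^2\times\mathbb{R}$ (space $\times$ time) with space-time Fourier transform $\widehat u(\xi,\tau)$, $\xi\in\mathbb{R}^2$, $\tau\in\mathbb{R}$, and for $s,b\in\mathbb{R}$, $$\|u\|_{X^{s,b}}=\|\langle\xi\rangle^s\langle\tau+|\xi|^2\rangle^b\,\widehat u(\xi,\tau)\|_{L^2_{\xi,\tau}},\qquad \langle\cdot\rangle=\sqrt{1+|\cdot|^2}.$$ $I$ is the identity operator and $K$ is the Fourier multiplier operator acting in the spatial variables by $\widehat{K(f)}(\xi)=\alpha(\xi)\widehat f(\xi)$ with $\alpha(\xi)=\xi_1^2/|\xi|^2$ for $\xi=(\xi_1,\xi_2)\ne(0,0)$. The expression $(c_1I+c_2K)(u\overline v)\,w$ means the operator $c_1I+c_2K$ applied to $u\overline v$, then multiplied by $w$. $A\lesssim B$ means $A\le CB$ for a constant $C$ (here allowed to depend on $s,a,\epsilon,c_1,c_2$); the smallness of $\epsilon$ may depend on $s$ and $a$. *)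

(* Defs.v *)
From HB Require Import structures.
From mathcomp Require Import all_boot all_order all_algebra.
From mathcomp Require Import complex.
From mathcomp Require Import all_classical all_reals all_analysis.

Set Implicit Arguments.
Unset Strict Implicit.
Unset Printing Implicit Defensive.

Import Order.TTheory GRing.Theory Num.Theory.
Import numFieldNormedType.Exports.
Import ComplexField.Normc.

Local Open Scope classical_set_scope.
Local Open Scope ring_scope.
Local Open Scope complex_scope.

(* Points of space-time are triples z = ((x1, x2), t), and points of the dual
   space are triples zeta = ((xi1, xi2), tau); both have type R * R * R, with
   the product Borel sigma-algebra and the product Lebesgue measure. *)

Section bourgain_space.
Context {R : realType}.

Local Notation dom3 :=
  (measurableTypeR R * measurableTypeR R * measurableTypeR R)%type.
Local Notation mu :=
  ((@lebesgue_measure R \x @lebesgue_measure R) \x @lebesgue_measure R)%E.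

Definition dot3 (z zeta : R * R * R) : R :=
  z.1.1 * zeta.1.1 + z.1.2 * zeta.1.2 + z.2 * zeta.2.

Definition iter_derive (vs : seq (R * R * R)) (phi : R * R * R -> R) :
    R * R * R -> R :=
  foldr (fun v g z => 'D_v g z) phi vs.

(* The norm on R * R * R is the sup norm, which is equivalent to the Euclidean
   one. *)
Definition schwartz (phi : R * R * R -> R) : Prop :=
  forall vs : seq (R * R * R),
    (forall z, differentiable (iter_derive vs phi) z) /\
    (forall N : nat, exists C : R, forall z,
       (1 + `|z|) ^+ N * `|iter_derive vs phi z| <= C).

(* Fourier transform of a test function, normalized as the integral of
   exp (- i z . zeta) phi(z) dz. *)
Definition fourier_test (phi : R * R * R -> R) (zeta : R * R * R) : R[i] :=
  Rintegral mu setT (fun z => cos (dot3 z zeta) * phi z) -i*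
  Rintegral mu setT (fun z => sin (dot3 z zeta) * phi z).

Definition cmeasurable (f : R * R * R -> R[i]) : Prop :=
  measurable_fun [set: dom3] (fun z => complex.Re (f z)) /\
  measurable_fun [set: dom3] (fun z => complex.Im (f z)).

Definition cintegral (f : R * R * R -> R[i]) : R[i] :=
  Rintegral mu setT (fun z => complex.Re (f z)) +i*
  Rintegral mu setT (fun z => complex.Im (f z)).

(* Functions of polynomial growth in the L^1 sense, such as all L^p functions for
   1 <= p <= +oo; they define tempered distributions by absolutely convergent
   integrals. *)
Definition tempered (f : R * R * R -> R[i]) : Prop :=
  cmeasurable f /\
  exists N : nat,
    mu.-integrable setT (fun z => (normc (f z) / (1 + `|z|) ^+ N)%:E).

(* F is the (space-time) Fourier transform of f in the sense of tempered
   distributions; F is determined by f, and f by F, up to a null set.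
   By linearity, real-valued test functions suffice. *)
Definition is_fourier (f F : R * R * R -> R[i]) : Prop :=
  [/\ tempered f, tempered F &
      forall phi, schwartz phi ->
        cintegral (fun z => f z * fourier_test phi z) =
        cintegral (fun z => F z * (phi z)%:C)].

Definition bracket (r : R) : R := Num.sqrt (1 + r ^+ 2).

Definition normsq2 (xi : R * R) : R := xi.1 ^+ 2 + xi.2 ^+ 2.

Definition Xweight (s b : R) (zeta : R * R * R) : R :=
  bracket (Num.sqrt (normsq2 zeta.1)) `^ s *
  bracket (zeta.2 + normsq2 zeta.1) `^ b.

Definition weightedL2 (s b : R) (U : R * R * R -> R[i]) : \bar R :=
  Lnorm mu 2%:E (fun zeta => (Xweight s b zeta * normc (U zeta))%:E).

(* The set below is empty when the Fourier transform of u is not a function,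
   in which case the norm is +oo; otherwise it is a singleton, since the Fourier
   transform is unique up to a null set. *)
Definition Xnorm (s b : R) (u : R * R * R -> R[i]) : \bar R :=
  ereal_inf [set weightedL2 s b U | U in is_fourier u].

(* For s, b >= 0, which is the case where membership is used, all the tempered
   distributions of finite X^{s,b} norm are functions, in L^2. *)
Definition Xspace (s b : R) : set (R * R * R -> R[i]) :=
  [set u | (Xnorm s b u < +oo)%E].

(* The value at xi = (0, 0) is 0 and is irrelevant. *)
Definition alpha (xi : R * R) : R := xi.1 ^+ 2 / normsq2 xi.

(* g = K f, up to a null set. The symbol of K does not depend on tau, so
   that K acts in the spatial variables only. *)
Definition is_K (f g : R * R * R -> R[i]) : Prop :=
  exists2 F, is_fourier f F &
    is_fourier g (fun zeta => (alpha zeta.1)%:C * F zeta).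

(* h = (c1 I + c2 K) f, up to a null set. *)
Definition is_c1I_c2K (c1 c2 : R) (f h : R * R * R -> R[i]) : Prop :=
  exists2 g, is_K f g & h = (fun z => c1%:C * f z + c2%:C * g z).

End bourgain_space.

(* Main.v *)
(** The Fourier transform of (c1 I + c2 K)(u conj(v)) w is, up to constants and
    the bounded symbol c1 + c2 alpha, an integral over (zeta1, zeta2) of
    U(zeta1) conj(V(zeta2)) W(zeta3), where zeta = zeta1 - zeta2 + zeta3.  By
    the Cauchy-Schwarz inequality the estimate follows from a bound, uniform in
    zeta, for the integral of
      <xi>^(2(s+a)) <sigma>^(2b-2) / prod_i <xi_i>^(2s) <sigma_i>^(2b),
    where sigma = tau + |xi|^2.  With p = xi1 - xi and q = xi3 - xi, one has
    sigma1 - sigma2 + sigma3 - sigma = - 2 p.q, so that one of the four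
    modulations is at least |p.q|/2: the modulation weights are at most a
    multiple of <p.q>^(2b-2) times a function that is integrable in tau1 and
    tau3.  Moreover <xi> is bounded by a multiple of <xi1> + <p>, <xi3> + <q>
    and <xi2> + <p> + <q>, which reduces the remaining integral over (p, q) to
    products of brackets in which <p.q>^(2b-2) is integrated first in q, at a
    gain of <p>^(2b-2).

    Functions with Fourier transform in L^2 are handled through Gaussian
    regularization: it gives the Plancherel inequality, the exchange of
    products and convolutions, and the uniqueness of the Fourier transform of a
    tempered function, for which modulated and translated Gaussians are enough
    test functions. *)

Require Import Defs.
From HB Require Import structures.
From mathcomp Require Import all_boot all_order all_algebra.
From mathcomp Require Import complex.
From mathcomp Require Import all_classical all_reals all_analysis.
From mathcomp Require Import measurable_realfun ring lra.

Set Implicit Arguments.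
Unset Strict Implicit.
Unset Printing Implicit Defensive.

Import Order.TTheory GRing.Theory Num.Theory.
Import numFieldNormedType.Exports.
Import ComplexField.Normc.

Local Open Scope classical_set_scope.
Local Open Scope ring_scope.

(** * Integration *)

(** Both thresholds on [a] come from one exponent count. Put th = 2 - 2b = 1 - 2 eps, and let ga and
    ga + k, with k = 2 max(a, 0), stand for the frequency exponents 2s and 2(s + a). The integral in
    q is of order <p>^(-ga-th); against <p>^(ga+k) there remains <p>^(k-th), to be integrated over
    the plane with <p+xi>^(-ga). This asks for k <= th, that is a < 1/2, and for ga - k + th > 2,
    which brings a < s - 1/2; the strict inequalities leave room for eps. As th < 1, the factor
    <p.q>^(-th) is not integrable by itself along any line: it has to share the work with the
    frequency brackets. In return its loss |p_i|^(-th) near p_i = 0 is locally integrable. On the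
    Fourier side, nothing makes U, V and W integrable, and u conj(v) is a priori only in L^1, with a
    bounded transform. A separate bilinear estimate puts this transform in L^2; only then is K(u
    conj(v)) known to be a function, whose product with w falls under the L^2 theory. *)

Section product_measure.
Context {R : realType} d1 d2 (T1 : measurableType d1) (T2 : measurableType d2).
Variable m1 : {sigma_finite_measure set T1 -> \bar R}.
Variable m2 : {sigma_finite_measure set T2 -> \bar R}.

Let sigma_finite_prod : sigma_finite [set: T1 * T2] (m1 \x m2)%E.
Proof.
have /sigma_finiteP[F [TF ndF Foo]] := sigma_finiteT m1.
have /sigma_finiteP[G [TG ndG Goo]] := sigma_finiteT m2.
exists (fun n => F n `*` G n).
  apply/seteqP; split => // -[x y] _.
  have : [set: T1] x by []. rewrite TF => -[i _ Fx].
  have : [set: T2] y by []. rewrite TG => -[j _ Gy].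
  exists (maxn i j) => //; split => /=.
    by move: x Fx; exact/subsetPset/ndF/leq_maxl.
  by move: y Gy; exact/subsetPset/ndG/leq_maxr.
move=> n; have [? ?] := Foo n; have [? ?] := Goo n.
split; first exact: measurableX.
by rewrite product_measure1E// lte_mul_pinfty// ge0_fin_numE.
Qed.

(* Registered explicitly: the sigma-finite instance inferred for [m1 \x m2]
   requires subprobability measures. *)
Definition prodm : {sigma_finite_measure set (T1 * T2)%type -> \bar R} :=
  HB.pack (m1 \x m2)%E
    (Measure_isSigmaFinite.Build _ _ _ (m1 \x m2)%E sigma_finite_prod).

End product_measure.

(** * Affine changes of variables *)

Section change_of_variables.
Context {R : realType}.
Local Notation leb := (@lebesgue_measure R).

(** Only nonnegative integrands occur, so that products of such maps are handled by Tonelli; signed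
    and complex integrands are recovered afterwards from positive and negative parts. The constant
    [c] is the inverse of the Jacobian. *)
Definition scales d (T : measurableType d) (m : {measure set T -> \bar R})
    (t : T -> T) (c : R) : Prop :=
  measurable_fun [set: T] t /\
  forall f : T -> \bar R, measurable_fun setT f ->
    (forall x, (0 <= f x)%E) ->
    (\int[m]_x f (t x) = c%:E * \int[m]_x f x)%E.

(** The image of Lebesgue measure under the map, multiplied by |a|, agrees with Lebesgue measure on
    half-open intervals, hence everywhere. For a < 0 the preimage of such an interval is half-open
    on the other side, which does not change its length. *)
Lemma scales_affine (a y : R) : a != 0 ->
  scales leb (fun x : measurableTypeR R => a * x + y) `|a|^-1.
Proof.
move=> a0.
have mt : measurable_fun [set: measurableTypeR R]
    (fun x : measurableTypeR R => a * x + y : measurableTypeR R).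
  by apply: measurable_funD => //; apply: measurable_funM.
have a1 : 0 < `|a| by rewrite normr_gt0.
pose t := fun x : measurableTypeR R => a * x + y : measurableTypeR R.
pose nu := mscale (NngNum (normr_ge0 a))
  (measure_function_pushforward__canonical__measure_function_Measure leb mt).
have key A : measurable A -> leb A = nu A.
  apply: lebesgue_measure_unique => X [[u v] /= uv] <-.
  rewrite /nu /mscale /= /pushforward.
  have [ap|an|a00] := ltrgtP 0 a; last by rewrite -a00 eqxx in a0.
  - rewrite (_ : _ @^-1` _ =
       `](u - y) / a, (v - y) / a]%classic); last first.
      apply/seteqP; split => x /=;
      by rewrite !in_itv /= ltr_pdivrMr // ler_pdivlMr // ltrBlDr lerBrDr mulrC.
    rewrite !lebesgue_measure_itv /= !lte_fin ltr_pM2r ?invr_gt0 // ltrBlDr subrK.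
    case: ifP => _; last by rewrite mule0.
    rewrite -EFinM; congr EFin; rewrite gtr0_norm//.
    by field.
  - rewrite (_ : _ @^-1` _ =
       `[(v - y) / a, (u - y) / a[%classic); last first.
      apply/seteqP; split => x /=;
      by rewrite !in_itv /= ler_ndivrMr // ltr_ndivlMr // ltrBlDr lerBrDr mulrC andbC.
    rewrite !lebesgue_measure_itv /= !lte_fin ltr_nM2r ?invr_lt0 // ltrBlDr subrK.
    case: ifP => _; last by rewrite mule0.
    rewrite -EFinM; congr EFin; rewrite ltr0_norm//.
    by field.
split=> // f mf f0.
have -> : (\int[leb]_x f x = \int[nu]_x f x)%E.
  by apply: eq_measure_integral => A mA _; exact: key.
rewrite ge0_integral_mscale //= ge0_integral_pushforward //=.
by rewrite muleA -EFinM mulVf ?mul1e // gt_eqF.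
Qed.

Lemma scales_translate (y : R) :
  scales leb (fun x : measurableTypeR R => x + y) 1.
Proof.
have := scales_affine y (oner_neq0 R); rewrite normr1 invr1.
by under [X in scales leb X _]eq_fun do rewrite mul1r.
Qed.

Lemma scales_prod d1 d2 (T1 : measurableType d1) (T2 : measurableType d2)
    (m1 : {sigma_finite_measure set T1 -> \bar R})
    (m2 : {sigma_finite_measure set T2 -> \bar R}) t1 t2 c1 c2 :
  0 <= c2 ->
  scales m1 t1 c1 -> scales m2 t2 c2 ->
  scales (prodm m1 m2) (fun x : T1 * T2 => (t1 x.1, t2 x.2)) (c1 * c2).
Proof.
move=> c20 [mt1 h1] [mt2 h2].
have mt : measurable_fun [set: T1 * T2] (fun x : T1 * T2 => (t1 x.1, t2 x.2)).
  by apply: measurable_fun_pair; apply: measurableT_comp.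
split => // f mf f0.
rewrite fubini_tonelli1 //; last exact: measurableT_comp.
rewrite fubini_tonelli1 // /fubini_F /=.
have mF := @measurable_fun_fubini_tonelli_F _ _ _ _ _ m2 f mf f0.
under eq_integral => x _.
  rewrite (h2 (fun y => f (t1 x, y))) //; last exact: measurableT_comp.
  over.
rewrite ge0_integralZl; first last.
- by rewrite lee_fin.
- by move=> x _; apply: integral_ge0.
- exact: (measurableT_comp mF).
- exact: measurableT.
rewrite (h1 _ mF); last by move=> x; apply: integral_ge0.
by rewrite muleA -EFinM mulrC.
Qed.
End change_of_variables.

(** * Cauchy-Schwarz, Fatou and dominated convergence for real integrands *)

Section real_integrals.
Context d (T : measurableType d) {R : realType} (m : {measure set T -> \bar R}).
Local Open Scope ereal_scope.

Lemma ge0_le_integralT (f g : T -> \bar R) :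
  measurable_fun setT f -> measurable_fun setT g ->
  (forall x, 0 <= f x) -> (forall x, f x <= g x) ->
  \int[m]_x f x <= \int[m]_x g x.
Proof.
move=> mf mg f0 fg; apply: ge0_le_integral => //.
Qed.

Lemma integral_sqr_Lnorm (h : T -> R) : (forall x, 0 <= h x)%R ->
  \int[m]_x (h x ^+ 2)%:E = 'N[m]_2%:E[EFin \o h] * 'N[m]_2%:E[EFin \o h].
Proof.
move=> h0; have n0 : (2%:R : R) != 0%R by [].
have := powR_Lnorm m (EFin \o h) n0.
have -> : \int[m]_x (h x ^+ 2)%:E = \int[m]_x `|(EFin \o h) x| `^ 2.
  by apply: eq_integral => x _ /=; rewrite powR_mulrn ?ger0_norm.
move=> <-; rewrite (_ : 2%:R = 1 + 1)%R// poweRD ?poweRe1 ?Lnorm_ge0//.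
by rewrite /poweRD_def; apply/implyP => /eqP; lra.
Qed.

(** Kept squared and in the extended reals: this form applies before any of the integrals is known
    to be finite. *)
Lemma cauchy_schwarz_integral (f g : T -> R) :
  measurable_fun setT f -> measurable_fun setT g ->
  (forall x, 0 <= f x)%R -> (forall x, 0 <= g x)%R ->
  (\int[m]_x (f x * g x)%:E) * (\int[m]_x (f x * g x)%:E)
   <= (\int[m]_x (f x ^+ 2)%:E) * (\int[m]_x (g x ^+ 2)%:E).
Proof.
move=> mf mg f0 g0.
have -> : \int[m]_x (f x * g x)%:E = 'N[m]_1[EFin \o (f \* g)%R].
  rewrite Lnorm1; apply: eq_integral => x _ /=.
  by rewrite ger0_norm// mulr_ge0.
rewrite !integral_sqr_Lnorm// muleACA.
have h : 'N[m]_1[EFin \o (f \* g)%R] <= 'N[m]_2%:E[EFin \o f] * 'N[m]_2%:E[EFin \o g].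
  by apply: hoelder => //; lra.
by apply: lee_pmul => //; rewrite Lnorm_ge0.
Qed.

(** Fatou's lemma bounds the integral of the lower limit, a measurable function which coincides with
    [g] almost everywhere. *)
Lemma fatou_le (h : nat -> T -> R) (g : T -> R) (B : \bar R) :
  (forall n, measurable_fun setT (h n)) -> (forall n x, 0 <= h n x)%R ->
  measurable_fun setT g ->
  (\forall x \ae m, h ^~ x @ \oo --> g x) ->
  (forall n, \int[m]_x (h n x)%:E <= B) ->
  \int[m]_x (g x)%:E <= B.
Proof.
move=> mh h0 mg hg hB.
have mh' n : measurable_fun setT (EFin \o h n) by exact/measurable_EFinP.
have -> : \int[m]_x (g x)%:E = \int[m]_x limn_einf (fun n => (h n x)%:E).
  apply: ae_eq_integral => //.
  - exact/measurable_EFinP.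
  - rewrite /limn_einf; apply: measurableT_comp => //.
    apply: (measurable_fun_limn_esup (f := fun n x => - (h n x)%:E)) => n.
    apply: (measurableT_comp (f := -%E)) => //; exact: mh'.
  - apply: filterS hg => x hx _; apply/esym.
    have hx' : (fun n => (h n x)%:E) @ \oo --> (g x)%:E.
      by apply: cvg_comp hx _; exact: cvg_id.
    by have [] := cvg_limn_einf_sup hx'.
apply: (le_trans (fatou _ _ _ _)) => //.
  by move=> n x _; rewrite lee_fin.
rewrite limn_einf_lim; apply: lime_le; first exact: is_cvg_einfs.
apply: nearW => n; apply: le_trans (hB n).
by apply: ereal_inf_lbound; exists n => /=.
Qed.

Lemma dominated_cvg0 (h : nat -> T -> R) (g : T -> R) :
  (forall n, measurable_fun setT (h n)) -> (forall n x, 0 <= h n x)%R ->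
  m.-integrable setT (EFin \o g) ->
  (forall n x, h n x <= g x)%R ->
  (\forall x \ae m, h ^~ x @ \oo --> 0%R) ->
  (fun n => Rintegral m setT (h n)) @ \oo --> 0%R.
Proof.
move=> mh h0 ig hg hc.
have mh' n : measurable_fun setT (EFin \o h n) by exact/measurable_EFinP.
have mc : measurable_fun setT (cst 0 : T -> \bar R) by exact: measurable_cst.
have [||_ _] := dominated_convergence measurableT mh' mc _ ig _.
- apply: filterS hc => x hx _.
  by apply: (cvg_comp _ _ hx); exact: cvg_id.
- by apply: aeW => x n _ /=; rewrite ger0_norm// lee_fin.
rewrite integral0 => /fine_cvgP[_]; apply: cvg_trans.
by apply: near_eq_cvg; exact: nearW.
Qed.

End real_integrals.

(** * Complex-valued integrals *)

Section complex_integrals.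
Context {R : realType}.
Local Notation Re := (@complex.Re R).
Local Notation Im := (@complex.Im R).
Implicit Types z w : R[i].

Lemma normc_sqrt z : normc z = Num.sqrt (Re z ^+ 2 + Im z ^+ 2).
Proof. by case: z. Qed.

Lemma normc_ge0 z : 0 <= normc z.
Proof. by rewrite normc_sqrt sqrtr_ge0. Qed.

Lemma normc_sqr z : normc z ^+ 2 = Re z ^+ 2 + Im z ^+ 2.
Proof. by rewrite normc_sqrt sqr_sqrtr// addr_ge0// sqr_ge0. Qed.

Lemma Re_le_normc z : `|Re z| <= normc z.
Proof.
by rewrite -sqrtr_sqr normc_sqrt ler_sqrt ?lerDl ?sqr_ge0// addr_ge0// sqr_ge0.
Qed.

Lemma Im_le_normc z : `|Im z| <= normc z.
Proof.
by rewrite -sqrtr_sqr normc_sqrt ler_sqrt ?lerDr ?sqr_ge0// addr_ge0// sqr_ge0.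
Qed.

Lemma normc_le_ReIm z : normc z <= `|Re z| + `|Im z|.
Proof.
rewrite -(@ler_pXn2r _ 2) ?nnegrE ?normc_ge0 ?addr_ge0//.
rewrite normc_sqr sqrrD !real_normK ?num_real// lerD2r lerDl.
by rewrite mulrn_wge0// mulr_ge0.
Qed.

Lemma normcD z w : normc (z + w) <= normc z + normc w.
Proof. exact: le_normcD. Qed.

Lemma normc_conj z : normc (conjc z) = normc z.
Proof. by case: z => a b; rewrite /= sqrrN. Qed.

Lemma normcR (x : R) : normc (x%:C)%C = `|x|.
Proof. by rewrite /= expr0n /= addr0 sqrtr_sqr. Qed.

Lemma normc_subC z w : normc (z - w) = normc (w - z).
Proof. by rewrite -normcN opprB. Qed.

Lemma ReM z w : Re (z * w) = Re z * Re w - Im z * Im w.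
Proof. by case: z; case: w. Qed.

Lemma ImM z w : Im (z * w) = Re z * Im w + Im z * Re w.
Proof. by case: z => a b; case: w => c d /=; rewrite addrC. Qed.

Lemma ReD z w : Re (z + w) = Re z + Re w.
Proof. by case: z; case: w. Qed.

Lemma ImD z w : Im (z + w) = Im z + Im w.
Proof. by case: z; case: w. Qed.

Lemma ReN z : Re (- z) = - Re z. Proof. by case: z. Qed.
Lemma ImN z : Im (- z) = - Im z. Proof. by case: z. Qed.

Lemma complex_ext z w : Re z = Re w -> Im z = Im w -> z = w.
Proof. by case: z => a b; case: w => c d /= -> ->. Qed.

Section cmeas.
Context d (T : measurableType d).
Implicit Types f g : T -> R[i].

Definition cmeas f :=
  measurable_fun setT (Re \o f) /\ measurable_fun setT (Im \o f).

Lemma cmeasD f g : cmeas f -> cmeas g -> cmeas (fun x => f x + g x).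
Proof.
move=> [f1 f2] [g1 g2]; split.
  rewrite [X in measurable_fun _ X](_ : _ = fun x => Re (f x) + Re (g x)).
    exact: measurable_funD.
  by apply/funext => x /=; rewrite ReD.
rewrite [X in measurable_fun _ X](_ : _ = fun x => Im (f x) + Im (g x)).
  exact: measurable_funD.
by apply/funext => x /=; rewrite ImD.
Qed.

Lemma cmeasM f g : cmeas f -> cmeas g -> cmeas (fun x => f x * g x).
Proof.
move=> [f1 f2] [g1 g2]; split.
  rewrite [X in measurable_fun _ X](_ : _ =
    fun x => Re (f x) * Re (g x) - Im (f x) * Im (g x)).
    by apply: measurable_funB; exact: measurable_funM.
  by apply/funext => x /=; rewrite ReM.
rewrite [X in measurable_fun _ X](_ : _ =
    fun x => Re (f x) * Im (g x) + Im (f x) * Re (g x)).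
  by apply: measurable_funD; exact: measurable_funM.
by apply/funext => x /=; rewrite ImM.
Qed.

Lemma cmeas_cst z : cmeas (cst z).
Proof. by split; exact: measurable_cst. Qed.

Lemma cmeas_real (f : T -> R) : measurable_fun setT f ->
  cmeas (fun x => (f x)%:C%C).
Proof. by move=> mf; split => //; exact: measurable_cst. Qed.

Lemma cmeasN f : cmeas f -> cmeas (fun x => - f x).
Proof.
move=> mf; rewrite (_ : (fun _ => _) = fun x => cst (-1) x * f x).
  by apply: cmeasM => //; exact: cmeas_cst.
by apply/funext => x /=; rewrite mulN1r.
Qed.

Lemma cmeasB f g : cmeas f -> cmeas g -> cmeas (fun x => f x - g x).
Proof. by move=> mf mg; apply: cmeasD => //; exact: cmeasN. Qed.

Lemma cmeasJ f : cmeas f -> cmeas (fun x => conjc (f x)).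
Proof.
move=> [f1 f2]; split.
  rewrite [X in measurable_fun _ X](_ : _ = Re \o f)//.
  by apply/funext => x /=; case: (f x).
rewrite [X in measurable_fun _ X](_ : _ = (fun x => - (Im (f x)))).
  exact: measurable_funN.
by apply/funext => x /=; case: (f x).
Qed.

Lemma measurable_normc f : cmeas f -> measurable_fun setT (fun x => normc (f x)).
Proof.
move=> [f1 f2].
rewrite [X in measurable_fun _ X](_ : _ = fun x =>
  Num.sqrt (Re (f x) ^+ 2 + Im (f x) ^+ 2)); last first.
  by apply/funext => x; rewrite normc_sqrt.
apply: measurableT_comp.
  by apply: continuous_measurable_fun; exact: sqrt_continuous.
by apply: measurable_funD; apply: measurable_funX.
Qed.

End cmeas.

Lemma cmeas_comp d1 d2 (T1 : measurableType d1) (T2 : measurableType d2)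
    (f : T2 -> R[i]) (g : T1 -> T2) :
  cmeas f -> measurable_fun setT g -> cmeas (f \o g).
Proof.
move=> [f1 f2] mg; split; first exact: (measurableT_comp f1 mg).
exact: (measurableT_comp f2 mg).
Qed.

Section Cint.
Context d (T : measurableType d) (m : {measure set T -> \bar R}).
Implicit Types f g : T -> R[i].

Definition cintble f :=
  m.-integrable setT (EFin \o (Re \o f)) /\
  m.-integrable setT (EFin \o (Im \o f)).

Definition Cint f : R[i] :=
  Complex (Rintegral m setT (fun x => Re (f x)))
          (Rintegral m setT (fun x => Im (f x))).

Lemma cintble_cmeas f : cintble f -> cmeas f.
Proof.
by move=> [/measurable_int/measurable_EFinP ? /measurable_int/measurable_EFinP ?].
Qed.

Lemma integrable_normcP f : cmeas f ->
  cintble f <-> m.-integrable setT (fun x => (normc (f x))%:E).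
Proof.
move=> mf; split.
  move=> [i1 i2].
  have := integrableD measurableT (integrable_abse i1) (integrable_abse i2).
  apply: le_integrable => //.
    by apply/measurable_EFinP; exact: measurable_normc.
  move=> x _ /=; rewrite !lee_fin ger0_norm ?normc_ge0//.
  by rewrite ger0_norm ?addr_ge0// normc_le_ReIm.
by move=> i; case: mf => mf1 mf2; split; apply: le_integrable i => //=;
  try (exact/measurable_EFinP); move=> x _ /=;
  rewrite lee_fin (ger0_norm (normc_ge0 _)) ?Re_le_normc ?Im_le_normc.
Qed.

Lemma cintble_le f (g : T -> R) : cmeas f -> m.-integrable setT (EFin \o g) ->
  (forall x, normc (f x) <= g x) -> cintble f.
Proof.
move=> mf ig fg; apply/integrable_normcP => //.
apply: le_integrable ig => //.
  by apply/measurable_EFinP; exact: measurable_normc.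
move=> x _ /=; rewrite lee_fin (ger0_norm (normc_ge0 _)).
by rewrite (le_trans (fg x))// ler_norm.
Qed.

Lemma cintbleP f : cmeas f ->
  (\int[m]_x (normc (f x))%:E < +oo)%E -> cintble f.
Proof.
move=> mf fi; apply/integrable_normcP => //; apply/integrableP; split.
  by apply/measurable_EFinP; exact: measurable_normc.
by under eq_integral do rewrite /= ger0_norm ?normc_ge0//.
Qed.

Lemma cintble_norm f : cintble f ->
  (\int[m]_x (normc (f x))%:E < +oo)%E.
Proof.
move=> fi; have mf := cintble_cmeas fi.
have /integrableP[_] := (integrable_normcP mf).1 fi.
by under eq_integral do rewrite /= ger0_norm ?normc_ge0//.
Qed.

Lemma eq_Cint f g : f =1 g -> Cint f = Cint g.
Proof. by move=> /funext ->. Qed.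

Lemma cintbleD f g : cintble f -> cintble g -> cintble (fun x => f x + g x).
Proof.
move=> [f1 f2] [g1 g2]; split.
  have := integrableD measurableT f1 g1; apply: eq_integrable => // x _.
  by rewrite /= ReD.
have := integrableD measurableT f2 g2; apply: eq_integrable => // x _.
by rewrite /= ImD.
Qed.

Lemma CintD f g : cintble f -> cintble g ->
  Cint (fun x => f x + g x) = Cint f + Cint g.
Proof.
move=> [f1 f2] [g1 g2]; rewrite /Cint; apply: complex_ext => /=.
  by rewrite -RintegralD//; apply: eq_Rintegral => x _; rewrite ReD.
by rewrite -RintegralD//; apply: eq_Rintegral => x _; rewrite ImD.
Qed.

Lemma cintbleZ z f : cintble f -> cintble (fun x => z * f x).
Proof.
move=> fi; have mf := cintble_cmeas fi.
have := integrableZl measurableT (normc z) ((integrable_normcP mf).1 fi).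
move/cintble_le; apply.
  by apply: (cmeasM (f := cst z)) => //; exact: cmeas_cst.
by move=> x; rewrite normcM.
Qed.

Lemma CintZ z f : cintble f -> Cint (fun x => z * f x) = z * Cint f.
Proof.
move=> [f1 f2]; have Z (a : R) (h : T -> R) : m.-integrable setT (EFin \o h) ->
    m.-integrable setT (EFin \o (fun x => a * h x)).
  by move=> hi; have := integrableZl measurableT a hi.
rewrite /Cint; apply: complex_ext; rewrite ?ReM ?ImM /=.
  rewrite -!RintegralZl//= -RintegralB//=; try exact: Z.
  by apply: eq_Rintegral => x _; rewrite ReM.
rewrite -!RintegralZl//= -RintegralD//=; try exact: Z.
by apply: eq_Rintegral => x _; rewrite ImM.
Qed.

Lemma CintZr z f : cintble f -> Cint (fun x => f x * z) = Cint f * z.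
Proof.
by move=> fi; rewrite mulrC -CintZ//; apply: eq_Cint => x; rewrite mulrC.
Qed.

Lemma cintbleN f : cintble f -> cintble (fun x => - f x).
Proof.
move=> /(cintbleZ (-1)); rewrite (_ : (fun _ => _) = fun x => - f x)//.
by apply/funext => x; rewrite mulN1r.
Qed.

Lemma CintN f : cintble f -> Cint (fun x => - f x) = - Cint f.
Proof.
move=> fi; rewrite -mulN1r -CintZ//; apply: eq_Cint => x.
by rewrite mulN1r.
Qed.

Lemma cintbleB f g : cintble f -> cintble g -> cintble (fun x => f x - g x).
Proof. by move=> fi /cintbleN; exact: cintbleD. Qed.

Lemma CintB f g : cintble f -> cintble g ->
  Cint (fun x => f x - g x) = Cint f - Cint g.
Proof. by move=> fi gi; rewrite CintD ?CintN//; exact: cintbleN. Qed.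

Lemma cintbleJ f : cintble f -> cintble (fun x => conjc (f x)).
Proof.
move=> fi; have mf := cintble_cmeas fi.
apply/integrable_normcP; first exact: cmeasJ.
by under eq_fun do rewrite normc_conj; exact/integrable_normcP.
Qed.

Lemma CintJ f : cintble f -> Cint (fun x => conjc (f x)) = conjc (Cint f).
Proof.
move=> [f1 f2]; apply: complex_ext => /=.
  by apply: eq_Rintegral => x _; case: (f x).
rewrite -mulN1r -RintegralZl//.
by apply: eq_Rintegral => x _; rewrite mulN1r; case: (f x).
Qed.

Lemma Cint_real (f : T -> R) : Cint (fun x => (f x)%:C%C) = (Rintegral m setT f)%:C%C.
Proof.
apply: complex_ext => //=.
by rewrite /Rintegral integral0.
Qed.

(** Rotation trick: with z the integral, |z|^2 is the real part of the integral of conj(z) f, hence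
    at most |z| times the integral of |f|; then divide by |z|. *)
Lemma normc_Cint f : cintble f -> normc (Cint f) <= Rintegral m setT (fun x => normc (f x)).
Proof.
move=> fi; have mf := cintble_cmeas fi.
have ni := (integrable_normcP mf).1 fi.
set z := Cint f.
have [z0|z0] := eqVneq (normc z) 0.
  by rewrite z0; apply: Rintegral_ge0 => x _; exact: normc_ge0.
have zp : 0 < normc z by rewrite lt_neqAle eq_sym z0 normc_ge0.
rewrite -(ler_pM2l zp) -RintegralZl//.
have -> : normc z * normc z = Re (Cint (fun x => conjc z * f x)).
  rewrite CintZ// -/z -expr2 normc_sqr ReM.
  by case: z {z0 zp} => a b /=; rewrite mulNr opprK !expr2.
have [zi _] := cintbleZ (conjc z) fi.
apply: le_Rintegral => //.
  exact: (integrableZl measurableT (normc z) ni).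
move=> x _; rewrite -(normc_conj z) -normcM.
by apply: le_trans (Re_le_normc _); exact: ler_norm.
Qed.

Lemma ae_eq_Cint f g : cmeas f -> cmeas g ->
  (\forall x \ae m, f x = g x) -> Cint f = Cint g.
Proof.
move=> [f1 f2] [g1 g2] fg; apply: complex_ext => /=; congr fine;
  apply: ae_eq_integral => //; try (exact/measurable_EFinP);
  by apply: filterS fg => x -> _.
Qed.

End Cint.
End complex_integrals.

Arguments Cint : simpl never.
Arguments ComplexField.Normc.normc : simpl never.

(** * Fubini for real and complex integrands *)

Section product_integrals.
Context {R : realType}.
Local Notation Re := (@complex.Re R).
Local Notation Im := (@complex.Im R).
Context d1 d2 (T1 : measurableType d1) (T2 : measurableType d2).
Variable m1 : {sigma_finite_measure set T1 -> \bar R}.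
Variable m2 : {sigma_finite_measure set T2 -> \bar R}.

Lemma measurable_Rintegral_param (f : T1 * T2 -> R) : measurable_fun setT f ->
  measurable_fun setT (fun x => Rintegral m2 setT (fun y => f (x, y))).
Proof.
move=> mf; have mEf : measurable_fun setT (EFin \o f) by exact/measurable_EFinP.
apply: measurableT_comp => //.
under eq_fun do rewrite integralE.
apply: emeasurable_funB.
- have /= := @measurable_fun_fubini_tonelli_F _ _ _ _ _ m2 (EFin \o f)^\+%E
    (measurable_funepos mEf) (fun x => funepos_ge0 _ x).
  apply: eq_measurable_fun => x _; apply: eq_integral => y _.
  by rewrite ?(funeposE, funenegE).
- have /= := @measurable_fun_fubini_tonelli_F _ _ _ _ _ m2 (EFin \o f)^\-%E
    (measurable_funeneg mEf) (fun x => funeneg_ge0 _ x).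
  apply: eq_measurable_fun => x _; apply: eq_integral => y _.
  by rewrite ?(funeposE, funenegE).
Qed.

Lemma cmeas_Cint_param (f : T1 * T2 -> R[i]) : cmeas f ->
  cmeas (fun x => Cint m2 (fun y => f (x, y))).
Proof.
move=> [f1 f2]; split.
  exact: (measurable_Rintegral_param f1).
exact: (measurable_Rintegral_param f2).
Qed.

(** Integrability of every section, not just of almost every one, makes the inner extended integral
    finite everywhere, so that it can be replaced by its real value under the outer integral. *)
Lemma Rintegral_fubini1 (f : T1 * T2 -> R) :
  (prodm m1 m2).-integrable setT (EFin \o f) ->
  (forall x, m2.-integrable setT (fun y => (f (x, y))%:E)) ->
  m1.-integrable setT (fun x => (Rintegral m2 setT (fun y => f (x, y)))%:E) /\
  Rintegral m1 setT (fun x => Rintegral m2 setT (fun y => f (x, y))) =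
  Rintegral (prodm m1 m2) setT f.
Proof.
move=> fi f2.
have e x : (\int[m2]_y (f (x, y))%:E)%E = (Rintegral m2 setT (fun y => f (x, y)))%:E.
  by rewrite /Rintegral fineK//; apply: integrable_fin_num.
split.
  have := integrable_fubini_F fi; rewrite /fubini_F /=.
  by under eq_fun do rewrite e.
have := integral12_prod_meas1 fi; rewrite /fubini_F /=.
by under eq_integral do rewrite e; move=> h; rewrite [RHS]/Rintegral -h.
Qed.

Lemma Rintegral_fubini2 (f : T1 * T2 -> R) :
  (prodm m1 m2).-integrable setT (EFin \o f) ->
  (forall y, m1.-integrable setT (fun x => (f (x, y))%:E)) ->
  Rintegral m2 setT (fun y => Rintegral m1 setT (fun x => f (x, y))) =
  Rintegral (prodm m1 m2) setT f.
Proof.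
move=> fi f2.
have e y : (\int[m1]_x (f (x, y))%:E)%E = (Rintegral m1 setT (fun x => f (x, y)))%:E.
  by rewrite /Rintegral fineK//; apply: integrable_fin_num.
have := integral21_prod_meas1 fi; rewrite /fubini_G /=.
by under eq_integral do rewrite e; move=> h; rewrite [RHS]/Rintegral -h.
Qed.

Lemma Cint_fubini1 (f : T1 * T2 -> R[i]) : cintble (prodm m1 m2) f ->
  (forall x, cintble m2 (fun y => f (x, y))) ->
  cintble m1 (fun x => Cint m2 (fun y => f (x, y))) /\
  Cint m1 (fun x => Cint m2 (fun y => f (x, y))) = Cint (prodm m1 m2) f.
Proof.
move=> [f1 f2] fi.
have [i1 e1] := Rintegral_fubini1 f1 (fun x => (fi x).1).
have [i2 e2] := Rintegral_fubini1 f2 (fun x => (fi x).2).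
by split; [split | apply: complex_ext].
Qed.

Lemma Cint_fubini2 (f : T1 * T2 -> R[i]) : cintble (prodm m1 m2) f ->
  (forall y, cintble m1 (fun x => f (x, y))) ->
  Cint m2 (fun y => Cint m1 (fun x => f (x, y))) = Cint (prodm m1 m2) f.
Proof.
move=> [f1 f2] fi.
have e1 := Rintegral_fubini2 f1 (fun x => (fi x).1).
have e2 := Rintegral_fubini2 f2 (fun x => (fi x).2).
exact: complex_ext.
Qed.

Lemma cmeas_fst (f : T1 -> R[i]) : cmeas f -> cmeas (fun x : T1 * T2 => f x.1).
Proof. by move=> mf; apply: (cmeas_comp mf). Qed.

Lemma cmeas_snd (f : T2 -> R[i]) : cmeas f -> cmeas (fun x : T1 * T2 => f x.2).
Proof. by move=> mf; apply: (cmeas_comp mf). Qed.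

Lemma integral_prod_mul (f : T1 -> R) (g : T2 -> R) :
  measurable_fun setT f -> measurable_fun setT g ->
  (forall x, 0 <= f x) -> (forall x, 0 <= g x) ->
  (\int[prodm m1 m2]_x (f x.1 * g x.2)%:E =
   (\int[m1]_x (f x)%:E) * \int[m2]_x (g x)%:E)%E.
Proof.
move=> mf mg f0 g0.
have mEg : measurable_fun setT (EFin \o g) by exact/measurable_EFinP.
have mEf : measurable_fun setT (EFin \o f) by exact/measurable_EFinP.
have g0' : (0 <= \int[m2]_x (g x)%:E)%E.
  by apply: integral_ge0 => x _; rewrite lee_fin.
rewrite fubini_tonelli1; last 2 first.
- by apply/measurable_EFinP; apply: measurable_funM; apply: measurableT_comp.
- by move=> x; rewrite lee_fin mulr_ge0.
rewrite /fubini_F /= -ge0_integralZr//; last first.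
  by move=> x _; rewrite lee_fin.
apply: eq_integral => x _; rewrite -ge0_integralZl_EFin//.
by move=> y _; rewrite lee_fin.
Qed.

Lemma Cint_prod_mul (f : T1 -> R[i]) (g : T2 -> R[i]) :
  cintble m1 f -> cintble m2 g ->
  cintble (prodm m1 m2) (fun x => f x.1 * g x.2) /\
  Cint (prodm m1 m2) (fun x => f x.1 * g x.2) = Cint m1 f * Cint m2 g.
Proof.
move=> fi gi.
have mf := cintble_cmeas fi; have mg := cintble_cmeas gi.
have i : cintble (prodm m1 m2) (fun x => f x.1 * g x.2).
  apply: cintbleP; first by apply: cmeasM; [exact: cmeas_fst | exact: cmeas_snd].
  under eq_integral do rewrite normcM.
  rewrite (integral_prod_mul (measurable_normc mf) (measurable_normc mg));
    try (by move=> x; exact: normc_ge0).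
  by apply: lte_mul_pinfty => //; [apply: integral_ge0 => x _; rewrite lee_fin normc_ge0
    | rewrite ge0_fin_numE ?cintble_norm//; apply: integral_ge0 => x _; rewrite lee_fin normc_ge0
    | exact: cintble_norm].
split => //.
rewrite -(Cint_fubini1 i (fun x => cintbleZ (f x) gi)).2.
rewrite -CintZr//; apply: eq_Cint => x /=.
exact: CintZ.
Qed.

End product_integrals.

(** * Square-integrable functions *)

Section L2.
Context {R : realType} d (T : measurableType d) (m : {measure set T -> \bar R}).
Implicit Types f g : T -> R[i].

(** The square of the L^2 norm, in the extended reals: Tonelli, Fatou and monotonicity apply to it
    directly. *)
Definition N2 f : \bar R := (\int[m]_x (normc (f x) ^+ 2)%:E)%E.

Definition L2 f : Prop := cmeas f /\ (N2 f < +oo)%E.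

Lemma measurable_sqr_normc f : cmeas f ->
  measurable_fun setT (fun x => (normc (f x) ^+ 2)%:E).
Proof.
by move=> mf; apply/measurable_EFinP; apply: measurable_funX; exact: measurable_normc.
Qed.

Lemma N2_ge0 f : (0 <= N2 f)%E.
Proof. by apply: integral_ge0 => x _; rewrite lee_fin sqr_ge0. Qed.

Lemma N2_fin f : L2 f -> N2 f \is a fin_num.
Proof. by move=> [_ fi]; rewrite ge0_fin_numE ?N2_ge0. Qed.

Lemma L2_integrable f : L2 f ->
  m.-integrable setT (fun x => (normc (f x) ^+ 2)%:E).
Proof.
move=> [mf fi]; apply/integrableP; split; first exact: measurable_sqr_normc.
by under eq_integral do rewrite /= ger0_norm ?sqr_ge0//.
Qed.

Lemma le_N2 f g : cmeas f -> cmeas g ->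
  (forall x, normc (f x) <= normc (g x)) -> (N2 f <= N2 g)%E.
Proof.
move=> mf mg fg; apply: ge0_le_integralT; try exact: measurable_sqr_normc.
- by move=> x; rewrite lee_fin sqr_ge0.
- by move=> x; rewrite lee_fin lerXn2r ?nnegrE ?normc_ge0.
Qed.

Lemma N2Z z f : cmeas f -> N2 (fun x => z * f x) = ((normc z ^+ 2)%:E * N2 f)%E.
Proof.
move=> mf; rewrite -ge0_integralZl_EFin ?sqr_ge0//.
- by apply: eq_integral => x _; rewrite normcM exprMn.
- by move=> x _; rewrite lee_fin sqr_ge0.
- exact: measurable_sqr_normc.
Qed.

Lemma L2Z z f : L2 f -> L2 (fun x => z * f x).
Proof.
move=> [mf fi]; split.
  by apply: (cmeasM (f := cst z)) => //; exact: cmeas_cst.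
by rewrite N2Z//; apply: lte_mul_pinfty; rewrite ?lee_fin ?sqr_ge0.
Qed.

(** From (x + y)^2 <= 2 x^2 + 2 y^2. This quasi-triangle inequality replaces Minkowski: all its uses
    are finiteness statements or limits equal to 0, where the factor 2 is harmless. *)
Lemma N2D f g : cmeas f -> cmeas g ->
  (N2 (fun x => (f x + g x)%R) <= 2%:E * N2 f + 2%:E * N2 g)%E.
Proof.
move=> mf mg; have mf2 := measurable_sqr_normc mf.
have mg2 := measurable_sqr_normc mg.
have f20 (h : T -> R[i]) x : setT x -> (0 <= (normc (h x) ^+ 2)%:E)%E.
  by move=> _; rewrite lee_fin sqr_ge0.
rewrite /N2 -!ge0_integralZl_EFin//; try exact: f20.
rewrite -ge0_integralD//; first last.
- exact: measurable_funeM.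
- by move=> x _; rewrite -EFinM lee_fin mulr_ge0// sqr_ge0.
- exact: measurable_funeM.
- by move=> x _; rewrite -EFinM lee_fin mulr_ge0// sqr_ge0.
apply: ge0_le_integralT.
- by apply: measurable_sqr_normc; exact: cmeasD.
- by apply: emeasurable_funD; exact: measurable_funeM.
- by move=> x; rewrite lee_fin sqr_ge0.
- move=> x; rewrite -!EFinM -EFinD lee_fin.
  apply: (@le_trans _ _ ((normc (f x) + normc (g x)) ^+ 2)).
    by rewrite lerXn2r ?nnegrE ?addr_ge0 ?normc_ge0// normcD.
  have := sqr_ge0 (normc (f x) - normc (g x)); nra.
Qed.

Lemma L2D f g : L2 f -> L2 g -> L2 (fun x => f x + g x).
Proof.
move=> [mf fi] [mg gi]; split; first exact: cmeasD.
apply: (le_lt_trans (N2D mf mg)); apply: lte_add_pinfty;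
  by apply: lte_mul_pinfty.
Qed.

Lemma L2N f : L2 f -> L2 (fun x => - f x).
Proof.
move=> /(L2Z (-1)); rewrite (_ : (fun _ => _) = fun x => - f x)//.
by apply/funext => x; rewrite mulN1r.
Qed.

Lemma L2B f g : L2 f -> L2 g -> L2 (fun x => f x - g x).
Proof. by move=> fi /L2N; exact: L2D. Qed.

Lemma N2J f : N2 (fun x => conjc (f x)) = N2 f.
Proof. by apply: eq_integral => x _; rewrite normc_conj. Qed.

Lemma L2J f : L2 f -> L2 (fun x => conjc (f x)).
Proof. by move=> [mf fi]; split; [exact: cmeasJ | rewrite N2J]. Qed.

Lemma L2_le f g : cmeas f -> L2 g -> (forall x, normc (f x) <= normc (g x)) -> L2 f.
Proof. by move=> mf [mg gi] fg; split => //; apply: le_lt_trans gi; exact: le_N2. Qed.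

Lemma ae_N2 f g : cmeas f -> cmeas g -> (\forall x \ae m, f x = g x) -> N2 f = N2 g.
Proof.
move=> mf mg fg; apply: ae_eq_integral => //; try exact: measurable_sqr_normc.
by apply: filterS fg => x -> _.
Qed.

Lemma ae_L2 f g : cmeas g -> (\forall x \ae m, f x = g x) -> L2 f -> L2 g.
Proof. by move=> mg fg [mf fi]; split => //; rewrite -(ae_N2 mf mg). Qed.

Lemma N2M f g : cmeas f -> cmeas g ->
  ((\int[m]_x (normc (f x * g x)%R)%:E) * (\int[m]_x (normc (f x * g x)%R)%:E)
   <= N2 f * N2 g)%E.
Proof.
move=> mf mg; under eq_integral do rewrite normcM.
by apply: cauchy_schwarz_integral; try exact: measurable_normc;
  move=> x; exact: normc_ge0.
Qed.

Lemma cintbleM f g : L2 f -> L2 g -> cintble m (fun x => f x * g x).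
Proof.
move=> lf lg.
have := integrableD measurableT (L2_integrable lf) (L2_integrable lg).
move/cintble_le; apply; first by apply: cmeasM; [exact: lf.1|exact: lg.1].
move=> x /=; rewrite normcM.
have := sqr_ge0 (normc (f x) - normc (g x)).
have := normc_ge0 (f x); have := normc_ge0 (g x); nra.
Qed.

Lemma normc_CintM f g : L2 f -> L2 g ->
  normc (Cint m (fun x => f x * g x)) <=
    Num.sqrt (fine (N2 f)) * Num.sqrt (fine (N2 g)).
Proof.
move=> lf lg; have fgi := cintbleM lf lg.
have mfg := cintble_cmeas fgi.
apply: (le_trans (normc_Cint fgi)).
rewrite -sqrtrM ?fine_ge0 ?N2_ge0//.
have r0 : 0 <= Rintegral m setT (fun x => normc (f x * g x)).
  by apply: Rintegral_ge0 => x _; exact: normc_ge0.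
rewrite -(ger0_norm r0) -sqrtr_sqr ler_sqrt ?mulr_ge0 ?fine_ge0 ?N2_ge0//.
rewrite -lee_fin expr2 !EFinM !fineK ?N2_fin//.
  exact: (N2M lf.1 lg.1).
by apply: integrable_fin_num => //; exact/integrable_normcP.
Qed.

End L2.

Section scales_signed.
Context {R : realType} d (T : measurableType d) (m : {measure set T -> \bar R}).
Variables (t : T -> T) (c : R).
Hypotheses (c0 : 0 <= c) (mtc : scales m t c).

Lemma scales_integrable (f : T -> R) : m.-integrable setT (EFin \o f) ->
  m.-integrable setT (EFin \o (fun x => f (t x))).
Proof.
have [mt h] := mtc.
move=> /integrableP[mf fi]; apply/integrableP; split.
  exact: (measurableT_comp mf mt).
rewrite (h (fun x => `|(EFin \o f) x|)%E)//.
  exact: lte_mul_pinfty.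
exact: measurableT_comp.
Qed.

Lemma scales_Rintegral (f : T -> R) : m.-integrable setT (EFin \o f) ->
  Rintegral m setT (fun x => f (t x)) = c * Rintegral m setT f.
Proof.
have [mt h] := mtc.
move=> fi; have mf := measurable_int m fi.
have ip := integrable_pos_fin_num measurableT fi.
have im := integrable_neg_fin_num measurableT fi.
rewrite /Rintegral integralE.
rewrite (_ : (\int[m]_x (fun x => (f (t x))%:E)^\+ x)%E =
  (c%:E * \int[m]_x (EFin \o f)^\+ x)%E); last first.
  rewrite -h//; last exact: measurable_funepos.
  by apply: eq_integral => x _; rewrite !funeposE.
rewrite (_ : (\int[m]_x (fun x => (f (t x))%:E)^\- x)%E =
  (c%:E * \int[m]_x (EFin \o f)^\- x)%E); last first.
  rewrite -h//; last exact: measurable_funeneg.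
  by apply: eq_integral => x _; rewrite !funenegE.
rewrite -muleBr//; last exact: fin_num_adde_defr.
rewrite -integralE fineM//.
by apply: integrable_fin_num.
Qed.

Lemma scales_cintble (f : T -> R[i]) : cintble m f ->
  cintble m (fun x => f (t x)).
Proof.
move=> [f1 f2]; split; first exact: (scales_integrable f1).
exact: (scales_integrable f2).
Qed.

Lemma scales_Cint (f : T -> R[i]) : cintble m f ->
  Cint m (fun x => f (t x)) = c%:C%C * Cint m f.
Proof.
move=> [f1 f2]; apply: complex_ext; rewrite ?ReM ?ImM /= mul0r ?subr0 ?addr0.
  exact: scales_Rintegral f1.
exact: scales_Rintegral f2.
Qed.

End scales_signed.

(** * Gaussian integrals and Fourier inversion *)

Section gaussian1.
Context {R : realType}.
Local Notation leb := (@lebesgue_measure R).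

Lemma integrable_gauss_scaled (e : R) : e != 0 ->
  leb.-integrable setT (EFin \o (fun x => gauss_fun (e * x))).
Proof.
move=> e0; have e1 : 0 <= `|e|^-1 by rewrite invr_ge0.
have := scales_integrable e1 (scales_affine 0 e0) (@integrableT_gauss R).
by apply: eq_integrable => // x _ /=; rewrite addr0.
Qed.

Lemma continuous_gauss_scaled (e : R) : continuous (fun x : R => gauss_fun (e * x)).
Proof.
move=> x; apply: (@continuous_comp _ _ _ (fun x : R => e * x) gauss_fun).
  exact: mulrl_continuous.
exact: continuous_gauss_fun.
Qed.

(** Three quarters of the exponent absorb the factor |x|, since |x| <= 1 + 3/4 x^2 <= exp (3/4 x^2);
    the remaining quarter is the Gaussian at x / 2. *)
Lemma integrable_x_gauss :
  leb.-integrable setT (EFin \o (fun x => `|x| * gauss_fun x)).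
Proof.
have h : (2%:R : R)^-1 != 0 by rewrite invr_eq0.
apply: le_integrable (integrable_gauss_scaled h) => //.
  apply/measurable_EFinP; apply: measurable_funM => //.
  exact: measurable_gauss_fun.
move=> x _ /=; rewrite lee_fin.
rewrite normrM normr_id !(ger0_norm (gauss_fun_ge0 _)) /gauss_fun.
have -> : - x ^+ 2 = - (2^-1 * x) ^+ 2 + - (3 / 4 * x ^+ 2) by field.
rewrite expRD mulrCA -[leRHS]mulr1 ler_pM2l ?expR_gt0//.
have h1 : `|x| <= expR (3 / 4 * x ^+ 2).
  apply: le_trans (expR_ge1Dx _).
  rewrite -real_normK ?num_real//.
  have := sqr_ge0 (`|x| - 2/3); nra.
apply: (le_trans (ler_wpM2r (expR_ge0 _) h1)).
by rewrite -expRD subrr expR0.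
Qed.

(** The integrals over [-n-1, n+1] are boundary terms, which tend to 0, and they also tend to the
    full integral by dominated convergence. *)
Lemma integral_derivative_eq0 (F f : R -> R) :
  (forall x, is_derive x (1 : R) F (f x)) -> continuous f ->
  leb.-integrable setT (EFin \o f) ->
  (fun n => F n%:R) @ \oo --> 0 -> (fun n => F (- n%:R)) @ \oo --> 0 ->
  Rintegral leb setT f = 0.
Proof.
move=> dF cf fi F1 F2.
pose g n (x : R) := f x * \1_(`[- n.+1%:R, n.+1%:R]%classic) x.
have ftc n : Rintegral leb setT (g n) = F n.+1%:R - F (- n.+1%:R).
  have n0 : - n.+1%:R < n.+1%:R :> R by rewrite gtrN.
  have cF x : {for x, continuous F}.
    by apply: differentiable_continuous; apply/derivable1_diffP; case: (dF x).
  have h := @continuous_FTC2 R f F _ _ n0 (continuous_subspaceT cf).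
  rewrite -[RHS]/(fine (F n.+1%:R - F (- n.+1%:R))%:E) EFinB -h.
  - rewrite [in RHS]integral_mkcond; congr fine.
    apply: eq_integral => x _; rewrite /g patchE.
    by case: ifPn => hx; rewrite indicE ?hx ?(negbTE hx) ?mulr1 ?mulr0.
  - split.
    + by move=> x _; case: (dF x).
    + exact/cvg_at_right_filter/cF.
    + exact/cvg_at_left_filter/cF.
  - by move=> x _; rewrite derive1E; apply: derive_val.
have mf : measurable_fun setT f by exact: continuous_measurable_fun.
have mg n : measurable_fun setT (g n).
  by apply: measurable_funM.
have gi n : leb.-integrable setT (EFin \o g n).
  apply: le_integrable fi => //; first (apply/measurable_EFinP; exact: mg).
  move=> x _; rewrite lee_fin normrM ler_piMr// indicE.
  by case: (_ \in _); rewrite ?normr1 ?normr0.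
have lim0 : (fun n => Rintegral leb setT (g n)) @ \oo --> 0.
  under eq_fun do rewrite ftc.
  rewrite -(subr0 0); apply: cvgB.
    by have := F1; rewrite -(cvg_shiftS (fun n => F n%:R)).
  by have := F2; rewrite -(cvg_shiftS (fun n => F (- n%:R))).
have lim1 : (fun n => Rintegral leb setT (fun x => `|g n x - f x|)) @ \oo --> 0.
  apply: (@dominated_cvg0 _ (measurableTypeR R) R leb (fun n x => `|g n x - f x|) (fun x => `|f x|)) => //.
  - move=> n; have : measurable_fun setT (fun x : R => `|g n x - f x|).
      by apply: measurableT_comp => //; exact: measurable_funB.
    exact.
  - exact: integrable_norm.
  - move=> n x; rewrite /g indicE; case: (_ \in _).
      by rewrite mulr1 subrr normr0.
    by rewrite mulr0 sub0r normrN.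
  - apply: aeW => x.
    apply: cvg_near_cst; near=> n.
    rewrite /g indicE mem_set ?mulr1 ?subrr ?normr0//=.
    rewrite in_itv/= -ler_norml.
    by near: n; exists (Num.trunc `|x|) => // n /= ?;
      apply: ltW; apply: lt_le_trans (truncnS_gt _) _; rewrite ler_nat ltnS.
have : (fun n => Rintegral leb setT (g n)) @ \oo --> Rintegral leb setT f.
  apply/cvgrPdist_le => e e0.
  have /cvgrPdist_le/(_ e e0) := lim1.
  apply: filterS => n; rewrite sub0r normrN ger0_norm; last first.
    by apply: Rintegral_ge0.
  apply: le_trans; rewrite distrC.
  have -> : Rintegral leb setT (g n) - Rintegral leb setT f =
      Rintegral leb setT (fun x => g n x - f x).
    by rewrite RintegralB//; exact: gi.
  apply: le_normr_Rintegral => //.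
  by have := integrableB measurableT (gi n) fi.
by move=> /cvg_unique; apply.
Unshelve. all: by end_near.
Qed.

Definition gauss_cos (y : R) : R :=
  Rintegral leb setT (fun x => gauss_fun x * cos (x * y)).

Lemma is_derive_gauss_fun (x : R) :
  is_derive x (1 : R) (@gauss_fun R) (- (2 * x) * gauss_fun x).
Proof.
rewrite /gauss_fun.
have h : is_derive x (1 : R) (fun x : R => - x ^+ 2) (- (2 * x)).
  by apply: trigger_derive; rewrite /GRing.scale /=; ring.
by rewrite [_ * expR _]mulrC; have := is_derive1_comp (is_derive_expR _) h.
Qed.

Lemma is_derive_cosM (x y : R) :
  is_derive y (1 : R) (fun y : R => cos (x * y)) (- sin (x * y) * x).
Proof.
have h : is_derive y (1 : R) (fun y : R => x * y) x.
  by apply: trigger_derive; rewrite /GRing.scale /=; ring.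
by have := is_derive1_comp (is_derive_cos _) h.
Qed.

Lemma is_derive_sinM (x y : R) :
  is_derive y (1 : R) (fun y : R => sin (x * y)) (cos (x * y) * x).
Proof.
have h : is_derive y (1 : R) (fun y : R => x * y) x.
  by apply: trigger_derive; rewrite /GRing.scale /=; ring.
by have := is_derive1_comp (is_derive_sin _) h.
Qed.

Lemma continuous_is_derive (f df : R -> R) :
  (forall x, is_derive x (1 : R) f (df x)) -> continuous f.
Proof.
move=> h x; apply: differentiable_continuous; apply/derivable1_diffP.
by case: (h x).
Qed.

Lemma integrable_bounded_mul (h g : R -> R) (B : R) :
  measurable_fun setT h -> (forall x, `|h x| <= B) ->
  leb.-integrable setT (EFin \o g) ->
  leb.-integrable setT (EFin \o (fun x => g x * h x)).
Proof.
move=> mh hB gi; have mg : measurable_fun setT g.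
  by apply/measurable_EFinP; exact: (measurable_int leb gi).
have := integrableZl measurableT B (integrable_abse gi).
apply: le_integrable => //.
  by apply/measurable_EFinP; exact: measurable_funM.
move=> x _ /=; rewrite lee_fin !normrM normr_id mulrC ler_wpM2r//.
by rewrite (le_trans (hB x))// ler_norm.
Qed.

(** Differentiating under the integral produces -x sin (x y), and -2 x exp (-x^2) is the derivative
    of the Gaussian. Integration by parts then returns the cosine integral, whence a linear
    differential equation of order one. *)
Lemma is_derive_gauss_cos (y : R) :
  is_derive y (1 : R) gauss_cos (- (y / 2) * gauss_cos y).
Proof.
pose f (y x : R) := gauss_fun x * cos (x * y).
have mcos (z : R) : measurable_fun setT (fun x : R => cos (x * z)).
  apply: continuous_measurable_fun.
  apply: (continuous_is_derive (df := fun x => - sin (x * z) * z)) => x.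
  by have := is_derive_cosM z x; under eq_fun do rewrite mulrC; rewrite (mulrC z).
have msin (z : R) : measurable_fun setT (fun x : R => sin (x * z)).
  apply: continuous_measurable_fun.
  apply: (continuous_is_derive (df := fun x => cos (x * z) * z)) => x.
  by have := is_derive_sinM z x; under eq_fun do rewrite mulrC; rewrite (mulrC z).
have gi := @integrableT_gauss R.
have fi z : leb.-integrable setT (EFin \o f z).
  by apply: (integrable_bounded_mul (B := 1)) => // x; rewrite ler_norml cos_geN1 cos_le1.
have df z x : is_derive z (1 : R) (f ^~ x) (gauss_fun x * (- sin (x * z) * x)).
  exact: is_deriveZ (is_derive_cosM x z).
have d1 z x : partial1of2 f z x = gauss_fun x * (- sin (x * z) * x).
  by rewrite partial1of2E; apply: derive_val.
pose I := `]y - 1, y + 1[%classic.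
have Iy : `]y - 1, y + 1[%classic y by rewrite /= in_itv/= ltrBlDr ltrDl ltr01.
have dd z x : `]y - 1, y + 1[%classic z -> setT x -> derivable (f ^~ x) z 1.
  by move=> _ _; case: (df z x).
have G0 x : 0 <= `|x| * @gauss_fun R x by rewrite mulr_ge0 ?gauss_fun_ge0.
have ub z x : `]y - 1, y + 1[%classic z -> setT x -> `|partial1of2 f z x| <= `|x| * gauss_fun x.
  move=> _ _; rewrite d1 !normrM normrN mulrC (ger0_norm (gauss_fun_ge0 _)).
  rewrite ler_wpM2r ?gauss_fun_ge0// ler_piMl//.
  by rewrite ler_norml sin_geN1 sin_le1.
have fiI z : `]y - 1, y + 1[%classic z -> leb.-integrable setT (EFin \o f z) by [].
have D := derivable_under_integral measurableT Iy fiI dd G0 integrable_x_gauss ub.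
have E := differentiation_under_integral measurableT Iy fiI dd G0 integrable_x_gauss ub.
suff e : - (y / 2) * gauss_cos y = 'D_1 gauss_cos y.
  by rewrite e; apply: DeriveDef.
rewrite -derive1E E.
pose f1 (x : R) := (- (2 * x) * gauss_fun x) * sin (x * y).
have i1 : leb.-integrable setT (EFin \o f1).
  apply: le_integrable (integrableZl measurableT 2 integrable_x_gauss) => //.
    apply/measurable_EFinP; apply: measurable_funM => //.
      apply: measurable_funM; last exact: measurable_gauss_fun.
      by apply: measurable_funN; exact: measurable_funM.
    exact: msin.
  move=> x _ /=; rewrite lee_fin !normrM normrN normrM normr_id.
  rewrite (@ger0_norm _ 2)// mulrA ler_piMr ?mulr_ge0//.
  by rewrite ler_norml sin_geN1 sin_le1.
have i2 : leb.-integrable setT (EFin \o (fun x => f y x * y)).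
  exact: (integrable_bounded_mul (B := `|y|) (h := cst y)).
(* Integration by parts: the integrand is the derivative of the Gaussian times sin (x y), which
   vanishes at both ends. *)
have s0 : Rintegral leb setT (fun x => f1 x + f y x * y) = 0.
  have lim0 (F : R -> R) : (forall x, `|F x| <= gauss_fun x) ->
      (fun n => F n%:R) @ \oo --> 0 /\ (fun n => F (- n%:R)) @ \oo --> 0.
    move=> hF.
    have g0 : (fun n => @gauss_fun R n%:R) @ \oo --> 0.
      by apply: (cvg_comp _ _ (@cvgr_idn R)); exact: cvg_gauss_fun.
    split; apply: norm_cvg0; apply: (squeeze_cvgr _ (cvg_cst 0) g0); apply: nearW => n.
      by rewrite normr_ge0 hF.
    by rewrite normr_ge0 (le_trans (hF _))// /gauss_fun sqrrN.
  have [l1 l2] : (fun n => gauss_fun n%:R * sin (n%:R * y)) @ \oo --> 0 /\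
      (fun n => gauss_fun (- n%:R) * sin (- n%:R * y)) @ \oo --> 0.
    apply: (lim0 (fun x => gauss_fun x * sin (x * y))) => x.
    rewrite normrM (ger0_norm (gauss_fun_ge0 _)) ler_piMr ?gauss_fun_ge0//.
    by rewrite ler_norml sin_geN1 sin_le1.
  have D1 x : is_derive x (1 : R) (fun x => gauss_fun x * sin (x * y)) (f1 x + f y x * y).
    have h1 : is_derive x (1 : R) (fun x : R => sin (x * y)) (cos (x * y) * y).
      by have := is_derive_sinM y x; under eq_fun do rewrite mulrC; rewrite (mulrC y).
    have := is_deriveM (is_derive_gauss_fun x) h1; move/is_derive_eq; apply.
    by rewrite /GRing.scale /= /f1 /f; ring.
  have cs : continuous (fun x : R => sin (x * y)).
    apply: (continuous_is_derive (df := fun x => cos (x * y) * y)) => x.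
    by have := is_derive_sinM y x; under eq_fun do rewrite mulrC; rewrite (mulrC y).
  have cc : continuous (fun x : R => cos (x * y)).
    apply: (continuous_is_derive (df := fun x => - sin (x * y) * y)) => x.
    by have := is_derive_cosM y x; under eq_fun do rewrite mulrC; rewrite (mulrC y).
  have cg := @continuous_gauss_fun R.
  have C1 : continuous (fun x => f1 x + f y x * y).
    move=> x; apply: cvgD.
      apply: cvgM; last exact: cs.
      apply: cvgM; last exact: cg.
      apply: cvgN; apply: cvgM; first exact: cvg_cst.
      exact: cvg_id.
    apply: cvgM; last exact: cvg_cst.
    by apply: cvgM; [exact: cg|exact: cc].
  have I1 : leb.-integrable setT (EFin \o (fun x => f1 x + f y x * y)).
    exact: (integrableD measurableT i1 i2).
  exact: (integral_derivative_eq0 D1 C1 I1 l1 l2).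
have e1 : Rintegral leb setT f1 = - (y * gauss_cos y).
  move: s0; rewrite RintegralD// RintegralZr// => /eqP.
  by rewrite addr_eq0 mulrC => /eqP.
have -> : - (y / 2) * gauss_cos y = 2^-1 * Rintegral leb setT f1.
  by rewrite e1; field.
rewrite -RintegralZl//; apply: eq_Rintegral => x _; rewrite d1 /f1.
by field.
Qed.

(** By the differential equation the product with exp ((y/2)^2) is constant, and at y = 0 it is the
    Gaussian integral. *)
Lemma gauss_cosE (y : R) : gauss_cos y = Num.sqrt pi * expR (- (y / 2) ^+ 2).
Proof.
pose h (y : R) := gauss_cos y * expR ((y / 2) ^+ 2).
have hd (x : R) : is_derive x (1 : R) h 0.
  have d1 : is_derive x (1 : R) (fun y : R => (y / 2) ^+ 2) (x / 2).
    by apply: trigger_derive; rewrite /GRing.scale /=; field.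
  have d2 := is_derive1_comp (is_derive_expR _) d1.
  have := is_deriveM (is_derive_gauss_cos x) d2; move/is_derive_eq; apply.
  by rewrite /GRing.scale /=; ring.
have := is_derive_0_is_cst y 0 hd.
rewrite /h mul0r expr0n /= expR0 mulr1.
have -> : gauss_cos 0 = Num.sqrt pi.
  rewrite /gauss_cos /Rintegral; under eq_integral do rewrite mulr0 cos0 mulr1.
  by rewrite integralT_gauss.
by move=> <-; rewrite expRN mulfK// gt_eqF// expR_gt0.
Qed.

Lemma integral_gauss_sin (y : R) :
  Rintegral leb setT (fun x => gauss_fun x * sin (x * y)) = 0.
Proof.
have msin : measurable_fun setT (fun x : R => sin (x * y)).
  apply: continuous_measurable_fun.
  apply: (continuous_is_derive (df := fun x => cos (x * y) * y)) => x.
  by have := is_derive_sinM y x; under eq_fun do rewrite mulrC; rewrite (mulrC y).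
have i : leb.-integrable setT (EFin \o (fun x => gauss_fun x * sin (x * y))).
  apply: (integrable_bounded_mul (B := 1)) => //.
    by move=> x; rewrite ler_norml sin_geN1 sin_le1.
  exact: integrableT_gauss.
have n1 : (-1 : R) != 0 by rewrite oppr_eq0.
have := scales_Rintegral (scales_affine 0 n1) i.
rewrite normrN1 invr1 mul1r.
have -> : Rintegral leb setT (fun x => gauss_fun (-1 * x + 0) * sin ((-1 * x + 0) * y)) =
    - Rintegral leb setT (fun x => gauss_fun x * sin (x * y)).
  rewrite -[RHS]mulN1r -RintegralZl//; apply: eq_Rintegral => x _.
  rewrite addr0 mulN1r mulNr sinN /gauss_fun sqrrN; ring.
by move=> h; lra.
Qed.

End gaussian1.

Section expi.
Context {R : realType}.

Definition expi (t : R) : R[i] := Complex (cos t) (sin t).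

Lemma expiD (s t : R) : expi (s + t) = expi s * expi t.
Proof.
by apply: complex_ext; rewrite ?ReM ?ImM /= ?cosD ?sinD// addrC mulrC [X in _ + X]mulrC.
Qed.

Lemma expiN (t : R) : expi (- t) = conjc (expi t).
Proof. by apply: complex_ext; rewrite /= ?cosN ?sinN. Qed.

Lemma normc_expi (t : R) : normc (expi t) = 1.
Proof. by rewrite normc_sqrt /= cos2Dsin2 sqrtr1. Qed.

Lemma cmeas_expi d (T : measurableType d) (f : T -> R) :
  measurable_fun setT f -> cmeas (fun x => expi (f x)).
Proof.
move=> mf; split.
  apply: (measurableT_comp _ mf); apply: continuous_measurable_fun.
  exact: continuous_cos.
apply: (measurableT_comp _ mf); apply: continuous_measurable_fun.
exact: continuous_sin.
Qed.

End expi.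

(** These named copies of the line, the plane and space-time carry sigma-finite measures, and [mu3]
    unfolds to the measure used in the statement, so that results pass from one to the other by
    conversion. *)
Definition mR (R : realType) : measurableType _ := measurableTypeR R.
Definition lam (R : realType) : {sigma_finite_measure set (mR R) -> \bar R} :=
  @lebesgue_measure R.
Definition E2 (R : realType) : measurableType _ := (mR R * mR R)%type.
Definition mu2 (R : realType) : {sigma_finite_measure set (E2 R) -> \bar R} :=
  prodm (lam R) (lam R).
Definition E3 (R : realType) : measurableType _ := (E2 R * mR R)%type.
Definition mu3 (R : realType) : {sigma_finite_measure set (E3 R) -> \bar R} :=
  prodm (mu2 R) (lam R).

(** * Gaussian regularization of Fourier integrals on space-time *)

Section space3.
Context {R : realType}.
Local Notation E := (E3 R).
Local Notation mu := (mu3 R).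
Local Notation lam := (lam R).

Definition gauss3 (z : R * R * R) : R :=
  gauss_fun z.1.1 * gauss_fun z.1.2 * gauss_fun z.2.

Definition aff3 (e : R) (y z : R * R * R) : R * R * R :=
  ((e * z.1.1 + y.1.1, e * z.1.2 + y.1.2), e * z.2 + y.2).

Definition sub3 (y z : R * R * R) : R * R * R :=
  ((y.1.1 - z.1.1, y.1.2 - z.1.2), y.2 - z.2).

Definition scale3 (e : R) (z : R * R * R) : R * R * R :=
  ((e * z.1.1, e * z.1.2), e * z.2).

Section measurability.
Context d (T : measurableType d).
Implicit Types f g : T -> E.

Lemma measurable_coord f : measurable_fun setT f ->
  [/\ measurable_fun setT (fun t => (f t).1.1 : R),
      measurable_fun setT (fun t => (f t).1.2 : R) &
      measurable_fun setT (fun t => (f t).2 : R)].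
Proof.
move=> mf; split; last exact: (measurableT_comp measurable_snd mf).
  apply: (measurableT_comp measurable_fst).
  exact: (measurableT_comp measurable_fst mf).
apply: (measurableT_comp measurable_snd).
exact: (measurableT_comp measurable_fst mf).
Qed.

Lemma measurable_triple (f1 f2 f3 : T -> R) :
  measurable_fun setT f1 -> measurable_fun setT f2 -> measurable_fun setT f3 ->
  measurable_fun setT (fun t => ((f1 t, f2 t), f3 t) : E).
Proof.
by move=> m1 m2 m3; apply: measurable_fun_pair => //; exact: measurable_fun_pair.
Qed.

Lemma measurable_dot3 f g : measurable_fun setT f -> measurable_fun setT g ->
  measurable_fun setT (fun t => dot3 (f t) (g t)).
Proof.
move=> /measurable_coord[f1 f2 f3] /measurable_coord[g1 g2 g3].
by apply: measurable_funD; [apply: measurable_funD|]; exact: measurable_funM.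
Qed.

Lemma measurable_sub3 f g : measurable_fun setT f -> measurable_fun setT g ->
  measurable_fun setT (fun t => sub3 (f t) (g t) : E).
Proof.
move=> /measurable_coord[f1 f2 f3] /measurable_coord[g1 g2 g3].
by apply: measurable_triple; exact: measurable_funB.
Qed.

Lemma measurable_scale3 e f : measurable_fun setT f ->
  measurable_fun setT (fun t => scale3 e (f t) : E).
Proof.
move=> /measurable_coord[f1 f2 f3].
by apply: measurable_triple; exact: measurable_funM.
Qed.

Lemma measurable_gauss3 f : measurable_fun setT f ->
  measurable_fun setT (fun t => gauss3 (f t)).
Proof.
move=> /measurable_coord[f1 f2 f3].
have mg := @measurable_gauss_fun R.
by apply: measurable_funM; [apply: measurable_funM|]; exact: (measurableT_comp mg).
Qed.

End measurability.

Lemma scales_lam (a y : R) : a != 0 -> scales lam (fun x => a * x + y) `|a|^-1.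
Proof. exact: scales_affine. Qed.

Lemma scales_aff2 (e : R) (y : R * R) : e != 0 ->
  scales (mu2 R) (fun x => (e * x.1 + y.1, e * x.2 + y.2)) (`|e| ^- 2).
Proof.
move=> e0; have i0 : 0 <= `|e|^-1 by rewrite invr_ge0.
have := scales_prod i0 (scales_lam y.1 e0) (scales_lam y.2 e0).
by rewrite -invfM.
Qed.

Lemma scales_aff3 (e : R) (y : R * R * R) : e != 0 ->
  scales mu (aff3 e y) (`|e| ^- 3).
Proof.
move=> e0; have i0 : 0 <= `|e|^-1 by rewrite invr_ge0.
have := scales_prod i0 (scales_aff2 y.1 e0) (scales_lam y.2 e0).
by rewrite -invfM -exprSr.
Qed.

Lemma dot3C (z w : R * R * R) : dot3 z w = dot3 w z.
Proof. by rewrite /dot3; ring. Qed.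

Lemma dot3_sub3 (z x y : R * R * R) : dot3 z (sub3 x y) = dot3 z x - dot3 z y.
Proof. by rewrite /dot3 /=; ring. Qed.

Lemma gauss3_ge0 z : 0 <= gauss3 z.
Proof. by rewrite /gauss3 !mulr_ge0 ?gauss_fun_ge0. Qed.

Lemma gauss3_le1 z : gauss3 z <= 1.
Proof. by rewrite /gauss3 !mulr_ile1 ?mulr_ge0 ?gauss_fun_ge0 ?gauss_fun_le1. Qed.

Lemma Cint_gauss1 (y : R) :
  cintble lam (fun x => (gauss_fun x)%:C%C * expi (x * y)) /\
  Cint lam (fun x => (gauss_fun x)%:C%C * expi (x * y)) =
    (Num.sqrt pi * gauss_fun (y / 2))%:C%C.
Proof.
split.
  apply: (@cintble_le _ _ _ lam _ gauss_fun); last 1 first.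
  - by move=> x; rewrite normcM normc_expi mulr1 normcR ger0_norm ?gauss_fun_ge0.
  - apply: cmeasM; first by apply: cmeas_real; exact: measurable_gauss_fun.
    by apply: cmeas_expi; exact: measurable_funM.
  - exact: integrableT_gauss.
apply: complex_ext => /=.
  rewrite -[X in Num.sqrt pi * X]/(expR (- (y / 2) ^+ 2)) -gauss_cosE.
  by apply: eq_Rintegral => x _; rewrite /= mul0r subr0.
rewrite -[RHS](integral_gauss_sin y).
by apply: eq_Rintegral => x _; rewrite /= mul0r addr0.
Qed.

Lemma Cint_gauss3 (w : R * R * R) :
  cintble mu (fun z => (gauss3 z)%:C%C * expi (dot3 z w)) /\
  Cint mu (fun z => (gauss3 z)%:C%C * expi (dot3 z w)) =
    (Num.sqrt pi ^+ 3 * gauss3 (scale3 2^-1 w))%:C%C.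
Proof.
have [i1 e1] := Cint_gauss1 w.1.1.
have [i2 e2] := Cint_gauss1 w.1.2.
have [i3 e3] := Cint_gauss1 w.2.
have [i12 e12] := Cint_prod_mul i1 i2.
have [i123 e123] := Cint_prod_mul i12 i3.
have E0 : (fun z : E => (gauss3 z)%:C%C * expi (dot3 z w)) =
    (fun x => (gauss_fun x.1.1)%:C%C * expi (x.1.1 * w.1.1) *
        ((gauss_fun x.1.2)%:C%C * expi (x.1.2 * w.1.2)) *
        ((gauss_fun x.2)%:C%C * expi (x.2 * w.2))).
  by apply/funext => z; rewrite /gauss3 /dot3 !expiD !rmorphM /=; ring.
rewrite E0; split; first exact: i123.
rewrite e123 e12 e1 e2 e3 /gauss3 /= -!rmorphM /=.
by congr (_%:C%C); rewrite ![2^-1 * _]mulrC; ring.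
Qed.

Lemma Cint_gauss3_scaled (e : R) (w : R * R * R) : 0 < e ->
  cintble mu (fun z => (gauss3 (scale3 e z))%:C%C * expi (dot3 z w)) /\
  Cint mu (fun z => (gauss3 (scale3 e z))%:C%C * expi (dot3 z w)) =
    (e ^- 3 * Num.sqrt pi ^+ 3 * gauss3 (scale3 (2 * e)^-1 w))%:C%C.
Proof.
move=> e0; have en0 : e != 0 by rewrite gt_eqF.
have [i h] := Cint_gauss3 (scale3 e^-1 w).
have E0 : (fun z : E => (gauss3 (scale3 e z))%:C%C * expi (dot3 z w)) =
   (fun z => (gauss3 (aff3 e (0,0,0) z))%:C%C * expi (dot3 (aff3 e (0,0,0) z) (scale3 e^-1 w))).
  apply/funext => z; rewrite /aff3 /scale3 /dot3 /= !addr0; congr (_ * expi _).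
  by field.
have e30 : 0 <= `|e| ^- 3 by rewrite invr_ge0 exprn_ge0.
rewrite E0; split; first exact: (scales_cintble e30 (scales_aff3 _ en0) i).
rewrite (scales_Cint (scales_aff3 _ en0) i) h -rmorphM /= mulrA gtr0_norm//.
congr ((_ * gauss3 _)%:C%C).
by rewrite /scale3 /= invfM; congr (_, _, _); rewrite mulrA.
Qed.

Lemma integral_gauss1 : (\int[lam]_z (gauss_fun z)%:E = (Num.sqrt pi)%:E)%E.
Proof. exact: integralT_gauss. Qed.

Lemma integral_gauss3 : (\int[mu]_z (gauss3 z)%:E = (Num.sqrt pi ^+ 3)%:E)%E.
Proof.
have g0 := @gauss_fun_ge0 R.
have mg : measurable_fun [set: mR R] (@gauss_fun R) by exact: measurable_gauss_fun.
have m2 : measurable_fun [set: E2 R] (fun x => gauss_fun x.1 * gauss_fun x.2).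
  by apply: measurable_funM; apply: (measurableT_comp mg).
have p2 (x : E2 R) : 0 <= gauss_fun x.1 * gauss_fun x.2 by rewrite mulr_ge0.
rewrite (integral_prod_mul (mu2 R) lam m2 mg p2 g0).
rewrite (integral_prod_mul lam lam mg mg g0 g0) integral_gauss1.
by rewrite -!EFinM; congr EFin; ring.
Qed.

Lemma integrable_gauss3 : mu.-integrable setT (EFin \o gauss3).
Proof.
apply/integrableP; split.
  by apply/measurable_EFinP; apply: (@measurable_gauss3 _ E id); exact: measurable_id.
under eq_integral do rewrite /= ger0_norm ?gauss3_ge0//.
by rewrite integral_gauss3 ltry.
Qed.

Lemma measurable_gauss3_scaled (e : R) :
  measurable_fun [set: E] (fun z : E => gauss3 (scale3 e z)).
Proof.
apply: (@measurable_gauss3 _ E (fun z => scale3 e z)).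
by apply: (@measurable_scale3 _ E e id); exact: measurable_id.
Qed.

Lemma integrable_gauss3_scaled (e : R) : e != 0 ->
  mu.-integrable setT (EFin \o (fun z => gauss3 (scale3 e z))).
Proof.
move=> e0; have e30 : 0 <= `|e| ^- 3 by rewrite invr_ge0 exprn_ge0.
have := scales_integrable e30 (scales_aff3 (0,0,0) e0) integrable_gauss3.
by apply: eq_integrable => // z _ /=; rewrite /aff3 /scale3 !addr0.
Qed.

Section core.
Context d (T : measurableType d) (nu : {sigma_finite_measure set T -> \bar R}).
Variables (H : T -> R[i]) (X : T -> E).
Hypotheses (iH : cintble nu H) (mX : measurable_fun setT X).

(** The Fourier integral, with a positive sign in the exponent, of the image under [X] of the
    complex measure H nu. With [X] the identity this is the usual Fourier integral; with [X] the sum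
    map on E * E it is a product of two of them. One inversion argument thus covers transforms and
    convolutions. *)
Definition extension (z : E) : R[i] := Cint nu (fun w => H w * expi (dot3 z (X w))).

Definition ftransform (P : E -> R[i]) (z : E) : R[i] :=
  Cint mu (fun x => P x * expi (- dot3 z x)).

Lemma cintble_mul_expi d' (S : measurableType d') (m : {measure set S -> \bar R})
    (G : S -> R[i]) (f : S -> R) : cintble m G -> measurable_fun setT f ->
  cintble m (fun w => G w * expi (f w)).
Proof.
move=> iG mf; have mG := cintble_cmeas iG.
apply: (cintble_le _ ((integrable_normcP m mG).1 iG)).
  by apply: cmeasM => //; exact: cmeas_expi.
by move=> x; rewrite normcM normc_expi mulr1.
Qed.

Lemma measurable_dotX (z : E) : measurable_fun setT (fun w => dot3 z (X w)).
Proof. by apply: measurable_dot3 => //; exact: measurable_cst. Qed.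

Lemma cmeas_extension : cmeas extension.
Proof.
apply: (cmeas_Cint_param nu (f := fun p : E * T => H p.2 * expi (dot3 p.1 (X p.2)))).
apply: cmeasM; first by apply: cmeas_snd; exact: cintble_cmeas iH.
apply: cmeas_expi; apply: measurable_dot3; first exact: measurable_fst.
exact: (measurableT_comp mX).
Qed.

Lemma normc_extension (z : E) : normc (extension z) <= Rintegral nu setT (fun w => normc (H w)).
Proof.
apply: (le_trans (normc_Cint (cintble_mul_expi iH (measurable_dotX z)))).
rewrite le_eqVlt; apply/orP; left; apply/eqP.
by apply: eq_Rintegral => w _; rewrite normcM normc_expi mulr1.
Qed.

(* The value at v of the Fourier transform of z |-> gauss3 (e z). *)
Definition kern (e : R) (v : E) : R :=
  e ^- 3 * Num.sqrt pi ^+ 3 * gauss3 (scale3 (2 * e)^-1 v).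

(** The Gaussian makes the integral in z, w and x absolutely convergent, so that z can be integrated
    first. The two characters combine into the character at X w - x, and the z-integral is the
    transform of the Gaussian at that point. *)
Lemma core_identity (P : E -> R[i]) (e : R) : 0 < e -> cintble mu P ->
  Cint mu (fun z => extension z * ftransform P z * (gauss3 (scale3 e z))%:C%C) =
  Cint (prodm nu mu) (fun p => H p.1 * P p.2 * (kern e (sub3 (X p.1) p.2))%:C%C).
Proof.
move=> e0 iP; have mP := cintble_cmeas iP; have mH := cintble_cmeas iH.
have en0 : e != 0 by rewrite gt_eqF.
pose HP (p : T * E) := H p.1 * P p.2.
have iHP : cintble (prodm nu mu) HP by exact: (Cint_prod_mul iH iP).1.
pose Phi (q : E * (T * E)) := (gauss3 (scale3 e q.1))%:C%C * HP q.2 *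
   expi (dot3 q.1 (sub3 (X q.2.1) q.2.2)).
have mdot : measurable_fun setT (fun q : E * (T * E) => dot3 q.1 (sub3 (X q.2.1) q.2.2)).
  apply: measurable_dot3; first exact: measurable_fst.
  apply: measurable_sub3; last exact: (measurableT_comp measurable_snd).
  apply: (measurableT_comp mX); exact: (measurableT_comp measurable_fst).
have ig : cintble mu (fun z => (gauss3 (scale3 e z))%:C%C).
  apply: (cintble_le _ (integrable_gauss3_scaled en0)).
    by apply: cmeas_real; exact: measurable_gauss3_scaled.
  by move=> z; rewrite normcR ger0_norm ?gauss3_ge0.
have iPhi : cintble (prodm mu (prodm nu mu)) Phi.
  apply: cintble_mul_expi => //.
  exact: (Cint_prod_mul ig iHP).1.
have iz z : cintble (prodm nu mu) (fun p => Phi (z, p)).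
  apply: (cintble_mul_expi (G := fun p => (gauss3 (scale3 e z))%:C%C * HP p)).
    exact: cintbleZ.
  exact: (measurable_fun_pair2 z mdot).
have ip p : cintble mu (fun z => Phi (z, p)).
  apply: cintble_mul_expi; last exact: (measurable_fun_pair1 p mdot).
  rewrite (_ : (fun _ => _) = fun z => HP p * (gauss3 (scale3 e z))%:C%C).
    exact: cintbleZ.
  by apply/funext => z; rewrite mulrC.
transitivity (Cint (prodm mu (prodm nu mu)) Phi).
  rewrite -(Cint_fubini1 iPhi iz).2; apply: eq_Cint => z.
  have i1 := cintble_mul_expi iH (measurable_dotX z).
  have i2 : cintble mu (fun x => P x * expi (- dot3 z x)).
    apply: cintble_mul_expi => //; apply: measurable_funN.
    by apply: measurable_dot3; [exact: measurable_cst|exact: measurable_id].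
  have [i12 e12] := Cint_prod_mul i1 i2.
  rewrite /extension /ftransform -e12 mulrC -CintZ//; apply: eq_Cint => p.
  by rewrite /Phi /HP /= dot3_sub3 expiD; ring.
rewrite -(Cint_fubini2 iPhi ip); apply: eq_Cint => p.
have [i h] := Cint_gauss3_scaled (sub3 (X p.1) p.2) e0.
rewrite /kern -h -CintZ//; apply: eq_Cint => z.
by rewrite /Phi /HP /=; ring.
Qed.


End core.

Lemma cintble_mul_bounded d (T : measurableType d) (m : {measure set T -> \bar R})
    (f : T -> R[i]) (h : T -> R) (B : R) : cintble m f -> measurable_fun setT h ->
  (forall x, `|h x| <= B) -> cintble m (fun x => f x * (h x)%:C%C).
Proof.
move=> fi mh hB; have mf := cintble_cmeas fi.
have := integrableZl measurableT B ((integrable_normcP m mf).1 fi).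
move/cintble_le; apply; first by apply: cmeasM => //; exact: cmeas_real.
by move=> x /=; rewrite normcM normcR mulrC ler_wpM2r// normc_ge0.
Qed.

Lemma cintble_real d (T : measurableType d) (m : {measure set T -> \bar R})
    (h : T -> R) : m.-integrable setT (EFin \o h) -> cintble m (fun x => (h x)%:C%C).
Proof.
move=> hi; split => //.
exact: integrable0.
Qed.

Lemma cvg_normc_unique (a : nat -> R[i]) (x y : R[i]) :
  (fun n => normc (a n - x)) @ \oo --> (0 : R) ->
  (fun n => normc (a n - y)) @ \oo --> (0 : R) -> x = y.
Proof.
move=> ax ay; apply/eqP; rewrite -subr_eq0; apply/eqP; apply: eq0_normc.
apply/eqP; rewrite eq_le normc_ge0 andbT.
have h : (fun n => normc (a n - x) + normc (a n - y)) @ \oo --> (0 : R).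
  by rewrite -(addr0 0); apply: cvgD.
apply: (@ler_cvg_to _ _ _ _ (cst (normc (x - y))) _ _ _ _ h).
  exact: cvg_cst.
apply: nearW => n /=; rewrite (_ : x - y = - (a n - x) + (a n - y)); last by ring.
by apply: (le_trans (normcD _ _)); rewrite normcN.
Qed.

(** Exactly what makes Gaussian mollifications of [phi] bounded and convergent at every point.
    Schwartz functions qualify, and so do the cut-offs that approximate indicators of octants, which
    are not smooth. *)
Definition test (phi : E -> R) := [/\ measurable_fun [set: E] phi,
  (exists B, forall x, `|phi x| <= B),
  continuous (phi : R * R * R -> R) & mu.-integrable setT (EFin \o phi)].

Lemma kern_ge0 (e : R) v : 0 < e -> 0 <= kern e v.
Proof.
move=> e0; have e3 : 0 <= e ^- 3 by rewrite invr_ge0 exprn_ge0// ltW.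
by rewrite mulr_ge0 ?gauss3_ge0// mulr_ge0// exprn_ge0 ?sqrtr_ge0.
Qed.

Lemma kern_le (e : R) v : 0 < e -> `|kern e v| <= e ^- 3 * Num.sqrt pi ^+ 3.
Proof.
move=> e0; have e3 : 0 <= e ^- 3 by rewrite invr_ge0 exprn_ge0// ltW.
by rewrite ger0_norm ?kern_ge0// /kern ler_piMr ?gauss3_le1// mulr_ge0// exprn_ge0 ?sqrtr_ge0.
Qed.

Lemma measurable_kern d (T : measurableType d) (e : R) (f : T -> E) :
  measurable_fun setT f -> measurable_fun setT (fun x => kern e (f x)).
Proof.
move=> mf; apply: measurable_funM => //; apply: measurable_gauss3.
exact: measurable_scale3.
Qed.

Lemma sqrt_pi6 : Num.sqrt pi ^+ 3 * Num.sqrt pi ^+ 3 = pi ^+ 3 :> R.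
Proof. by rewrite -exprMn -expr2 sqr_sqrtr// pi_ge0. Qed.

(** Substitution of y - 2 e x for x: the kernel becomes e^(-3) sqrt(pi)^3 [gauss3] x and the
    Jacobian is (2 e)^3, whence the constant 8 sqrt(pi)^3, free of [e]. *)
Lemma Rintegral_kern (phi : E -> R) (e : R) (y : E) : 0 < e ->
  mu.-integrable setT (EFin \o phi) ->
  Rintegral mu setT (fun x => phi x * kern e (sub3 y x)) =
  (8 * Num.sqrt pi ^+ 3) *
    Rintegral mu setT (fun x => phi (aff3 (- (2 * e)) y x) * gauss3 x) /\
  mu.-integrable setT (EFin \o (fun x => phi (aff3 (- (2 * e)) y x) * gauss3 x)).
Proof.
move=> e0 iphi; have en0 : - (2 * e) != 0 by rewrite oppr_eq0 mulf_neq0// gt_eqF.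
have mk : measurable_fun setT (fun x => kern e (sub3 y x)).
  by apply: measurable_kern; apply: measurable_sub3; [exact: measurable_cst|exact: measurable_id].
have fi : mu.-integrable setT (EFin \o (fun x => phi x * kern e (sub3 y x))).
  by have [] := cintble_mul_bounded (cintble_real iphi) mk (fun x => kern_le _ e0);
    rewrite /= => h _; apply: eq_integrable h => // x _ /=; rewrite mulr0 subr0.
have e30 : 0 <= `|- (2 * e)| ^- 3 by rewrite invr_ge0 exprn_ge0.
have K : (fun x => phi (aff3 (- (2 * e)) y x) * kern e (sub3 y (aff3 (- (2 * e)) y x))) =
  (fun x => e ^- 3 * Num.sqrt pi ^+ 3 * (phi (aff3 (- (2 * e)) y x) * gauss3 x)).
  apply/funext => x; rewrite /kern (_ : scale3 _ _ = x); first by ring.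
  have ee : e != 0 by rewrite gt_eqF.
  by case: x => -[x1 x2] x3; rewrite /scale3 /sub3 /aff3 /=; congr (_, _, _); field.
have := scales_Rintegral (scales_aff3 y en0) fi.
have := scales_integrable e30 (scales_aff3 y en0) fi.
rewrite K => i1.
have c0 : e ^- 3 * Num.sqrt pi ^+ 3 != 0.
  by rewrite mulf_neq0 ?invr_eq0 ?expf_neq0 ?gt_eqF ?sqrtr_gt0 ?pi_gt0.
have i2 : mu.-integrable setT (EFin \o (fun x => phi (aff3 (- (2 * e)) y x) * gauss3 x)).
  have := integrableZl measurableT (e ^- 3 * Num.sqrt pi ^+ 3)^-1 i1.
  by apply: eq_integrable => // x _; rewrite /= -EFinM mulrA mulVf// mul1r.
rewrite RintegralZl// normrN gtr0_norm ?mulr_gt0// => h; split => //.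
have -> : 8 * Num.sqrt pi ^+ 3 = (2 * e) ^+ 3 * (e ^- 3 * Num.sqrt pi ^+ 3).
  by have ee : e != 0 by [rewrite gt_eqF]; rewrite exprMn -mulrA [e ^+ 3 * _]mulrA divff ?expf_neq0// mul1r; congr (_ * _); ring.
rewrite -mulrA h mulrA divff ?mul1r// expf_neq0// mulf_neq0// gt_eqF//.
Qed.

Definition epsn (n : nat) : R := n.+1%:R^-1.

Lemma eps_gt0 n : 0 < epsn n.
Proof. by rewrite /epsn invr_gt0. Qed.

Lemma cvg_epsn : epsn @ \oo --> (0 : R).
Proof. exact: cvg_harmonic. Qed.

Lemma cvg_eps_mul (a b : R) : (fun n => a * epsn n + b) @ \oo --> b.
Proof.
rewrite -[X in _ --> X](add0r b) -(mulr0 a); apply: cvgD; last exact: cvg_cst.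
by apply: cvgM; [exact: cvg_cst|exact: cvg_epsn].
Qed.

Lemma Rintegral_gauss3 : Rintegral mu setT gauss3 = Num.sqrt pi ^+ 3.
Proof. by rewrite /Rintegral integral_gauss3. Qed.

Lemma measurable_aff3 (e : R) (y : E) : measurable_fun setT (aff3 e y : E -> E).
Proof.
have [m1 m2 m3] := measurable_coord (@measurable_id _ E setT).
by apply: measurable_triple; apply: measurable_funD => //; exact: measurable_funM.
Qed.

Section mollify.
Variables (phi : E -> R) (B : R).
Hypotheses (mphi : measurable_fun [set: E] phi) (iphi : mu.-integrable setT (EFin \o phi)).
Hypothesis (hB : forall x, `|phi x| <= B).

(** Not normalized: the kernel has mass 8 sqrt(pi)^3 sqrt(pi)^3 = (2 pi)^3, the constant that
    appears in all limits below. *)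
Definition mollify n (y : E) : R :=
  Rintegral mu setT (fun x => phi x * kern (epsn n) (sub3 y x)).

Lemma mollify_le n y : `|mollify n y| <= (2 * pi) ^+ 3 * B.
Proof.
rewrite /mollify; have [-> i] := Rintegral_kern y (eps_gt0 n) iphi.
rewrite normrM ger0_norm ?mulr_ge0 ?exprn_ge0 ?sqrtr_ge0//.
rewrite exprMn -sqrt_pi6 (_ : 2 ^+ 3 * _ * B = 8 * Num.sqrt pi ^+ 3 * (B * Num.sqrt pi ^+ 3)); last by ring.
rewrite ler_wpM2l ?mulr_ge0 ?exprn_ge0 ?sqrtr_ge0//.
apply: (le_trans (le_normr_Rintegral measurableT i)).
rewrite -Rintegral_gauss3 -RintegralZl//; last exact: integrable_gauss3.
apply: le_Rintegral => //; first exact: integrable_norm.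
  exact: (integrableZl measurableT B integrable_gauss3).
by move=> x _; rewrite normrM (ger0_norm (gauss3_ge0 _)) ler_wpM2r ?gauss3_ge0.
Qed.

Hypothesis cphi : continuous (phi : R * R * R -> R).

(** After rescaling, the Gaussian is fixed and [phi] is evaluated at points tending to y: continuity
    gives the pointwise limit and boundedness the domination. *)
Lemma mollify_cvg y :
  (fun n => `|mollify n y - (2 * pi) ^+ 3 * phi y|) @ \oo --> 0.
Proof.
pose h n (x : E) := `|phi (aff3 (- (2 * epsn n)) y x) - phi y| * gauss3 x.
have mg3 : measurable_fun setT (gauss3 : E -> R).
  by apply: (@measurable_gauss3 _ E id); exact: measurable_id.
have mh n : measurable_fun setT (h n).
  apply: measurable_funM => //; apply: measurableT_comp => //.
  apply: measurable_funB => //.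
  exact: (measurableT_comp mphi (measurable_aff3 _ _)).
have hlim : (fun n => Rintegral mu setT (h n)) @ \oo --> 0.
  apply: (@dominated_cvg0 _ E R mu h (fun x => (2 * B) * gauss3 x)) => //.
  - by move=> n x; rewrite mulr_ge0 ?gauss3_ge0.
  - exact: (integrableZl measurableT (2 * B) integrable_gauss3).
  - move=> n x; rewrite ler_wpM2r ?gauss3_ge0//.
    apply: (le_trans (ler_normB _ _)); rewrite (_ : 2 * B = B + B); last by ring.
    by rewrite lerD.
  - apply: aeW => x; rewrite /h -(mul0r (gauss3 x)); apply: cvgM; last exact: cvg_cst.
    rewrite -(normr0 R); apply: cvg_norm; rewrite -(subrr (phi y)); apply: cvgB; last exact: cvg_cst.
    apply: (cvg_comp (fun n => aff3 (- (2 * epsn n)) y x) phi (F := \oo) (G := nbhs (y : R * R * R))); last exact: cphi.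
    have c1 (a b : R) : (fun n => - (2 * epsn n) * a + b) @ \oo --> b.
      rewrite (_ : (fun n => _) = (fun n => - (2 * a) * epsn n + b)).
        exact: cvg_eps_mul.
      by apply/funext => n; ring.
    have c2 : (fun n => aff3 (- (2 * epsn n)) y x) @ \oo --> (((y.1.1, y.1.2), y.2) : R * R * R).
      exact: (cvg_pair (cvg_pair (c1 x.1.1 y.1.1) (c1 x.1.2 y.1.2)) (c1 x.2 y.2)).
    by move: c2; rewrite -!surjective_pairing.
apply: (squeeze_cvgr _ (cvg_cst 0) (_ : (fun n => 8 * Num.sqrt pi ^+ 3 * Rintegral mu setT (h n)) @ \oo --> 0)); last first.
  rewrite -(mulr0 (8 * Num.sqrt pi ^+ 3)); apply: cvgM => //; exact: cvg_cst.
apply: nearW => n; rewrite normr_ge0 /=.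
rewrite /mollify; have [-> i] := Rintegral_kern y (eps_gt0 n) iphi.
have i2 := integrableZl measurableT (phi y) integrable_gauss3.
rewrite exprMn -sqrt_pi6 (_ : 2 ^+ 3 * _ * phi y = 8 * Num.sqrt pi ^+ 3 * (phi y * Num.sqrt pi ^+ 3)); last by ring.
rewrite -mulrBr normrM ger0_norm ?mulr_ge0 ?exprn_ge0 ?sqrtr_ge0//.
rewrite ler_wpM2l ?mulr_ge0 ?exprn_ge0 ?sqrtr_ge0//.
rewrite -Rintegral_gauss3 -RintegralZl//; last exact: integrable_gauss3.
rewrite -RintegralB//.
have i3 := integrableB measurableT i i2.
apply: (le_trans (le_normr_Rintegral measurableT i3)).
rewrite le_eqVlt; apply/orP; left; apply/eqP; apply: eq_Rintegral => x _.
by rewrite /h -mulrBl normrM (ger0_norm (gauss3_ge0 _)).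
Qed.

End mollify.
Section inversion.
Context d (T : measurableType d) (nu : {sigma_finite_measure set T -> \bar R}).
Variables (H : T -> R[i]) (X : T -> E).
Hypotheses (iH : cintble nu H) (mX : measurable_fun setT X).
Variables (phi : E -> R) (B : R).
Hypotheses (mphi : measurable_fun [set: E] phi) (iphi : mu.-integrable setT (EFin \o phi)).
Hypothesis (hB : forall x, `|phi x| <= B).
Hypothesis cphi : continuous (phi : R * R * R -> R).

Let K : R := (2 * pi) ^+ 3.

Let cphiC := cintble_real iphi.

Lemma core_mollify n :
  Cint (prodm nu mu) (fun p => H p.1 * (phi p.2)%:C%C *
       (kern (epsn n) (sub3 (X p.1) p.2))%:C%C) =
  Cint nu (fun w => H w * (mollify phi n (X w))%:C%C).
Proof.
have mk : measurable_fun setT (fun p : T * E => kern (epsn n) (sub3 (X p.1) p.2)).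
  apply: measurable_kern; apply: measurable_sub3; last exact: measurable_snd.
  exact: (measurableT_comp mX).
have i1 := cintble_mul_bounded (Cint_prod_mul iH cphiC).1 mk (fun x => kern_le _ (eps_gt0 n)).
have mk2 y : measurable_fun setT (fun x : E => kern (epsn n) (sub3 y x)).
  apply: measurable_kern; apply: measurable_sub3; last exact: measurable_id.
  exact: measurable_cst.
have i3 y := cintble_mul_bounded cphiC (mk2 y) (fun x => kern_le _ (eps_gt0 n)).
have i2 w : cintble mu (fun x => H w * (phi x)%:C%C * (kern (epsn n) (sub3 (X w) x))%:C%C).
  have := cintbleZ (H w) (i3 (X w)).
  by congr cintble; apply/funext => x; rewrite mulrA.
rewrite -(Cint_fubini1 i1 i2).2; apply: eq_Cint => w.
under eq_Cint do rewrite /= -mulrA.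
rewrite CintZ//; congr (_ * _); rewrite /mollify -Cint_real.
by apply: eq_Cint => x; apply: complex_ext => /=; ring.
Qed.

Lemma measurable_mollify n : measurable_fun setT (mollify phi n).
Proof.
apply: (measurable_Rintegral_param mu (f := fun p => phi p.2 * kern (epsn n) (sub3 p.1 p.2))).
apply: measurable_funM; first exact: (measurableT_comp mphi).
by apply: measurable_kern; apply: measurable_sub3.
Qed.

Lemma cintble_mollify n : cintble nu (fun w => H w * (mollify phi n (X w))%:C%C).
Proof.
apply: (cintble_mul_bounded (B := K * B)) => //.
  exact: (measurableT_comp (measurable_mollify n) mX).
by move=> w; exact: mollify_le.
Qed.

Lemma cintble_test : cintble nu (fun w => H w * (phi (X w))%:C%C).
Proof.
apply: (cintble_mul_bounded (B := B)) => //.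
exact: (measurableT_comp mphi mX).
Qed.

Lemma cvg_mollify :
  (fun n => normc (Cint nu (fun w => H w * (mollify phi n (X w))%:C%C) -
     K%:C%C * Cint nu (fun w => H w * (phi (X w))%:C%C))) @ \oo --> (0 : R).
Proof.
have mH := cintble_cmeas iH.
pose h n w := normc (H w) * `|mollify phi n (X w) - K * phi (X w)|.
have mphiX := measurableT_comp mphi mX.
have mmX n := measurableT_comp (measurable_mollify n) mX.
have mh n : measurable_fun setT (h n).
  apply: measurable_funM; first exact: measurable_normc.
  apply: measurableT_comp => //; apply: measurable_funB; first exact: mmX.
  by apply: measurable_funM.
have hlim : (fun n => Rintegral nu setT (h n)) @ \oo --> 0.
  apply: (@dominated_cvg0 _ T R nu h (fun w => (2 * K * B) * normc (H w))) => //.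
  - by move=> n w; rewrite mulr_ge0 ?normc_ge0.
  - exact: (integrableZl measurableT _ ((integrable_normcP nu mH).1 iH)).
  - move=> n w; rewrite /h mulrC ler_wpM2r ?normc_ge0//.
    apply: (le_trans (ler_normB _ _)); rewrite (_ : 2 * K * B = K * B + K * B); last by ring.
    rewrite lerD//; first exact: mollify_le.
    have K0 : 0 <= K by rewrite exprn_ge0// mulr_ge0// pi_ge0.
    by rewrite normrM (ger0_norm K0) ler_wpM2l.
  - apply: aeW => w; rewrite /h -(mulr0 (normc (H w))); apply: cvgM; first exact: cvg_cst.
    exact: mollify_cvg.
apply: (squeeze_cvgr _ (cvg_cst 0) hlim); apply: nearW => n.
have ii := cintbleB (cintble_mollify n) (cintbleZ K%:C%C cintble_test).
rewrite normc_ge0 andTb -(CintZ _ cintble_test).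
rewrite -(CintB (cintble_mollify n) (cintbleZ K%:C%C cintble_test)).
apply: (le_trans (normc_Cint ii)).
rewrite le_eqVlt; apply/orP; left; apply/eqP; apply: eq_Rintegral => w _.
rewrite /h -normcR -normcM; congr normc; case: (H w) => p q; apply: complex_ext => /=; ring.
Qed.

Lemma cvg_gauss3_eps (z : E) : (fun n => gauss3 (scale3 (epsn n) z)) @ \oo --> (1 : R).
Proof.
have g1 (x : R) : (fun n => gauss_fun (epsn n * x)) @ \oo --> (1 : R).
  have -> : 1 = gauss_fun (0 : R) by rewrite /gauss_fun expr0n /= oppr0 expR0.
  apply: (cvg_comp (fun n => epsn n * x) gauss_fun (G := nbhs (0 : R))); last exact: continuous_gauss_fun.
  rewrite -(mul0r x); apply: cvgM; [exact: cvg_epsn|exact: cvg_cst].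
rewrite -(mulr1 1) -{1}(mulr1 1).
by apply: cvgM; [apply: cvgM|]; exact: g1.
Qed.

Lemma cvg_gauss_regularize (G : E -> R[i]) : cintble mu G ->
  (fun n => normc (Cint mu (fun z => G z * (gauss3 (scale3 (epsn n) z))%:C%C) -
     Cint mu G)) @ \oo --> (0 : R).
Proof.
move=> iG; have mG := cintble_cmeas iG.
pose h n z := normc (G z) * `|gauss3 (scale3 (epsn n) z) - 1|.
have mh n : measurable_fun setT (h n).
  apply: measurable_funM; first exact: measurable_normc.
  apply: measurableT_comp => //; apply: measurable_funB => //.
  exact: measurable_gauss3_scaled.
have hlim : (fun n => Rintegral mu setT (h n)) @ \oo --> 0.
  apply: (@dominated_cvg0 _ E R mu h (fun z => normc (G z))) => //.
  - by move=> n w; rewrite mulr_ge0 ?normc_ge0.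
  - exact: ((integrable_normcP mu mG).1 iG).
  - move=> n w; rewrite /h ler_piMr ?normc_ge0// distrC ger0_norm ?subr_ge0 ?gauss3_le1//.
    by rewrite gerBl gauss3_ge0.
  - apply: aeW => w; rewrite /h -(mulr0 (normc (G w))); apply: cvgM; first exact: cvg_cst.
    rewrite -(normr0 R); apply: cvg_norm; rewrite -(subrr (1 : R)); apply: cvgB; last exact: cvg_cst.
    exact: cvg_gauss3_eps.
have i1 n : cintble mu (fun z => G z * (gauss3 (scale3 (epsn n) z))%:C%C).
  apply: (cintble_mul_bounded (B := 1)) => //; first exact: measurable_gauss3_scaled.
  by move=> z; rewrite ger0_norm ?gauss3_ge0 ?gauss3_le1.
apply: (squeeze_cvgr _ (cvg_cst 0) hlim); apply: nearW => n.
rewrite normc_ge0 andTb -CintB//.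
apply: (le_trans (normc_Cint (cintbleB (i1 n) iG))).
rewrite le_eqVlt; apply/orP; left; apply/eqP; apply: eq_Rintegral => w _.
rewrite /h -normcR -normcM; congr normc; case: (G w) => p q; apply: complex_ext => /=; ring.
Qed.

(** One sequence of Gaussian-regularized integrals has both sides as limits: the left one by
    dominated convergence, the right one because [core_identity] turns the sequence into
    mollifications of [phi]. *)
Lemma fourier_pairing :
  cintble mu (fun z => extension nu H X z * ftransform (fun x => (phi x)%:C%C) z) ->
  Cint mu (fun z => extension nu H X z * ftransform (fun x => (phi x)%:C%C) z) =
  K%:C%C * Cint nu (fun w => H w * (phi (X w))%:C%C).
Proof.
move=> iA; have h1 := cvg_gauss_regularize iA.
have h2 := cvg_mollify.
pose a n := Cint nu (fun w => H w * (mollify phi n (X w))%:C%C).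
apply: (cvg_normc_unique (a := a)) => //.
apply: (cvg_trans _ h1); apply: near_eq_cvg; apply: nearW => n.
by rewrite /a -core_mollify -(core_identity iH mX (eps_gt0 n) cphiC).
Qed.

End inversion.
End space3.

Arguments extension : simpl never.
Arguments ftransform : simpl never.
Arguments mollify : simpl never.
Arguments kern : simpl never.
Arguments gauss3 : simpl never.

(** * The Fourier transform on L^2 *)

Section plancherel.
Context {R : realType}.
Local Notation E := (E3 R).
Local Notation mu := (mu3 R).
Local Notation K := ((2 * pi) ^+ 3 : R).

Lemma K_gt0 : 0 < K.
Proof. by rewrite exprn_gt0// mulr_gt0// pi_gt0. Qed.

Lemma integral_kern (e : R) (y : E) : 0 < e ->
  (\int[mu]_x (kern e (sub3 y x))%:E = K%:E)%E.
Proof.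
move=> e0; have en0 : e != 0 by rewrite gt_eqF.
have a0 : - (2 * e)^-1 != 0 by rewrite oppr_eq0 invr_eq0 mulf_neq0.
have [mt h] := scales_aff3 (scale3 (2 * e)^-1 y) a0.
have mg : measurable_fun setT (fun x : E => (gauss3 x)%:E).
  by apply/measurable_EFinP; apply: (@measurable_gauss3 _ _ E id); exact: measurable_id.
have c0 : 0 <= e ^- 3 * Num.sqrt pi ^+ 3.
  by rewrite mulr_ge0 ?exprn_ge0 ?sqrtr_ge0// invr_ge0 exprn_ge0// ltW.
transitivity (\int[mu]_x ((e ^- 3 * Num.sqrt pi ^+ 3)%:E *
    (gauss3 (aff3 (- (2 * e)^-1) (scale3 (2 * e)^-1 y) x))%:E))%E.
  apply: eq_integral => x _; rewrite -EFinM /kern; congr (_ * gauss3 _)%:E.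
  by rewrite /scale3 /aff3 /sub3 /=; congr (_, _, _); ring.
rewrite ge0_integralZl_EFin//; last 2 first.
- by move=> x _; rewrite lee_fin gauss3_ge0.
- exact: (measurableT_comp mg mt).
rewrite (h (fun x => (gauss3 x)%:E))//; last by move=> x; rewrite lee_fin gauss3_ge0.
rewrite integral_gauss3 -!EFinM; congr EFin.
rewrite normrN gtr0_norm ?invr_gt0 ?mulr_gt0//.
rewrite exprVn invrK exprMn [RHS]exprMn -sqrt_pi6 mulrACA.
rewrite (_ : e ^- 3 * (2 ^+ 3 * e ^+ 3) = 2 ^+ 3)//.
by rewrite mulrCA mulVf ?mulr1// expf_neq0.
Qed.

Lemma kern_sym (e : R) (x y : E) : kern e (sub3 x y) = kern e (sub3 y x).
Proof.
rewrite /kern; congr (_ * _); rewrite /gauss3 /scale3 /sub3 /= /gauss_fun.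
by congr (expR _ * expR _ * expR _); congr (- _); ring.
Qed.

Lemma ftransform_conj (G : E -> R[i]) (z : E) : cintble mu G ->
  ftransform (fun x => conjc (G x)) z = conjc (extension mu G id z).
Proof.
move=> iG; rewrite /ftransform /extension -CintJ; last first.
  apply: cintble_mul_expi => //; apply: measurable_dot3; last exact: measurable_id.
  exact: measurable_cst.
by apply: eq_Cint => x; rewrite rmorphM /= expiN.
Qed.

Lemma measurable_kern2 (e : R) :
  measurable_fun [set: E * E] (fun p : E * E => kern e (sub3 p.1 p.2)).
Proof. by apply: measurable_kern; apply: measurable_sub3. Qed.

Lemma integral_sqr_kern (G : E -> R[i]) (e : R) : 0 < e -> L2 mu G ->
  (\int[prodm mu mu]_p ((normc (G p.1) ^+ 2) * kern e (sub3 p.1 p.2))%:E = K%:E * N2 mu G)%E /\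
  (\int[prodm mu mu]_p ((normc (G p.2) ^+ 2) * kern e (sub3 p.1 p.2))%:E = K%:E * N2 mu G)%E.
Proof.
move=> e0 [mG _].
have mG2 := measurable_funX 2 (measurable_normc mG).
have mk y : measurable_fun setT (fun x : E => (kern e (sub3 y x))%:E).
  apply/measurable_EFinP; exact: (measurable_fun_pair2 y (measurable_kern2 e)).
have N x : (\int[mu]_y ((normc (G x) ^+ 2) * kern e (sub3 x y))%:E = K%:E * (normc (G x) ^+ 2)%:E)%E.
  under eq_integral do rewrite EFinM.
  rewrite ge0_integralZl_EFin; [|exact: measurableT| |exact: mk|exact: sqr_ge0].
    by rewrite integral_kern// muleC.
  by move=> y _; rewrite lee_fin kern_ge0.
have mprod (pr : E * E -> E) : measurable_fun setT pr ->
    measurable_fun setT (fun p : E * E => ((normc (G (pr p)) ^+ 2) * kern e (sub3 p.1 p.2))%:E).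
  move=> mpr; apply/measurable_EFinP; apply: measurable_funM; last exact: measurable_kern2.
  exact: (measurableT_comp mG2 mpr).
have Z : (\int[mu]_x (K%:E * (normc (G x) ^+ 2)%:E) = K%:E * N2 mu G)%E.
  rewrite ge0_integralZl_EFin//; last first.
  - exact: ltW K_gt0.
  - exact: measurable_sqr_normc.
  - by move=> y _; rewrite lee_fin sqr_ge0.
split.
- rewrite fubini_tonelli1; last 2 first.
  + exact: mprod.
  + by move=> p; rewrite lee_fin mulr_ge0 ?sqr_ge0 ?kern_ge0.
  by rewrite /fubini_F /= -Z; apply: eq_integral => x _; rewrite N.
- rewrite fubini_tonelli2; last 2 first.
  + exact: mprod.
  + by move=> p; rewrite lee_fin mulr_ge0 ?sqr_ge0 ?kern_ge0.
  rewrite /fubini_G /= -Z; apply: eq_integral => x _; rewrite -N.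
  by apply: eq_integral => y _; rewrite kern_sym.
Qed.

(** Take conj G as the second function in [core_identity]. One side becomes the Gaussian-weighted
    integral of the squared modulus of the transform; the other is a quadratic form with kernel
    [kern], bounded through |G(x) G(y)| <= (|G(x)|^2 + |G(y)|^2) / 2 and the mass (2 pi)^3 of the
    kernel. Fatou removes the Gaussian. *)
Lemma plancherel_le (G : E -> R[i]) : cintble mu G -> L2 mu G ->
  (N2 mu (extension mu G id) <= K%:E * N2 mu G)%E.
Proof.
move=> iG l2G; have mG := l2G.1.
set A := extension mu G id.
have mA : cmeas A by apply: cmeas_extension => //; exact: measurable_id.
have mA2 := measurable_funX 2 (measurable_normc mA).
pose h n z := normc (A z) ^+ 2 * gauss3 (scale3 (epsn n) z).
have mh n : measurable_fun setT (h n).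
  by apply: measurable_funM => //; exact: measurable_gauss3_scaled.
apply: (@fatou_le _ E R mu h) => //.
- by move=> n z; rewrite mulr_ge0 ?sqr_ge0 ?gauss3_ge0.
- apply: aeW => z; rewrite -[X in _ --> X]mulr1; apply: cvgM; first exact: cvg_cst.
  exact: cvg_gauss3_eps.
move=> n; have e0 : 0 < epsn n :> R by exact: eps_gt0.
have en0 : epsn n != 0 :> R by rewrite gt_eqF.
pose M := Rintegral mu setT (fun w => normc (G w)).
have AM z : normc (A z) <= M by apply: normc_extension => //; exact: measurable_id.
have ih : mu.-integrable setT (EFin \o h n).
  apply: le_integrable (integrableZl measurableT (M ^+ 2) (integrable_gauss3_scaled en0)) => //.
    exact/measurable_EFinP.
  move=> z _; have g0 := gauss3_ge0 (scale3 (epsn n) z).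
  have h0 : 0 <= h n z by rewrite mulr_ge0 ?sqr_ge0.
  rewrite /= lee_fin; apply: le_trans (ler_norm _); rewrite (ger0_norm h0).
  rewrite /h; apply: ler_wpM2r => //.
  by rewrite lerXn2r ?nnegrE ?normc_ge0// (le_trans (normc_ge0 _) (AM z)).
have -> : (\int[mu]_z (h n z)%:E = (Rintegral mu setT (h n))%:E)%E.
  by rewrite /Rintegral fineK//; apply: integrable_fin_num.
have iJ : cintble mu (fun x => conjc (G x)) by exact: cintbleJ.
have := core_identity iG (@measurable_id _ E setT) e0 iJ.
have -> : Cint mu (fun z => extension mu G id z * ftransform (fun x => conjc (G x)) z *
    (gauss3 (scale3 (epsn n) z))%:C%C) = (Rintegral mu setT (h n))%:C%C.
  rewrite -Cint_real; apply: eq_Cint => z; rewrite ftransform_conj// -/A /h.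
  by rewrite normc_sqr; case: (A z) => p q; apply: complex_ext => /=; ring.
set Q := Cint (prodm mu mu) _ => eQ.
have hr : Rintegral mu setT (h n) <= normc Q.
  by rewrite -eQ normcR ler_norm.
have mk2 := measurable_kern2 (epsn n).
have iQ := cintble_mul_bounded (Cint_prod_mul iG iJ).1 mk2 (fun x => kern_le _ e0).
have i2 := (integrable_normcP _ (cintble_cmeas iQ)).1 iQ.
apply: (@le_trans _ _ (Rintegral (prodm mu mu) setT (fun p : E * E => normc
   (G p.1 * conjc (G p.2) * (kern (epsn n) (sub3 p.1 p.2))%:C%C)))%:E).
  by rewrite lee_fin (le_trans hr)// normc_Cint.
rewrite /Rintegral fineK; last exact: integrable_fin_num.
have [e1 e2] := integral_sqr_kern e0 l2G.
have mGk (pr : E * E -> E) : measurable_fun setT pr -> measurable_fun setT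
    (fun p : E * E => (2^-1 * (normc (G (pr p)) ^+ 2 * kern (epsn n) (sub3 p.1 p.2)))%:E).
  move=> mpr; apply/measurable_EFinP; apply: measurable_funM => //.
  apply: measurable_funM => //; apply: measurable_funX.
  exact: (measurableT_comp (measurable_normc mG) mpr).
have half (pr : E * E -> E) : measurable_fun setT pr ->
    (\int[prodm mu mu]_p ((normc (G (pr p)) ^+ 2) * kern (epsn n) (sub3 p.1 p.2))%:E = K%:E * N2 mu G)%E ->
    (\int[prodm mu mu]_p (2^-1 * ((normc (G (pr p)) ^+ 2) * kern (epsn n) (sub3 p.1 p.2)))%:E = 2^-1%:E * (K%:E * N2 mu G))%E.
  move=> mpr <-; under eq_integral do rewrite EFinM.
  rewrite ge0_integralZl_EFin//.
  - by move=> p _; rewrite lee_fin mulr_ge0 ?sqr_ge0 ?kern_ge0.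
  - apply/measurable_EFinP; apply: measurable_funM => //; apply: measurable_funX.
    exact: (measurableT_comp (measurable_normc mG) mpr).
rewrite -[leRHS]mul1e (_ : 1 = 2^-1%:E + 2^-1%:E)%E; last by rewrite -EFinD; congr EFin; lra.
rewrite ge0_muleDl ?lee_fin//.
have h1 := half _ measurable_fst e1; have h2 := half _ measurable_snd e2.
rewrite -{1}h1 -h2.
rewrite -ge0_integralD//; last 4 first.
- by move=> p _; rewrite lee_fin mulr_ge0// mulr_ge0 ?sqr_ge0 ?kern_ge0.
- exact: mGk.
- by move=> p _; rewrite lee_fin mulr_ge0// mulr_ge0 ?sqr_ge0 ?kern_ge0.
- exact: mGk.
apply: ge0_le_integralT.
- exact: (measurable_int _ i2).
- by apply: emeasurable_funD; exact: mGk.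
- by move=> p; rewrite lee_fin normc_ge0.
- move=> p; rewrite -EFinD lee_fin -mulrDr -mulrDl !normcM normcR normc_conj.
  rewrite ger0_norm ?kern_ge0// mulrA ler_wpM2r ?kern_ge0//.
  have := sqr_ge0 (normc (G p.1) - normc (G p.2)); nra.
Qed.

End plancherel.

Section fourier_L2.
Context {R : realType}.
Local Notation E := (E3 R).
Local Notation mu := (mu3 R).
Local Notation K := ((2 * pi) ^+ 3 : R).
Implicit Types F f : E -> R[i].

(** An L^2 function need not be integrable; the Gaussian factor makes it so, and keeps it in L^2
    with a norm that does not grow. *)
Definition regularize (n : nat) F (z : E) : R[i] :=
  F z * (gauss3 (scale3 (epsn n) z))%:C%C.

Lemma epsn_neq0 n : epsn n != 0 :> R.
Proof. by rewrite gt_eqF ?eps_gt0. Qed.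

Lemma cmeas_regularize n F : cmeas F -> cmeas (regularize n F).
Proof.
by move=> mF; apply: cmeasM => //; apply: cmeas_real; exact: measurable_gauss3_scaled.
Qed.

Lemma L2_regularize n F : L2 mu F -> L2 mu (regularize n F).
Proof.
move=> lF; apply: (L2_le _ lF); first by apply: cmeas_regularize; exact: lF.1.
move=> z; rewrite normcM normcR ger0_norm ?gauss3_ge0// ler_piMr ?normc_ge0//.
exact: gauss3_le1.
Qed.

Lemma cintble_regularize n F : L2 mu F -> cintble mu (regularize n F).
Proof.
move=> lF; have mF := lF.1.
have := integrableD measurableT (L2_integrable lF) (integrable_gauss3_scaled (epsn_neq0 n)).
move/cintble_le; apply; first exact: cmeas_regularize.
move=> z /=; rewrite normcM normcR ger0_norm ?gauss3_ge0//.
have := gauss3_le1 (scale3 (epsn n) z); have := gauss3_ge0 (scale3 (epsn n) z).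
have := sqr_ge0 (normc (F z) - gauss3 (scale3 (epsn n) z)); have := normc_ge0 (F z); nra.
Qed.

Lemma regularize_cvg F : L2 mu F ->
  (fun n => fine (N2 mu (fun z => F z - regularize n F z))) @ \oo --> 0.
Proof.
move=> lF; have mF := lF.1.
apply: (@dominated_cvg0 _ E R mu (fun n z => normc (F z - regularize n F z) ^+ 2)
  (fun z => normc (F z) ^+ 2)) => //.
- move=> n; apply: measurable_funX; apply: measurable_normc.
  by apply: cmeasB => //; exact: cmeas_regularize.
- by move=> n z; rewrite sqr_ge0.
- exact: L2_integrable.
- move=> n z; rewrite lerXn2r ?nnegrE ?normc_ge0//.
  rewrite (_ : F z - _ = F z * (1 - gauss3 (scale3 (epsn n) z))%:C%C); last first.
    by rewrite /regularize; case: (F z) => p q; apply: complex_ext => /=; ring.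
  rewrite normcM normcR ger0_norm ?subr_ge0 ?gauss3_le1// ler_piMr ?normc_ge0//.
  by rewrite gerBl gauss3_ge0.
- apply: aeW => z.
  have -> : (fun n => normc (F z - regularize n F z) ^+ 2) =
      (fun n => normc (F z) ^+ 2 * (1 - gauss3 (scale3 (epsn n) z)) ^+ 2).
    apply/funext => n.
    rewrite (_ : F z - _ = F z * (1 - gauss3 (scale3 (epsn n) z))%:C%C); last first.
      by rewrite /regularize; case: (F z) => p q; apply: complex_ext => /=; ring.
    by rewrite normcM normcR exprMn real_normK ?num_real.
  rewrite -[X in _ --> X](mulr0 (normc (F z) ^+ 2)); apply: cvgM; first exact: cvg_cst.
  have h : (fun n => 1 - gauss3 (scale3 (epsn n) z)) @ \oo --> (0 : R).
    by rewrite -[X in _ --> X](subrr (1 : R)); apply: cvgB; [exact: cvg_cst|exact: cvg_gauss3_eps].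
  by rewrite -[X in _ --> X](mulr0 (0 : R)); apply: cvgM.
Qed.

Definition approxF (n : nat) F : E -> R[i] := extension mu (regularize n F) id.

Lemma cmeas_approxF n F : L2 mu F -> cmeas (approxF n F).
Proof.
move=> lF; apply: cmeas_extension; first exact: cintble_regularize.
exact: measurable_id.
Qed.

Lemma L2_approxF n F : L2 mu F -> L2 mu (approxF n F).
Proof.
move=> lF; split; first exact: cmeas_approxF.
have := plancherel_le (cintble_regularize n lF) (L2_regularize n lF).
move/le_lt_trans; apply; apply: lte_mul_pinfty; rewrite ?lee_fin ?(ltW K_gt0)//.
exact: (L2_regularize n lF).2.
Qed.

Definition defect n F := fine (N2 mu (fun z => F z - regularize n F z)).

Lemma defect_ge0 n F : 0 <= defect n F.
Proof. by rewrite fine_ge0// N2_ge0. Qed.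

Lemma N2_defect n F : L2 mu F ->
  N2 mu (fun z => F z - regularize n F z) = (defect n F)%:E.
Proof.
by move=> lF; rewrite /defect fineK//; apply/N2_fin/L2B => //; exact: L2_regularize.
Qed.

Lemma N2_approxB n m F : L2 mu F ->
  (N2 mu (fun z => (approxF n F z - approxF m F z)%R) <=
   (K * (2 * defect n F + 2 * defect m F))%:E)%E.
Proof.
move=> lF; have mF := lF.1.
have iD := cintbleB (cintble_regularize n lF) (cintble_regularize m lF).
have lD := L2B (L2_regularize n lF) (L2_regularize m lF).
rewrite (_ : (fun z => _) = extension mu (fun z => regularize n F z - regularize m F z) id); last first.
  apply/funext => z; rewrite /approxF /extension -CintB.
  - by apply: eq_Cint => w; rewrite mulrBl.
  - apply: cintble_mul_expi; first exact: cintble_regularize.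
    by apply: measurable_dot3; [exact: measurable_cst|exact: measurable_id].
  - apply: cintble_mul_expi; first exact: cintble_regularize.
    by apply: measurable_dot3; [exact: measurable_cst|exact: measurable_id].
apply: (le_trans (plancherel_le iD lD)).
set D := (2 * defect n F + 2 * defect m F).
rewrite (_ : (K * D)%:E = K%:E * D%:E)%E// lee_pmul2l//; last by rewrite lte_fin K_gt0.
have e : (fun z => regularize n F z - regularize m F z) =
    (fun z => (F z - regularize m F z) + (- (F z - regularize n F z))).
  by apply/funext => z; ring.
have ln := L2B lF (L2_regularize n lF); have lm := L2B lF (L2_regularize m lF).
rewrite e; apply: (le_trans (N2D _ lm.1 (L2N ln).1)).
have -> : N2 mu (fun z => - (F z - regularize n F z)) = N2 mu (fun z => F z - regularize n F z).
  by apply: eq_integral => z _; rewrite normcN.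
rewrite (N2_defect m lF) (N2_defect n lF).
rewrite -[leLHS]/((2 * defect m F)%:E + (2 * defect n F)%:E)%E -EFinD.
rewrite lee_fin /D [leRHS]addrC; exact: lexx.
Qed.

(* [f] is the Fourier transform of [F] up to normalization, defined as the [L^2]
   limit of the Fourier integrals of the regularizations of [F]. *)
Definition l2pair f F := [/\ L2 mu f, L2 mu F &
  (fun n => fine (N2 mu (fun z => K%:C%C * f z - approxF n F z))) @ \oo --> 0].

(** The rate 8^-k is chosen so that a summable 2^-k is left after the weight 4^k used for the almost
    everywhere convergence. *)
Lemma subseq_defect F : L2 mu F -> exists nk : nat -> nat,
  forall k, defect (nk k) F <= (8 ^- k).
Proof.
move=> lF; suff /choice[nk hnk] : forall k, exists n, defect n F <= 8 ^- k by exists nk.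
move=> k.
have e0 : 0 < 8 ^- k :> R by rewrite invr_gt0 exprn_gt0.
have /cvgrPdist_le/(_ _ e0)[n _ /(_ n (leqnn n))] := regularize_cvg lF.
by rewrite /= sub0r normrN ger0_norm ?defect_ge0//; exists n.
Qed.

(** The increments are at most sqrt(S) 2^-k, so the telescoping series is dominated by a geometric
    one. *)
Lemma cvg_of_summable (a : nat -> R) (S : R) :
  (forall k, (a k.+1 - a k) ^+ 2 <= S / 4 ^+ k) -> cvgn a.
Proof.
move=> h.
have S0 : 0 <= S.
  have := h 0%N; rewrite expr0 divr1; apply: le_trans; exact: sqr_ge0.
have d k : `|telescope a k| <= geometric (Num.sqrt S) 2^-1 k.
  rewrite /telescope /geometric /= -(sqrtr_sqr (a k.+1 - a k)).
  apply: (@le_trans _ _ (Num.sqrt (S / 4 ^+ k))); first by rewrite ler_wsqrtr.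
  rewrite sqrtrM// (_ : (4 ^+ k)^-1 = (2^-1 ^+ k) ^+ 2); last first.
    by rewrite -exprM mulnC exprM -exprVn; congr (_ ^+ _); lra.
  by rewrite sqrtr_sqr ger0_norm// exprn_ge0.
have cv : cvgn (series (telescope a)).
  apply: normed_cvg; apply: (series_le_cvg _ _ d) => [n|n|].
  - exact: normr_ge0.
  - by rewrite /geometric /= mulr_ge0 ?sqrtr_ge0 ?exprn_ge0.
  - by apply: is_cvg_geometric_series; rewrite ger0_norm//; lra.
rewrite (_ : a = (fun n => a 0%N + series (telescope a) n)).
  by apply: is_cvgD => //; exact: is_cvg_cst.
by apply/funext => n; rewrite -eq_sum_telescope.
Qed.

Lemma normc_dist (z w : R[i]) : `|normc z - normc w| <= normc (z - w).
Proof.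
have h (x y : R[i]) : normc x <= normc (x - y) + normc y by rewrite -{1}(subrK y x) normcD.
rewrite ler_norml; apply/andP; split.
  have := h w z; rewrite -[normc (w - z)]normcN opprB => h1; rewrite lerBrDr addrC lerBlDr addrC.
  by [].
by rewrite lerBlDr.
Qed.

Lemma cvg_dist0 (u : nat -> R) (l : R) : u @ \oo --> l ->
  (fun n => `|u n - l|) @ \oo --> 0.
Proof.
move=> h; rewrite -(normr0 R) -(subrr l); apply: cvg_norm.
by apply: cvgB => //; exact: cvg_cst.
Qed.

Lemma pow8E k : 8 ^- k = 4 ^- k * 2^-1 ^+ k :> R.
Proof. by rewrite exprVn -invfM -exprMn; congr (_ ^- _); lra. Qed.

Lemma pow8_le k n : (n <= k)%N -> 8 ^- k <= 8 ^- n :> R.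
Proof.
by move=> nk; rewrite lef_pV2 ?posrE ?exprn_gt0// ler_weXn2l//; lra.
Qed.

(** A Riesz-Fischer argument. Along a fast subsequence the sum of 4^k |a_(k+1) - a_k|^2 has finite
    integral, hence is finite almost everywhere, and there a_k converges. Fatou upgrades this to L^2
    convergence of the whole family [approxF]. *)
Lemma l2pair_exists F : L2 mu F -> exists f, l2pair f F.
Proof.
move=> lF; have [nk hnk] := subseq_defect lF.
pose a k := approxF (nk k) F.
have ma k : cmeas (a k) by exact: cmeas_approxF.
pose t k z := 4 ^+ k * normc (a k.+1 z - a k z) ^+ 2.
have mD k : measurable_fun setT (fun z => normc (a k.+1 z - a k z) ^+ 2).
  by apply: measurable_funX; apply: measurable_normc; exact: cmeasB.
have mt k : measurable_fun setT (fun z => (t k z)%:E).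
  by apply/measurable_EFinP; exact: measurable_funM.
have t0 k z : (0 <= (t k z)%:E)%E by rewrite lee_fin /t mulr_ge0 ?sqr_ge0 ?exprn_ge0.
pose S z := (\sum_(0 <= k <oo) (t k z)%:E)%E.
have it k : (\int[mu]_z (t k z)%:E <= (geometric (4 * K) 2^-1 k)%:E)%E.
  under eq_integral do rewrite EFinM.
  have s0 z : setT z -> (0 <= (normc (a k.+1 z - a k z) ^+ 2)%:E)%E.
    by move=> _; rewrite lee_fin sqr_ge0.
  have ms : measurable_fun setT (fun z => (normc (a k.+1 z - a k z) ^+ 2)%:E).
    exact/measurable_EFinP.
  have k0 : 0 <= 4 ^+ k :> R by rewrite exprn_ge0.
  rewrite (ge0_integralZl_EFin mu measurableT s0 ms k0).
  apply: (@le_trans _ _ ((4 ^+ k)%:E * (K * (2 * defect (nk k.+1) F + 2 * defect (nk k) F))%:E)%E).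
    by rewrite lee_pmul2l ?lte_fin ?exprn_gt0//; exact: N2_approxB.
  rewrite -EFinM lee_fin /geometric /=.
  have h1 : defect (nk k.+1) F <= 8 ^- k.
    by apply: (le_trans (hnk k.+1)); apply: pow8_le.
  have h2 := hnk k.
  apply: (@le_trans _ _ (4 ^+ k * (K * (4 * 8 ^- k)))).
    move: h1 h2; move: (defect (nk k.+1) F) (defect (nk k) F) (8 ^- k) => d1 d2 q h1 h2.
    rewrite ler_wpM2l// ler_wpM2l ?(ltW K_gt0)//; lra.
  rewrite pow8E.
  have q0 : 4 ^+ k != 0 :> R by rewrite expf_neq0.
  rewrite le_eqVlt; apply/orP; left; apply/eqP.
  rewrite (_ : _ * (K * _) = 4 * K * (4 ^+ k * 4 ^- k) * 2^-1 ^+ k); last by ring.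
  by rewrite divff// mulr1.
have mS : measurable_fun setT S.
  by apply: ge0_emeasurable_sum => //; move=> k; exact: t0.
have S0 z : (0 <= S z)%E by exact: nneseries_ge0.
have Sfin : (\int[mu]_z S z < +oo)%E.
  rewrite integral_nneseries//.
  apply: (@le_lt_trans _ _ (\sum_(0 <= k <oo) (geometric (4 * K) 2^-1 k)%:E)%E).
    by apply: lee_nneseries => // k _ _; apply: integral_ge0 => z _; exact: t0.
  have g0 k : 0 <= geometric (4 * K) 2^-1 k.
    have h := ltW (@K_gt0 R); rewrite /geometric /=; apply: mulr_ge0.
      exact: mulr_ge0.
    exact: exprn_ge0.
  have cg : cvgn (series (geometric (4 * K) 2^-1)).
    by apply: is_cvg_geometric_series; rewrite ger0_norm// invf_lt1// ltr1n.
  rewrite (_ : \sum_(0 <= k <oo) _ = (limn (series (geometric (4 * K) 2^-1)))%:E)%E; first exact: ltry.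
  rewrite -EFin_lim//; apply/congr_lim/funext => n /=.
  by rewrite /series /= sumEFin.
have iS : mu.-integrable setT S.
  apply/integrableP; split => //.
  by under eq_integral do rewrite gee0_abs//.
have aeS : \forall z \ae mu, S z \is a fin_num.
  by apply: filterS (integrable_ae measurableT iS) => z; exact.
have bnd z : S z \is a fin_num -> forall k,
    normc (a k.+1 z - a k z) ^+ 2 <= fine (S z) / 4 ^+ k.
  move=> Sz k; rewrite ler_pdivlMr ?exprn_gt0// mulrC -lee_fin fineK//.
  apply: le_trans (nneseries_lim_ge k.+1 (fun n _ _ => t0 n z)).
  by rewrite big_nat_recr//= leeDr// sume_ge0.
(* The upper limit is defined and measurable everywhere, and it is the limit wherever [S] is finite;
   elsewhere its value is irrelevant. *)
pose lm (p : R[i] -> R) z := fine (limn_esup (fun k => (p (a k z))%:E)).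
pose f0 z := Complex (lm (@complex.Re R) z) (lm (@complex.Im R) z).
have mf0 : cmeas f0.
  have ml (p : R[i] -> R) : (forall k, measurable_fun setT (fun z => p (a k z))) ->
      measurable_fun setT (lm p).
    move=> mp; apply: measurableT_comp => //.
    apply: (measurable_fun_limn_esup (f := fun k z => (p (a k z))%:E)) => k.
    exact/measurable_EFinP.
  by split; apply: ml => k; [exact: (ma k).1|exact: (ma k).2].
have lim1 (p : R[i] -> R) z : S z \is a fin_num ->
    (forall x y, p (x - y) = p x - p y) -> (forall x, `|p x| <= normc x) ->
    (fun k => p (a k z)) @ \oo --> lm p z.
  move=> Sz pB pn; have cv : cvgn (fun k => p (a k z)).
    apply: (@cvg_of_summable _ (fine (S z))) => k.
    apply: le_trans (bnd z Sz k); rewrite -pB -real_normK ?num_real//.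
    by rewrite lerXn2r ?nnegrE ?normc_ge0.
  have /cvg_ex[l hl] := cv.
  have hl' : (fun k => (p (a k z))%:E) @ \oo --> l%:E by apply: (cvg_comp _ _ hl); exact: cvg_id.
  by rewrite /lm; have [_ ->] := cvg_limn_einf_sup hl'.
have limc z : S z \is a fin_num -> (fun k => normc (a k z - f0 z)) @ \oo --> (0 : R).
  move=> Sz.
  have r := lim1 (@complex.Re R) z Sz (fun x y => ltac:(by rewrite ReD ReN)) (@Re_le_normc R).
  have i := lim1 (@complex.Im R) z Sz (fun x y => ltac:(by rewrite ImD ImN)) (@Im_le_normc R).
  have h : (fun k => `|complex.Re (a k z) - lm (@complex.Re R) z| +
      `|complex.Im (a k z) - lm (@complex.Im R) z|) @ \oo --> (0 : R).
    rewrite -[X in _ --> X](addr0 (0 : R)); apply: cvgD.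
      exact: cvg_dist0 r.
    exact: cvg_dist0 i.
  apply: (squeeze_cvgr _ (cvg_cst 0) h); apply: nearW => k.
  rewrite normc_ge0 andTb; apply: (le_trans (normc_le_ReIm _)).
  by rewrite !(ReD, ImD, ReN, ImN).
(* Fatou along the index k + n: the shift bounds the defect of every term of the subsequence
   involved by 8^-n. *)
have main n : (N2 mu (fun z => (f0 z - approxF n F z)%R) <= (K * (2 * 8 ^- n + 2 * defect n F))%:E)%E.
  apply: (@fatou_le _ E R mu (fun k z => normc (a (k + n)%N z - approxF n F z) ^+ 2)).
  - move=> k; apply: measurable_funX; apply: measurable_normc; apply: cmeasB => //.
    exact: cmeas_approxF.
  - by move=> k z; rewrite sqr_ge0.
  - by apply: measurable_funX; apply: measurable_normc; apply: cmeasB => //; exact: cmeas_approxF.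
  - apply: filterS aeS => z Sz.
    have h : (fun k => normc (a (k + n)%N z - approxF n F z)) @ \oo --> normc (f0 z - approxF n F z).
      rewrite (cvg_shiftn n (fun k => normc (a k z - approxF n F z))).
      apply/cvgrPdist_le => e e0.
      have /cvgrPdist_le/(_ e e0) := limc z Sz.
      apply: filterS => k; rewrite sub0r normrN ger0_norm ?normc_ge0//.
      apply: le_trans; rewrite distrC.
      rewrite (_ : a k z - f0 z = (a k z - approxF n F z) - (f0 z - approxF n F z)); last by ring.
      exact: normc_dist.
    by apply: cvgM.
  - move=> k; apply: (le_trans (N2_approxB (nk (k + n)%N) n lF)).
    rewrite lee_fin ler_wpM2l ?(ltW K_gt0)// lerD2r ler_wpM2l//.
    by apply: (le_trans (hnk _)); apply: pow8_le; exact: leq_addl.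
have K0 : K%:C%C != 0 :> R[i].
  by apply/eqP => -[/eqP]; rewrite gt_eqF// K_gt0.
exists (fun z => K%:C%C^-1 * f0 z); split => //.
- apply: L2Z.
  rewrite (_ : f0 = fun z => (f0 z - approxF 0 F z) + approxF 0 F z); last first.
    by apply/funext => z; rewrite subrK.
  have l0 := L2_approxF 0 lF.
  apply: L2D => //; split; first exact: (cmeasB mf0 l0.1).
  exact: (le_lt_trans (main 0%N) (ltry _)).
- have e n : (fun z => K%:C%C * (K%:C%C^-1 * f0 z) - approxF n F z) = (fun z => f0 z - approxF n F z).
    by apply/funext => z; rewrite mulrA divff// mul1r.
  under eq_fun do rewrite e.
  have b : (fun n => K * (2 * 8 ^- n + 2 * defect n F)) @ \oo --> (0 : R).
    rewrite -[X in _ --> X](mulr0 K); apply: cvgM; first exact: cvg_cst.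
    rewrite -[X in _ --> X](addr0 0); apply: cvgD.
      rewrite -[X in _ --> X](mulr0 2); apply: cvgM; first exact: cvg_cst.
      under eq_fun do rewrite -exprVn.
      by apply: cvg_expr; rewrite ger0_norm// invf_lt1// ltr1n.
    by rewrite -[X in _ --> X](mulr0 2); apply: cvgM; [exact: cvg_cst|exact: regularize_cvg].
  apply: (squeeze_cvgr _ (cvg_cst 0) b); apply: nearW => n.
  rewrite fine_ge0 ?N2_ge0//= -lee_fin fineK ?main//.
  by rewrite ge0_fin_numE ?N2_ge0// (le_lt_trans (main n) (ltry _)).
Qed.

End fourier_L2.

Lemma cintble_iterated d1 d2 (R : realType) (T1 : measurableType d1) (T2 : measurableType d2)
    (m1 : {sigma_finite_measure set T1 -> \bar R}) (m2 : {sigma_finite_measure set T2 -> \bar R})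
    (f : T1 * T2 -> R[i]) (h : T2 -> R) :
  cmeas f -> m2.-integrable setT (EFin \o h) ->
  (forall y, \int[m1]_x (normc (f (x, y)))%:E <= (h y)%:E)%E ->
  cintble (prodm m1 m2) f.
Proof.
move=> mf /integrableP[mh ih] fh.
have mn : measurable_fun setT (fun p => (normc (f p))%:E).
  by apply/measurable_EFinP; exact: measurable_normc.
have n0 p : (0 <= (normc (f p))%:E)%E by rewrite lee_fin normc_ge0.
apply: cintbleP => //; rewrite fubini_tonelli2//.
apply: le_lt_trans ih; apply: ge0_le_integralT.
- exact: measurable_fun_fubini_tonelli_G.
- exact: measurableT_comp.
- by move=> y; apply: integral_ge0.
- by move=> y; apply: (le_trans (fh y)); rewrite /= lee_fin ler_norm.
Qed.

(** * Pairing with test functions and the convolution theorem *)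

Section pairing.
Context {R : realType}.
Local Notation E := (E3 R).
Local Notation mu := (mu3 R).
Local Notation K := ((2 * pi) ^+ 3 : R).
Implicit Types (F G f g : E -> R[i]) (phi : E -> R).

Definition add3 (y z : R * R * R) : R * R * R :=
  ((y.1.1 + z.1.1, y.1.2 + z.1.2), y.2 + z.2).

Lemma sub3E (y x : E) : sub3 y x = aff3 (-1) y x.
Proof. by rewrite /sub3 /aff3; congr (_, _, _); ring. Qed.

Lemma sub3_add3 (y x : E) : sub3 (add3 x y) x = y.
Proof. by case: y => -[a b] c; rewrite /add3 /sub3 /=; congr (_, _, _); ring. Qed.

Lemma expi_add3 (z x y : E) : expi (dot3 z (add3 x y)) = expi (dot3 z x) * expi (dot3 z y).
Proof. by rewrite -expiD; congr expi; rewrite /dot3 /=; ring. Qed.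

Lemma measurable_add3 d (T : measurableType d) (f1 f2 : T -> E) :
  measurable_fun setT f1 -> measurable_fun setT f2 ->
  measurable_fun setT (fun t => add3 (f1 t) (f2 t) : E).
Proof.
move=> /measurable_coord[? ? ?] /measurable_coord[? ? ?].
by apply: measurable_triple; exact: measurable_funD.
Qed.

Lemma scales_sub3 (y : E) : scales mu (fun x => sub3 y x) 1.
Proof.
have n1 : (-1 : R) != 0 by rewrite oppr_eq0.
have := scales_aff3 y n1; rewrite normrN1 expr1n invr1.
by congr scales; apply/funext => x; rewrite sub3E.
Qed.

Lemma scales_shear : scales (prodm mu mu) (fun p => (p.1, add3 p.1 p.2)) 1.
Proof.
have mt : measurable_fun [set: E * E] (fun p : E * E => (p.1, add3 p.1 p.2 : E)).
  by apply: measurable_fun_pair => //; exact: measurable_add3.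
split => // h mh h0; rewrite mul1e.
rewrite fubini_tonelli1//; last exact: (measurableT_comp mh mt).
rewrite [RHS]fubini_tonelli1//; apply: eq_integral => x _; rewrite /fubini_F.
have n1 : (1 : R) != 0 by [].
have [m s] := scales_aff3 x n1.
have mhx : measurable_fun setT (fun y => h (x, y)) by exact: (measurable_fun_pair2 x mh).
have := s _ mhx (fun y => h0 (x, y)); rewrite normr1 expr1n invr1 mul1e => <-.
apply: eq_integral => y _; congr h; congr pair.
by rewrite /add3 /aff3 /=; congr (_, _, _); ring.
Qed.

Lemma L2_sub3 (y : E) G : L2 mu G ->
  L2 mu (fun x => G (sub3 y x)) /\ N2 mu (fun x => G (sub3 y x)) = N2 mu G.
Proof.
move=> [mG iG]; have [mt s] := scales_sub3 y.
have e : N2 mu (fun x => G (sub3 y x)) = N2 mu G.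
  rewrite /N2 (s (fun x => (normc (G x) ^+ 2)%:E)) ?mul1e//.
  - exact: measurable_sqr_normc.
  - by move=> x; rewrite lee_fin sqr_ge0.
by split=> //; split; [exact: (cmeas_comp mG mt)|rewrite e].
Qed.

Lemma cintble_mul_cbounded d (T : measurableType d) (m : {measure set T -> \bar R})
    (f h : T -> R[i]) (B : R) : cintble m f -> cmeas h ->
  (forall x, normc (h x) <= B) -> cintble m (fun x => f x * h x).
Proof.
move=> fi mh hB; have mf := cintble_cmeas fi.
have := integrableZl measurableT B ((integrable_normcP m mf).1 fi).
move/cintble_le; apply; first exact: cmeasM.
by move=> x /=; rewrite normcM mulrC ler_wpM2r// normc_ge0.
Qed.

Lemma cvg_sqrt0 (u : nat -> R) (c : R) : u @ \oo --> 0 ->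
  (fun n => c * Num.sqrt (u n)) @ \oo --> 0.
Proof.
move=> h; rewrite -(mulr0 c); apply: cvgM; first exact: cvg_cst.
rewrite -sqrtr0; apply: (cvg_comp u Num.sqrt h); exact: sqrt_continuous.
Qed.

Lemma cvg_CintM d (T : measurableType d) (m : {measure set T -> \bar R})
    (f h : T -> R[i]) (fn : nat -> T -> R[i]) :
  L2 m f -> (forall n, L2 m (fn n)) -> L2 m h ->
  (fun n => fine (N2 m (fun x => f x - fn n x))) @ \oo --> 0 ->
  (fun n => normc (Cint m (fun x => fn n x * h x) - Cint m (fun x => f x * h x))) @ \oo --> 0.
Proof.
move=> lf lfn lh c.
have b := cvg_sqrt0 (Num.sqrt (fine (N2 m h))) c.
apply: (squeeze_cvgr _ (cvg_cst 0) b); apply: nearW => n.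
rewrite normc_ge0 andTb normc_subC -CintB; [|exact: cintbleM..].
rewrite mulrC; apply: le_trans (normc_CintM (L2B lf (lfn n)) lh).
by rewrite le_eqVlt; apply/orP; left; apply/eqP; congr normc; apply: eq_Cint => x; rewrite mulrBl.
Qed.

Section test_function.
Variable phi : E -> R.
Hypothesis tphi : test phi.
Let phiC (x : E) : R[i] := (phi x)%:C%C.
Let hphi z := ftransform phiC z.

Lemma test_cintble : cintble mu phiC.
Proof. by case: tphi => _ _ _ i; exact: cintble_real. Qed.

Lemma test_L2 : L2 mu phiC.
Proof.
case: tphi => mphi [B hB] _ iphi; split; first exact: cmeas_real.
have i := integrableZl measurableT B (integrable_abse iphi).
have /integrableP[mi] := i; apply: le_lt_trans.
apply: ge0_le_integralT.
- by apply: measurable_sqr_normc; exact: cmeas_real.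
- exact: measurableT_comp.
- by move=> x; rewrite lee_fin sqr_ge0.
- move=> x /=; rewrite lee_fin normcR; apply: le_trans (ler_norm _).
  by rewrite expr2 ler_wpM2r.
Qed.

Lemma ftransform_testE (z : E) : hphi z = conjc (extension mu phiC id z).
Proof.
rewrite -ftransform_conj; last exact: test_cintble.
by apply: eq_Cint => x; rewrite /phiC; congr (_ * _); apply: complex_ext; rewrite /= ?oppr0.
Qed.

Lemma ftransform_test_L2 : L2 mu hphi.
Proof.
rewrite (_ : hphi = fun z => conjc (extension mu phiC id z)); last first.
  by apply/funext => z; exact: ftransform_testE.
apply: L2J; split.
  by apply: cmeas_extension; [exact: test_cintble|exact: measurable_id].
apply: (le_lt_trans (plancherel_le test_cintble test_L2)).
by apply: lte_mul_pinfty; rewrite ?lee_fin ?(ltW K_gt0)//; exact: test_L2.2.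
Qed.

Lemma ftransform_test_bounded : exists B, forall z, normc (hphi z) <= B.
Proof.
exists (Rintegral mu setT (fun w => normc (phiC w))) => z.
rewrite ftransform_testE normc_conj; apply: normc_extension; last exact: measurable_id.
exact: test_cintble.
Qed.

(** For the regularizations of F this is [fourier_pairing] with the identity map; both sides pass to
    the L^2 limit because the test function and its transform are square-integrable. *)
Lemma l2pair_pairing f F : l2pair f F ->
  Cint mu (fun z => f z * hphi z) = Cint mu (fun z => F z * phiC z).
Proof.
move=> [lf lF fF].
have K0 : K%:C%C != 0 :> R[i].
  by apply/eqP => -[/eqP]; rewrite gt_eqF// K_gt0.
apply: (mulfI K0).
have lh := ftransform_test_L2; have lp := test_L2.
pose a n := Cint mu (fun z => approxF n F z * hphi z).
have ih n := cintbleM (L2_approxF n lF) lh.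
have aE n : a n = K%:C%C * Cint mu (fun z => regularize n F z * phiC z).
  case: tphi => mphi [B hB] cphi iphi.
  apply: (fourier_pairing (X := id) (cintble_regularize n lF) (@measurable_id _ _ _) mphi iphi hB cphi).
  exact: ih.
apply: (cvg_normc_unique (a := a)).
  have := cvg_CintM (L2Z K%:C%C lf) (fun n => L2_approxF n lF) lh fF.
  rewrite (_ : Cint _ (fun z => _ * f z * hphi z) = K%:C%C * Cint mu (fun z => f z * hphi z)); first exact.
  by rewrite -(CintZ _ (cintbleM lf lh)); apply: eq_Cint => x; rewrite mulrA.
have := cvg_CintM lF (fun n => L2_regularize n lF) lp (regularize_cvg lF).
move=> /(cvgM (cvg_cst K)); rewrite mulr0; apply: cvg_trans; apply: near_eq_cvg; apply: nearW => n.
by rewrite aE -mulrBr normcM normcR ger0_norm// ltW// K_gt0.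
Qed.

End test_function.

(** For square-integrable factors the integral converges at every point, and its modulus is bounded
    by the product of the two norms. *)
Definition fconv F G (zeta : E) : R[i] := Cint mu (fun x => F x * G (sub3 zeta x)).

Lemma cmeas_fconv F G : cmeas F -> cmeas G -> cmeas (fconv F G).
Proof.
move=> mF mG; apply: (cmeas_Cint_param mu (f := fun p : E * E => F p.2 * G (sub3 p.1 p.2))).
apply: cmeasM; first exact: cmeas_snd.
by apply: (cmeas_comp mG); exact: measurable_sub3.
Qed.

Lemma normc_fconv F G zeta : L2 mu F -> L2 mu G ->
  normc (fconv F G zeta) <= Num.sqrt (fine (N2 mu F)) * Num.sqrt (fine (N2 mu G)).
Proof.
move=> lF lG; have [lG' e] := L2_sub3 zeta lG.
by apply: (le_trans (normc_CintM lF lG')); rewrite e.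
Qed.

Lemma realcM (x y : R) : (x * y)%:C%C = x%:C%C * y%:C%C.
Proof. by apply: complex_ext => /=; ring. Qed.

Lemma realcB (x y : R) : (x - y)%:C%C = x%:C%C - y%:C%C.
Proof. by apply: complex_ext => /=; ring. Qed.

Lemma normcM_le_sqr (z w : R[i]) : normc (z * w) <= normc z ^+ 2 + normc w ^+ 2.
Proof.
rewrite normcM; move: (normc_ge0 z) (normc_ge0 w) => a b.
by have := sqr_ge0 (normc z - normc w); nra.
Qed.

Section product.
Variables (f F g G : E -> R[i]) (phi : E -> R).
Hypotheses (pf : l2pair f F) (pg : l2pair g G) (tphi : test phi).
Let lf := let: And3 a _ _ := pf in a.
Let lF := let: And3 _ a _ := pf in a.
Let lg := let: And3 a _ _ := pg in a.
Let lG := let: And3 _ a _ := pg in a.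
Let phiC (x : E) : R[i] := (phi x)%:C%C.
Let hphi z := ftransform phiC z.
Let S (p : E * E) := F p.1 * G (sub3 p.2 p.1) * phiC p.2.
Let P (p : E * E) := F p.1 * G p.2 * phiC (add3 p.1 p.2).

(** For fixed y the integral of |F(x) G(y - x)| is at most the sum of the squared norms of F and G,
    a bound independent of y, and the test function is integrable in y. *)
Lemma cintble_conv_test : cintble (prodm mu mu) S.
Proof.
have mphi : measurable_fun setT phi by case: tphi.
have mS : cmeas S.
  apply: cmeasM; last by apply: (cmeas_comp (cmeas_real mphi)); exact: measurable_snd.
  apply: cmeasM; first by apply: cmeas_fst; exact: lF.1.
  by apply: (cmeas_comp lG.1); exact: measurable_sub3.
pose B := fine (N2 mu F) + fine (N2 mu G).
have B0 : 0 <= B by rewrite addr_ge0 ?fine_ge0 ?N2_ge0.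
have iB : mu.-integrable setT (EFin \o (fun y => B * `|phi y|)).
  by case: tphi => _ _ _ /integrable_abse/(integrableZl measurableT B).
apply: (cintble_iterated mS iB).
move=> y; have [lG' e] := L2_sub3 y lG.
have c := normc_ge0 (phiC y).
have mx : measurable_fun setT (fun x => (normc (F x * G (sub3 y x)))%:E).
  by apply/measurable_EFinP; apply: measurable_normc; apply: cmeasM; [exact: lF.1|exact: lG'.1].
have -> : (\int[mu]_x (normc (S (x, y)))%:E = (normc (phiC y))%:E * \int[mu]_x (normc (F x * G (sub3 y x)))%:E)%E.
  rewrite -ge0_integralZl_EFin//; last by move=> x _; rewrite lee_fin normc_ge0.
  by apply: eq_integral => x _; rewrite -EFinM mulrC -normcM.
rewrite -normcR mulrC EFinM lee_wpmul2l ?lee_fin//.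
rewrite /B EFinD !fineK ?N2_fin// -e /N2 -ge0_integralD//; last 4 first.
- by move=> x _; rewrite lee_fin sqr_ge0.
- by apply: measurable_sqr_normc; exact: lF.1.
- by move=> x _; rewrite lee_fin sqr_ge0.
- by apply: measurable_sqr_normc; exact: lG'.1.
apply: ge0_le_integralT => //.
- apply: emeasurable_funD; apply: measurable_sqr_normc; [exact: lF.1|exact: lG'.1].
- by move=> x; rewrite lee_fin normc_ge0.
- by move=> x; rewrite -EFinD lee_fin normcM_le_sqr.
Qed.

Lemma product_shear : P = fun p => S (p.1, add3 p.1 p.2).
Proof. by apply/funext => p; rewrite /P /S /= sub3_add3. Qed.

Lemma cintble_product_test : cintble (prodm mu mu) P.
Proof.
by rewrite product_shear; exact: (scales_cintble ler01 scales_shear cintble_conv_test).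
Qed.

Lemma Cint_product_test : Cint (prodm mu mu) P = Cint mu (fun zeta => fconv F G zeta * phiC zeta).
Proof.
rewrite product_shear (scales_Cint scales_shear cintble_conv_test) mul1r.
have ix y : cintble mu (fun x => F x * G (sub3 y x)).
  by apply: cintbleM => //; exact: (L2_sub3 y lG).1.
rewrite -(Cint_fubini2 cintble_conv_test) => [|y].
  by apply: eq_Cint => y; rewrite /S /fconv -CintZr.
rewrite /S /= (_ : (fun x => _) = fun x => phiC y * (F x * G (sub3 y x))); first exact: cintbleZ.
by apply/funext => x; rewrite mulrC.
Qed.

(** A character at a sum is the product of the characters, so the Fourier integral over E * E along
    the sum map factors. *)
Lemma extension_product n z :
  extension (prodm mu mu) (fun p => regularize n F p.1 * regularize n G p.2)
    (fun p => add3 p.1 p.2) z = approxF n F z * approxF n G z.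
Proof.
have i H : L2 mu H -> cintble mu (fun w => regularize n H w * expi (dot3 z w)).
  move=> lH; apply: cintble_mul_expi; first exact: cintble_regularize.
  by apply: measurable_dot3; [exact: measurable_cst|exact: measurable_id].
have [_ <-] := Cint_prod_mul (i _ lF) (i _ lG).
by apply: eq_Cint => p; rewrite expi_add3; ring.
Qed.

Lemma product_cvg :
  (fun n => normc (Cint (prodm mu mu) (fun p => regularize n F p.1 * regularize n G p.2 *
     phiC (add3 p.1 p.2)) - Cint (prodm mu mu) P)) @ \oo --> 0.
Proof.
have iP := cintble_product_test; have mP := cintble_cmeas iP.
pose c n (p : E * E) := gauss3 (scale3 (epsn n) p.1) * gauss3 (scale3 (epsn n) p.2).
have mc n : measurable_fun setT (c n).
  apply: measurable_funM; first exact: (measurableT_comp (measurable_gauss3_scaled (epsn n)) measurable_fst).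
  exact: (measurableT_comp (measurable_gauss3_scaled (epsn n)) measurable_snd).
have c01 n p : 0 <= 1 - c n p <= 1.
  rewrite /c; have := gauss3_ge0 (scale3 (epsn n) p.1); have := gauss3_le1 (scale3 (epsn n) p.1).
  have := gauss3_ge0 (scale3 (epsn n) p.2); have := gauss3_le1 (scale3 (epsn n) p.2).
  by move: (gauss3 _) (gauss3 _) => u v h1 h2 h3 h4; apply/andP; split; nra.
have iD n : cintble (prodm mu mu) (fun p => P p * (1 - c n p)%:C%C).
  apply: (cintble_mul_bounded (B := 1) iP); first exact: measurable_funB.
  by move=> p; have /andP[h1 h2] := c01 n p; rewrite ger0_norm.
have iR n : cintble (prodm mu mu) (fun p => P p * (c n p)%:C%C).
  apply: (cintble_mul_bounded (B := 1) iP) => // p.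
  rewrite ger0_norm; last by rewrite mulr_ge0 ?gauss3_ge0.
  by have /andP[h1 _] := c01 n p; rewrite -subr_ge0.
have b : (fun n => fine (\int[prodm mu mu]_p (normc (P p) * (1 - c n p))%:E)%E) @ \oo --> 0.
  apply: (@dominated_cvg0 _ _ R (prodm mu mu) (fun n p => normc (P p) * (1 - c n p))
    (fun p => normc (P p))).
  - by move=> n; apply: measurable_funM; [exact: measurable_normc|exact: measurable_funB].
  - by move=> n p; have /andP[h1 h2] := c01 n p; rewrite mulr_ge0 ?normc_ge0.
  - exact: (integrable_normcP _ mP).1.
  - by move=> n p; have /andP[h1 h2] := c01 n p; rewrite ler_piMr ?normc_ge0.
  - apply: aeW => p; rewrite -[X in _ --> X](mulr0 (normc (P p))).
    apply: cvgM; first exact: cvg_cst.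
    rewrite -[X in _ --> X](subrr (1 : R)); apply: cvgB; first exact: cvg_cst.
    rewrite -[X in _ --> X](mulr1 (1 : R)); apply: cvgM; exact: cvg_gauss3_eps.
apply: (squeeze_cvgr _ (cvg_cst 0) b); apply: nearW => n.
rewrite normc_ge0 andTb normc_subC.
rewrite (_ : Cint _ (fun p => regularize n F p.1 * _ * _) = Cint (prodm mu mu) (fun p => P p * (c n p)%:C%C)); last first.
  apply: eq_Cint => p; rewrite /P /c /regularize.
  by rewrite realcM; ring.
rewrite -CintB//; apply: (@le_trans _ _ (normc (Cint (prodm mu mu) (fun p => P p * (1 - c n p)%:C%C)))).
  rewrite le_eqVlt; apply/orP; left; apply/eqP; congr normc; apply: eq_Cint => p.
  by rewrite realcB mulrBr mulr1.
apply: (le_trans (normc_Cint (iD n))); rewrite le_eqVlt; apply/orP; left; apply/eqP.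
by apply: eq_Rintegral => p _; have /andP[h1 h2] := c01 n p; rewrite normcM normcR ger0_norm.
Qed.

(** Convolution theorem, tested. By [extension_product] the product of the approximants is a Fourier
    integral along the sum map, so [fourier_pairing] applies to it. The approximants converge to K f
    and K g, which produces K^2 on the left, while inversion gives a single K on the right; one K is
    cancelled. *)
Lemma l2pair_product :
  K%:C%C * Cint mu (fun z => f z * g z * hphi z) =
  Cint mu (fun zeta => fconv F G zeta * phiC zeta).
Proof.
have [Bh hB] := ftransform_test_bounded tphi.
have mh : cmeas hphi := (ftransform_test_L2 tphi).1.
have K0 : K%:C%C != 0 :> R[i].
  by apply/eqP => -[/eqP]; rewrite gt_eqF// K_gt0.
apply: (mulfI K0).
have lMh H : L2 mu H -> L2 mu (fun z => H z * hphi z).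
  move=> lH; apply: (L2_le _ (L2Z Bh%:C%C lH)); first by apply: cmeasM => //; exact: lH.1.
  move=> z; rewrite !normcM normcR mulrC ler_wpM2r ?normc_ge0//.
  by apply: (le_trans (hB z)); exact: ler_norm.
have la n := L2_approxF n lF; have lb n := L2_approxF n lG.
pose a n := Cint mu (fun z => approxF n F z * approxF n G z * hphi z).
have ia n : cintble mu (fun z => approxF n F z * approxF n G z * hphi z).
  exact: (cintble_mul_cbounded (cintbleM (la n) (lb n)) mh hB).
have aE n : a n = K%:C%C * Cint (prodm mu mu) (fun p => regularize n F p.1 * regularize n G p.2 *
     phiC (add3 p.1 p.2)).
  case: tphi => mphi [B hB'] cphi iphi.
  have iH := (Cint_prod_mul (cintble_regularize n lF) (cintble_regularize n lG)).1.
  have mX : measurable_fun [set: E * E] (fun p : E * E => add3 p.1 p.2 : E).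
    exact: measurable_add3.
  have e : (fun z => extension (prodm mu mu) (fun p => regularize n F p.1 * regularize n G p.2)
    (fun p => add3 p.1 p.2) z * ftransform phiC z) = (fun z => approxF n F z * approxF n G z * hphi z).
    by apply/funext => z; rewrite extension_product.
  rewrite /a -e; apply: (fourier_pairing iH mX mphi iphi hB' cphi).
  by rewrite e.
apply: (cvg_normc_unique (a := a)); last first.
  have := product_cvg; rewrite Cint_product_test.
  move=> /(cvgM (cvg_cst K)); rewrite mulr0; apply: cvg_trans; apply: near_eq_cvg; apply: nearW => n.
  by rewrite aE -mulrBr normcM normcR ger0_norm// ltW// K_gt0.
have lKf := L2Z K%:C%C lf; have lKg := L2Z K%:C%C lg.
have h1 : (fun n => normc (Cint mu (fun z => approxF n F z * (K%:C%C * g z * hphi z)) -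
   Cint mu (fun z => K%:C%C * f z * (K%:C%C * g z * hphi z)))) @ \oo --> 0.
  by case: pf => _ _ fF; apply: (cvg_CintM lKf la (lMh _ lKg) fF).
(* Error from replacing K g by its approximant: by Cauchy-Schwarz it is multiplied by the norm of
   the approximant of f times the transformed test function, bounded uniformly in n through
   [plancherel_le]. *)
have h2 : (fun n => Num.sqrt (fine (N2 mu (fun z => K%:C%C * g z - approxF n G z))) *
    Num.sqrt (Bh ^+ 2 * (K * fine (N2 mu F)))) @ \oo --> 0.
  case: pg => _ _ /(cvg_sqrt0 (Num.sqrt (Bh ^+ 2 * (K * fine (N2 mu F))))).
  by apply: cvg_trans; apply: near_eq_cvg; apply: nearW => n; rewrite mulrC.
have h3 := cvgD h1 h2; move: (h3 ltac:(exact _)) => {}h3; rewrite addr0 in h3.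
apply: (squeeze_cvgr _ (cvg_cst 0) h3); apply: nearW => n; rewrite normc_ge0 andTb.
pose q := Cint mu (fun z => approxF n F z * (K%:C%C * g z * hphi z)).
have -> : K%:C%C * (K%:C%C * Cint mu (fun z => f z * g z * hphi z)) =
   Cint mu (fun z => K%:C%C * f z * (K%:C%C * g z * hphi z)).
  have i := cintble_mul_cbounded (cintbleM lf lg) mh hB.
  rewrite mulrA -CintZ//; apply: eq_Cint => z; ring.
rewrite -(subrK q (a n)) -addrA addrC; apply: (le_trans (normcD _ _)); rewrite lerD2l normc_subC.
rewrite /q /a -CintB//; last exact: (cintbleM (la n) (lMh _ lKg)).
rewrite (_ : Cint _ _ = Cint mu (fun z => (K%:C%C * g z - approxF n G z) * (approxF n F z * hphi z))); last first.
  by apply: eq_Cint => z; ring.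
apply: (le_trans (normc_CintM (L2B lKg (lb n)) (lMh _ (la n)))).
rewrite ler_wpM2l ?sqrtr_ge0// ler_wsqrtr//.
rewrite -lee_fin fineK; last by apply: N2_fin; exact: lMh.
apply: (@le_trans _ _ (N2 mu (fun z => Bh%:C%C * approxF n F z))).
  apply: le_N2; [exact: (lMh _ (la n)).1|exact: (L2Z Bh%:C%C (la n)).1|].
  move=> z; rewrite !normcM normcR mulrC ler_wpM2r ?normc_ge0//.
  by apply: (le_trans (hB z)); exact: ler_norm.
rewrite N2Z ?normcR ?real_normK ?num_real//; last exact: (la n).1.
rewrite (EFinM (Bh ^+ 2)) lee_wpmul2l ?lee_fin ?sqr_ge0//.
apply: (le_trans (plancherel_le (cintble_regularize n lF) (L2_regularize n lF))).
rewrite (EFinM K) lee_wpmul2l ?lee_fin ?(ltW K_gt0)// fineK ?N2_fin//.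
apply: le_N2; [exact: cmeas_regularize lF.1|exact: lF.1|].
move=> z; rewrite normcM normcR ger0_norm ?gauss3_ge0// ler_piMr ?normc_ge0//.
exact: gauss3_le1.
Qed.

End product.
End pairing.

(** * Uniqueness of Fourier transforms *)

Section zero_function.
Context d (T : measurableType d) {R : realType} (m : {measure set T -> \bar R}).
Implicit Types (h p : T -> R).

Lemma integrable_mul_bounded h p (B : R) : m.-integrable setT (EFin \o h) ->
  measurable_fun setT p -> (forall x, `|p x| <= B) ->
  m.-integrable setT (EFin \o (fun x => h x * p x)).
Proof.
move=> ih mp pB; have ci := cintble_mul_bounded (cintble_real ih) mp pB.
apply: eq_integrable (ci.1) => // x _ /=; congr EFin; ring.
Qed.

(** Orthogonality passes to bounded pointwise limits of test functions, by dominated convergence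
    against |h|. *)
Lemma Rintegral_lim0 h p (pn : nat -> T -> R) : m.-integrable setT (EFin \o h) ->
  (forall n, measurable_fun setT (pn n)) -> measurable_fun setT p ->
  (forall n x, 0 <= pn n x <= 1) -> (forall x, 0 <= p x <= 1) ->
  (forall x, pn ^~ x @ \oo --> p x) ->
  (forall n, Rintegral m setT (fun x => h x * pn n x) = 0) ->
  Rintegral m setT (fun x => h x * p x) = 0.
Proof.
move=> ih mpn mp pn1 p1 pnp i0.
have /measurable_int/measurable_EFinP mh := ih.
have b1 (q : R) : 0 <= q <= 1 -> `|q| <= 1 by move=> /andP[? ?]; rewrite ger0_norm.
have ip := integrable_mul_bounded ih mp (fun x => b1 _ (p1 x)).
have ipn n := integrable_mul_bounded ih (mpn n) (fun x => b1 _ (pn1 n x)).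
pose k n x := `|h x| * `|p x - pn n x|.
have c : (fun n => Rintegral m setT (k n)) @ \oo --> 0.
  apply: (dominated_cvg0 (g := fun x => `|h x|)).
  - by move=> n; apply: measurable_funM; apply: measurableT_comp => //; exact: measurable_funB.
  - by move=> n x; rewrite mulr_ge0.
  - exact: integrable_abse ih.
  - move=> n x; have /andP[? ?] := p1 x; have /andP[? ?] := pn1 n x.
    by rewrite ler_piMr// ler_norml; apply/andP; split; lra.
  - apply: aeW => x; rewrite -[X in _ --> X](mulr0 `|h x|); apply: cvgM; first exact: cvg_cst.
    rewrite -(normr0 R) -[X in `|X|](subrr (p x)); apply: cvg_norm; apply: cvgB => //; exact: cvg_cst.
apply/eqP; rewrite -normr_le0; apply/ler_addgt0Pl => e e0; rewrite addr0.
have /cvgrPdist_le/(_ _ e0)[n _ /(_ n (leqnn n))] := c.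
rewrite sub0r normrN; apply: le_trans.
have -> : Rintegral m setT (fun x => h x * p x) = Rintegral m setT (fun x => h x * p x - h x * pn n x).
  by rewrite RintegralB// i0 subr0.
have iD : m.-integrable setT (EFin \o (fun x => h x * p x - h x * pn n x)).
  by have := integrableB measurableT ip (ipn n); apply: eq_integrable.
apply: (le_trans (le_normr_Rintegral measurableT iD)).
apply: le_trans (ler_norm _); rewrite le_eqVlt; apply/orP; left; apply/eqP.
by apply: eq_Rintegral => x _; rewrite -mulrBr normrM.
Qed.

(** The sets over which [h] integrates to 0 form a Dynkin system: complements use the vanishing of
    the total integral, disjoint countable unions the integrability. Hence the integral over every
    measurable set vanishes. *)
Lemma zero_on_pi_system h (G : set (set T)) : m.-integrable setT (EFin \o h) ->
  measurable = <<s G >> -> setI_closed G ->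
  (\int[m]_x (h x)%:E = 0)%E ->
  (forall A, G A -> \int[m]_(x in A) (h x)%:E = 0)%E ->
  \forall x \ae m, h x = 0.
Proof.
move=> ih GE GI hT hG.
have hA A : measurable A -> (\int[m]_(x in A) (h x)%:E = 0)%E.
  rewrite {1}GE; apply: (dynkin_induction GE GI hT hG) => [B mB B0|F mF tF F0].
    have mh := measurable_int m ih.
    have := @integral_setU _ _ _ m B (~` B) (EFin \o h) mB (measurableC mB).
    rewrite setUv hT => /(_ mh); rewrite /= B0 add0e => ->//.
    by rewrite disj_set2E setICr.
  rewrite integral_bigcup//; last first.
    by apply: integrableS ih => //; exact: bigcupT_measurable.
  by apply: eseries0 => i _ _; exact: F0.
have := @integral_ae_eq _ T R m setT measurableT (cst 0%E) (EFin \o h) ih (measurable_cst _).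
have H A : A `<=` setT -> measurable A ->
   (\int[m]_(x in A) (EFin \o h) x = \int[m]_(x in A) (cst 0 x))%E.
  by move=> _ mA; rewrite integral0; exact: hA.
by move=> /(_ H); apply: filterS => x /(_ I) /= [].
Qed.

End zero_function.

(** * Test functions separate integrable functions *)

Section test_separation.
Context {R : realType}.
Local Notation E := (E3 R).
Local Notation mu := (mu3 R).

(** A continuous approximation of the indicator of t > 0: as t + |t| is twice the positive part, the
    quotient is 0 for t <= 0 and tends to 1 for t > 0. *)
Definition step (n : nat) (t : R) : R := (t + `|t|) / (t + `|t| + epsn n).

Lemma pos_part_ge0 (t : R) : 0 <= t + `|t|.
Proof. by rewrite -lerBlDl sub0r -normrN ler_norm. Qed.

Lemma step_01 n t : 0 <= step n t <= 1.
Proof.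
have := pos_part_ge0 t; have e := eps_gt0 n : 0 < epsn n :> R; move=> p0.
have q0 : 0 < t + `|t| + epsn n by rewrite ltr_wpDl.
by rewrite /step divr_ge0 ?(ltW q0)//= ler_pdivrMr// mul1r lerDl ltW.
Qed.

Lemma mulr01 (x y : R) : 0 <= x <= 1 -> 0 <= y <= 1 -> 0 <= x * y <= 1.
Proof. by move=> /andP[? ?] /andP[? ?]; rewrite mulr_ge0 ?mulr_ile1. Qed.

Lemma continuous_step n : continuous (step n).
Proof.
move=> t; have := pos_part_ge0 t; have e := eps_gt0 n : 0 < epsn n :> R; move=> p0.
have c : (fun t : R => t + `|t|) @ t --> t + `|t|.
  by apply: cvgD; [exact: cvg_id|exact: norm_continuous].
apply: cvgM => //; apply: cvgV; first by rewrite gt_eqF// ltr_wpDl.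
by apply: cvgD => //; exact: cvg_cst.
Qed.

Lemma step_cvg (t : R) : step ^~ t @ \oo --> ((0 < t)%R%:R : R).
Proof.
have [t0|t0] := ltP 0 t.
  have p0 : t + `|t| != 0 by rewrite gtr0_norm// gt_eqF// addr_gt0.
  rewrite -[X in _ --> X](@divff _ (t + `|t|))//; apply: cvgM; first exact: cvg_cst.
  rewrite -{2}[t + `|t|]addr0; apply: cvgV; first by rewrite addr0.
  by apply: cvgD; [exact: cvg_cst|exact: cvg_epsn].
rewrite (_ : step ^~ t = fun=> 0); first exact: cvg_cst.
by apply/funext => n; rewrite /step ler0_norm// subrr mul0r.
Qed.

Lemma continuous_coord : [/\ continuous (fun z : R * R * R => z.1.1),
  continuous (fun z : R * R * R => z.1.2) & continuous (fun z : R * R * R => z.2)].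
Proof.
split => -[[x y] t].
- by apply: (@continuous_comp _ _ _ (fst : R * R * R -> R * R) (fst : R * R -> R)); exact: cvg_fst.
- by apply: (@continuous_comp _ _ _ (fst : R * R * R -> R * R) (snd : R * R -> R)); [exact: cvg_fst|exact: cvg_snd].
- exact: cvg_snd.
Qed.

Lemma continuous_gauss3_scaled (e : R) : continuous (fun z : R * R * R => gauss3 (scale3 e z)).
Proof.
have [c1 c2 c3] := continuous_coord; move=> z; rewrite /gauss3 /scale3 /=.
have c (f : R * R * R -> R) : continuous f -> (fun z => gauss_fun (e * f z)) @ z --> gauss_fun (e * f z).
  by move=> cf; apply: (@continuous_comp _ _ _ f (fun x => gauss_fun (e * x)) z (cf z)); exact: continuous_gauss_scaled.
by apply: cvgM; [apply: cvgM|]; exact: c.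
Qed.

Definition soft_octant (a : R * R * R) n (z : R * R * R) : R :=
  step n (z.1.1 - a.1.1) * step n (z.1.2 - a.1.2) * step n (z.2 - a.2) *
  gauss3 (scale3 (epsn n) z).

(** Translated octants are stable under intersection, by taking the maximum of the corners
    coordinatewise, and their indicators are products of three one-dimensional steps. *)
Definition octant (a : R * R * R) : set E :=
  [set z | [&& 0 < z.1.1 - a.1.1, 0 < z.1.2 - a.1.2 & 0 < z.2 - a.2]].

Lemma measurable_step n d (T : measurableType d) (f : T -> R) a :
  measurable_fun setT f -> measurable_fun setT (fun t => step n (f t - a)).
Proof.
move=> mf; apply: (measurableT_comp (f := step n)); last exact: measurable_funB.
by apply: continuous_measurable_fun; exact: continuous_step.
Qed.

Lemma measurable_soft_octant a n : measurable_fun [set: E] (soft_octant a n).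
Proof.
have [m1 m2 m3] := measurable_coord (@measurable_id _ E setT).
apply: measurable_funM; last exact: measurable_gauss3_scaled.
by apply: measurable_funM; [apply: measurable_funM|]; exact: measurable_step.
Qed.

Lemma soft_octant_01 a n z : 0 <= soft_octant a n z <= 1.
Proof.
rewrite /soft_octant; apply: mulr01; last by rewrite gauss3_ge0 gauss3_le1.
by apply: mulr01; [apply: mulr01|]; exact: step_01.
Qed.

Lemma test_soft_octant a n : test (soft_octant a n).
Proof.
have [c1 c2 c3] := continuous_coord.
have m := measurable_soft_octant a n; split => //.
- by exists 1 => x; have /andP[h0 h1] := soft_octant_01 a n x; rewrite ger0_norm.
- move=> z.
  have c (f : R * R * R -> R) b : continuous f -> (fun z => step n (f z - b)) @ z --> step n (f z - b).
    move=> cf; apply: (continuous_comp (f := fun z => f z - b) (g := step n)).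
      by apply: cvgB; [exact: cf|exact: cvg_cst].
    exact: continuous_step.
  apply: cvgM; last exact: continuous_gauss3_scaled.
  by apply: cvgM; [apply: cvgM|]; exact: c.
- apply: (le_integrable measurableT _ _ (integrable_gauss3_scaled (@epsn_neq0 R n))); first exact/measurable_EFinP.
  move=> z _; have /andP[h0 h1] := soft_octant_01 a n z.
  rewrite /= lee_fin ger0_norm// (ger0_norm (gauss3_ge0 _)) /soft_octant.
  have /andP[p0 p1] : 0 <= step n (z.1.1 - a.1.1) * step n (z.1.2 - a.1.2) * step n (z.2 - a.2) <= 1.
    by apply: mulr01; [apply: mulr01|]; exact: step_01.
  by rewrite ler_piMl ?gauss3_ge0.
Qed.

Lemma test_gauss3 (e : R) : e != 0 -> test (fun z => gauss3 (scale3 e z)).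
Proof.
move=> e0; split.
- exact: measurable_gauss3_scaled.
- by exists 1 => z; rewrite ger0_norm ?gauss3_ge0 ?gauss3_le1.
- exact: continuous_gauss3_scaled.
- exact: integrable_gauss3_scaled.
Qed.

(** A half-space x_i > c is the countable union of the octants whose other two corner coordinates
    are -n. The coordinates are therefore measurable for the generated sigma-algebra, which thus
    contains the product one. *)
Lemma measurable_octants :
  measurable = <<s [set A | exists a, A = octant a] >> :> set (set E).
Proof.
set G := [set A | _]; rewrite eqEsubset; split => A.
  pose T := g_sigma_algebraType G.
  have mo a : measurable (octant a : set T) by apply: sub_sigma_algebra; exists a.
  have mc (p : T -> measurableTypeR R) (q : R -> nat -> R * R * R) :
      (forall x, p @^-1` `]x, +oo[ = \bigcup_n octant (q x n)) -> measurable_fun setT p.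
    move=> pq; apply: (@measurability _ _ _ _ setT p _ (RGenOInfty.measurableE R)) => _ [_ [x ->] <-].
    rewrite setTI; apply: (eq_ind_r measurable _ (pq x)).
    by apply: bigcupT_measurable => n; exact: mo.
  have nat3 (a b : R) : exists n : nat, (- n%:R < a) /\ (- n%:R < b).
    exists (Num.truncn (`|a| + `|b|)).+1.
    have h := truncnS_gt (`|a| + `|b|).
    have := ler_norm (- a); have := ler_norm (- b); rewrite !normrN.
    have := normr_ge0 a; have := normr_ge0 b; split; lra.
  have m1 : measurable_fun [set: T] (fun t : T => (t : E).1.1 : R).
    apply: (mc _ (fun x n => ((x, - n%:R), - n%:R))) => x.
    apply/seteqP; split => [[[u v] w]|[[u v] w]] /=.
      rewrite in_itv/= andbT => xu; have [n [h1 h2]] := nat3 v w.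
      by exists n => //; rewrite /octant /= !subr_gt0 xu h1.
    by move=> [n _]; rewrite /octant /= !subr_gt0 in_itv/= andbT => /and3P[].
  have m2 : measurable_fun [set: T] (fun t : T => (t : E).1.2 : R).
    apply: (mc _ (fun x n => ((- n%:R, x), - n%:R))) => x.
    apply/seteqP; split => [[[u v] w]|[[u v] w]] /=.
      rewrite in_itv/= andbT => xu; have [n [h1 h2]] := nat3 u w.
      by exists n => //; rewrite /octant /= !subr_gt0 xu h1.
    by move=> [n _]; rewrite /octant /= !subr_gt0 in_itv/= andbT => /and3P[].
  have m3 : measurable_fun [set: T] (fun t : T => (t : E).2 : R).
    apply: (mc _ (fun x n => ((- n%:R, - n%:R), x))) => x.
    apply/seteqP; split => [[[u v] w]|[[u v] w]] /=.
      rewrite in_itv/= andbT => xu; have [n [h1 h2]] := nat3 u v.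
      by exists n => //; rewrite /octant /= !subr_gt0 h1 h2 xu.
    by move=> [n _]; rewrite /octant /= !subr_gt0 in_itv/= andbT => /and3P[].
  have mid := measurable_triple m1 m2 m3.
  move=> mA; have := mid measurableT A mA; rewrite setTI.
  by congr (_ _); apply/seteqP; split => [[[u v] w]|[[u v] w]].
apply: smallest_sub; first exact: sigma_algebra_measurable.
move=> _ [a ->].
have [m1 m2 m3] := measurable_coord (@measurable_id _ E setT).
have mg (f : E -> R) b : measurable_fun setT f -> measurable [set z | 0 < f z - b].
  move=> mf; rewrite -[X in measurable X]setTI.
  apply: (@measurable_fun_ltr _ _ _ setT (cst 0) (fun z => f z - b)) => //.
  exact: measurable_funB.
rewrite (_ : octant a = [set z : E | 0 < z.1.1 - a.1.1] `&` ([set z : E | 0 < z.1.2 - a.1.2] `&`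
  [set z : E | 0 < z.2 - a.2])).
  by apply: measurableI; [exact: mg|apply: measurableI; exact: mg].
by apply/seteqP; split => z /=; [move=> /and3P[]|move=> [? [? ?]]; apply/and3P].
Qed.

(** The constant 1 and the indicators of octants are bounded pointwise limits of tests, so [h]
    integrates to 0 over the whole space and over a generating pi-system. *)
Lemma test_separates_real (h : E -> R) : mu.-integrable setT (EFin \o h) ->
  (forall phi, test phi -> Rintegral mu setT (fun z => h z * phi z) = 0) ->
  \forall z \ae mu, h z = 0.
Proof.
move=> ih h0.
have fin A : measurable A -> (\int[mu]_(x in A) (h x)%:E)%E \is a fin_num.
  by move=> mA; apply: integrable_fin_num => //; apply: integrableS ih.
apply: (zero_on_pi_system ih measurable_octants).
- move=> _ _ [a ->] [b ->].
  exists ((Num.max a.1.1 b.1.1, Num.max a.1.2 b.1.2), Num.max a.2 b.2).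
  apply/seteqP; split => z; rewrite /octant /= !subr_gt0 !gt_max.
    by move=> [/and3P[-> -> ->] /and3P[-> -> ->]].
  by move=> /and3P[/andP[-> ->] /andP[-> ->] /andP[-> ->]].
- have := @Rintegral_lim0 _ E R mu h (cst 1) (fun n z => gauss3 (scale3 (epsn n) z)) ih.
  rewrite /Rintegral => H; rewrite -[LHS]fineK ?fin//; congr EFin.
  rewrite -[RHS]H; first by congr fine; apply: eq_integral => x _; rewrite mulr1.
  + by move=> n; exact: measurable_gauss3_scaled.
  + exact: measurable_cst.
  + by move=> n z; rewrite gauss3_ge0 gauss3_le1.
  + by move=> z; rewrite ler01 lexx.
  + by move=> z; exact: cvg_gauss3_eps.
  + by move=> n; apply: h0; apply: test_gauss3; exact: epsn_neq0.
- move=> _ [a ->].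
  have mo : measurable (octant a) by rewrite measurable_octants; apply: sub_sigma_algebra; exists a.
  rewrite -[LHS]fineK ?fin//; congr EFin; rewrite -/(Rintegral _ _ _) Rintegral_mkcond.
  have := @Rintegral_lim0 _ E R mu h (\1_(octant a)) (soft_octant a) ih.
  move=> H; rewrite -[RHS]H.
  + by apply: eq_Rintegral => x _; rewrite patchE indicE; case: ifP; rewrite ?mulr1 ?mulr0.
  + exact: measurable_soft_octant.
  + exact: measurable_indic.
  + by move=> n z; exact: soft_octant_01.
  + by move=> z; rewrite indicE; case: (_ \in _); rewrite ?lexx ?ler01.
  + move=> z; rewrite indicE.
    have -> : (z \in octant a)%:R = (0 < z.1.1 - a.1.1)%R%:R * (0 < z.1.2 - a.1.2)%R%:R *
       (0 < z.2 - a.2)%R%:R * 1 :> R.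
      rewrite (_ : (z \in octant a) = [&& 0 < z.1.1 - a.1.1, 0 < z.1.2 - a.1.2 & 0 < z.2 - a.2]).
        by rewrite mulr1 -!natrM !mulnb andbA.
      by apply/idP/idP; rewrite inE.
    apply: cvgM; last exact: cvg_gauss3_eps.
    by apply: cvgM; [apply: cvgM|]; exact: step_cvg.
  + by move=> n; apply: h0; exact: test_soft_octant.
Qed.

Lemma test_separates (H : E -> R[i]) : cintble mu H ->
  (forall phi, test phi -> Cint mu (fun z => H z * (phi z)%:C%C) = 0) ->
  \forall z \ae mu, H z = 0.
Proof.
move=> [i1 i2] H0.
have r := test_separates_real i1; have i := test_separates_real i2.
have e (phi : E -> R) : Cint mu (fun z => H z * (phi z)%:C%C) =
  Complex (Rintegral mu setT (fun z => complex.Re (H z) * phi z))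
    (Rintegral mu setT (fun z => complex.Im (H z) * phi z)).
  apply: complex_ext; apply: eq_Rintegral => z _; case: (H z) => p q /=; ring.
have r0 : \forall z \ae mu, complex.Re (H z) = 0.
  by apply: r => phi tphi; have := H0 phi tphi; rewrite e => -[].
have i0 : \forall z \ae mu, complex.Im (H z) = 0.
  by apply: i => phi tphi; have := H0 phi tphi; rewrite e => -[].
by apply: filterS2 r0 i0 => z ? ?; exact: complex_ext.
Qed.

End test_separation.

(** * Differentials of Gaussians and of trigonometric functions *)

Section differential.
Context {R : realType}.
Local Notation V := (R * R * R)%type.
Implicit Types (f g : V -> R) (z v w y : V).

Definition has_diff z f (df : V -> R) := is_diff z f df.

Lemma has_diff_ext z f df dg : (forall v, df v = dg v) -> has_diff z f df -> has_diff z f dg.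
Proof. by move=> e; rewrite (_ : dg = df)//; apply/funext => v; rewrite e. Qed.

Lemma has_diff_differentiable z f df : has_diff z f df -> differentiable f z.
Proof. by move=> []. Qed.

Lemma has_diff_derive z f df v : has_diff z f df -> 'D_v f z = df v.
Proof. by move=> [d e]; rewrite deriveE// e. Qed.

Lemma has_diffD z f g df dg : has_diff z f df -> has_diff z g dg ->
  has_diff z (fun x => f x + g x) (fun v => df v + dg v).
Proof. by move=> ? ?; exact: is_diffD. Qed.

Lemma has_diffM z f g df dg : has_diff z f df -> has_diff z g dg ->
  has_diff z (fun x => f x * g x) (fun v => f z * dg v + g z * df v).
Proof. by move=> ? ?; exact: is_diffM. Qed.

Lemma has_diff_cst z (c : R) : has_diff z (fun=> c) (fun=> 0).
Proof. exact: is_diff_cst. Qed.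

Lemma has_diff_comp z f df (g : R -> R) (dg : R) :
  has_diff z f df -> is_derive (f z) (1 : R) g dg -> has_diff z (fun x => g (f x)) (fun v => df v * dg).
Proof.
move=> hf [d e]; have dd : differentiable g (f z) by apply/derivable1_diffP.
have hg : is_diff (f z) g (fun h : R => h * dg).
  by apply: DiffDef => //; rewrite diff1E// derive1E e.
exact: (is_diff_comp hf hg).
Qed.

Lemma continuous_dot3 w : continuous (fun z : V => dot3 z w).
Proof.
have [c1 c2 c3] := @continuous_coord R; move=> z.
have cM (f : V -> R) b : continuous f -> (fun z => f z * b) @ z --> f z * b.
  by move=> cf; apply: cvgM; [exact: cf|exact: cvg_cst].
by apply: cvgD; [apply: cvgD|]; exact: cM.
Qed.

Lemma has_diff_linear (f : {linear V -> R}) z : continuous f -> has_diff z f f.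
Proof.
move=> cf; apply: DiffDef; last by rewrite diff_lin.
exact: (@linear_differentiable R V R f z cf).
Qed.

Lemma has_diff_dot3 z w : has_diff z (fun x => dot3 x w) (fun v => dot3 v w).
Proof.
have hl : linear (fun x : V => dot3 x w).
  by move=> a x y; rewrite /dot3 /= /GRing.scale /=; ring.
pose lM := GRing.isLinear.Build _ _ _ _ _ hl.
pose f : {linear V -> R} := HB.pack (fun x : V => dot3 x w) lM.
have cf : continuous f by exact: continuous_dot3.
exact: (has_diff_linear z cf).
Qed.

End differential.

Section gaussian_family.
Context {R : realType}.
Local Notation V := (R * R * R)%type.
Implicit Types (f g : V -> R) (z v w y : V).

(* A class of Schwartz functions closed under directional derivatives. *)
Inductive gfam : (V -> R) -> Prop :=
| gfam_base y w th : gfam (fun z => gauss3 (sub3 z y) * cos (dot3 z w + th))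
| gfam_mul w c f : gfam f -> gfam (fun z => (dot3 z w + c) * f z)
| gfam_add f g : gfam f -> gfam g -> gfam (fun z => f z + g z).

Lemma gauss3_expR z : gauss3 z = expR (- dot3 z z).
Proof. by rewrite /gauss3 /gauss_fun -!expRD /dot3; congr expR; ring. Qed.

Lemma dot3_subself z y : dot3 (sub3 z y) (sub3 z y) =
  dot3 z ((1,0),0) * dot3 z ((1,0),0) + dot3 z ((0,1),0) * dot3 z ((0,1),0) +
  dot3 z ((0,0),1) * dot3 z ((0,0),1) + dot3 z (scale3 (- 2) y) + dot3 y y.
Proof. by rewrite /dot3 /sub3 /scale3 /=; ring. Qed.

Lemma has_diff_gauss3 z y : has_diff z (fun z => gauss3 (sub3 z y))
  (fun v => - 2 * dot3 v (sub3 z y) * gauss3 (sub3 z y)).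
Proof.
have e : (fun z => gauss3 (sub3 z y)) = (fun z => expR (- 1 * (dot3 z ((1,0),0) * dot3 z ((1,0),0) + dot3 z ((0,1),0) * dot3 z ((0,1),0) +
  dot3 z ((0,0),1) * dot3 z ((0,0),1) + dot3 z (scale3 (- 2) y) + dot3 y y))).
  by apply/funext => x; rewrite gauss3_expR dot3_subself mulN1r.
rewrite {1}e.
have L w := has_diff_dot3 z w.
have H := has_diffD (has_diffD (has_diffD (has_diffD (has_diffM (L ((1,0),0)) (L ((1,0),0)))
  (has_diffM (L ((0,1),0)) (L ((0,1),0)))) (has_diffM (L ((0,0),1)) (L ((0,0),1)))) (L (scale3 (- 2) y)))
  (has_diff_cst z (dot3 y y)).
have HH := has_diffM (has_diff_cst z (- 1)) H.
apply: has_diff_ext (has_diff_comp HH (is_derive_expR _)) => v.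
rewrite gauss3_expR dot3_subself !mulN1r.
move: (expR _) => q; rewrite /dot3 /sub3 /scale3 /=; ring.
Qed.

(** The derivative -sin is written as -cos with the phase lowered by pi/2. This is why [gfam_base]
    carries a phase: the family contains sines and is stable under differentiation. *)
Lemma has_diff_cos z w (th : R) : has_diff z (fun z => cos (dot3 z w + th))
  (fun v => - dot3 v w * cos (dot3 z w + (th - pi / 2))).
Proof.
have H := has_diffD (has_diff_dot3 z w) (has_diff_cst z th).
apply: has_diff_ext (has_diff_comp H (is_derive_cos _)) => v.
by rewrite addr0 addrA cosB cos_pihalf sin_pihalf mulr0 add0r mulr1 mulrN mulNr.
Qed.

Lemma gfam_scale c f : gfam f -> gfam (fun z => c * f z).
Proof.
move/(gfam_mul ((0,0),0) c); congr gfam; apply/funext => z.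
by rewrite /dot3 /= !mulr0 !add0r.
Qed.

Lemma gfam_diff f : gfam f -> (forall z, differentiable f z) /\ forall v, gfam (fun z => 'D_v f z).
Proof.
elim=> {f} [y w th|w c f gf [df Df]|f g gf [df Df] gg [dg Dg]].
- have H z := has_diffM (has_diff_gauss3 z y) (has_diff_cos z w th).
  split=> [z|v]; first exact: has_diff_differentiable (H z).
  rewrite (_ : (fun z => _) = fun z =>
     (- dot3 v w) * (gauss3 (sub3 z y) * cos (dot3 z w + (th - pi / 2))) +
     (dot3 z (scale3 (- 2) v) + 2 * dot3 v y) * (gauss3 (sub3 z y) * cos (dot3 z w + th))).
    by apply: gfam_add; [apply: gfam_scale; exact: gfam_base|apply: gfam_mul; exact: gfam_base].
  apply/funext => z; rewrite (has_diff_derive v (H z)).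
  move: (gauss3 _) (cos _) (cos _) => a b d; rewrite /dot3 /sub3 /scale3 /=; ring.
- have hf z : has_diff z f ('d f z) by exact: differentiableP.
  have H z := has_diffM (has_diffD (has_diff_dot3 z w) (has_diff_cst z c)) (hf z).
  split=> [z|v]; first exact: has_diff_differentiable (H z).
  rewrite (_ : (fun z => _) = fun z => (dot3 z w + c) * 'D_v f z + dot3 v w * f z).
    by apply: gfam_add; [exact: gfam_mul|exact: gfam_scale].
  by apply/funext => z; rewrite (has_diff_derive v (H z)) deriveE// addr0 [f z * _]mulrC.
- have hf z : has_diff z f ('d f z) by exact: differentiableP.
  have hg z : has_diff z g ('d g z) by exact: differentiableP.
  have H z := has_diffD (hf z) (hg z).
  split=> [z|v]; first exact: has_diff_differentiable (H z).
  rewrite (_ : (fun z => _) = fun z => 'D_v f z + 'D_v g z); first exact: gfam_add.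
  by apply/funext => z; rewrite (has_diff_derive v (H z)) !deriveE.
Qed.

(** Apply x / N <= exp (x / N) and raise to the power N. *)
Lemma exprn_le_expR (N : nat) (x : R) : 0 <= x -> x ^+ N <= N%:R ^+ N * expR x.
Proof.
move=> x0; case: N => [|N]; first by rewrite !expr0 mul1r; apply: le_trans (expR_ge1Dx x); rewrite lerDl.
have n0 : N.+1%:R != 0 :> R by rewrite pnatr_eq0.
have -> : expR x = expR (x / N.+1%:R) ^+ N.+1 by rewrite -expRM_natl mulrC divfK.
rewrite -exprMn lerXn2r ?nnegrE ?mulr_ge0 ?expR_ge0//.
rewrite mulrC -ler_pdivrMr ?ltr0n//; apply: le_trans (expR_ge1Dx _); by rewrite lerDr.
Qed.

Lemma norm3_ge z : [/\ `|z.1.1| <= `|z|, `|z.1.2| <= `|z| & `|z.2| <= `|z|].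
Proof.
by case: z => -[x y] t; rewrite !prod_normE /=; split; rewrite !le_max ?lexx ?orbT.
Qed.

Lemma norm3_le z : `|z| <= `|z.1.1| + `|z.1.2| + `|z.2|.
Proof.
case: z => -[x y] t; rewrite !prod_normE /= !ge_max.
have := normr_ge0 x; have := normr_ge0 y; have := normr_ge0 t.
by move=> *; apply/andP; split; [apply/andP; split|]; lra.
Qed.

Lemma dot3_le z w : `|dot3 z w| <= 3 * `|w| * `|z|.
Proof.
have [a1 a2 a3] := norm3_ge z; have [b1 b2 b3] := norm3_ge w.
rewrite /dot3; apply: (le_trans (ler_normD _ _)).
apply: (@le_trans _ _ (`|w| * `|z| + `|w| * `|z| + `|w| * `|z|)); last by rewrite le_eqVlt; apply/orP; left; apply/eqP; ring.
apply: lerD; last by rewrite normrM mulrC ler_pM.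
by apply: (le_trans (ler_normD _ _)); apply: lerD; rewrite normrM mulrC ler_pM.
Qed.

(** The power is dominated by N^N exp (1 + |z|), and in each coordinate |z_i| <= (z_i - y_i)^2 +
    |y_i| + 1, so that the Gaussian absorbs the exponential; the three extra units make the 3 in the
    constant. *)
Lemma gauss3_decay (N : nat) y : exists C : R, forall z, (1 + `|z|) ^+ N * gauss3 (sub3 z y) <= C.
Proof.
exists (N%:R ^+ N * expR (1 + `|y.1.1| + `|y.1.2| + `|y.2| + 3)) => z.
have h := norm3_le z; have z0 := normr_ge0 z.
have := @exprn_le_expR N (1 + `|z|) (ltac:(lra)) => hN.
have := ler_wpM2r (gauss3_ge0 (sub3 z y)) hN; move=> /le_trans; apply.
rewrite -mulrA ler_wpM2l ?exprn_ge0 ?ler0n// gauss3_expR -expRD ler_expR.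
have q (a b : R) : `|a| - (a - b) * (a - b) <= `|b| + 1.
  have := ler_normD (a - b) b; rewrite subrK => h1.
  have := sqr_ge0 (`|a - b| - 1); rewrite sqrrB expr1n mulr1 real_normK ?num_real// => h2.
  by have := normr_ge0 (a - b); nra.
have := q z.1.1 y.1.1; have := q z.1.2 y.1.2; have := q z.2 y.2.
by rewrite /dot3 /sub3 /=; lra.
Qed.

Lemma gfam_decay f : gfam f -> forall N : nat, exists C : R, forall z, (1 + `|z|) ^+ N * `|f z| <= C.
Proof.
have p0 N z : 0 <= (1 + `|z|) ^+ N :> R by rewrite exprn_ge0// addr_ge0.
elim=> {f} [y w th|w c f gf IH|f g gf IHf gg IHg] N.
- have [C hC] := gauss3_decay N y; exists C => z; apply: le_trans (hC z).
  rewrite ler_wpM2l// normrM ger0_norm ?gauss3_ge0// ler_piMr ?gauss3_ge0//.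
  by rewrite ler_norml cos_geN1 cos_le1.
- have [C hC] := IH N.+1; exists ((3 * `|w| + `|c|) * C) => z.
  have k0 : 0 <= 3 * `|w| + `|c| by rewrite addr_ge0// mulr_ge0.
  apply: (@le_trans _ _ ((3 * `|w| + `|c|) * ((1 + `|z|) ^+ N.+1 * `|f z|))); last exact: ler_wpM2l.
  rewrite normrM exprS.
  have : `|dot3 z w + c| <= (3 * `|w| + `|c|) * (1 + `|z|).
    have := ler_normD (dot3 z w) c; have := dot3_le z w.
    by have := normr_ge0 z; have := normr_ge0 w; have := normr_ge0 c; nra.
  have := p0 N z; have := normr_ge0 (f z).
  move: ((1 + `|z|) ^+ N) `|f z| `|dot3 _ _ + _| => a b d b0 a0 hd.
  have := ler_wpM2l (mulr_ge0 a0 b0) hd.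
  by move: (3 * `|w| + `|c|) (1 + `|z|) => p q; rewrite -!mulrA => h; lra.
- have [C hC] := IHf N; have [D hD] := IHg N; exists (C + D) => z.
  have := lerD (hC z) (hD z); apply: le_trans.
  by rewrite -mulrDr ler_wpM2l// ler_normD.
Qed.

Lemma gfam_schwartz f : gfam f -> schwartz f.
Proof.
move=> gf vs.
have gd : gfam (iter_derive vs f) by elim: vs => //= v vs IH; exact: (gfam_diff IH).2.
by split; [exact: (gfam_diff gd).1|exact: gfam_decay].
Qed.

End gaussian_family.

(** * Schwartz functions and tempered functions *)

Section test_schwartz.
Context {R : realType}.
Local Notation E := (E3 R).
Local Notation mu := (mu3 R).
Local Notation K := ((2 * pi) ^+ 3 : R).
Implicit Types (f g F G : E -> R[i]) (phi : E -> R).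

Lemma measurable_near_coord (f : E -> R) a e : measurable_fun setT f ->
  measurable [set z | `|f z - a| < e].
Proof.
move=> mf; rewrite -[X in measurable X]setTI.
apply: (@measurable_fun_ltr _ _ _ setT (fun z => `|f z - a|) (cst e)) => //.
by apply: measurableT_comp => //; exact: measurable_funB.
Qed.

(** The space has both a topology, from the sup norm, and a product sigma-algebra. An open set is
    the union of the countably many boxes with rational centre and radius 1/(n+1) that it contains;
    this links the two structures. *)
Lemma open_measurable3 (U : set (R * R * R)) : open U -> measurable (U : set E).
Proof.
move=> oU.
have [m1 m2 m3] := measurable_coord (@measurable_id _ E setT).
pose box (q : rat * rat * rat) (n : nat) : set E :=
  [set z | `|z.1.1 - ratr q.1.1| < epsn n] `&` ([set z | `|z.1.2 - ratr q.1.2| < epsn n] `&`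
  [set z | `|z.2 - ratr q.2| < epsn n]).
have mbox q n : measurable (box q n).
  apply: measurableI; first exact: (measurable_near_coord _ _ m1).
  by apply: measurableI; [exact: (measurable_near_coord _ _ m2)|exact: (measurable_near_coord _ _ m3)].
rewrite (_ : (U : set E) = \bigcup_(p : (rat * rat * rat) * nat)
    (if `[< box p.1 p.2 `<=` U >] then box p.1 p.2 else set0)).
  apply: countable_bigcupT_measurable; first exact: countableP.
  by move=> p; case: ifP.
apply/seteqP; split => [z Uz|z [p _]]; last by case: asboolP => // h; exact: h.
have /nbhs_ballP[e /= e0 he] : nbhs z U by exact: open_nbhs_nbhs.
have [n hn] : exists n, 2 * epsn n < e.
  have h : (fun n => 2 * epsn n) @ \oo --> (0 : R).
    by rewrite -[X in _ --> X](mulr0 2); apply: cvgM; [exact: cvg_cst|exact: cvg_epsn].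
  have /cvgrPdist_lt/(_ _ e0)[n _ /(_ n (leqnn n))] := h.
  by rewrite sub0r normrN => h1; exists n; exact: le_lt_trans (ler_norm _) h1.
have n0 : 0 < epsn n :> R by exact: eps_gt0.
have approx_rat (x : R) : exists q : rat, `|x - ratr q| < epsn n.
  have /rat_in_itvoo[q] : x - epsn n < x + epsn n by lra.
  rewrite in_itv/= => /andP[h1 h2]; exists q; rewrite ltr_norml; apply/andP; split; lra.
have [q1 h1] := approx_rat z.1.1; have [q2 h2] := approx_rat z.1.2; have [q3 h3] := approx_rat z.2.
exists (((q1, q2), q3), n) => //=; case: asboolP => [//|[]] y [/= y1 [y2 y3]]; apply: he.
rewrite -ball_normE /ball_ /=.
have t (a b q : R) : `|a - q| < epsn n -> `|b - q| < epsn n -> `|a - b| < e.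
  rewrite !ltr_norml => /andP[? ?] /andP[? ?]; apply/andP; split; lra.
case: z h1 h2 h3 {Uz} => -[z1 z2] z3 /= h1 h2 h3.
case: y y1 y2 y3 => -[w1 w2] w3 /= y1 y2 y3.
by rewrite !prod_normE /= !gt_max (t _ _ _ h1 y1) (t _ _ _ h2 y2) (t _ _ _ h3 y3).
Qed.

Lemma continuous_measurable3 phi : continuous (phi : R * R * R -> R) -> measurable_fun [set: E] phi.
Proof.
move=> cphi; apply: (@measurability _ _ _ (measurableTypeR R) setT phi _ (RGenOInfty.measurableE R)) => _ [_ [x ->] <-].
rewrite setTI; apply: open_measurable3.
have -> : phi @^-1` `]x, +oo[ = phi @^-1` [set y | x < y].
  by apply/seteqP; split => z /=; rewrite in_itv/= andbT.
by apply: open_comp; [move=> z _; exact: cphi|exact: open_gt].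
Qed.

(** Split by reflection. The origin is counted twice, which an inequality tolerates. *)
Lemma even_integral (h : R -> R) : measurable_fun [set: mR R] h -> (forall x, 0 <= h x) ->
  (forall x, h (- x) = h x) ->
  (\int[lam R]_x (h x)%:E <= 2%:E * \int[lam R]_(x in `[0%R, +oo[) (h x)%:E)%E.
Proof.
move=> mh h0 he.
pose k (x : R) := h x * \1_(`[0%R, +oo[%classic) x.
have mI : measurable_fun [set: mR R] (\1_(`[0%R, +oo[%classic) : R -> R) by exact: measurable_indic.
have mk : measurable_fun [set: mR R] (fun x => (k x)%:E).
  by apply/measurable_EFinP; exact: measurable_funM.
have k0 x : (0 <= (k x)%:E)%E by rewrite lee_fin mulr_ge0// indicE.
have n1 : (-1 : R) != 0 by rewrite oppr_eq0.
have [mt s] := @scales_lam R (-1) 0 n1.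
have ek : (\int[lam R]_(x in `[0%R, +oo[) (h x)%:E = \int[lam R]_x (k x)%:E)%E.
  rewrite integral_mkcond; apply: eq_integral => x _.
  by rewrite patchE /k indicE; case: ifP; rewrite ?mulr1 ?mulr0.
have ek' : (\int[lam R]_x (k (-1 * x + 0))%:E = \int[lam R]_x (k x)%:E)%E.
  by rewrite (s (fun x => (k x)%:E))// normrN1 invr1 mul1e.
rewrite ek -[2%:E]/((1 + 1)%:E) EFinD ge0_muleDl ?lee_fin// !mul1e -{2}ek' -ge0_integralD//; last exact: (measurableT_comp mk mt).
apply: ge0_le_integralT => //.
- by apply/measurable_EFinP.
- by apply: emeasurable_funD => //; exact: (measurableT_comp mk mt).
move=> x; rewrite -EFinD lee_fin /k !indicE mulN1r addr0 he -mulrDr.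
have [x0|x0] := leP 0 x.
  by rewrite mem_set ?in_itv/= ?in_itv/= ?x0// ler_peMr// lerDl.
rewrite [X in _ + X](_ : _ = 1) ?ler_peMr ?lerDr//.
by rewrite mem_set// /= in_itv/= andbT oppr_ge0 ltW.
Qed.

Lemma integrable_oneDsqrV : (lam R).-integrable setT (EFin \o (fun x => (oneDsqr x)^-1)).
Proof.
have c : continuous (fun x : R => (oneDsqr x)^-1) by exact: continuous_oneDsqrV.
have mc := continuous_measurable_fun c.
have p x : 0 <= (oneDsqr x)^-1 :> R by rewrite invr_ge0 addr_ge0// sqr_ge0.
apply/integrableP; split; first exact/measurable_EFinP.
under eq_integral => x _ do rewrite gee0_abs ?lee_fin//.
apply: le_lt_trans (even_integral mc p _) _; first by move=> x; rewrite /oneDsqr sqrrN.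
by rewrite integral0y_oneDsqr -EFinM ltry.
Qed.

Lemma continuous_decay n : continuous (fun z : R * R * R => ((1 + `|z|) ^+ n)^-1).
Proof.
move=> z; apply: cvgV; first by rewrite gt_eqF// exprn_gt0// ltr_pwDl.
apply: (@continuous_comp _ _ _ (fun z : R * R * R => 1 + `|z|) (fun x : R => x ^+ n)).
  by apply: cvgD; [exact: cvg_cst|exact: norm_continuous].
exact: exprn_continuous.
Qed.

Lemma measurable_decay n : measurable_fun [set: E] (fun z => ((1 + `|z : R * R * R|) ^+ n)^-1).
Proof. by apply: continuous_measurable3 => z; exact: continuous_decay. Qed.

(** The exponent 6 is two per coordinate: the sup norm dominates each coordinate, so the function is
    at most a product of three factors 1 / (1 + x^2). *)
Lemma integrable_decay6 : mu.-integrable setT (fun z => (((1 + `|z|) ^+ 6)^-1)%:E).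
Proof.
pose w x : R[i] := ((oneDsqr x)^-1)%:C%C.
have iw := cintble_real integrable_oneDsqrV.
have [[i3 _] _] := Cint_prod_mul (Cint_prod_mul iw iw).1 iw.
have mn := measurable_decay 6.
apply: (le_integrable measurableT _ _ i3); first exact/measurable_EFinP.
move=> z _ /=; rewrite lee_fin.
have [h1 h2 h3] := norm3_ge z.
have p x : 0 <= (oneDsqr x)^-1 :> R by rewrite invr_ge0 addr_ge0// sqr_ge0.
have q : 0 < 1 + `|z| by rewrite ltr_pwDl.
rewrite ger0_norm; last by rewrite invr_ge0 exprn_ge0// ltW.
rewrite !(mul0r, mulr0, subr0) ger0_norm ?mulr_ge0//.
have l (x : R) : `|x| <= `|z| -> (1 + `|z|) ^- 2 <= (oneDsqr x)^-1.
  move=> xz; rewrite lef_pV2 ?posrE ?exprn_gt0 ?(lt_le_trans ltr01 (oneDsqr_ge1 _))//.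
  rewrite /oneDsqr -real_normK ?num_real//.
  by have := normr_ge0 x; nra.
have -> : ((1 + `|z|) ^+ 6)^-1 = (1 + `|z|) ^- 2 * (1 + `|z|) ^- 2 * (1 + `|z|) ^- 2.
  by rewrite -!invfM -!exprD.
have e0 : 0 <= (1 + `|z|) ^- 2 by rewrite invr_ge0 exprn_ge0// ltW.
by apply: ler_pM; rewrite ?mulr_ge0 ?l//; apply: ler_pM; rewrite ?l.
Qed.

Lemma schwartz_decay phi N : schwartz phi ->
  exists C : R, forall z, (1 + `|z|) ^+ N * `|phi z| <= C.
Proof. by move=> /(_ [::])[_]; exact. Qed.

Lemma continuous_schwartz phi : schwartz phi -> continuous (phi : R * R * R -> R).
Proof. by move=> /(_ [::])[d _] z; apply: differentiable_continuous; exact: d. Qed.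

Lemma test_schwartz phi : schwartz phi -> test phi.
Proof.
move=> sphi; have cphi := continuous_schwartz sphi; have mphi := continuous_measurable3 cphi.
split=> //.
- have [C hC] := schwartz_decay 0 sphi; exists C => z.
  by have := hC z; rewrite expr0 mul1r.
- have [C hC] := schwartz_decay 6 sphi.
  have := integrableZl measurableT C integrable_decay6.
  apply: le_integrable => //; first exact/measurable_EFinP.
  move=> z _ /=; rewrite lee_fin; apply: le_trans (ler_norm _).
  by rewrite ler_pdivlMr ?exprn_gt0 ?ltr_pwDl// mulrC.
Qed.

Lemma fourier_testE phi z : schwartz phi ->
  fourier_test phi z = ftransform (fun x => (phi x)%:C%C) z.
Proof.
move=> sphi; have [m [B hB] _ iphi] := test_schwartz sphi.
have mcos : measurable_fun [set: E] (fun x : E => sin (dot3 x z)).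
  apply: measurableT_comp; last by apply: measurable_dot3; [exact: measurable_id|exact: measurable_cst].
  by apply: continuous_measurable_fun; exact: continuous_sin.
apply: complex_ext => /=.
  by apply: eq_Rintegral => x _ /=; rewrite cosN dot3C; ring.
have i : mu.-integrable setT (EFin \o (fun x => phi x * sin (dot3 x z))).
  apply: (integrable_mul_bounded (B := 1) iphi mcos) => x.
  by rewrite ler_norml sin_geN1 sin_le1.
rewrite -[LHS]mulN1r.
transitivity (-1 * Rintegral mu setT (fun x => phi x * sin (dot3 x z))).
  by congr (_ * _); apply: eq_Rintegral => x _; rewrite [LHS]mulrC.
rewrite -RintegralZl//; apply: eq_Rintegral => x _ /=; rewrite sinN dot3C; ring.
Qed.

Lemma tempered_L2 f : L2 mu f -> tempered f.
Proof.
move=> lf; split; first exact: lf.1.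
(* Half of 6: |f| (1 + |z|)^-3 <= |f|^2 + (1 + |z|)^-6, and both terms are integrable. *)
exists 3; have i := integrableD measurableT (L2_integrable lf) integrable_decay6.
have mn := measurable_normc lf.1.
have md := measurable_decay 3.
apply: le_integrable i => //; first by apply/measurable_EFinP; exact: measurable_funM.
move=> z _ /=; rewrite lee_fin.
have -> : ((1 + `|z|) ^+ 6)^-1 = ((1 + `|z|) ^- 3) ^+ 2 by rewrite exprVn -exprM.
have q : 0 <= (1 + `|z|) ^- 3 by rewrite invr_ge0 exprn_ge0// addr_ge0.
have n0 := normc_ge0 (f z).
move: (normc (f z)) ((1 + `|z|) ^- 3) n0 q => a b a0 b0.
by rewrite !ger0_norm ?addr_ge0 ?mulr_ge0 ?sqr_ge0//; have := sqr_ge0 (a - b); nra.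
Qed.

Lemma tempered_cintble f : cintble mu f -> tempered f.
Proof.
move=> fi; have mf := cintble_cmeas fi; split => //; exists 0%N.
by have := (integrable_normcP _ mf).1 fi; apply: eq_integrable => // x _; rewrite expr0 divr1.
Qed.

Lemma tempered_bounded f B : cmeas f -> (forall z, normc (f z) <= B) -> tempered f.
Proof.
move=> mf fB; split => //; exists 6.
have := cintble_mul_cbounded (cintble_real integrable_decay6) mf fB.
move=> i; have := (integrable_normcP _ (cintble_cmeas i)).1 i; apply: eq_integrable => // z _.
rewrite normcM normcR mulrC ger0_norm// invr_ge0 exprn_ge0// addr_ge0//.
Qed.

Lemma cintble_tempered f (h : E -> R[i]) : tempered f -> cmeas h ->
  (forall N, exists C : R, forall z, (1 + `|z|) ^+ N * normc (h z) <= C) ->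
  cintble mu (fun z => f z * h z).
Proof.
move=> [mf [N iN]] mh hd; have [C hC] := hd N.
have := integrableZl measurableT C iN; move/cintble_le; apply; first exact: cmeasM.
move=> z /=; have p : 0 < (1 + `|z|) ^+ N by rewrite exprn_gt0// ltr_pwDl.
rewrite normcM mulrA ler_pdivlMr// [C * _]mulrC -mulrA ler_wpM2l ?normc_ge0// mulrC.
exact: hC.
Qed.

End test_schwartz.

(** * Distributional Fourier transforms: products, uniqueness, conjugation *)

Section is_fourier.
Context {R : realType}.
Local Notation E := (E3 R).
Local Notation mu := (mu3 R).
Local Notation K := ((2 * pi) ^+ 3 : R).
Implicit Types (f g F G : E -> R[i]) (phi : E -> R).

Lemma real_complex_neq0 (x : R) : x != 0 -> x%:C%C != 0 :> R[i].
Proof. by move=> x0; apply/eqP => -[/eqP]; exact/negP. Qed.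

Lemma K_neq0 : K%:C%C != 0 :> R[i].
Proof. by apply: real_complex_neq0; rewrite gt_eqF// K_gt0. Qed.

Lemma cintegralE f : cintegral f = Cint mu f.
Proof. reflexivity. Qed.

Lemma is_fourierP f F : is_fourier f F <-> [/\ tempered f, tempered F &
  forall phi, schwartz phi ->
    Cint mu (fun z => f z * ftransform (fun x => (phi x)%:C%C) z) = Cint mu (fun z => F z * (phi z)%:C%C)].
Proof.
have e phi : schwartz phi -> (fun z => f z * fourier_test phi z) = (fun z => f z * ftransform (fun x => (phi x)%:C%C) z).
  by move=> sphi; apply/funext => z; rewrite fourier_testE.
split=> -[tf tF h]; split; [exact tf|exact tF| |exact tf|exact tF|] => phi sphi;
  move: (h phi sphi); rewrite !cintegralE (e _ sphi) => h'; exact h'.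
Qed.

Lemma l2pair_is_fourier f F : l2pair f F -> is_fourier f F.
Proof.
move=> p; have [lf lF _] := p; apply/is_fourierP; split; [exact: tempered_L2..|].
by move=> phi /test_schwartz tphi; exact: l2pair_pairing.
Qed.

(** The two sides are tempered for different reasons: a product of L^2 functions is integrable,
    while their convolution is merely bounded. *)
Lemma is_fourier_product f F g G : l2pair f F -> l2pair g G ->
  is_fourier (fun z => f z * g z) (fun zeta => (K^-1)%:C%C * fconv F G zeta).
Proof.
move=> pf pg; have [lf lF _] := pf; have [lg lG _] := pg; apply/is_fourierP; split.
- by apply: tempered_cintble; exact: cintbleM.
- apply: (tempered_bounded (B := K^-1 * (Num.sqrt (fine (N2 mu F)) * Num.sqrt (fine (N2 mu G))))).
    by apply: (cmeasM (f := cst _)); [exact: cmeas_cst|apply: cmeas_fconv; [exact: lF.1|exact: lG.1]].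
  have K0 : 0 <= K^-1 by rewrite invr_ge0 ltW// K_gt0.
  by move=> z; rewrite normcM normcR ger0_norm// ler_wpM2l// normc_fconv.
- move=> phi /test_schwartz tphi; apply: (mulfI K_neq0).
  rewrite (l2pair_product pf pg tphi).
  have tc : tempered (fconv F G).
    by apply: tempered_bounded; [apply: cmeas_fconv; [exact: lF.1|exact: lG.1]|move=> z; exact: normc_fconv].
  have K0 : K != 0 by rewrite gt_eqF// K_gt0.
  rewrite -(CintZ (K%:C%C)); last first.
    have [mphi [B hB] _ iphi] := tphi.
    have mc : cmeas (fun z => (K^-1)%:C%C * fconv F G z).
      by apply: (cmeasM (f := cst _)); [exact: cmeas_cst|apply: cmeas_fconv; [exact: lF.1|exact: lG.1]].
    rewrite (_ : (fun z => _) = fun z => (phi z)%:C%C * ((K^-1)%:C%C * fconv F G z)); last first.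
      by apply/funext => z; rewrite mulrC.
    apply: (cintble_mul_cbounded (cintble_real iphi) mc
      (B := K^-1 * (Num.sqrt (fine (N2 mu F)) * Num.sqrt (fine (N2 mu G))))) => z.
    have Ki : 0 <= K^-1 by rewrite invr_ge0 ltW// K_gt0.
    by rewrite normcM normcR ger0_norm// ler_wpM2l// normc_fconv.
  by apply: eq_Cint => z; rewrite !mulrA -realcM divff// mul1r.
Qed.

Lemma cintble_tempered_schwartz F phi : tempered F -> schwartz phi ->
  cintble mu (fun z => F z * (phi z)%:C%C).
Proof.
move=> tF sphi; have [m _ _ _] := test_schwartz sphi.
apply: cintble_tempered => //; first exact: cmeas_real.
move=> N; have [C hC] := schwartz_decay N sphi; exists C => z.
by rewrite normcR.
Qed.

Lemma temperedB f g : tempered f -> tempered g -> tempered (fun z => f z - g z).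
Proof.
move=> [mf [N iN]] [mg [M iM]]; split; first exact: cmeasB.
exists (maxn N M).
have i := integrableD measurableT iN iM.
have m := measurable_normc (cmeasB mf mg).
have md := @measurable_decay R (maxn N M).
apply: le_integrable i => //; first by apply/measurable_EFinP; exact: measurable_funM.
move=> z _; rewrite /= lee_fin.
have z1 : 1 <= 1 + `|z| by rewrite lerDl.
have p n : 0 < (1 + `|z|) ^+ n by rewrite exprn_gt0// (lt_le_trans ltr01).
have n0 h : 0 <= normc (h z : R[i]) by exact: normc_ge0.
have l n : (n <= maxn N M)%N -> ((1 + `|z|) ^+ maxn N M)^-1 <= ((1 + `|z|) ^+ n)^-1.
  by move=> nm; rewrite lef_pV2 ?posrE ?p// ler_weXn2l.
rewrite ger0_norm; last exact: (divr_ge0 (normc_ge0 _) (ltW (p _))).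
rewrite ger0_norm; last exact: (addr_ge0 (divr_ge0 (normc_ge0 _) (ltW (p _))) (divr_ge0 (normc_ge0 _) (ltW (p _)))).
apply: (@le_trans _ _ ((normc (f z) + normc (g z)) / (1 + `|z|) ^+ maxn N M)).
  rewrite ler_wpM2r ?invr_ge0 ?(ltW (p _))//.
  by apply: (le_trans (normcD _ _)); rewrite normcN.
by rewrite mulrDl lerD// ler_wpM2l ?n0 ?l ?leq_maxl ?leq_maxr.
Qed.

(** By [fourier_pairing] a vanishing Fourier integral makes [W] orthogonal to every test. *)
Lemma extension_eq0 (W : E -> R[i]) : cintble mu W ->
  (forall z, extension mu W id z = 0) -> \forall z \ae mu, W z = 0.
Proof.
move=> iW W0; apply: test_separates => // phi [mphi [B hB] cphi iphi].
have e : (fun z => extension mu W id z * ftransform (fun x => (phi x)%:C%C) z) = fun=> 0.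
  by apply/funext => z; rewrite W0 mul0r.
have c0 : cintble mu (fun=> 0 : R[i]).
  by apply: (cintble_le (g := fun=> 0)); [exact: cmeas_cst|exact: integrable0|move=> z; rewrite normc0].
have := fourier_pairing iW (@measurable_id _ _ _) mphi iphi hB cphi.
rewrite e => /(_ c0) /eqP.
rewrite (_ : Cint mu (fun=> 0) = 0); last first.
  by apply: complex_ext; rewrite /= /Rintegral integral0.
by rewrite eq_sym mulf_eq0 (negbTE K_neq0) => /eqP.
Qed.

Lemma ae_mul_eq0 f (h : E -> R[i]) : (forall z, h z != 0) ->
  (\forall z \ae mu, f z * h z = 0) -> \forall z \ae mu, f z = 0.
Proof.
move=> h0; apply: filterS => z /eqP; rewrite mulf_eq0 (negbTE (h0 z)) orbF => /eqP.
exact.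
Qed.

Lemma gauss3_gt0 (z : R * R * R) : 0 < gauss3 z.
Proof. by rewrite gauss3_expR expR_gt0. Qed.

Lemma schwartz_gauss_cos w th : schwartz (fun z : R * R * R => gauss3 z * cos (dot3 z w + th)).
Proof.
have := gfam_schwartz (gfam_base (((0 : R), 0), 0) w th); congr schwartz; apply/funext => z.
by congr (gauss3 _ * _); case: z => -[a b] c; rewrite /sub3 /= !subr0.
Qed.

Lemma schwartz_gauss_translate w : schwartz (fun z : R * R * R => gauss3 (sub3 z w)).
Proof.
have := gfam_schwartz (gfam_base w (((0 : R), 0), 0) 0); congr schwartz; apply/funext => z.
by rewrite /dot3 /= !mulr0 !addr0 cos0 mulr1.
Qed.

(** The difference F1 - F2 need not be integrable, but its product with a Gaussian is. The Fourier
    integral of this product at z tests F1 - F2 against Gaussians times cosine and sine, which are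
    Schwartz, so it vanishes; and a Gaussian has no zeros. *)
Lemma fourier_unique f F1 F2 : is_fourier f F1 -> is_fourier f F2 ->
  \forall z \ae mu, F1 z = F2 z.
Proof.
move=> /is_fourierP[tf t1 h1] /is_fourierP[_ t2 h2].
have t := temperedB t1 t2.
have H phi : schwartz phi -> Cint mu (fun z => (F1 z - F2 z) * (phi z)%:C%C) = 0.
  move=> sphi; have i1 := cintble_tempered_schwartz t1 sphi; have i2 := cintble_tempered_schwartz t2 sphi.
  have e : (fun z => (F1 z - F2 z) * (phi z)%:C%C) = (fun z => F1 z * (phi z)%:C%C - F2 z * (phi z)%:C%C).
    by apply/funext => z; rewrite mulrBl.
  by rewrite e CintB// -(h1 _ sphi) -(h2 _ sphi) subrr.
pose g (z : E) : R[i] := (gauss3 z)%:C%C.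
have sg : schwartz (@gauss3 R).
  have := schwartz_gauss_translate ((0, 0), 0); congr schwartz; apply/funext => z.
  by congr gauss3; case: z => -[a b] c; rewrite /sub3 /= !subr0.
suff : \forall z \ae mu, F1 z - F2 z = 0 by apply: filterS => z /eqP; rewrite subr_eq0 => /eqP.
apply: (ae_mul_eq0 (h := g)) => [z|].
  by apply: real_complex_neq0; rewrite gt_eqF// gauss3_gt0.
apply: extension_eq0; first exact: cintble_tempered_schwartz.
move=> z; rewrite /extension.
have s1 := schwartz_gauss_cos z 0; have s2 := schwartz_gauss_cos z (- (pi / 2)).
have i1 := cintble_tempered_schwartz t s1; have i2 := cintble_tempered_schwartz t s2.
(* The character is split as cosine plus i times sine, the sine being a cosine with phase -pi/2. *)
transitivity (Cint mu (fun w => (F1 w - F2 w) * (gauss3 w * cos (dot3 w z + 0))%:C%C +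
  'i%C * ((F1 w - F2 w) * (gauss3 w * cos (dot3 w z - (pi / 2)))%:C%C))).
  apply: eq_Cint => w; rewrite /g addr0 cosB cos_pihalf sin_pihalf mulr0 add0r mulr1.
  rewrite dot3C /expi; case: (F1 w - F2 w) => p q; apply: complex_ext => /=; ring.
by rewrite CintD ?CintZ ?H ?mulr0 ?addr0//; exact: cintbleZ.
Qed.

Lemma ftransform_gauss_translate w (z : E) :
  ftransform (fun x => (gauss3 (sub3 x w))%:C%C) z =
  expi (dot3 (scale3 (-1) w) z) * (Num.sqrt pi ^+ 3 * gauss3 (scale3 2^-1 z))%:C%C.
Proof.
have [i0 e0] := Cint_gauss3 (scale3 (-1) z).
have n1 : (1 : R) != 0 by [].
have s := scales_aff3 (scale3 (-1) w) n1.
have i := cintbleZ (expi (dot3 (scale3 (-1) w) z)) i0.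
have := scales_Cint s i; rewrite normr1 expr1n invr1 mul1r (CintZ _ i0) e0.
rewrite (_ : gauss3 (scale3 2^-1 (scale3 (-1) z)) = gauss3 (scale3 2^-1 z)); last first.
  by rewrite !gauss3_expR; congr (expR (- _)); rewrite /dot3 /scale3 /=; ring.
move=> <-; apply: eq_Cint => x.
rewrite (_ : aff3 1 (scale3 (-1) w) x = sub3 x w); last first.
  by rewrite /aff3 /sub3 /scale3 /=; congr (_, _, _); ring.
rewrite mulrCA -expiD; congr (_ * expi _).
by rewrite /dot3 /sub3 /scale3 /=; ring.
Qed.

Lemma gauss3_half_decay (N : nat) : exists C : R, forall z : R * R * R,
  (1 + `|z|) ^+ N * gauss3 (scale3 2^-1 z) <= C.
Proof.
have [C hC] := gauss3_decay N (((0 : R), 0), 0).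
exists (2 ^+ N * C) => z; have := hC (scale3 2^-1 z).
rewrite (_ : sub3 _ _ = scale3 2^-1 z); last by rewrite /sub3 /= !subr0.
have -> : `|scale3 2^-1 z| = 2^-1 * `|z|.
  by case: z => -[a b] c; rewrite !prod_normE /= !normrM ger0_norm// !maxr_pMr.
have := @gauss3_ge0 R (scale3 2^-1 z) => g0.
move/(ler_wpM2l (exprn_ge0 N (ler0n R 2))); apply: le_trans.
rewrite [leRHS]mulrA -exprMn ler_wpM2r// lerXn2r ?nnegrE//.
by have := normr_ge0 z; lra.
Qed.

(** Dual to [fourier_unique]: the transform of a Gaussian translated by -w is a character with
    frequency w times the Gaussian of z / 2. Pairing f1 - f2 with it gives, up to a nonzero
    constant, the Fourier integral at w of (f1 - f2) times that Gaussian. *)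
Lemma fourier_injective f1 f2 F : is_fourier f1 F -> is_fourier f2 F ->
  \forall z \ae mu, f1 z = f2 z.
Proof.
move=> /is_fourierP[t1 tF h1] /is_fourierP[t2 _ h2].
have t := temperedB t1 t2.
pose g (z : E) : R[i] := (gauss3 (scale3 2^-1 z))%:C%C.
have mg : cmeas g by apply: cmeas_real; exact: measurable_gauss3_scaled.
have ig f : tempered f -> cintble mu (fun z => f z * g z).
  move=> tf; apply: cintble_tempered => // N; have [C hC] := gauss3_half_decay N.
  by exists C => z; rewrite normcR ger0_norm ?gauss3_ge0.
suff : \forall z \ae mu, f1 z - f2 z = 0 by apply: filterS => z /eqP; rewrite subr_eq0 => /eqP.
apply: (ae_mul_eq0 (h := g)) => [z|].
  by apply: real_complex_neq0; rewrite gt_eqF// gauss3_gt0.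
apply: extension_eq0; first exact: ig.
move=> w; have sw := schwartz_gauss_translate (scale3 (-1) w).
have c0 : Num.sqrt pi ^+ 3 != 0 :> R by rewrite expf_neq0// gt_eqF// sqrtr_gt0 pi_gt0.
have ie f : tempered f -> cintble mu (fun x => f x * g x * expi (dot3 w x)).
  move=> tf; apply: cintble_mul_expi; first exact: ig.
  by apply: measurable_dot3; [exact: measurable_cst|exact: measurable_id].
have E0 f : tempered f -> Cint mu (fun z => f z * ftransform (fun x => (gauss3 (sub3 x (scale3 (-1) w)))%:C%C) z)
    = (Num.sqrt pi ^+ 3)%:C%C * Cint mu (fun x => f x * g x * expi (dot3 w x)).
  move=> tf; rewrite -CintZ; last exact: ie.
  apply: eq_Cint => x; rewrite ftransform_gauss_translate realcM.
  rewrite (_ : scale3 (-1) (scale3 (-1) w) = w); first by rewrite /g; ring.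
  by case: w {sw ie} => -[a b] c; rewrite /scale3 /=; congr (_, _, _); ring.
have := h1 _ sw; rewrite -(h2 _ sw) !E0// => /(mulfI (real_complex_neq0 c0)) e.
rewrite /extension (_ : (fun x => _) = (fun x => f1 x * g x * expi (dot3 w x) - f2 x * g x * expi (dot3 w x))).
  by rewrite CintB ?e ?subrr//; exact: ie.
by apply/funext => x; rewrite !mulrBl.
Qed.

(** The L^2 construction provides some function with transform F, and injectivity identifies it with
    f. A distributional transform lying in L^2 thereby gives access to the product and conjugation
    rules. *)
Lemma is_fourier_l2pair f F : is_fourier f F -> L2 mu F -> l2pair f F.
Proof.
move=> ff lF; have [f0 p] := l2pair_exists lF.
have e := fourier_injective (l2pair_is_fourier p) ff.
have [l0 _ c0] := p; have [[mf _] _ _] := ff.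
split => //; first exact: ae_L2 e l0.
move: c0; apply: cvg_trans; apply: near_eq_cvg; apply: nearW => n; congr fine.
have mK (h : E -> R[i]) : cmeas h -> cmeas (fun z => K%:C%C * h z - approxF n F z).
  move=> mh; apply: cmeasB; last exact: cmeas_approxF.
  by apply: (cmeasM (f := cst _)) => //; exact: cmeas_cst.
apply: ae_N2; [exact: mK l0.1|exact: mK|].
by apply: filterS e => z ->.
Qed.

Lemma conjcM (x y : R[i]) : conjc (x * y) = conjc x * conjc y.
Proof. by case: x => a b; case: y => c d; apply: complex_ext => /=; ring. Qed.

Lemma conjcB (x y : R[i]) : conjc (x - y) = conjc x - conjc y.
Proof. by case: x => a b; case: y => c d; apply: complex_ext => /=; ring. Qed.

Lemma conjc_realC (x : R) : conjc (x%:C%C) = x%:C%C.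
Proof. by apply: complex_ext => /=; rewrite ?oppr0. Qed.

Lemma approxF_conj n F (z : E) : L2 mu F ->
  approxF n (fun x => conjc (F (sub3 ((0, 0), 0) x))) z = conjc (approxF n F z).
Proof.
move=> lF; have i := cintble_regularize n lF.
have me : measurable_fun [set: E] (fun w : E => dot3 z w).
  by apply: measurable_dot3; [exact: measurable_cst|exact: measurable_id].
have i' := cintble_mul_expi i me.
rewrite /approxF /extension -(CintJ i').
have := scales_Cint (scales_sub3 ((0, 0), 0)) (cintbleJ i'); rewrite mul1r => <-.
apply: eq_Cint => w; rewrite conjcM -expiN /regularize conjcM conjc_realC.
congr (_ * _%:C%C * expi _); first by rewrite !gauss3_expR; congr expR; rewrite /dot3 /scale3 /sub3 /=; ring.
by rewrite /dot3 /sub3 /=; ring.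
Qed.

Lemma l2pair_conj f F : l2pair f F ->
  l2pair (fun z => conjc (f z)) (fun x => conjc (F (sub3 ((0, 0), 0) x))).
Proof.
move=> [lf lF c]; have [lF' _] := L2_sub3 ((0, 0), 0) lF.
split; [exact: L2J|exact: L2J|].
have e n : N2 mu (fun z => K%:C%C * conjc (f z) - approxF n (fun x => conjc (F (sub3 ((0, 0), 0) x))) z) =
    N2 mu (fun z => K%:C%C * f z - approxF n F z).
  rewrite -[RHS]N2J; congr N2; apply/funext => z.
  by rewrite approxF_conj// conjcB conjcM conjc_realC.
by under eq_fun do rewrite e.
Qed.

End is_fourier.

(** * Integrals of brackets *)

Section power_integrals.
Context {R : realType}.
Implicit Types (e r x y : R).

Lemma powRN_anti (u v : R) r : 0 < u -> u <= v -> 0 <= r -> v `^ (- r) <= u `^ (- r).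
Proof.
move=> u0 uv r0; have v0 := lt_le_trans u0 uv.
rewrite !powRN lef_pV2 ?posrE ?powR_gt0//.
by apply: ge0_ler_powR => //; rewrite nnegrE ltW.
Qed.

Lemma is_derive_shifted_powR e r x : 0 < x + e ->
  is_derive x (1 : R) (fun x => (x + e) `^ r) (r * (x + e) `^ (r - 1)).
Proof.
move=> xe.
have h : is_derive x (1 : R) (fun x => x + e) 1.
  by apply: is_derive_eq; rewrite addr0.
have := @is_derive1_comp _ (fun y : R => y `^ r) (fun x => x + e) x _ _ (is_derive1_powR r xe) h.
by rewrite mulr1.
Qed.

Lemma continuous_shifted_powR e r x : 0 < x + e ->
  {for x, continuous (fun x => (x + e) `^ r)}.
Proof.
move=> xe; apply: differentiable_continuous; apply/derivable1_diffP.
by have [] := is_derive_shifted_powR r xe.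
Qed.

Lemma cvgy_shifted_powR e r : 0 < e -> r < 0 -> (fun x => (x + e) `^ r) @ +oo --> (0 : R).
Proof.
move=> e0 r0; apply/cvgrPdist_le => d d0; near=> x.
rewrite sub0r normrN ger0_norm ?powR_ge0//.
have xM : d `^ (r^-1) <= x + e.
  by rewrite -lerBlDr; near: x; apply: nbhs_pinfty_ge; exact: num_real.
have M0 : 0 < d `^ r^-1 by exact: powR_gt0.
have dE : d = (d `^ r^-1) `^ r by rewrite -powRrM mulVf ?lt_eqF// powRr1// ltW.
have r0' : 0 <= - r by rewrite oppr_ge0 ltW.
by rewrite [leRHS]dE; have := powRN_anti M0 xM r0'; rewrite opprK.
Unshelve. all: by end_near. Qed.

Lemma integral0y_powR r : 1 < r ->
  (\int[lam R]_(x in `[0%R, +oo[) ((x + 1) `^ (- r))%:E = ((r - 1)^-1)%:E)%E.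
Proof.
move=> r1; have r0 : 1 - r < 0 by rewrite subr_lt0.
have rn : 1 - r != 0 by rewrite lt_eqF.
have d x : 0 <= x -> is_derive x (1 : R) (fun x => (1 - r)^-1 * (x + 1) `^ (1 - r)) ((x + 1) `^ (- r)).
  move=> x0; have xe : 0 < x + 1 by rewrite ltr_wpDl.
  have := is_derive_shifted_powR (1 - r) xe => h.
  apply: is_derive_eq; rewrite -[LHS]/((1 - r)^-1 * ((1 - r) * (x + 1) `^ (1 - r - 1))).
  by rewrite mulrA mulVf// mul1r; congr (_ `^ _); ring.
have c x : 0 <= x -> {for x, continuous (fun x => (1 - r)^-1 * (x + 1) `^ (1 - r))}.
  move=> x0; apply: differentiable_continuous; apply/derivable1_diffP.
  by have [] := d x x0.
rewrite (@ge0_continuous_FTC2y _ _ (fun x => (1 - r)^-1 * (x + 1) `^ (1 - r)) 0 0).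
- by rewrite (add0r 1) powR1 mulr1 -EFinB sub0r -invrN opprB.
- by move=> x _; exact: powR_ge0.
- apply: continuous_in_subspaceT => x; rewrite inE/= in_itv/= andbT => x0.
  by apply: continuous_shifted_powR; rewrite ltr_wpDl.
- rewrite -[X in _ --> X](mulr0 (1 - r)^-1); apply: cvgM; first exact: cvg_cst.
  exact: cvgy_shifted_powR.
- by move=> x x0; have [] := d x (ltW x0).
- by apply: cvg_at_right_filter; exact: (c 0).
- move=> x; rewrite in_itv/= andbT => x0; rewrite derive1E.
  by have [_ ->] := d x (ltW x0).
Qed.

(** The bound must not depend on [e]. For e >= 1 the integrand is at most 1; for e < 1 the
    antiderivative at 1 is at most (1 + e) / (1 - r), below 2 / (1 - r). *)
Lemma integral01_powR e r : 0 < e -> 0 < r -> r < 1 ->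
  (\int[lam R]_(x in `[0%R, 1%R]) ((x + e) `^ (- r))%:E <= (2 / (1 - r))%:E)%E.
Proof.
move=> e0 r0 r1; have r2 : 0 < 1 - r by rewrite subr_gt0.
have rn : 1 - r != 0 by rewrite gt_eqF.
have mf : measurable_fun [set: mR R] (fun x : R => (x + e) `^ (- r)).
  apply: (measurableT_comp (measurable_powR _)); exact: measurable_funD.
have [e1|e1] := leP 1 e.
  apply: (@le_trans _ _ (\int[lam R]_(x in `[0%R, 1%R]) (cst 1%:E x))%E).
    apply: ge0_le_integral => //.
    - by move=> x _; rewrite lee_fin powR_ge0.
    - by apply/measurable_EFinP; exact: measurable_funTS.
    - move=> x /=; rewrite in_itv/= => /andP[x0 _]; rewrite lee_fin powRN invf_le1 ?powR_gt0 ?ltr_wpDl//.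
      have h : 1 <= x + e by rewrite (le_trans e1)// lerDr.
      by have := ler_powR h (ltW r0); rewrite powRr0.
  rewrite integral_cst// mul1e -[X in (X <= _)%E]/(lebesgue_measure `[0%R, 1%R]%classic).
  rewrite lebesgue_measure_itv/= lte_fin ltr01 oppr0 adde0 lee_fin.
  by rewrite ler_pdivlMr// mul1r; lra.
have d x : 0 <= x -> is_derive x (1 : R) (fun x => (1 - r)^-1 * (x + e) `^ (1 - r)) ((x + e) `^ (- r)).
  move=> x0; have xe : 0 < x + e by rewrite ltr_wpDl.
  have := is_derive_shifted_powR (1 - r) xe => h.
  apply: is_derive_eq; rewrite -[LHS]/((1 - r)^-1 * ((1 - r) * (x + e) `^ (1 - r - 1))).
  by rewrite mulrA mulVf// mul1r; congr (_ `^ _); ring.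
have c x : 0 <= x -> {for x, continuous (fun x => (1 - r)^-1 * (x + e) `^ (1 - r))}.
  move=> x0; apply: differentiable_continuous; apply/derivable1_diffP.
  by have [] := d x x0.
rewrite (@continuous_FTC2 _ _ (fun x => (1 - r)^-1 * (x + e) `^ (1 - r)) 0 1) => //.
- rewrite -EFinB lee_fin -mulrBr mulrC ler_wpM2r ?invr_ge0 ?(ltW r2)//.
  apply: (@le_trans _ _ ((1 + e) `^ (1 - r))); first by rewrite gerBl powR_ge0.
  have h : 1 <= 1 + e by rewrite lerDl ltW.
  apply: (@le_trans _ _ (1 + e)); last by lra.
  have := ler_powR h (_ : 1 - r <= 1); rewrite powRr1 ?(le_trans ler01)//; apply.
  by rewrite gerBl ltW.
- apply: continuous_in_subspaceT => x; rewrite inE/= in_itv/= => /andP[x0 _].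
  by apply: continuous_shifted_powR; rewrite ltr_wpDl.
- split.
  + by move=> x; rewrite in_itv/= => /andP[x0 _]; have [] := d x (ltW x0).
  + by apply: cvg_at_right_filter; exact: c.
  + by apply: cvg_at_left_filter; exact: c.
- move=> x; rewrite in_itv/= => /andP[x0 _]; rewrite derive1E.
  by have [_ ->] := d x (ltW x0).
Qed.

End power_integrals.

(** * Japanese brackets on the line and in the plane *)

Section brackets.
Context {R : realType}.
Implicit Types (x y r s : R) (p q : R * R).

(** Indexed by the rate of decay; a negative [r] gives a growing weight. *)
Definition jb r x : R := bracket x `^ (- r).

Definition bracket2 p : R := bracket (Num.sqrt (normsq2 p)).

Definition jb2 r p : R := bracket2 p `^ (- r).

Lemma bracket_ge1 x : 1 <= bracket x.
Proof. by rewrite -{1}sqrtr1 ler_sqrt ?addr_ge0 ?sqr_ge0// lerDl sqr_ge0. Qed.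

Lemma bracket_gt0 x : 0 < bracket x.
Proof. exact: lt_le_trans (bracket_ge1 x). Qed.

Lemma bracket_sqr x : bracket x ^+ 2 = 1 + x ^+ 2.
Proof. by rewrite sqr_sqrtr// addr_ge0// sqr_ge0. Qed.

Lemma normsq2_ge0 p : 0 <= normsq2 p.
Proof. by rewrite addr_ge0// sqr_ge0. Qed.

Lemma bracket2_sqr p : bracket2 p ^+ 2 = 1 + normsq2 p.
Proof. by rewrite bracket_sqr sqr_sqrtr// normsq2_ge0. Qed.

Lemma bracket2_ge1 p : 1 <= bracket2 p. Proof. exact: bracket_ge1. Qed.

Lemma bracket2_gt0 p : 0 < bracket2 p. Proof. exact: bracket_gt0. Qed.

Lemma jb_gt0 r x : 0 < jb r x. Proof. by rewrite powR_gt0// bracket_gt0. Qed.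

Lemma jb_ge0 r x : 0 <= jb r x. Proof. exact: ltW (jb_gt0 r x). Qed.

Lemma jb2_gt0 r p : 0 < jb2 r p. Proof. by rewrite powR_gt0// bracket2_gt0. Qed.

Lemma jb2_ge0 r p : 0 <= jb2 r p. Proof. exact: ltW (jb2_gt0 r p). Qed.

Lemma jb_le1 r x : 0 <= r -> jb r x <= 1.
Proof.
by move=> r0; have := powRN_anti ltr01 (bracket_ge1 x) r0; rewrite powR1.
Qed.

Lemma jbD r s x : jb (r + s) x = jb r x * jb s x.
Proof. by rewrite /jb opprD powRD// (gt_eqF (bracket_gt0 x)) implybT. Qed.

Lemma jb2D r s p : jb2 (r + s) p = jb2 r p * jb2 s p.
Proof. exact: jbD. Qed.

Lemma jb_mono r x y : 0 <= r -> `|x| <= `|y| -> jb r y <= jb r x.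
Proof.
move=> r0 xy; apply: powRN_anti => //; first exact: bracket_gt0.
rewrite -(@ler_pXn2r _ 2) ?nnegrE ?(ltW (bracket_gt0 _))// !bracket_sqr lerD2l.
by rewrite -[x ^+ 2]real_normK ?num_real// -[y ^+ 2]real_normK ?num_real// lerXn2r ?nnegrE.
Qed.

Lemma jb2_mono r p q : 0 <= r -> normsq2 p <= normsq2 q -> jb2 r q <= jb2 r p.
Proof.
move=> r0 pq; apply: jb_mono => //.
by rewrite !ger0_norm ?sqrtr_ge0// ler_wsqrtr.
Qed.

Lemma jb_exp_mono r s x : r <= s -> jb s x <= jb r x.
Proof.
by move=> rs; rewrite /jb; apply: ler_powR; [exact: bracket_ge1|rewrite lerN2].
Qed.

(** The planar bracket dominates that of each coordinate, so its exponent can be shared between the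
    two coordinates. This reduces planar integrals to integrals over lines. *)
Lemma jb2_split r s p : 0 <= r -> 0 <= s -> jb2 (r + s) p <= jb r p.1 * jb s p.2.
Proof.
move=> r0 s0; rewrite jb2D; apply: ler_pM; rewrite ?jb2_ge0//.
- apply: (@jb_mono r p.1 (Num.sqrt (normsq2 p))) => //.
  by rewrite [leRHS]ger0_norm ?sqrtr_ge0// -sqrtr_sqr ler_wsqrtr// lerDl sqr_ge0.
- apply: (@jb_mono s p.2 (Num.sqrt (normsq2 p))) => //.
  by rewrite [leRHS]ger0_norm ?sqrtr_ge0// -sqrtr_sqr ler_wsqrtr// lerDr sqr_ge0.
Qed.

Lemma jbN r x : jb r (- x) = jb r x.
Proof. by rewrite /jb /bracket sqrrN. Qed.

Lemma measurable_bracket d (T : measurableType d) (f : T -> R) :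
  measurable_fun setT f -> measurable_fun setT (fun t => bracket (f t)).
Proof.
move=> mf; apply: (measurableT_comp (f := @Num.sqrt R)).
  by apply: continuous_measurable_fun; exact: sqrt_continuous.
by apply: measurable_funD => //; exact: measurable_funX.
Qed.

Lemma measurable_jb d (T : measurableType d) r (f : T -> R) :
  measurable_fun setT f -> measurable_fun setT (fun t => jb r (f t)).
Proof.
by move=> mf; apply: (measurableT_comp (measurable_powR _)); exact: measurable_bracket.
Qed.

Lemma measurable_jb2 d (T : measurableType d) r (f : T -> E2 R) :
  measurable_fun setT f -> measurable_fun setT (fun t => jb2 r (f t)).
Proof.
move=> mf; apply: measurable_jb; apply: (measurableT_comp (f := @Num.sqrt R)).
  by apply: continuous_measurable_fun; exact: sqrt_continuous.
have m1 : measurable_fun setT (fun t => (f t).1) by exact: (measurableT_comp measurable_fst mf).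
have m2 : measurable_fun setT (fun t => (f t).2) by exact: (measurableT_comp measurable_snd mf).
by apply: measurable_funD; exact: measurable_funX.
Qed.

Lemma bracket_lower x : (`|x| + 1) / 2 <= bracket x.
Proof.
rewrite -(@ler_pXn2r _ 2) ?nnegrE ?divr_ge0 ?addr_ge0 ?(ltW (bracket_gt0 _))//.
rewrite bracket_sqr -[x ^+ 2]real_normK ?num_real//.
have := sqr_ge0 (`|x| - 1); have := normr_ge0 x; nra.
Qed.

Lemma jbE r x : jb r x = bracket x `^ (- r). Proof. by []. Qed.

Lemma jb2E r p : jb2 r p = bracket2 p `^ (- r). Proof. by []. Qed.

End brackets.

#[global] Opaque jb jb2.

Section nonnegative_integrals.
Context d (T : measurableType d) {R : realType} (m : {measure set T -> \bar R}).
Implicit Types (f g : T -> R) (D : set T).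
Local Open Scope ereal_scope.

Lemma nnintZ D c f : measurable D -> (0 <= c)%R -> measurable_fun setT f -> (forall x, 0 <= f x)%R ->
  \int[m]_(x in D) (c * f x)%:E = c%:E * \int[m]_(x in D) (f x)%:E.
Proof.
move=> mD c0 mf f0; under eq_integral do rewrite EFinM.
rewrite ge0_integralZl_EFin//; first by move=> x _; rewrite lee_fin.
by apply/measurable_EFinP; exact: measurable_funTS.
Qed.

Lemma nnintD D f g : measurable D -> measurable_fun setT f -> (forall x, 0 <= f x)%R ->
  measurable_fun setT g -> (forall x, 0 <= g x)%R ->
  \int[m]_(x in D) (f x + g x)%:E = \int[m]_(x in D) (f x)%:E + \int[m]_(x in D) (g x)%:E.
Proof.
move=> mD mf f0 mg g0; under eq_integral do rewrite EFinD.
rewrite ge0_integralD//; try by move=> x _; rewrite lee_fin.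
- by apply/measurable_EFinP; exact: measurable_funTS.
- by apply/measurable_EFinP; exact: measurable_funTS.
Qed.

Lemma nnint_le D f g : measurable D -> measurable_fun setT f -> (forall x, 0 <= f x)%R ->
  measurable_fun setT g -> (forall x, D x -> f x <= g x)%R ->
  \int[m]_(x in D) (f x)%:E <= \int[m]_(x in D) (g x)%:E.
Proof.
move=> mD mf f0 mg fg; apply: ge0_le_integral => //.
- by move=> x _; rewrite lee_fin.
- by apply/measurable_EFinP; exact: measurable_funTS.
- by apply/measurable_EFinP; exact: measurable_funTS.
Qed.

Lemma ae_imply (P Q : T -> Prop) : (forall x, P x -> Q x) ->
  (\forall x \ae m, P x) -> \forall x \ae m, Q x.
Proof. by move=> PQ; exact: filterS. Qed.

(* For u, v with s u <= s v, monotonicity gives g v <= g u, hence f u * g v <= f u * g u. *)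
Lemma mul_antitone_le f g (s : T -> R) :
  (forall x, 0 <= f x)%R -> (forall x, 0 <= g x)%R ->
  (forall x y, s x <= s y -> f y <= f x)%R -> (forall x y, s x <= s y -> g y <= g x)%R ->
  forall u v, (f u * g v <= f u * g u + f v * g v)%R.
Proof.
move=> f0 g0 fs gs u v; have [h|/ltW h] := leP (s u) (s v).
  by apply: ler_wpDr; rewrite ?mulr_ge0// ler_wpM2l ?gs.
by apply: ler_wpDl; rewrite ?mulr_ge0// ler_wpM2r ?fs.
Qed.

(** Shifting two functions that decrease with the same size function [s] costs at most a factor 2:
    the product is bounded pointwise by the unshifted product taken at each of the two points, and
    each term is translated back. This gives all uniformity in translations. *)
Lemma integral_antitone_shift f g (s : T -> R) (tu tv : T -> T) :
  (forall x, 0 <= f x)%R -> (forall x, 0 <= g x)%R ->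
  measurable_fun setT f -> measurable_fun setT g ->
  (forall x y, s x <= s y -> f y <= f x)%R -> (forall x y, s x <= s y -> g y <= g x)%R ->
  scales m tu 1 -> scales m tv 1 ->
  \int[m]_x (f (tu x) * g (tv x))%:E <= 2%:E * \int[m]_x (f x * g x)%:E.
Proof.
move=> f0 g0 mf mg fs gs [mu hu] [mv hv].
have mfg : measurable_fun setT (fun x => f x * g x)%R by exact: measurable_funM.
have p x : (0 <= f x * g x)%R by rewrite mulr_ge0.
have eu := hu (fun x => (f x * g x)%:E) ((measurable_EFinP _ _).2 mfg) (fun x => p x).
have ev := hv (fun x => (f x * g x)%:E) ((measurable_EFinP _ _).2 mfg) (fun x => p x).
rewrite mul1e in eu; rewrite mul1e in ev.
rewrite -[2%:E]/((1 + 1)%:E) EFinD ge0_muleDl ?lee_fin// !mul1e -{1}eu -ev.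
rewrite -nnintD//; last 2 first.
- exact: (measurableT_comp mfg mu).
- exact: (measurableT_comp mfg mv).
apply: nnint_le => //.
- by apply: measurable_funM; [exact: (measurableT_comp mf mu)|exact: (measurableT_comp mg mv)].
- by move=> x; rewrite mulr_ge0.
- by apply: measurable_funD; [exact: (measurableT_comp mfg mu)|exact: (measurableT_comp mfg mv)].
- by move=> x _; exact: (mul_antitone_le f0 g0 fs gs).
Qed.

End nonnegative_integrals.

Section bracket_integrals.
Context {R : realType}.
Implicit Types (x y e r th ka c : R).
Local Notation lam := (lam R).
Local Notation mu2 := (mu2 R).

Lemma measurable_shifted_powR e r : measurable_fun [set: mR R] (fun x : R => (x + e) `^ r).
Proof. by apply: (measurableT_comp (measurable_powR _)); exact: measurable_funD. Qed.

Lemma measurable_abs : measurable_fun [set: mR R] (fun x : R => `|x|).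
Proof. by apply: continuous_measurable_fun; exact: norm_continuous. Qed.

(** On [0, 1] the singular factor is integrable uniformly in [e], as th < 1. Beyond 1 both bases are
    at least (x + 1) / 2 and the total exponent exceeds 1; the constant 2^(ka+th) pays for the
    division by 2. *)
Lemma jb_singular_halfline ka th : 0 <= ka -> 0 < th -> th < 1 -> 1 < ka + th ->
  exists2 C, 0 <= C & forall e, 0 < e ->
    (\int[lam]_(x in `[0%R, +oo[) (jb ka x * (x + e) `^ (- th))%:E <= C%:E)%E.
Proof.
move=> k0 t0 t1 kt.
pose Q := 2 `^ (ka + th).
have Q0 : 0 <= Q by exact: powR_ge0.
exists (2 / (1 - th) + Q * (ka + th - 1)^-1).
  have h1 : 0 <= 1 - th by rewrite subr_ge0 ltW.
  have h2 : 0 <= ka + th - 1 by rewrite subr_ge0 ltW.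
  by rewrite addr_ge0 ?divr_ge0 ?mulr_ge0 ?invr_ge0.
move=> e e0.
have mp : measurable_fun [set: mR R] (fun x => jb ka x * (x + e) `^ (- th)).
  by apply: measurable_funM; [exact: measurable_jb|exact: measurable_shifted_powR].
have p0 x : 0 <= jb ka x * (x + e) `^ (- th) by rewrite mulr_ge0 ?jb_ge0 ?powR_ge0.
have -> : (`[0%R, +oo[%classic : set (mR R)) = `[0%R, 1%R] `|` `]1%R, +oo[.
  by rewrite -itv_bndbnd_setU// bnd_simp.
rewrite ge0_integral_setU//; last 3 first.
- by apply/measurable_EFinP; exact: measurable_funTS.
- by move=> x _; rewrite lee_fin.
- rewrite disj_set2E; apply/eqP/seteqP; split => x //= []; rewrite !in_itv/= => /andP[_ h1].
  by rewrite andbT ltNge h1.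
rewrite EFinD; apply: leeD.
  apply: le_trans (integral01_powR e0 t0 t1); apply: nnint_le => //.
    exact: measurable_shifted_powR.
  by move=> x _; rewrite ler_piMl ?powR_ge0// jb_le1.
rewrite EFinM -(integral0y_powR kt).
rewrite -nnintZ//; last 2 first.
- exact: measurable_shifted_powR.
- by move=> x; rewrite powR_ge0.
have mq : measurable_fun [set: mR R] (fun x : R => Q * (x + 1) `^ (- (ka + th))).
  by apply: measurable_funM => //; exact: measurable_shifted_powR.
apply: (@le_trans _ _ (\int[lam]_(x in `]1%R, +oo[) (Q * (x + 1) `^ (- (ka + th)))%:E)%E); last first.
  apply: ge0_subset_integral => //.
  - by apply/measurable_EFinP; exact: measurable_funTS.
  - by move=> x _; rewrite lee_fin mulr_ge0 ?powR_ge0.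
  - by move=> x /=; rewrite !in_itv/= !andbT => /ltW; apply: le_trans.
apply: nnint_le => // x /=; rewrite in_itv/= andbT => x1.
have x0 : 0 < x by exact: lt_trans x1.
have h0 : 0 < (x + 1) / 2 by rewrite divr_gt0// addr_gt0.
have -> : Q * (x + 1) `^ (- (ka + th)) = ((x + 1) / 2) `^ (- ka) * ((x + 1) / 2) `^ (- th).
  rewrite -powRD; last by rewrite (gt_eqF h0) implybT.
  have h1 : 0 <= x + 1 by rewrite addr_ge0// ltW.
  rewrite -opprD powRM//.
  rewrite mulrC; congr (_ * _).
  by rewrite -[2^-1]powR_inv1// -powRrM mulN1r opprK.
apply: ler_pM; rewrite ?jb_ge0 ?powR_ge0//.
  rewrite jbE; apply: powRN_anti => //; apply: le_trans (bracket_lower x).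
  by rewrite gtr0_norm.
by apply: powRN_anti; rewrite ?ltW//; lra.
Qed.

(** For x >= 0 one has <r x> >= (|r| / 2) (x + 1/|r|): the factor |r|^(-th) comes out, and what
    remains is the half-line integral with e = 1/|r|, bounded independently of [e]. *)
Lemma jb_dilated ka th : 0 <= ka -> 0 < th -> th < 1 -> 1 < ka + th ->
  exists2 C, 0 <= C & forall r, r != 0 ->
    (\int[lam]_x (jb ka x * jb th (r * x))%:E <= (C * `|r| `^ (- th))%:E)%E.
Proof.
move=> k0 t0 t1 kt; have [C C0 hC] := jb_singular_halfline k0 t0 t1 kt.
exists (2 * (2 `^ th * C)); first by rewrite !mulr_ge0 ?powR_ge0.
move=> r r0; have r1 : 0 < `|r| by rewrite normr_gt0.
have mh : measurable_fun [set: mR R] (fun x => jb ka x * jb th (r * x)).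
  by apply: measurable_funM; apply: measurable_jb => //; exact: measurable_funM.
apply: (le_trans (even_integral mh _ _)) => [x|x|].
- by rewrite mulr_ge0 ?jb_ge0.
- by rewrite mulrN !jbN.
rewrite -mulrA EFinM lee_pmul2l// ?lte_fin//.
pose Q := 2 `^ th * `|r| `^ (- th).
have Q0 : 0 <= Q by rewrite mulr_ge0 ?powR_ge0.
have ir : 0 < `|r|^-1 by rewrite invr_gt0.
apply: (@le_trans _ _ (\int[lam]_(x in `[0%R, +oo[) (Q * (jb ka x * (x + `|r|^-1) `^ (- th)))%:E)%E).
  apply: nnint_le => //.
  - by move=> x; rewrite mulr_ge0 ?jb_ge0.
  - apply: measurable_funM => //; apply: measurable_funM; first exact: measurable_jb.
    exact: measurable_shifted_powR.
  move=> x /=; rewrite in_itv/= andbT => x0; rewrite mulrCA ler_wpM2l ?jb_ge0//.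
  have h0 : 0 < x + `|r|^-1 by rewrite ltr_wpDl.
  have h : `|r| / 2 * (x + `|r|^-1) <= bracket (r * x).
    apply: le_trans (bracket_lower _); rewrite normrM (ger0_norm x0).
    rewrite mulrDr [_ / 2 * _^-1]mulrAC divff ?gt_eqF// mul1r mulrDl mul1r lerD2r.
    by rewrite mulrAC.
  rewrite jbE; apply: (le_trans (powRN_anti _ h (ltW t0))); first by rewrite mulr_gt0// divr_gt0.
  rewrite powRM ?(ltW h0) ?divr_ge0 ?(ltW r1)// powRM ?(ltW r1)//.
  rewrite -[2^-1]powR_inv1// -powRrM mulN1r opprK /Q [`|r| `^ _ * _]mulrC.
  exact: lexx.
rewrite nnintZ//; last 2 first.
- by apply: measurable_funM; [exact: measurable_jb|exact: measurable_shifted_powR].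
- by move=> x; rewrite mulr_ge0 ?jb_ge0 ?powR_ge0.
rewrite mulrAC [leRHS]EFinM lee_wpmul2l ?lee_fin//; exact: hC.
Qed.

Lemma scales_shift (y : R) : scales lam (fun x => x + y) 1.
Proof. exact: scales_translate. Qed.

(** Since r x + c = r (x + c / r), both factors are translates of functions decreasing in |x|, so
    the dilated estimate holds uniformly in the translations. *)
Lemma jb_affine ka th : 0 <= ka -> 0 < th -> th < 1 -> 1 < ka + th ->
  exists2 C, 0 <= C & forall r y c, r != 0 ->
    (\int[lam]_x (jb ka (x + y) * jb th (r * x + c))%:E <= (C * `|r| `^ (- th))%:E)%E.
Proof.
move=> k0 t0 t1 kt; have [C C0 hC] := jb_dilated k0 t0 t1 kt.
exists (2 * C); first by rewrite mulr_ge0.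
move=> r y c r0; rewrite -mulrA EFinM.
have mf : measurable_fun [set: mR R] (jb ka) by exact: measurable_jb.
have mg : measurable_fun [set: mR R] (fun x => jb th (r * x)).
  by apply: measurable_jb; exact: measurable_funM.
have := integral_antitone_shift (m := lam) (f := jb ka) (g := fun x => jb th (r * x)) (s := fun x : R => `|x|)
  (@jb_ge0 R ka) (fun x => jb_ge0 th _) mf mg _ _ (scales_shift y) (scales_shift (c / r)).
have e x : r * (x + c / r) = r * x + c by rewrite mulrDr mulrCA divff// mulr1.
under eq_integral => x _ do rewrite e.
move=> h; apply: (le_trans (h _ _)).
- by move=> u v uv; exact: jb_mono.
- by move=> u v uv; apply: jb_mono; rewrite ?(ltW t0)// !normrM ler_wpM2l.
by rewrite lee_wpmul2l ?lee_fin//; exact: hC.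
Qed.

Lemma jb_integral ka : 1 < ka -> exists2 C, 0 <= C &
  (\int[lam]_x (jb ka x)%:E <= C%:E)%E.
Proof.
move=> k1.
(* The dilated estimate is used with r = 1, after splitting ka as (ka - 1/2) + 1/2. *)
have t0 : 0 < 2^-1 :> R by [].
have t1 : 2^-1 < 1 :> R by rewrite invf_lt1// ltr1n.
have k2 : 0 <= ka - 2^-1 by lra.
have kt : 1 < ka - 2^-1 + 2^-1 by rewrite subrK.
have [C C0 hC] := jb_dilated k2 t0 t1 kt.
exists C => //; have := hC 1 (oner_neq0 R); rewrite normr1 powR1 mulr1.
under eq_integral => x _ do rewrite mul1r -jbD subrK.
exact.
Qed.

Lemma ae_neq0 : \forall x \ae lam, x != 0.
Proof.
exists [set 0]; split => //; first exact: lebesgue_measure_set1.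
by move=> x /= /negP; rewrite negbK => /eqP.
Qed.

Lemma measurable_jb_abs m1 th : measurable_fun [set: mR R] (fun x => jb m1 x * `|x| `^ (- th)).
Proof.
apply: measurable_funM; first exact: measurable_jb.
by apply: (measurableT_comp (measurable_powR _)); exact: measurable_abs.
Qed.

(** Limit of the half-line bounds, which are uniform in [e], by Fatou; the pointwise limit holds
    away from the null set x = 0. *)
Lemma jb_abs_integral m1 th : 0 <= m1 -> 0 < th -> th < 1 -> 1 < m1 + th ->
  exists2 C, 0 <= C & (\int[lam]_x (jb m1 x * `|x| `^ (- th))%:E <= C%:E)%E.
Proof.
move=> m0 t0 t1 mt; have [D D0 hD] := jb_singular_halfline m0 t0 t1 mt.
exists (2 * D); first by rewrite mulr_ge0.
apply: (@fatou_le _ _ R lam (fun n x => jb m1 x * (`|x| + epsn n) `^ (- th)) (fun x => jb m1 x * `|x| `^ (- th))) => //.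
- move=> n; apply: measurable_funM; first exact: measurable_jb.
  by apply: (measurableT_comp (measurable_powR _)); apply: measurable_funD => //; exact: measurable_abs.
- by move=> n x; rewrite mulr_ge0 ?jb_ge0 ?powR_ge0.
- exact: measurable_jb_abs.
- apply: ae_imply ae_neq0 => x x0; apply: cvgM; first exact: cvg_cst.
  have h : {for (0 : R), continuous (fun e : R => (e + `|x|) `^ (- th))}.
    by apply: continuous_shifted_powR; rewrite add0r normr_gt0.
  have := cvg_comp _ _ (@cvg_epsn R) h; rewrite /= add0r.
  by apply: cvg_trans; apply: near_eq_cvg; apply: nearW => n /=; rewrite addrC.
move=> n.
have me : measurable_fun [set: mR R] (fun x : R => jb m1 x * (`|x| + epsn n) `^ (- th)).
  apply: measurable_funM; first exact: measurable_jb.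
  by apply: (measurableT_comp (measurable_powR _)); apply: measurable_funD => //; exact: measurable_abs.
apply: (le_trans (even_integral me _ _)) => [x|x|].
- by rewrite mulr_ge0 ?jb_ge0 ?powR_ge0.
- by rewrite jbN normrN.
rewrite EFinM lee_wpmul2l ?lee_fin//; apply: le_trans (hD (epsn n) (eps_gt0 n)).
rewrite le_eqVlt; apply/orP; left; apply/eqP; apply: eq_integral => x.
by rewrite inE/= in_itv/= andbT => x0; rewrite ger0_norm.
Qed.

End bracket_integrals.

Section majorant.
Context d (T : measurableType d) (R : realType) (m : {measure set T -> \bar R}).

Lemma nnint_majorant (f g1 g2 : T -> R) (Q A B : R) : 0 <= Q ->
  measurable_fun setT f -> (forall x, 0 <= f x) ->
  measurable_fun setT g1 -> (forall x, 0 <= g1 x) ->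
  measurable_fun setT g2 -> (forall x, 0 <= g2 x) ->
  (forall x, f x <= Q * (g1 x + g2 x)) ->
  (\int[m]_x (g1 x)%:E <= A%:E)%E -> (\int[m]_x (g2 x)%:E <= B%:E)%E ->
  (\int[m]_x (f x)%:E <= (Q * (A + B))%:E)%E.
Proof.
move=> Q0 mf f0 m1 g10 m2 g20 fg hA hB.
have mg := measurable_funD m1 m2.
apply: (@le_trans _ _ (\int[m]_x (Q * (g1 x + g2 x))%:E)%E).
  by apply: nnint_le => //; exact: measurable_funM.
rewrite nnintZ//; last by move=> x; rewrite addr_ge0.
by rewrite nnintD// EFinM lee_wpmul2l ?lee_fin// EFinD leeD.
Qed.

End majorant.

Section tonelli.
Context d1 d2 (R : realType) (T1 : measurableType d1) (T2 : measurableType d2)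
  (m1 : {sigma_finite_measure set T1 -> \bar R}) (m2 : {sigma_finite_measure set T2 -> \bar R}).
Local Open Scope ereal_scope.
Implicit Types f : T1 * T2 -> \bar R.

Lemma tonelli1 f : measurable_fun setT f -> (forall p, 0 <= f p) ->
  \int[prodm m1 m2]_p f p = \int[m1]_x \int[m2]_y f (x, y).
Proof. by move=> mf f0; rewrite fubini_tonelli1. Qed.

Lemma tonelli2 f : measurable_fun setT f -> (forall p, 0 <= f p) ->
  \int[prodm m1 m2]_p f p = \int[m2]_y \int[m1]_x f (x, y).
Proof. by move=> mf f0; rewrite fubini_tonelli2. Qed.

Lemma tonelli_swap f : measurable_fun setT f -> (forall p, 0 <= f p) ->
  \int[m1]_x \int[m2]_y f (x, y) = \int[m2]_y \int[m1]_x f (x, y).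
Proof. by move=> mf f0; rewrite -tonelli1// tonelli2. Qed.

Lemma measurable_integral1 f : measurable_fun setT f -> (forall p, 0 <= f p) ->
  measurable_fun setT (fun x => \int[m2]_y f (x, y)).
Proof. by move=> mf f0; exact: measurable_fun_fubini_tonelli_F. Qed.

Lemma measurable_integral2 f : measurable_fun setT f -> (forall p, 0 <= f p) ->
  measurable_fun setT (fun y => \int[m1]_x f (x, y)).
Proof. by move=> mf f0; exact: measurable_fun_fubini_tonelli_G. Qed.

Lemma tonelli1_le (f : T1 * T2 -> R) (h : T1 -> R) B :
  measurable_fun setT f -> (forall p, 0 <= f p)%R -> measurable_fun setT h ->
  (forall x, \int[m2]_y (f (x, y))%:E <= (h x)%:E) ->
  \int[m1]_x (h x)%:E <= B -> \int[prodm m1 m2]_p (f p)%:E <= B.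
Proof.
move=> mf f0 mh fh; apply: le_trans.
have mf' : measurable_fun setT (EFin \o f) by exact/measurable_EFinP.
have f0' p : 0 <= (EFin \o f) p by rewrite lee_fin.
rewrite (tonelli1 mf' f0'); apply: ge0_le_integralT => //.
- exact: measurable_integral1.
- exact/measurable_EFinP.
- by move=> x; apply: integral_ge0.
Qed.

Lemma tonelli2_le (f : T1 * T2 -> R) (h : T2 -> R) B :
  measurable_fun setT f -> (forall p, 0 <= f p)%R -> measurable_fun setT h ->
  (forall y, \int[m1]_x (f (x, y))%:E <= (h y)%:E) ->
  \int[m2]_y (h y)%:E <= B -> \int[prodm m1 m2]_p (f p)%:E <= B.
Proof.
move=> mf f0 mh fh; apply: le_trans.
have mf' : measurable_fun setT (EFin \o f) by exact/measurable_EFinP.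
have f0' p : 0 <= (EFin \o f) p by rewrite lee_fin.
rewrite (tonelli2 mf' f0'); apply: ge0_le_integralT => //.
- exact: measurable_integral2.
- exact/measurable_EFinP.
- by move=> x; apply: integral_ge0.
Qed.

End tonelli.

Section tonelli4.
Context d1 d2 d3 d4 (R : realType) (T1 : measurableType d1) (T2 : measurableType d2)
  (T3 : measurableType d3) (T4 : measurableType d4)
  (m1 : {sigma_finite_measure set T1 -> \bar R}) (m2 : {sigma_finite_measure set T2 -> \bar R})
  (m3 : {sigma_finite_measure set T3 -> \bar R}) (m4 : {sigma_finite_measure set T4 -> \bar R}).
Local Open Scope ereal_scope.

(** Each point is a pair of a frequency and a time frequency; this order puts the two time variables
    inside, to be integrated with both spatial frequencies frozen. *)
Lemma tonelli4 (f : (T1 * T2) * (T3 * T4) -> \bar R) :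
  measurable_fun setT f -> (forall p, 0 <= f p) ->
  \int[prodm m1 m2]_x \int[prodm m3 m4]_y f (x, y) =
  \int[m1]_a \int[m3]_c \int[m2]_b \int[m4]_e f ((a, b), (c, e)).
Proof.
move=> mf f0; rewrite (tonelli1 m1 m2 (f := fun x => \int[prodm m3 m4]_y f (x, y))); last 2 first.
- exact: measurable_integral1.
- by move=> x; exact: integral_ge0.
apply: eq_integral => a _.
pose h (p : T2 * T3) := \int[m4]_e f ((a, p.1), (p.2, e)).
have mg : measurable_fun setT (fun q : (T2 * T3) * T4 => f ((a, q.1.1), (q.1.2, q.2))).
  apply: (measurableT_comp mf).
  apply: measurable_fun_pair; apply: measurable_fun_pair => //.
  - by apply: (measurableT_comp measurable_fst); exact: measurable_fst.
  - by apply: (measurableT_comp measurable_snd); exact: measurable_fst.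
have mh : measurable_fun setT h.
  exact: (measurable_integral1 m4 (f := fun q : (T2 * T3) * T4 => f ((a, q.1.1), (q.1.2, q.2)))).
have h0 p : 0 <= h p by exact: integral_ge0.
rewrite -[RHS](tonelli_swap m2 m3 (f := h))//.
apply: eq_integral => b _; rewrite tonelli1//.
have := measurable_fun_pair2 (a, b) mf; exact.
Qed.

End tonelli4.

(** * Planar integrals containing the resonance factor *)

Section planar.
Context {R : realType}.
Implicit Types (p q x y xi : R * R) (r ga th ka : R).
Local Notation lam := (lam R).
Local Notation mu2 := (mu2 R).

Definition add2 p q : R * R := (p.1 + q.1, p.2 + q.2).
Definition dot2 p q : R := p.1 * q.1 + p.2 * q.2.

Lemma scales_add2 y : scales mu2 (fun x => add2 x y) 1.
Proof.
have := scales_aff2 y (oner_neq0 R); rewrite normr1 expr1n invr1.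
by congr scales; apply/funext => x; rewrite /add2 !mul1r.
Qed.

Lemma measurable_add2 d (T : measurableType d) (f g : T -> E2 R) :
  measurable_fun setT f -> measurable_fun setT g ->
  measurable_fun setT (fun t => add2 (f t) (g t) : E2 R).
Proof.
move=> mf mg; apply: measurable_fun_pair; apply: measurable_funD.
- exact: (measurableT_comp measurable_fst mf).
- exact: (measurableT_comp measurable_fst mg).
- exact: (measurableT_comp measurable_snd mf).
- exact: (measurableT_comp measurable_snd mg).
Qed.

Lemma measurable_dot2 d (T : measurableType d) (f g : T -> E2 R) :
  measurable_fun setT f -> measurable_fun setT g ->
  measurable_fun setT (fun t => dot2 (f t) (g t)).
Proof.
move=> mf mg; apply: measurable_funD; apply: measurable_funM.
- exact: (measurableT_comp measurable_fst mf).
- exact: (measurableT_comp measurable_fst mg).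
- exact: (measurableT_comp measurable_snd mf).
- exact: (measurableT_comp measurable_snd mg).
Qed.

Lemma dot2_le p q : dot2 p q <= bracket2 p * bracket2 q.
Proof.
apply: le_trans (ler_norm _) _.
rewrite -(@ler_pXn2r _ 2) ?nnegrE ?mulr_ge0 ?(ltW (bracket2_gt0 _))//.
rewrite real_normK ?num_real// exprMn !bracket2_sqr /normsq2 /dot2.
have := sqr_ge0 (p.1 * q.2 - p.2 * q.1); have := sqr_ge0 p.1; have := sqr_ge0 p.2.
have := sqr_ge0 q.1; have := sqr_ge0 q.2; nra.
Qed.

Lemma bracket2_add p q : bracket2 (add2 p q) <= bracket2 p + bracket2 q.
Proof.
rewrite -(@ler_pXn2r _ 2) ?nnegrE ?addr_ge0 ?(ltW (bracket2_gt0 _))//.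
rewrite sqrrD !bracket2_sqr; have := dot2_le p q; rewrite /normsq2 /add2 /dot2 /=; nra.
Qed.

Lemma bracket2N p : bracket2 (- p.1, - p.2) = bracket2 p.
Proof. by rewrite /bracket2 /normsq2 /= !sqrrN. Qed.

Lemma jb2_integral r : 2 < r -> exists2 C, 0 <= C & (\int[mu2]_p (jb2 r p)%:E <= C%:E)%E.
Proof.
move=> r2; have r1 : 1 < r / 2 by rewrite ltr_pdivlMr// mul1r.
have r0 : 0 <= r / 2 by rewrite (le_trans ler01)// ltW.
have [C C0 hC] := jb_integral r1.
exists (C * C); first by rewrite mulr_ge0.
have mj : measurable_fun [set: mR R] (jb (r / 2)) by exact: measurable_jb.
apply: (@le_trans _ _ (\int[mu2]_p (jb (r / 2) p.1 * jb (r / 2) p.2)%:E)%E).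
  apply: nnint_le => //.
  - by apply: (@measurable_jb2 _ _ _ _ id).
  - by move=> p; exact: jb2_ge0.
  - apply: measurable_funM; [exact: (measurableT_comp mj measurable_fst)|exact: (measurableT_comp mj measurable_snd)].
  - move=> p _; have := jb2_split p r0 r0; by rewrite -splitr.
rewrite integral_prod_mul//; [|exact: jb_ge0..].
by rewrite EFinM; apply: lee_pmul => //; apply: integral_ge0 => x _; rewrite lee_fin jb_ge0.
Qed.

Lemma jb2_convolution ga r : 0 <= ga -> 0 <= r -> 2 < ga + r ->
  exists2 C, 0 <= C & forall x y,
    (\int[mu2]_p (jb2 ga (add2 p x) * jb2 r (add2 p y))%:E <= C%:E)%E.
Proof.
move=> g0 r0 gr; have [C C0 hC] := jb2_integral gr.
exists (2 * C); first by rewrite mulr_ge0.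
move=> x y; apply: (le_trans (integral_antitone_shift (m := mu2) (f := jb2 ga) (g := jb2 r)
   (s := @normsq2 R) _ _ _ _ _ _ (scales_add2 x) (scales_add2 y))).
- by move=> p; exact: jb2_ge0.
- by move=> p; exact: jb2_ge0.
- by apply: (@measurable_jb2 _ _ _ _ id).
- by apply: (@measurable_jb2 _ _ _ _ id).
- by move=> u v; exact: jb2_mono.
- by move=> u v; exact: jb2_mono.
rewrite EFinM lee_wpmul2l ?lee_fin//; apply: le_trans hC.
by under eq_integral => p _ do rewrite -jb2D.
Qed.

Lemma integral_jb_shift r (y : R) : (\int[lam]_x (jb r (x + y))%:E = \int[lam]_x (jb r x)%:E)%E.
Proof.
have [_ h] := scales_shift y; rewrite (h (fun x : mR R => (jb r x)%:E)) ?mul1e//.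
- by apply/measurable_EFinP; exact: measurable_jb.
- by move=> x; rewrite lee_fin jb_ge0.
Qed.

(** Along the axis of a nonzero coordinate p_i the form p.x is affine with slope p_i, and
    [jb_affine] gains |p_i|^(-th) whatever the other coordinate of x; the latter is then integrated
    by its own share of the bracket. *)
Lemma planar_oscillatory ga th : 1 < ga -> 0 < th -> th < 1 -> 2 < ga + th ->
  exists2 C, 0 <= C & forall y p,
   (p.1 != 0 -> (\int[mu2]_x (jb2 ga (add2 x y) * jb th (dot2 p x))%:E <= (C * `|p.1| `^ (- th))%:E)%E) /\
   (p.2 != 0 -> (\int[mu2]_x (jb2 ga (add2 x y) * jb th (dot2 p x))%:E <= (C * `|p.2| `^ (- th))%:E)%E).
Proof.
move=> g1 t0 t1 gt.
(* The excess ga + th - 2 is halved: 1 + eta > 1 goes to the free coordinate, and ka + th = 1 + eta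
   > 1 is left for the coordinate paired with the resonance factor. *)
pose eta := (ga + th - 2) / 2; pose ka := ga - 1 - eta.
have e0 : 1 < 1 + eta by rewrite /eta; lra.
have e1 : 0 <= 1 + eta by rewrite /eta; lra.
have k0 : 0 <= ka by rewrite /ka /eta; lra.
have kt : 1 < ka + th by rewrite /ka /eta; lra.
have gE : ga = ka + (1 + eta) by rewrite /ka; lra.
have [C C0 hC] := jb_affine k0 t0 t1 kt; have [D D0 hD] := jb_integral e0.
exists (D * C); first by rewrite mulr_ge0.
move=> y p.
have mS (f : E2 R -> R) c r : measurable_fun setT f -> measurable_fun setT (fun x : E2 R => jb r (f x + c)).
  by move=> mf; apply: measurable_jb; exact: measurable_funD.
have mo : measurable_fun setT (fun x : E2 R => jb th (dot2 p x)).
  by apply: measurable_jb; apply: measurable_dot2; [exact: measurable_cst|exact: measurable_id].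
have ml : measurable_fun setT (fun x : E2 R => jb2 ga (add2 x y) * jb th (dot2 p x)).
  by apply: measurable_funM => //; apply: measurable_jb2; apply: measurable_add2;
    [exact: measurable_id|exact: measurable_cst].
have l0 x : 0 <= jb2 ga (add2 x y) * jb th (dot2 p x) by rewrite mulr_ge0 ?jb_ge0 ?jb2_ge0.
have m1 := @measurable_fst _ _ (mR R) (mR R). have m2 := @measurable_snd _ _ (mR R) (mR R).
have mD c (K : R) : measurable_fun [set: mR R] (fun x : mR R => jb (1 + eta) (x + c) * K).
  by apply: measurable_funM => //; apply: measurable_jb; exact: measurable_funD.
have mp1 := measurable_funM (mS _ y.2 (1 + eta) m2) (measurable_funM (mS _ y.1 ka m1) mo).
have mp2 := measurable_funM (mS _ y.1 (1 + eta) m1) (measurable_funM (mS _ y.2 ka m2) mo).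
have fin c (r : R) : (\int[lam]_x (jb (1 + eta) (x + c) * (C * r `^ (- th)))%:E <= (D * C * r `^ (- th))%:E)%E.
  under eq_integral do rewrite mulrC.
  rewrite nnintZ ?mulr_ge0 ?powR_ge0//; last 2 first.
  - by apply: measurable_jb; exact: measurable_funD.
  - by move=> x; exact: jb_ge0.
  rewrite integral_jb_shift (_ : D * C * r `^ (- th) = C * r `^ (- th) * D); last by ring.
  by rewrite [leRHS]EFinM lee_wpmul2l// lee_fin mulr_ge0 ?powR_ge0.
split => p0.
- apply: (@le_trans _ _ (\int[mu2]_x (jb (1 + eta) (x.2 + y.2) * (jb ka (x.1 + y.1) * jb th (dot2 p x)))%:E)%E).
    apply: nnint_le; [exact: measurableT|exact: ml|exact: l0|exact: mp1|].
    move=> x _; rewrite mulrA ler_wpM2r ?jb_ge0// mulrC gE.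
    exact: (jb2_split (add2 x y) k0 e1).
  rewrite tonelli2; last 2 first.
  + by apply/measurable_EFinP; exact: mp1.
  + by move=> x; rewrite lee_fin !mulr_ge0 ?jb_ge0.
  apply: le_trans (fin y.2 `|p.1|); apply: ge0_le_integralT.
  + apply: (measurable_integral2 lam (f := fun x => (jb (1 + eta) (x.2 + y.2) * (jb ka (x.1 + y.1) * jb th (dot2 p x)))%:E)).
      by apply/measurable_EFinP; exact: mp1.
    by move=> x; rewrite lee_fin !mulr_ge0 ?jb_ge0.
  + by apply/measurable_EFinP; exact: mD.
  + by move=> x; apply: integral_ge0 => ? _; rewrite lee_fin !mulr_ge0 ?jb_ge0.
  move=> x2; rewrite /dot2 /= nnintZ ?jb_ge0//; last 2 first.
  + apply: measurable_funM; apply: measurable_jb; first exact: measurable_funD.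
    by apply: measurable_funD => //; exact: measurable_funM.
  + by move=> x; rewrite mulr_ge0 ?jb_ge0.
  by rewrite EFinM lee_wpmul2l ?lee_fin ?jb_ge0//; exact: hC.
- apply: (@le_trans _ _ (\int[mu2]_x (jb (1 + eta) (x.1 + y.1) * (jb ka (x.2 + y.2) * jb th (dot2 p x)))%:E)%E).
    apply: nnint_le; [exact: measurableT|exact: ml|exact: l0|exact: mp2|].
    move=> x _; rewrite mulrA ler_wpM2r ?jb_ge0// gE addrC.
    exact: (jb2_split (add2 x y) e1 k0).
  rewrite tonelli1; last 2 first.
  + by apply/measurable_EFinP; exact: mp2.
  + by move=> x; rewrite lee_fin !mulr_ge0 ?jb_ge0.
  apply: le_trans (fin y.1 `|p.2|); apply: ge0_le_integralT.
  + apply: (measurable_integral1 lam (f := fun x => (jb (1 + eta) (x.1 + y.1) * (jb ka (x.2 + y.2) * jb th (dot2 p x)))%:E)).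
      by apply/measurable_EFinP; exact: mp2.
    by move=> x; rewrite lee_fin !mulr_ge0 ?jb_ge0.
  + by apply/measurable_EFinP; exact: mD.
  + by move=> x; apply: integral_ge0 => ? _; rewrite lee_fin !mulr_ge0 ?jb_ge0.
  move=> x1; rewrite /dot2 /= nnintZ ?jb_ge0//; last 2 first.
  + apply: measurable_funM; apply: measurable_jb; first exact: measurable_funD.
    by apply: measurable_funD => //; exact: measurable_funM.
  + by move=> x; rewrite mulr_ge0 ?jb_ge0.
  rewrite EFinM lee_wpmul2l ?lee_fin ?jb_ge0//.
  apply: le_trans (hC p.2 y.2 (p.1 * x1) p0).
  by rewrite le_eqVlt; apply/orP; left; apply/eqP; apply: eq_integral => x _; rewrite addrC [X in jb th X]addrC.
Qed.

Lemma mul_le_pairl (a b Q : R) : 0 <= a -> 0 <= b -> 0 <= Q -> a <= Q -> a * b <= Q * (a + b).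
Proof. by move=> a0 b0 Q0 aQ; rewrite mulrDr ler_wpDl ?mulr_ge0 ?ler_wpM2r. Qed.

(** The larger of <u> and <v> is at least <p> / 2; its decay is converted into decay in p and the
    other factor is kept. *)
Lemma jb2_pair ga p u v : 0 <= ga -> bracket2 p <= bracket2 u + bracket2 v ->
  jb2 ga u * jb2 ga v <= 2 `^ ga * jb2 ga p * (jb2 ga u + jb2 ga v).
Proof.
move=> g0 puv; have p0 := bracket2_gt0 p; have h0 : 0 < bracket2 p / 2 by rewrite divr_gt0.
have Q0 : 0 <= 2 `^ ga * jb2 ga p by rewrite mulr_ge0 ?powR_ge0 ?jb2_ge0.
have e : 2 `^ ga * jb2 ga p = (bracket2 p / 2) `^ (- ga).
  by rewrite powRM ?(ltW p0)// -[2^-1]powR_inv1// -powRrM mulN1r opprK mulrC jb2E.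
have u0 := jb2_ge0 ga u; have v0 := jb2_ge0 ga v.
have [h|h] := leP (bracket2 u) (bracket2 v).
  have hv : jb2 ga v <= 2 `^ ga * jb2 ga p.
    by rewrite e; apply: powRN_anti => //; rewrite ler_pdivrMr// mulr_natr mulr2n (le_trans puv)// lerD2r.
  by rewrite mulrC addrC; exact: (mul_le_pairl v0 u0 Q0 hv).
have hu : jb2 ga u <= 2 `^ ga * jb2 ga p.
  by rewrite e; apply: powRN_anti => //; rewrite ler_pdivrMr// mulr_natr mulr2n (le_trans puv)// lerD2l ltW.
exact: (mul_le_pairl u0 v0 Q0 hu).
Qed.

Lemma measurable_jb2_add ga x : measurable_fun setT (fun q : E2 R => jb2 ga (add2 q x)).
Proof.
apply: measurable_jb2; apply: measurable_add2; [exact: measurable_id|exact: measurable_cst].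
Qed.

Lemma measurable_jb_dot2 th p : measurable_fun setT (fun q : E2 R => jb th (dot2 p q)).
Proof.
apply: measurable_jb; apply: measurable_dot2; [exact: measurable_cst|exact: measurable_id].
Qed.

(** The arguments q + xi and q + xi + p differ by p, so one of the two brackets yields <p>^(-ga).
    The other, together with <p.q>^(-th), yields a further |p_i|^(-th), where p_i is the larger
    coordinate and hence comparable to <p> unless p is small. *)
Lemma resonant_inner ga th : 1 < ga -> 0 < th -> th < 1 -> 2 < ga + th ->
  exists2 C, 0 <= C & forall xi p,
   (\int[mu2]_q (jb2 ga (add2 q xi) * jb2 ga (add2 q (add2 xi p)) * jb th (dot2 p q))%:E
     <= (C * jb2 (ga + th) p)%:E)%E.
Proof.
move=> g1 t0 t1 gt; have g0 : 0 <= ga by lra.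
have gg : 2 < ga + ga by lra.
have [C C0 hC] := jb2_convolution g0 g0 gg.
have [D D0 hD] := planar_oscillatory g1 t0 t1 gt.
exists (C * 2 `^ (ga + th) + 2 `^ ga * (2 * D * 2 `^ th)).
  by rewrite addr_ge0 ?mulr_ge0 ?powR_ge0.
move=> xi p.
have m1 := measurable_jb2_add ga xi; have m2 := measurable_jb2_add ga (add2 xi p).
have m3 := measurable_jb_dot2 th p.
have j0 := jb2_ge0 (ga + th) p.
have mI : measurable_fun setT (fun q : E2 R => jb2 ga (add2 q xi) * jb2 ga (add2 q (add2 xi p)) * jb th (dot2 p q)).
  by apply: measurable_funM => //; exact: measurable_funM.
have I0 q : 0 <= jb2 ga (add2 q xi) * jb2 ga (add2 q (add2 xi p)) * jb th (dot2 p q).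
  by rewrite !mulr_ge0 ?jb_ge0 ?jb2_ge0.
(* For bounded p every power of <p> is comparable to 1: the resonance factor is bounded by 1 and the
   convolution of the two brackets suffices. *)
have small : bracket2 p <= 2 -> (\int[mu2]_q (jb2 ga (add2 q xi) * jb2 ga (add2 q (add2 xi p)) * jb th (dot2 p q))%:E
     <= ((C * 2 `^ (ga + th) + 2 `^ ga * (2 * D * 2 `^ th)) * jb2 (ga + th) p)%:E)%E.
  move=> p2; apply: (@le_trans _ _ C%:E).
    apply: le_trans (hC xi (add2 xi p)); apply: nnint_le; [exact: measurableT|exact: mI|exact: I0|exact: (measurable_funM m1 m2)|].
    by move=> q _; rewrite ler_piMr ?mulr_ge0 ?jb2_ge0// jb_le1// ltW.
  rewrite lee_fin mulrDl; apply: ler_wpDr; first by rewrite !mulr_ge0 ?powR_ge0.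
  have h : 2 `^ (- (ga + th)) <= jb2 (ga + th) p.
    by rewrite jb2E; apply: powRN_anti => //; [exact: bracket2_gt0|rewrite addr_ge0// ltW].
  have := ler_wpM2l (mulr_ge0 C0 (powR_ge0 2 (ga + th))) h; apply: le_trans.
  by rewrite -mulrA -powRD ?subrr ?powRr0 ?mulr1// pnatr_eq0 implybT.
(* Here [P] stands for the modulus of a dominant coordinate of p, so that <p> <= 2 P. *)
have large (P : R) : 0 < P -> bracket2 p <= 2 * P ->
    (forall y, (\int[mu2]_x (jb2 ga (add2 x y) * jb th (dot2 p x))%:E <= (D * P `^ (- th))%:E)%E) ->
    (\int[mu2]_q (jb2 ga (add2 q xi) * jb2 ga (add2 q (add2 xi p)) * jb th (dot2 p q))%:E
     <= ((C * 2 `^ (ga + th) + 2 `^ ga * (2 * D * 2 `^ th)) * jb2 (ga + th) p)%:E)%E.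
  move=> P0 pP hP.
  pose Q := 2 `^ ga * jb2 ga p.
  have Q0 : 0 <= Q by rewrite mulr_ge0 ?powR_ge0 ?jb2_ge0.
  have ma := measurable_funM m1 m3; have mb := measurable_funM m2 m3.
  apply: (@le_trans _ _ (Q * (D * P `^ (- th) + D * P `^ (- th)))%:E).
    apply: nnint_majorant (hP xi) (hP (add2 xi p)).
    - exact: Q0.
    - exact: mI.
    - exact: I0.
    - exact: ma.
    - by move=> q; apply: mulr_ge0; [exact: jb2_ge0|exact: jb_ge0].
    - exact: mb.
    - by move=> q; apply: mulr_ge0; [exact: jb2_ge0|exact: jb_ge0].
    - move=> q; rewrite -mulrDl mulrA; apply: ler_wpM2r; first exact: jb_ge0.
      apply: jb2_pair; first exact: g0.
      have := bracket2_add (add2 q (add2 xi p)) (- (add2 q xi).1, - (add2 q xi).2).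
      rewrite bracket2N addrC; congr (bracket2 _ <= _).
      by rewrite /add2 [RHS]surjective_pairing /=; congr pair; ring.
  rewrite lee_fin mulrDl; apply: ler_wpDl; first by rewrite !mulr_ge0 ?powR_ge0.
  have hp : P `^ (- th) <= 2 `^ th * jb2 th p.
    rewrite jb2E -[2 `^ th](_ : 2^-1 `^ (- th) = _); last by rewrite -[2^-1]powR_inv1// -powRrM mulN1r opprK.
    rewrite mulrC -powRM ?(ltW (bracket2_gt0 _))//; apply: powRN_anti; rewrite ?(ltW t0)//.
      by rewrite divr_gt0 ?bracket2_gt0.
    by rewrite ler_pdivrMr// mulrC.
  have := ler_wpM2l (mulr_ge0 Q0 D0) hp; rewrite jb2D /Q.
  move: (2 `^ ga) (jb2 ga p) (2 `^ th) (jb2 th p) (P `^ (- th)) => a b c d e; nra.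
have sq : bracket2 p ^+ 2 = 1 + (p.1 ^+ 2 + p.2 ^+ 2) by rewrite bracket2_sqr.
have b0 := bracket2_gt0 p.
have [h1|h1] := leP `|p.1| 1; have [h2|h2] := leP `|p.2| 1.
- apply: small; rewrite -(@ler_pXn2r _ 2) ?nnegrE ?(ltW b0)// sq -[p.1 ^+ 2]real_normK ?num_real//.
  by rewrite -[p.2 ^+ 2]real_normK ?num_real//; have := normr_ge0 p.1; have := normr_ge0 p.2; nra.
- apply: (large `|p.2|); first exact: lt_trans h2.
    rewrite -(@ler_pXn2r _ 2) ?nnegrE ?(ltW b0) ?mulr_ge0// sq -[p.1 ^+ 2]real_normK ?num_real//.
    by rewrite -[p.2 ^+ 2]real_normK ?num_real//; have := normr_ge0 p.1; nra.
  by move=> y; apply: (hD y p).2; rewrite -normr_gt0 (lt_trans ltr01).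
- apply: (large `|p.1|); first exact: lt_trans h1.
    rewrite -(@ler_pXn2r _ 2) ?nnegrE ?(ltW b0) ?mulr_ge0// sq -[p.1 ^+ 2]real_normK ?num_real//.
    by rewrite -[p.2 ^+ 2]real_normK ?num_real//; have := normr_ge0 p.2; nra.
  by move=> y; apply: (hD y p).1; rewrite -normr_gt0 (lt_trans ltr01).
- have [h|h] := leP `|p.1| `|p.2|.
    apply: (large `|p.2|); first exact: lt_trans h2.
      rewrite -(@ler_pXn2r _ 2) ?nnegrE ?(ltW b0) ?mulr_ge0// sq -[p.1 ^+ 2]real_normK ?num_real//.
      by rewrite -[p.2 ^+ 2]real_normK ?num_real//; nra.
    by move=> y; apply: (hD y p).2; rewrite -normr_gt0 (lt_trans ltr01).
  apply: (large `|p.1|); first exact: lt_trans h1.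
    rewrite -(@ler_pXn2r _ 2) ?nnegrE ?(ltW b0) ?mulr_ge0// sq -[p.1 ^+ 2]real_normK ?num_real//.
    by rewrite -[p.2 ^+ 2]real_normK ?num_real//; nra.
  by move=> y; apply: (hD y p).1; rewrite -normr_gt0 (lt_trans ltr01).
Qed.

(** No lower bound on p is available here, so the loss |p_1|^(-th) of the inner integral is kept and
    integrated in p_1: it is locally integrable because th < 1, and a share of <p>^(-mu) takes care
    of infinity. *)
Lemma resonant_low ga mu th : 1 < ga -> 1 < mu -> 0 < th -> th < 1 -> 2 < ga + th -> 2 < mu + th ->
  exists2 C, 0 <= C &
   (\int[mu2]_p \int[mu2]_q (jb2 mu p * (jb2 ga q * jb th (dot2 p q)))%:E <= C%:E)%E.
Proof.
move=> g1 m1 t0 t1 gt mt.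
have [D D0 hD] := planar_oscillatory g1 t0 t1 gt.
pose eta := (mu + th - 2) / 2; pose ka := mu - 1 - eta.
have e0 : 1 < 1 + eta by rewrite /eta; lra.
have e1 : 0 <= 1 + eta by rewrite /eta; lra.
have k0 : 0 <= ka by rewrite /ka /eta; lra.
have kt : 1 < ka + th by rewrite /ka /eta; lra.
have gE : mu = ka + (1 + eta) by rewrite /ka; lra.
have [A A0 hA] := jb_integral e0; have [B B0 hB] := jb_abs_integral k0 t0 t1 kt.
exists (A * (D * B)); first by rewrite !mulr_ge0.
have mf : measurable_fun setT (fun x : E2 R * E2 R => (jb2 mu x.1 * (jb2 ga x.2 * jb th (dot2 x.1 x.2)))%:E).
  apply/measurable_EFinP; apply: measurable_funM; first exact: measurable_jb2.
  apply: measurable_funM; first exact: measurable_jb2.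
  by apply: measurable_jb; exact: measurable_dot2.
have f0 (x : E2 R * E2 R) : (0 <= (jb2 mu x.1 * (jb2 ga x.2 * jb th (dot2 x.1 x.2)))%:E)%E.
  by rewrite lee_fin !mulr_ge0 ?jb2_ge0 ?jb_ge0.
have mF := measurable_integral1 mu2 mf f0.
rewrite (tonelli2 lam lam (f := fun p => \int[mu2]_q (jb2 mu p * (jb2 ga q * jb th (dot2 p q)))%:E)%E) //; last first.
  by move=> p; apply: integral_ge0 => q _; exact: (f0 (p, q)).
have mk := measurable_jb_abs ka th.
have mG (x2 : R) : measurable_fun [set: mR R] (fun x1 : mR R => jb (1 + eta) x2 * (D * (jb ka x1 * `|x1| `^ (- th)))).
  by apply: measurable_funM => //; exact: measurable_funM.
apply: (@le_trans _ _ (\int[lam]_x2 ((D * B) * jb (1 + eta) x2)%:E)%E); last first.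
  rewrite nnintZ ?mulr_ge0//; last 2 first.
  - exact: measurable_jb.
  - by move=> x; exact: jb_ge0.
  by rewrite [leRHS](_ : _ = (D * B)%:E * A%:E)%E ?lee_wpmul2l ?lee_fin ?mulr_ge0// -EFinM mulrC.
apply: ge0_le_integralT.
- apply: (measurable_integral2 lam (f := fun p => \int[mu2]_q (jb2 mu p * (jb2 ga q * jb th (dot2 p q)))%:E)%E) => //.
  by move=> p; apply: integral_ge0 => q _; exact: (f0 (p, q)).
- by apply/measurable_EFinP; apply: measurable_funM => //; exact: measurable_jb.
- by move=> x2; apply: integral_ge0 => x1 _; apply: integral_ge0 => q _; exact: (f0 (_, q)).
move=> x2.
apply: (@le_trans _ _ (\int[lam]_x1 (jb (1 + eta) x2 * (D * (jb ka x1 * `|x1| `^ (- th))))%:E)%E); last first.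
  rewrite nnintZ ?jb_ge0//; last 2 first.
  - exact: measurable_funM.
  - by move=> x; rewrite !mulr_ge0 ?jb_ge0 ?powR_ge0.
  rewrite nnintZ//; last by move=> x; rewrite !mulr_ge0 ?jb_ge0 ?powR_ge0.
  rewrite [leRHS](_ : _ = (jb (1 + eta) x2)%:E * (D%:E * B%:E))%E; last by rewrite -!EFinM mulrC.
  by rewrite lee_wpmul2l ?lee_fin ?jb_ge0// lee_wpmul2l ?lee_fin.
(* The inner bound is available for p_1 nonzero, hence a comparison almost everywhere. *)
apply: ae_ge0_le_integral => //.
- by move=> x1 _; apply: integral_ge0 => q _; exact: (f0 (_, q)).
- have := measurable_fun_pair1 x2 mF; exact.
- by move=> x1 _; rewrite lee_fin !mulr_ge0 ?jb_ge0 ?powR_ge0.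
- exact/measurable_EFinP.
apply: ae_imply (@ae_neq0 R) => x1 x10 _.
have mq : measurable_fun setT (fun q : E2 R => jb2 ga q * jb th (dot2 (x1, x2) q)).
  by apply: measurable_funM; [exact: (@measurable_jb2 _ _ _ _ id)|exact: measurable_jb_dot2].
rewrite nnintZ ?jb2_ge0//; last by move=> q; rewrite mulr_ge0 ?jb2_ge0 ?jb_ge0.
have h1 : (\int[mu2]_q (jb2 ga q * jb th (dot2 (x1, x2) q))%:E <= (D * `|x1| `^ (- th))%:E)%E.
  have [h _] := hD ((0, 0)) ((x1, x2) : R * R); apply: le_trans (h x10).
  rewrite le_eqVlt; apply/orP; left; apply/eqP; apply: eq_integral => -[q1 q2] _.
  by rewrite /add2 /= !addr0.
apply: (@le_trans _ _ ((jb2 mu (x1, x2))%:E * (D * `|x1| `^ (- th))%:E)%E).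
  by rewrite lee_wpmul2l ?lee_fin ?jb2_ge0.
rewrite -EFinM lee_fin [leRHS](_ : _ = jb ka x1 * jb (1 + eta) x2 * (D * `|x1| `^ (- th))); last by ring.
rewrite ler_wpM2r ?mulr_ge0 ?powR_ge0// {1}gE; exact: (jb2_split (x1, x2) k0 e1).
Qed.

End planar.

(** * Trilinear weights *)

Section weights.
Context {R : realType}.
Implicit Types (s a ga k t th be A B D N P Q : R).

Lemma powR_ge1_mono (x r s : R) : 1 <= x -> r <= s -> x `^ r <= x `^ s.
Proof. by move=> x1 rs; exact: ler_powR. Qed.

Lemma powR_base_mono (x y r : R) : 0 <= r -> 0 < x -> x <= y -> x `^ r <= y `^ r.
Proof.
by move=> r0 x0 xy; apply: ge0_ler_powR => //; rewrite nnegrE ltW// (lt_le_trans x0).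
Qed.

Lemma powR_half (x r : R) : 0 < x -> (x / 2) `^ (- r) = 2 `^ r * x `^ (- r).
Proof.
by move=> x0; rewrite powRM ?(ltW x0)// -[2^-1]powR_inv1// -powRrM mulN1r opprK mulrC.
Qed.

(** If N <= 4 P or N <= 4 Q, the growing power of N is charged to P or to Q. Otherwise A, B and D
    all exceed N / 2, so that the whole expression is at most a multiple of N^(-2 ga + k) = N^(-ga)
    N^(-(ga - k)), and N can be lowered to Q in one factor and to P in the other. *)
Lemma frequency_split ga k A B D N P Q : 0 < ga -> 0 <= k -> k <= ga ->
  1 <= A -> 1 <= B -> 1 <= D -> 1 <= N -> 1 <= P -> 1 <= Q ->
  N <= A + P -> N <= B + Q -> N <= D + (P + Q) ->
  N `^ (ga + k) * (A `^ (- ga) * B `^ (- ga) * D `^ (- ga)) <=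
  (4 `^ (ga + k) + 2 `^ ga * 2 `^ ga * 2 `^ ga) *
  (A `^ (- ga) * B `^ (- ga) * D `^ (- ga) * P `^ (ga + k) +
   A `^ (- ga) * B `^ (- ga) * D `^ (- ga) * Q `^ (ga + k) + Q `^ (- ga) * P `^ (- (ga - k))).
Proof.
move=> g0 k0 kg A1 B1 D1 N1 P1 Q1 h1 h2 h3.
have pos (x : R) : 1 <= x -> 0 < x by exact: lt_le_trans.
set T := A `^ (- ga) * B `^ (- ga) * D `^ (- ga).
have T0 : 0 <= T by rewrite !mulr_ge0 ?powR_ge0.
have gk0 : 0 <= ga + k by rewrite addr_ge0// ltW.
have large (x : R) : 1 <= x -> N <= 4 * x -> N `^ (ga + k) * T <= 4 `^ (ga + k) * (T * x `^ (ga + k)).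
  move=> x1 Nx; rewrite mulrC [4 `^ _ * _]mulrCA ler_wpM2l// -powRM ?(ltW (pos _ x1))//.
  exact: powR_base_mono (pos _ N1) Nx.
have u0 : 0 <= 4 `^ (ga + k) := powR_ge0 _ _.
have v0 : 0 <= 2 `^ ga * 2 `^ ga * 2 `^ ga by rewrite !mulr_ge0 ?powR_ge0.
have a0 : 0 <= T * P `^ (ga + k) by rewrite mulr_ge0 ?powR_ge0.
have b0 : 0 <= T * Q `^ (ga + k) by rewrite mulr_ge0 ?powR_ge0.
have c0 : 0 <= Q `^ (- ga) * P `^ (- (ga - k)) by rewrite mulr_ge0 ?powR_ge0.
have [hP|hP] := leP N (4 * P).
  apply: (le_trans (large P P1 hP)); apply: ler_pM => //; first by rewrite lerDl.
  by rewrite -addrA lerDl addr_ge0.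
have [hQ|hQ] := leP N (4 * Q).
  apply: (le_trans (large Q Q1 hQ)); apply: ler_pM => //; first by rewrite lerDl.
  by rewrite addrAC lerDr addr_ge0.
apply: (@le_trans _ _ (2 `^ ga * 2 `^ ga * 2 `^ ga * (Q `^ (- ga) * P `^ (- (ga - k))))); last first.
  by apply: ler_pM => //; [rewrite lerDr|rewrite lerDr addr_ge0].
have half (x : R) : N / 2 <= x -> x `^ (- ga) <= 2 `^ ga * N `^ (- ga).
  move=> hx; rewrite -powR_half ?pos//; apply: powRN_anti; rewrite ?(ltW g0)//.
  by rewrite divr_gt0// pos.
have hA : N / 2 <= A by lra.
have hB : N / 2 <= B by lra.
have hD : N / 2 <= D by lra.
have hT : T <= (2 `^ ga * N `^ (- ga)) * (2 `^ ga * N `^ (- ga)) * (2 `^ ga * N `^ (- ga)).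
  by apply: ler_pM; rewrite ?mulr_ge0 ?powR_ge0 ?half//; apply: ler_pM; rewrite ?powR_ge0 ?half.
apply: (le_trans (ler_wpM2l (powR_ge0 N (ga + k)) hT)).
have N0 : N != 0 by rewrite gt_eqF// pos.
have e : N `^ (ga + k) * (N `^ (- ga) * N `^ (- ga) * N `^ (- ga)) = N `^ (- ga) * N `^ (- (ga - k)).
  rewrite -!powRD ?N0 ?implybT//; congr (_ `^ _); ring.
rewrite (_ : N `^ (ga + k) * _ = 2 `^ ga * 2 `^ ga * 2 `^ ga * (N `^ (- ga) * N `^ (- (ga - k)))); last first.
  by rewrite -e; ring.
apply: ler_wpM2l => //; apply: ler_pM; rewrite ?powR_ge0//; apply: powRN_anti; rewrite ?pos ?(ltW g0) ?subr_ge0//; lra.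
Qed.

(* The exponent s can be large; trading [t] powers of brackets reduces it to
   ga / 2 < 1, the range where the integrals over frequencies are estimated. *)
Lemma frequency_reduce s a ga k t A B D N : 0 <= t -> 2 * s = ga + t -> 2 * (s + a) <= ga + k + t ->
  1 <= A -> 1 <= B -> 1 <= D -> 1 <= N -> N <= A + B + D ->
  N `^ (2 * (s + a)) * (A `^ (- (2 * s)) * B `^ (- (2 * s)) * D `^ (- (2 * s))) <=
  3 `^ t * (N `^ (ga + k) * (A `^ (- ga) * B `^ (- ga) * D `^ (- ga))).
Proof.
move=> t0 es ea A1 B1 D1 N1 NABD.
have pos (x : R) : 1 <= x -> 0 < x by exact: lt_le_trans.
have pw (x r q : R) : 1 <= x -> x `^ (r + q) = x `^ r * x `^ q.
  by move=> x1; rewrite powRD// (gt_eqF (pos _ x1)) implybT.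
have h1 : N `^ (2 * (s + a)) <= N `^ (ga + k) * N `^ t by rewrite -pw//; exact: powR_ge1_mono.
(* For numbers at least 1, the sum A + B + D is at most 3 A B D. *)
have h2 : N `^ t <= 3 `^ t * (A `^ t * B `^ t * D `^ t).
  have [A0 B0 D0] := And3 (ltW (pos _ A1)) (ltW (pos _ B1)) (ltW (pos _ D1)).
  rewrite -!powRM ?mulr_ge0//; apply: powR_base_mono => //; first exact: pos.
  apply: (le_trans NABD); have AB : 1 <= A * B by nra.
  nra.
have e (x : R) : 1 <= x -> x `^ (- (2 * s)) * x `^ t = x `^ (- ga).
  by move=> x1; rewrite -pw// es; congr (_ `^ _); ring.
rewrite -!(e _ A1) -!(e _ B1) -!(e _ D1).
have X0 : 0 <= A `^ (- (2 * s)) * B `^ (- (2 * s)) * D `^ (- (2 * s)) by rewrite !mulr_ge0 ?powR_ge0.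
apply: (le_trans (ler_wpM2r X0 h1)).
have := ler_wpM2l (mulr_ge0 (powR_ge0 N (ga + k)) X0) h2.
rewrite (_ : N `^ (ga + k) * (A `^ (- (2 * s)) * B `^ (- (2 * s)) * D `^ (- (2 * s))) * N `^ t =
  N `^ (ga + k) * N `^ t * (A `^ (- (2 * s)) * B `^ (- (2 * s)) * D `^ (- (2 * s)))); last by ring.
move/le_trans; apply; rewrite le_eqVlt; apply/orP; left; apply/eqP; ring.
Qed.

Lemma jb_double th (x y : R) : 0 <= th -> `|y| <= 2 * `|x| -> jb th x <= 2 `^ th * jb th y.
Proof.
move=> t0 yx; rewrite !jbE -powR_half ?bracket_gt0//.
apply: powRN_anti => //; first by rewrite divr_gt0// bracket_gt0.
rewrite ler_pdivrMr// -(@ler_pXn2r _ 2) ?nnegrE ?mulr_ge0 ?(ltW (bracket_gt0 _))//.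
rewrite exprMn !bracket_sqr -[x ^+ 2]real_normK ?num_real// -[y ^+ 2]real_normK ?num_real//.
by have := normr_ge0 y; have := normr_ge0 x; nra.
Qed.

(** The four moduli add up to at least 2 |w|, so one of them is at least |w| / 2. Its factor pays
    for [jb th w], which th <= be allows for each of the four. Among the other factors, two with
    indices in {1, 2, 3} are kept and the rest is bounded by 1. *)
Lemma modulation_split th be (w s0 s1 s2 s3 : R) : 0 <= th -> th <= be ->
  s1 + s3 - s2 - s0 = - (2 * w) ->
  jb th s0 * (jb be s1 * jb be s2 * jb be s3) <=
  2 `^ th * jb th w * (jb be s1 * jb be s3 + jb be s2 * jb be s3 + jb be s1 * jb be s2).
Proof.
move=> t0 tb ew.
have b0 : 0 <= be by exact: le_trans tb.
have W0 : 0 <= 2 `^ th * jb th w by rewrite mulr_ge0 ?powR_ge0 ?jb_ge0.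
have g x : 0 <= jb be x <= 1 by rewrite jb_ge0 jb_le1.
have hb x : `|w| <= 2 * `|x| -> jb be x <= 2 `^ th * jb th w.
  by move=> h; apply: (le_trans (jb_exp_mono _ tb)); exact: jb_double.
have ht x : 0 <= jb th x <= 1 by rewrite jb_ge0 jb_le1.
have := hb s1; have := hb s2; have := hb s3; have := @jb_double th s0 w t0.
have := g s1; have := g s2; have := g s3; have := ht s0.
move: (jb be s1) (jb be s2) (jb be s3) (jb th s0) (2 `^ th * jb th w) W0 => x y z u W W0.
move=> /andP[u0 u1] /andP[z0 z1] /andP[y0 y1] /andP[x0 x1] hu hz hy hx.
have aux (p q r v : R) : 0 <= p -> p <= W -> 0 <= q -> 0 <= r -> 0 <= v -> v <= 1 -> p * (q * r * v) <= W * (q * r).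
  move=> p0 pW q0 r0 v0 v1; apply: ler_pM => //; first by rewrite !mulr_ge0.
  by rewrite ler_piMr ?mulr_ge0.
have [xz yz xy] : [/\ 0 <= W * (x * z), 0 <= W * (y * z) & 0 <= W * (x * y)] by rewrite !mulr_ge0.
rewrite !mulrDr.
have [h0|h0] := leP `|w| (2 * `|s0|).
  have := aux u x z y u0 (hu h0) x0 z0 y0 y1.
  by rewrite (_ : x * z * y = x * y * z); [lra|ring].
have [h1|h1] := leP `|w| (2 * `|s1|).
  have := aux x y z u x0 (hx h1) y0 z0 u0 u1.
  by rewrite (_ : x * (y * z * u) = u * (x * y * z)); [lra|ring].
have [h2|h2] := leP `|w| (2 * `|s2|).
  have := aux y x z u y0 (hy h2) x0 z0 u0 u1.
  by rewrite (_ : y * (x * z * u) = u * (x * y * z)); [lra|ring].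
have [h3|h3] := leP `|w| (2 * `|s3|).
  have := aux z x y u z0 (hz h3) x0 y0 u0 u1.
  by rewrite (_ : z * (x * y * u) = u * (x * y * z)); [lra|ring].
exfalso.
have : `|2 * w| <= `|s1| + `|s3| + `|s2| + `|s0|.
  rewrite -normrN -ew.
  by apply: (le_trans (ler_normB _ _)); rewrite lerD2r; apply: (le_trans (ler_normB _ _)); rewrite lerD2r ler_normD.
rewrite normrM ger0_norm//; lra.
Qed.

(** Any two of the forms r + a1, r + u + a2, u + a3 are independent: in each product some variable
    occurs in just one factor and is integrated first, the exponent being above 1. *)
Lemma modulation_integral be : 1 < be -> exists2 C, 0 <= C & forall a1 a2 a3 : R,
  (\int[prodm (lam R) (lam R)]_p (jb be (p.2 + a1) * jb be (p.1 + a3) +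
    jb be (p.2 + p.1 + a2) * jb be (p.1 + a3) + jb be (p.2 + a1) * jb be (p.2 + p.1 + a2))%:E <= C%:E)%E.
Proof.
move=> b1; have [M M0 hM] := jb_integral b1.
exists (M * M + M * M + M * M); first by rewrite !addr_ge0 ?mulr_ge0.
move=> a1 a2 a3.
have m1 := @measurable_fst _ _ (mR R) (mR R); have m2 := @measurable_snd _ _ (mR R) (mR R).
have f1 : measurable_fun setT (fun p : mR R * mR R => jb be (p.2 + a1)).
  by apply: measurable_jb; exact: measurable_funD.
have f3 : measurable_fun setT (fun p : mR R * mR R => jb be (p.1 + a3)).
  by apply: measurable_jb; exact: measurable_funD.
have f2 : measurable_fun setT (fun p : mR R * mR R => jb be (p.2 + p.1 + a2)).
  by apply: measurable_jb; apply: measurable_funD => //; exact: measurable_funD.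
have g13 := measurable_funM f1 f3; have g23 := measurable_funM f2 f3; have g12 := measurable_funM f1 f2.
have pos (x y : R) : 0 <= jb be x * jb be y by apply: mulr_ge0; exact: jb_ge0.
have sh (c : R) : (\int[lam R]_x (jb be (x + c))%:E <= M%:E)%E by rewrite integral_jb_shift.
have fix2 (w c : R) : 0 <= w -> (\int[lam R]_x (w * jb be (x + c))%:E <= (M * w)%:E)%E.
  move=> w0; rewrite mulrC EFinM nnintZ; [|exact: measurableT|exact: w0| |by move=> x; exact: jb_ge0].
    by apply: lee_wpmul2l; [rewrite lee_fin|exact: sh].
  by apply: measurable_jb; exact: measurable_funD.
have outer (c : R) : (\int[lam R]_x (M * jb be (x + c))%:E <= (M * M)%:E)%E by exact: fix2.
have mM (c : R) : measurable_fun [set: mR R] (fun x : mR R => M * jb be (x + c)).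
  by apply: measurable_funM => //; apply: measurable_jb; exact: measurable_funD.
have p3 (p : mR R * mR R) : 0 <= jb be (p.2 + a1) * jb be (p.2 + p.1 + a2) by exact: pos.
have p2 (p : mR R * mR R) : 0 <= jb be (p.2 + p.1 + a2) * jb be (p.1 + a3) by exact: pos.
have p1 (p : mR R * mR R) : 0 <= jb be (p.2 + a1) * jb be (p.1 + a3) by exact: pos.
rewrite nnintD; [|exact: measurableT|exact: measurable_funD g13 g23|by move=> p; rewrite addr_ge0|exact: g12|exact: p3].
rewrite nnintD; [|exact: measurableT|exact: g13|exact: p1|exact: g23|exact: p2].
rewrite !EFinD; apply: leeD; first apply: leeD.
- apply: tonelli1_le; [exact: g13|exact: p1|exact: (mM a3)| |exact: (outer a3)] => x /=.
  by under eq_integral do rewrite mulrC; exact: fix2 (jb_ge0 _ _).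
- apply: tonelli1_le; [exact: g23|exact: p2|exact: (mM a3)| |exact: (outer a3)] => x /=.
  by under eq_integral do rewrite mulrC -addrA; exact: fix2 (jb_ge0 _ _).
- apply: tonelli2_le; [exact: g12|exact: p3|exact: (mM a1)| |exact: (outer a1)] => x /=.
  by under eq_integral do rewrite [x + _ + _]addrAC addrC; exact: fix2 (jb_ge0 _ _).
Qed.

End weights.

Lemma measurable_normsq2 d (T : measurableType d) (R : realType) (f : T -> E2 R) :
  measurable_fun setT f -> measurable_fun setT (fun t => normsq2 (f t)).
Proof.
move=> mf; apply: measurable_funD; apply: measurable_funX.
- exact: (measurableT_comp measurable_fst mf).
- exact: (measurableT_comp measurable_snd mf).
Qed.

Ltac measurability_step :=
  lazymatch goal with
  | |- measurable_fun _ (fun x => @GRing.mul _ (@?f x) (@?g x)) => apply: (@measurable_funM _ _ _ _ f g)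
  | |- measurable_fun _ (fun x => @GRing.add _ (@?f x) (@?g x)) => apply: (@measurable_funD _ _ _ _ f g)
  | |- measurable_fun _ (fun x => jb2 _ (@?f x)) => apply: measurable_jb2
  | |- measurable_fun _ (fun x => jb _ (@?f x)) => apply: measurable_jb
  | |- measurable_fun _ (fun x => add2 (@?f x) (@?g x)) => apply: measurable_add2
  | |- measurable_fun _ (fun x => dot2 (@?f x) (@?g x)) => apply: measurable_dot2
  | |- measurable_fun _ (fun x => add3 (@?f x) (@?g x)) => apply: measurable_add3
  | |- measurable_fun _ (fun x => normsq2 (@?f x)) => apply: measurable_normsq2
  | |- measurable_fun _ (fun x => x) => exact: measurable_id
  | |- measurable_fun _ (fun x => fst x) => exact: measurable_fst
  | |- measurable_fun _ (fun x => snd x) => exact: measurable_snd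
  | |- measurable_fun _ fst => exact: measurable_fst
  | |- measurable_fun _ snd => exact: measurable_snd
  | |- measurable_fun _ (fun x => fst (@?f x)) => apply: (measurableT_comp (g := f) measurable_fst)
  | |- measurable_fun _ (fun x => snd (@?f x)) => apply: (measurableT_comp (g := f) measurable_snd)
  | |- measurable_fun _ _ => exact: measurable_cst
  end.

(** * Majorant of the trilinear weight and its integral over the spatial frequencies *)

Section trilinear_weights.
Context {R : realType}.
Implicit Types (p q xi : R * R) (zeta : R * R * R).
Local Notation lam := (lam R).
Local Notation mu2 := (mu2 R).
Local Notation mu3 := (mu3 R).

Lemma add2C p q : add2 p q = add2 q p.
Proof. by rewrite /add2 addrC [p.2 + _]addrC. Qed.

Section resonant.
Variables (ga k th : R).
Hypotheses (k0 : 0 <= k) (kth : k <= th) (t0 : 0 < th) (t1 : th < 1) (g1 : 1 < ga - k) (gt : 2 < ga - k + th).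

(* What remains, after integration over the modulations, of the contribution of
   <p> >= <xi>/4; by symmetry, exchanging p and q gives that of <q> >= <xi>/4,
   and [low_term] is what remains when all frequencies are of size <xi>. *)
Definition resonant_term xi p q : R :=
  jb2 ga (add2 p xi) * jb2 (- (ga + k)) p *
  (jb2 ga (add2 q xi) * jb2 ga (add2 q (add2 xi p)) * jb th (dot2 p q)).

Definition low_term p q : R := jb2 (ga - k) p * (jb2 ga q * jb th (dot2 p q)).

Lemma resonant_term_ge0 xi p q : 0 <= resonant_term xi p q.
Proof.
apply: mulr_ge0; first by apply: mulr_ge0; exact: jb2_ge0.
by apply: mulr_ge0; [apply: mulr_ge0; exact: jb2_ge0|exact: jb_ge0].
Qed.

Lemma low_term_ge0 p q : 0 <= low_term p q.
Proof. by apply: mulr_ge0; [exact: jb2_ge0|apply: mulr_ge0; [exact: jb2_ge0|exact: jb_ge0]]. Qed.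

Lemma measurable_resonant_term d (T : measurableType d) xi (f g : T -> E2 R) :
  measurable_fun setT f -> measurable_fun setT g ->
  measurable_fun setT (fun x => resonant_term xi (f x) (g x)).
Proof. by move=> mf mg; rewrite /resonant_term; do ![exact: mf|exact: mg|measurability_step]. Qed.

Lemma measurable_low_term d (T : measurableType d) (f g : T -> E2 R) :
  measurable_fun setT f -> measurable_fun setT g ->
  measurable_fun setT (fun x => low_term (f x) (g x)).
Proof. by move=> mf mg; rewrite /low_term; do ![exact: mf|exact: mg|measurability_step]. Qed.

(** The inner estimate leaves <p>^(k-th) <p+xi>^(-ga), whose integral is bounded uniformly in xi
    because k <= th and ga + th - k > 2. The intermediate majorant [h] is exposed, since the same
    function serves the two resonant terms, which are integrated in opposite orders. *)
Lemma resonant_integral : exists2 C, 0 <= C & forall xi h,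
  (forall p, measurable_fun setT (fun q : E2 R => resonant_term xi p q)) -> h = (fun p : E2 R =>
    C * (jb2 ga (add2 p xi) * jb2 (th - k) (add2 p (0, 0)))) ->
  [/\ measurable_fun setT h, forall p, (\int[mu2]_q (resonant_term xi p q)%:E <= (h p)%:E)%E &
   (\int[mu2]_p (h p)%:E <= (C * C)%:E)%E].
Proof.
have ga1 : 1 < ga by move: k0 g1; lra.
have gt' : 2 < ga + th by move: k0 gt; lra.
have [C C0 hC] := resonant_inner ga1 t0 t1 gt'.
have ga0 : 0 <= ga by move: k0 g1; lra.
have tk0 : 0 <= th - k by rewrite subr_ge0.
have gk : 2 < ga + (th - k) by move: gt; lra.
have [D D0 hD] := jb2_convolution ga0 tk0 gk.
(* One constant serves twice: as the factor in [h], where C is needed, and as the bound of the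
   remaining integral, where D is. *)
exists (C + D); first exact: addr_ge0.
move=> xi h mr ->.
have mh : measurable_fun setT (fun p : E2 R => jb2 ga (add2 p xi) * jb2 (th - k) (add2 p (0, 0))).
  by do !measurability_step.
split.
- by apply: measurable_funM; [exact: measurable_cst|exact: mh].
- move=> p; rewrite nnintZ; [|exact: measurableT|by apply: mulr_ge0; exact: jb2_ge0| |]; last 2 first.
  + exact: (measurable_funM (measurable_funM (measurable_jb2_add ga xi) (measurable_jb2_add ga (add2 xi p))) (measurable_jb_dot2 th p)).
  + by move=> q; apply: mulr_ge0; [apply: mulr_ge0; exact: jb2_ge0|exact: jb_ge0].
  apply: (@le_trans _ _ ((jb2 ga (add2 p xi) * jb2 (- (ga + k)) p)%:E * (C * jb2 (ga + th) p)%:E)%E).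
    by apply: lee_wpmul2l; [rewrite lee_fin; apply: mulr_ge0; exact: jb2_ge0|exact: hC].
  rewrite -EFinM lee_fin.
  have -> : add2 p (0, 0) = p by rewrite /add2 !addr0 -surjective_pairing.
  rewrite mulrCA -mulrA -jb2D (_ : - (ga + k) + (ga + th) = th - k); last by ring.
  apply: ler_wpM2r; first by apply: mulr_ge0; exact: jb2_ge0.
  by rewrite lerDl.
- rewrite nnintZ; [|exact: measurableT|exact: addr_ge0|exact: mh|by move=> p; apply: mulr_ge0; exact: jb2_ge0].
  apply: (@le_trans _ _ ((C + D)%:E * D%:E)%E).
    by apply: lee_wpmul2l; [rewrite lee_fin addr_ge0|exact: hD].
  by rewrite -EFinM lee_fin ler_wpM2l ?addr_ge0// lerDr.
Qed.

Lemma spatial_integral : exists2 C, 0 <= C & forall xi,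
  (\int[prodm mu2 mu2]_z (resonant_term xi z.2 z.1 + resonant_term xi z.1 z.2 + low_term z.2 z.1)%:E <= C%:E)%E.
Proof.
have [C C0 hC] := resonant_integral.
have ga1 : 1 < ga by move: k0 g1; lra.
have gt' : 2 < ga + th by move: k0 gt; lra.
have [D D0 hD] := resonant_low ga1 g1 t0 t1 gt' gt.
exists (C * C + C * C + D); first by rewrite !addr_ge0 ?mulr_ge0.
move=> xi.
have mf : measurable_fun setT (fun z : E2 R * E2 R => z.1) by exact: measurable_fst.
have ms : measurable_fun setT (fun z : E2 R * E2 R => z.2) by exact: measurable_snd.
have r1 := measurable_resonant_term xi ms mf.
have r2 := measurable_resonant_term xi mf ms.
have r3 := measurable_low_term ms mf.
have [] := hC xi _ (fun p => measurable_resonant_term xi (measurable_cst p) (@measurable_id _ _ _)) erefl.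
set h := (fun p : E2 R => _) => mh hh ih.
have z1 (z : E2 R * E2 R) : 0 <= resonant_term xi z.2 z.1 by exact: resonant_term_ge0.
have z2 (z : E2 R * E2 R) : 0 <= resonant_term xi z.1 z.2 by exact: resonant_term_ge0.
have z3 (z : E2 R * E2 R) : 0 <= low_term z.2 z.1 by exact: low_term_ge0.
rewrite nnintD; [|exact: measurableT|exact: (measurable_funD r1 r2)|by move=> z; apply: addr_ge0; [exact: z1|exact: z2]|exact: r3|exact: z3].
rewrite nnintD; [|exact: measurableT|exact: r1|exact: z1|exact: r2|exact: z2].
rewrite !EFinD; apply: leeD; first apply: leeD.
- by apply: tonelli2_le; [exact: r1|exact: z1|exact: mh|exact: hh|exact: ih].
- by apply: tonelli1_le; [exact: r2|exact: z2|exact: mh|exact: hh|exact: ih].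
- rewrite tonelli2; [exact: hD|exact/measurable_EFinP|by move=> z; rewrite lee_fin; exact: z3].
Qed.

End resonant.

(** The inverse square of [Xweight], in terms of the doubled exponents s2 = 2 s and be = 2 b. *)
Definition weight_inv2 (s2 be : R) zeta : R := jb2 s2 zeta.1 * jb be (zeta.2 + normsq2 zeta.1).

Lemma weight_inv2_ge0 s2 be zeta : 0 <= weight_inv2 s2 be zeta.
Proof. by apply: mulr_ge0; [exact: jb2_ge0|exact: jb_ge0]. Qed.

Lemma measurable_weight_inv2 d (T : measurableType d) s2 be (f : T -> E3 R) :
  measurable_fun setT f -> measurable_fun setT (fun x => weight_inv2 s2 be (f x)).
Proof. by move=> mf; rewrite /weight_inv2; do ![exact: mf|measurability_step]. Qed.

Lemma bracket2_opp p q : bracket2 q <= bracket2 (add2 q p) + bracket2 p.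
Proof.
have := bracket2_add (add2 q p) (- p.1, - p.2); rewrite bracket2N; congr (bracket2 _ <= _).
by rewrite /add2 /= !addrK -surjective_pairing.
Qed.

(** The three points are zeta1 = zeta + (p, r), zeta3 = zeta + (q, u) and zeta2 = zeta + (p, r) +
    (q, u). The frequency estimates act on the brackets of the spatial parts and the modulation
    estimate on the rest, so the majorant separates into a function of (p, q) times one whose
    dependence on r and u is explicit. *)
Lemma trilinear_pointwise (s a ga k t th be : R) : 0 <= t -> 2 * s = ga + t ->
  2 * (s + a) <= ga + k + t -> 0 < ga -> 0 <= k -> k <= ga -> 0 <= th -> th <= be ->
  exists2 C, 0 <= C & forall zeta p q (r u : R),
  jb2 (- (2 * (s + a))) zeta.1 * jb th (zeta.2 + normsq2 zeta.1) *
   (weight_inv2 (2 * s) be (add3 zeta (p, r)) * weight_inv2 (2 * s) be (add3 zeta (add3 (p, r) (q, u))) *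
    weight_inv2 (2 * s) be (add3 zeta (q, u))) <=
  C * (resonant_term ga k th zeta.1 p q + resonant_term ga k th zeta.1 q p + low_term ga k th p q) *
  (jb be (r + (zeta.2 + normsq2 (add2 zeta.1 p))) * jb be (u + (zeta.2 + normsq2 (add2 zeta.1 q))) +
   jb be (r + u + (zeta.2 + normsq2 (add2 zeta.1 (add2 p q)))) * jb be (u + (zeta.2 + normsq2 (add2 zeta.1 q))) +
   jb be (r + (zeta.2 + normsq2 (add2 zeta.1 p))) * jb be (r + u + (zeta.2 + normsq2 (add2 zeta.1 (add2 p q))))).
Proof.
move=> t0 es ea g0 k0 kg th0 tb.
pose K := 3 `^ t * (4 `^ (ga + k) + 2 `^ ga * 2 `^ ga * 2 `^ ga).
have K0 : 0 <= K by rewrite mulr_ge0 ?addr_ge0 ?mulr_ge0 ?powR_ge0.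
exists (K * 2 `^ th); first by rewrite mulr_ge0 ?powR_ge0.
move=> [xi tau] p q r u.
set A := bracket2 (add2 xi p); set B := bracket2 (add2 xi q); set D := bracket2 (add2 xi (add2 p q)).
have A1 : 1 <= A by exact: bracket2_ge1.
have B1 : 1 <= B by exact: bracket2_ge1.
have D1 : 1 <= D by exact: bracket2_ge1.
have N1 := bracket2_ge1 xi; have P1 := bracket2_ge1 p; have Q1 := bracket2_ge1 q.
have hA : bracket2 xi <= A + bracket2 p by exact: bracket2_opp.
have hB : bracket2 xi <= B + bracket2 q by exact: bracket2_opp.
have hD : bracket2 xi <= D + (bracket2 p + bracket2 q).
  by apply: (le_trans (bracket2_opp (add2 p q) xi)); rewrite lerD2l bracket2_add.
have hABD : bracket2 xi <= A + B + D.
  have h1 := bracket2_add (add2 (add2 xi p) (add2 xi q)) (- (add2 xi (add2 p q)).1, - (add2 xi (add2 p q)).2).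
  have h2 := bracket2_add (add2 xi p) (add2 xi q).
  rewrite bracket2N (_ : add2 (add2 (add2 xi p) _) _ = xi) in h1; last first.
    by rewrite /add2 [RHS]surjective_pairing /=; congr pair; ring.
  by apply: (le_trans h1); rewrite lerD2r.
have F1 := frequency_reduce t0 es ea A1 B1 D1 N1 hABD.
have F2 := frequency_split g0 k0 kg A1 B1 D1 N1 P1 Q1 hA hB hD.
have -> : (xi, tau).1 = xi by [].
have -> : (xi, tau).2 = tau by [].
set s0 := tau + normsq2 xi.
have W (y : R * R) (v : R) : weight_inv2 (2 * s) be (add3 (xi, tau) (y, v)) =
   jb2 (2 * s) (add2 xi y) * jb be (tau + v + normsq2 (add2 xi y)) by [].
have -> : add3 (p, r) (q, u) = (add2 p q, r + u) by [].
rewrite !W -/s0.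
rewrite (_ : tau + r + normsq2 (add2 xi p) = r + (tau + normsq2 (add2 xi p))); last by ring.
rewrite (_ : tau + u + normsq2 (add2 xi q) = u + (tau + normsq2 (add2 xi q))); last by ring.
rewrite (_ : tau + (r + u) + normsq2 (add2 xi (add2 p q)) = r + u + (tau + normsq2 (add2 xi (add2 p q)))); last by ring.
set s1 := r + _; set s3 := u + _; set s2 := r + u + _.
(* Resonance identity: the time variables cancel and |xi+p|^2 + |xi+q|^2 - |xi+p+q|^2 - |xi|^2 = - 2
   p.q. *)
have es0 : s1 + s3 - s2 - s0 = - (2 * dot2 p q).
  by rewrite /s1 /s2 /s3 /s0 /normsq2 /add2 /dot2 /=; ring.
have G := modulation_split th0 tb es0.
rewrite !jb2E -/A -/B -/D opprK.
have regroup (x x0 y y1 z z1 v v1 : R) : x * x0 * (y * y1 * (z * z1) * (v * v1)) =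
    x * (y * v * z) * (x0 * (y1 * z1 * v1)) by ring.
rewrite regroup.
have FF := le_trans F1 (ler_wpM2l (powR_ge0 3 t) F2).
have X0 : 0 <= bracket2 xi `^ (2 * (s + a)) * (A `^ (- (2 * s)) * B `^ (- (2 * s)) * D `^ (- (2 * s))).
  by rewrite !mulr_ge0 ?powR_ge0.
have Y0 : 0 <= jb th s0 * (jb be s1 * jb be s2 * jb be s3).
  by apply: mulr_ge0; [exact: jb_ge0|apply: mulr_ge0; [apply: mulr_ge0|]; exact: jb_ge0].
apply: (le_trans (ler_pM X0 Y0 FF G)).
have eqt : resonant_term ga k th xi p q + resonant_term ga k th xi q p + low_term ga k th p q =
    A `^ (- ga) * bracket2 p `^ (ga + k) * (B `^ (- ga) * D `^ (- ga) * jb th (dot2 p q)) +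
    B `^ (- ga) * bracket2 q `^ (ga + k) * (A `^ (- ga) * D `^ (- ga) * jb th (dot2 p q)) +
    bracket2 p `^ (- (ga - k)) * (bracket2 q `^ (- ga) * jb th (dot2 p q)).
  rewrite /resonant_term /low_term !jb2E opprK (add2C p xi) (add2C q xi).
  rewrite (_ : add2 q (add2 xi p) = add2 xi (add2 p q)); last by rewrite /add2 /=; congr pair; ring.
  rewrite (_ : add2 p (add2 xi q) = add2 xi (add2 p q)); last by rewrite /add2 /=; congr pair; ring.
  by rewrite (_ : dot2 q p = dot2 p q)//; rewrite /dot2 mulrC [q.2 * _]mulrC.
rewrite eqt /K.
have expand (c3 c4 c2 x y z v w v' w' j m : R) :
  c3 * (c4 * (x * y * z * v + x * y * z * w + w' * v')) * (c2 * j * m) =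
  c3 * c4 * c2 * (x * v * (y * z * j) + y * w * (x * z * j) + v' * (w' * j)) * m by ring.
by rewrite expand.
Qed.

End trilinear_weights.

(** * Uniform integral bounds for the weights *)

Section weighted_estimates.
Context {R : realType}.
Implicit Types (zeta : R * R * R).
Local Notation lam := (lam R).
Local Notation mu2 := (mu2 R).
Local Notation mu3 := (mu3 R).
Local Notation E := (E3 R).

Lemma scales_add3 (y : E) : scales mu3 (fun x => add3 y x) 1.
Proof.
have n1 : (1 : R) != 0 by [].
have := scales_aff3 y n1; rewrite normr1 expr1n invr1.
by congr scales; apply/funext => x; rewrite /aff3 /add3; congr (_, _, _); ring.
Qed.

Lemma scales_sub3r (y : E) : scales mu3 (fun x => sub3 x y) 1.
Proof.
have n1 : (1 : R) != 0 by [].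
have := scales_aff3 (scale3 (-1) y) n1; rewrite normr1 expr1n invr1.
by congr scales; apply/funext => x; rewrite /aff3 /sub3 /scale3; congr (_, _, _); rewrite /=; ring.
Qed.

Lemma modulated_integral (be : R) : 1 < be -> exists2 C, 0 <= C & forall (S : R) (a1 a2 a3 : R), 0 <= S ->
  (\int[lam]_u \int[lam]_r (S * (jb be (r + a1) * jb be (u + a3) +
    jb be (r + u + a2) * jb be (u + a3) + jb be (r + a1) * jb be (r + u + a2)))%:E <= (C * S)%:E)%E.
Proof.
move=> b1; have [C C0 hC] := modulation_integral b1; exists C => // S a1 a2 a3 S0.
pose F (p : mR R * mR R) := jb be (p.2 + a1) * jb be (p.1 + a3) +
    jb be (p.2 + p.1 + a2) * jb be (p.1 + a3) + jb be (p.2 + a1) * jb be (p.2 + p.1 + a2).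
have mF : measurable_fun setT F by rewrite /F; do !measurability_step.
have F0 p : 0 <= F p by apply: addr_ge0; [apply: addr_ge0|]; apply: mulr_ge0; exact: jb_ge0.
have mSF : measurable_fun setT (fun p => (S * F p)%:E).
  by apply/measurable_EFinP; exact: (measurable_funM (measurable_cst S) mF).
have SF0 p : (0 <= (S * F p)%:E)%E by rewrite lee_fin mulr_ge0.
have := tonelli1 lam lam mSF SF0; rewrite /F /= => <-.
rewrite mulrC EFinM nnintZ; [|exact: measurableT|exact: S0|exact: mF|exact: F0].
by apply: lee_wpmul2l; [rewrite lee_fin|exact: hC].
Qed.

Lemma iterated_integral_le (f g : mR R * mR R -> \bar R) :
  measurable_fun setT f -> (forall w, 0 <= f w)%E -> measurable_fun setT g -> (forall w, f w <= g w)%E ->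
  (\int[lam]_u \int[lam]_r f (u, r) <= \int[lam]_u \int[lam]_r g (u, r))%E.
Proof.
move=> mf f0 mg fg.
have g0 w : (0 <= g w)%E by exact: le_trans (fg w).
by rewrite -(tonelli1 lam lam mf f0) -(tonelli1 lam lam mg g0); exact: ge0_le_integralT.
Qed.

(** The factor [S] depends on the frequencies alone, so it acts as a constant while [T] is
    integrated in the time variables; the bound on [T] is uniform, and [S] is integrated
    afterwards. *)
Lemma iterated4_majorant (G : E * E -> R) (S : E2 R -> E2 R -> R) (T : E2 R -> E2 R -> R -> R -> R) (A B D : R) :
  0 <= A -> 0 <= B ->
  measurable_fun setT (fun z => (G z)%:E) -> (forall z, (0 <= (G z)%:E)%E) ->
  measurable_fun setT (fun z : E2 R * E2 R => S z.2 z.1) -> (forall p q, 0 <= S p q) ->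
  (forall p q, measurable_fun setT (fun w : mR R * mR R => T p q w.2 w.1)) ->
  (forall p q r u, G ((q, u), (p, r)) <= A * S p q * T p q r u) ->
  (forall p q c, 0 <= c -> (\int[lam]_u \int[lam]_r (c * T p q r u)%:E <= (B * c)%:E)%E) ->
  (\int[prodm mu2 mu2]_z (S z.2 z.1)%:E <= D%:E)%E ->
  (\int[mu3]_x \int[mu3]_y (G (x, y))%:E <= (B * (A * D))%:E)%E.
Proof.
move=> A0 B0 mG G0 mS S0 mT GT hT hS.
have inner (p q : E2 R) : (\int[lam]_u \int[lam]_r (G ((q, u), (p, r)))%:E <= (B * (A * S p q))%:E)%E.
  apply: (@le_trans _ _ (\int[lam]_u \int[lam]_r (A * S p q * T p q r u)%:E)%E); last first.
    by apply: hT; apply: mulr_ge0.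
  have m4 : measurable_fun setT (fun w : mR R * mR R => (G ((q, w.1), (p, w.2)))%:E).
    apply: (measurableT_comp mG (g := fun w : mR R * mR R => ((q, w.1), (p, w.2)) : E * E)).
    apply: measurable_fun_pair; apply: measurable_fun_pair; do ?measurability_step.
  have mT' : measurable_fun setT (fun w : mR R * mR R => (A * S p q * T p q w.2 w.1)%:E).
    by apply/measurable_EFinP; exact: (measurable_funM (measurable_cst _)).
  have le4 w : ((G ((q, w.1), (p, w.2)))%:E <= (A * S p q * T p q w.2 w.1)%:E)%E.
    by rewrite lee_fin; exact: GT.
  exact: (iterated_integral_le m4 (fun w => G0 _) mT' le4).
have := tonelli4 mu2 lam mu2 lam mG G0.
rewrite -[mu3]/(prodm mu2 lam) => ->.
have m2 : measurable_fun setT (fun z : E2 R * E2 R => \int[lam]_u \int[lam]_r (G ((z.1, u), (z.2, r)))%:E)%E.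
  apply: (measurable_integral1 lam (f := fun w : (E2 R * E2 R) * mR R => \int[lam]_r (G ((w.1.1, w.2), (w.1.2, r)))%:E)%E); last first.
    by move=> w; apply: integral_ge0 => r _; exact: G0.
  apply: (measurable_integral1 lam (f := fun w : ((E2 R * E2 R) * mR R) * mR R => (G ((w.1.1.1, w.1.2), (w.1.1.2, w.2)))%:E)); last first.
    by move=> w; exact: G0.
  apply: (measurableT_comp mG (g := fun w : ((E2 R * E2 R) * mR R) * mR R => ((w.1.1.1, w.1.2), (w.1.1.2, w.2)) : E * E)).
  by apply: measurable_fun_pair; apply: measurable_fun_pair; do ?measurability_step.
have p2 (z : E2 R * E2 R) : (0 <= \int[lam]_u \int[lam]_r (G ((z.1, u), (z.2, r)))%:E)%E.
  by apply: integral_ge0 => u _; apply: integral_ge0 => r _; exact: G0.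
rewrite -(tonelli1 mu2 mu2 m2 p2).
have mAS := measurable_funM (measurable_cst A) mS.
have pS (z : E2 R * E2 R) : 0 <= S z.2 z.1 by exact: S0.
have mBS : measurable_fun setT (fun z : E2 R * E2 R => (B * (A * S z.2 z.1))%:E).
  by apply/measurable_EFinP; exact: (measurable_funM (measurable_cst B) mAS).
apply: (@le_trans _ _ (\int[prodm mu2 mu2]_z (B * (A * S z.2 z.1))%:E)%E).
  by apply: ge0_le_integralT; [exact: m2|exact: mBS|exact: p2|move=> z; exact: inner].
rewrite nnintZ; [|exact: measurableT|exact: B0|exact: mAS|by move=> z; apply: mulr_ge0].
rewrite nnintZ; [|exact: measurableT|exact: A0|exact: mS|exact: pS].
by rewrite !EFinM; apply: lee_wpmul2l; [rewrite lee_fin|apply: lee_wpmul2l; [rewrite lee_fin|exact: hS]].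
Qed.

Lemma trilinear_weights (s a ga k t th be : R) : 0 <= t -> 2 * s = ga + t ->
  2 * (s + a) <= ga + k + t -> 0 <= k -> k <= th -> 0 < th -> th < 1 -> 1 < ga - k -> 2 < ga - k + th -> 1 < be ->
  exists2 C, 0 <= C & forall zeta : E,
  (\int[mu3]_Q \int[mu3]_P (jb2 (- (2 * (s + a))) zeta.1 * jb th (zeta.2 + normsq2 zeta.1) *
   (weight_inv2 (2 * s) be (add3 zeta P) * weight_inv2 (2 * s) be (add3 zeta (add3 P Q)) *
    weight_inv2 (2 * s) be (add3 zeta Q)))%:E <= C%:E)%E.
Proof.
move=> t0 es ea k0 kth th0 th1 g1 gt b1.
have g0 : 0 < ga by lra.
have kg : k <= ga by lra.
have tb : th <= be by lra.
have [A A0 hA] := trilinear_pointwise t0 es ea g0 k0 kg (ltW th0) tb.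
have [B B0 hB] := modulated_integral b1.
have [D D0 hD] := spatial_integral k0 kth th0 th1 g1 gt.
exists (B * (A * D)); first by rewrite !mulr_ge0.
move=> zeta.
apply: (iterated4_majorant
  (G := fun z : E * E => jb2 (- (2 * (s + a))) zeta.1 * jb th (zeta.2 + normsq2 zeta.1) *
   (weight_inv2 (2 * s) be (add3 zeta z.2) * weight_inv2 (2 * s) be (add3 zeta (add3 z.2 z.1)) *
    weight_inv2 (2 * s) be (add3 zeta z.1)))
  (S := fun p q => resonant_term ga k th zeta.1 p q + resonant_term ga k th zeta.1 q p + low_term ga k th p q)
  (T := fun p q r u => jb be (r + (zeta.2 + normsq2 (add2 zeta.1 p))) * jb be (u + (zeta.2 + normsq2 (add2 zeta.1 q))) +
   jb be (r + u + (zeta.2 + normsq2 (add2 zeta.1 (add2 p q)))) * jb be (u + (zeta.2 + normsq2 (add2 zeta.1 q))) +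
   jb be (r + (zeta.2 + normsq2 (add2 zeta.1 p))) * jb be (r + u + (zeta.2 + normsq2 (add2 zeta.1 (add2 p q)))))
  A0 B0).
- apply/measurable_EFinP; apply: (measurable_funM (measurable_cst _)).
  apply: measurable_funM; [apply: measurable_funM|]; apply: measurable_weight_inv2.
  + by apply: measurable_add3; [exact: measurable_cst|exact: measurable_snd].
  + apply: measurable_add3; first exact: measurable_cst.
    by apply: measurable_add3; [exact: measurable_snd|exact: measurable_fst].
  + by apply: measurable_add3; [exact: measurable_cst|exact: measurable_fst].
- move=> z; rewrite lee_fin; apply: mulr_ge0; first by apply: mulr_ge0; [exact: jb2_ge0|exact: jb_ge0].
  by apply: mulr_ge0; [apply: mulr_ge0|]; exact: weight_inv2_ge0.
- apply: measurable_funD; first apply: measurable_funD.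
  + by apply: measurable_resonant_term; [exact: measurable_snd|exact: measurable_fst].
  + by apply: measurable_resonant_term; [exact: measurable_fst|exact: measurable_snd].
  + by apply: measurable_low_term; [exact: measurable_snd|exact: measurable_fst].
- move=> p q; apply: addr_ge0; [apply: addr_ge0; exact: resonant_term_ge0|exact: low_term_ge0].
- by move=> p q; do !measurability_step.
- by move=> p q r u; exact: hA.
- by move=> p q c c0; exact: hB.
- exact: hD.
Qed.

(** These are the variables of the iterated convolution, z.2 = zeta1 and z.1 = zeta1 - zeta2.
    Substituting z.1 = -Q and z.2 = zeta + P, which preserves the measure, gives the previous
    integral. *)
Lemma trilinear_weights_conv (s a ga k t th be : R) : 0 <= t -> 2 * s = ga + t ->
  2 * (s + a) <= ga + k + t -> 0 <= k -> k <= th -> 0 < th -> th < 1 -> 1 < ga - k -> 2 < ga - k + th -> 1 < be ->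
  exists2 C, 0 <= C & forall zeta : E,
  (\int[prodm mu3 mu3]_z (jb2 (- (2 * (s + a))) zeta.1 * jb th (zeta.2 + normsq2 zeta.1) *
   (weight_inv2 (2 * s) be z.2 * weight_inv2 (2 * s) be (sub3 z.2 z.1) *
    weight_inv2 (2 * s) be (sub3 zeta z.1)))%:E <= C%:E)%E.
Proof.
move=> t0 es ea k0 kth th0 th1 g1 gt b1.
have [C C0 hC] := trilinear_weights t0 es ea k0 kth th0 th1 g1 gt b1.
exists C => // zeta.
pose W := jb2 (- (2 * (s + a))) zeta.1 * jb th (zeta.2 + normsq2 zeta.1).
have W0 : 0 <= W by apply: mulr_ge0; [exact: jb2_ge0|exact: jb_ge0].
pose G (z : E * E) := W * (weight_inv2 (2 * s) be z.2 * weight_inv2 (2 * s) be (sub3 z.2 z.1) *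
    weight_inv2 (2 * s) be (sub3 zeta z.1)).
have mG : measurable_fun setT (fun z => (G z)%:E).
  apply/measurable_EFinP; apply: (measurable_funM (measurable_cst _)).
  apply: measurable_funM; [apply: measurable_funM|]; apply: measurable_weight_inv2.
  - exact: measurable_snd.
  - by apply: measurable_sub3; [exact: measurable_snd|exact: measurable_fst].
  - by apply: measurable_sub3; [exact: measurable_cst|exact: measurable_fst].
have G0 z : (0 <= (G z)%:E)%E.
  rewrite lee_fin; apply: mulr_ge0; first exact: W0.
  by apply: mulr_ge0; [apply: mulr_ge0|]; exact: weight_inv2_ge0.
rewrite -[X in (\int[_]_z X z <= _)%E]/(fun z => (G z)%:E) (tonelli1 mu3 mu3 mG G0).
have [_ h1] := scales_sub3 (((0 : R), 0), 0).
have mI := measurable_integral1 mu3 mG G0.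
have e1 := h1 _ mI (fun y => integral_ge0 _ (fun x _ => G0 (y, x))).
rewrite mul1e in e1; rewrite -e1; apply: le_trans (hC zeta).
rewrite le_eqVlt; apply/orP; left; apply/eqP; apply: eq_integral => Q _.
have [_ h2] := scales_add3 zeta.
have mQ : measurable_fun setT (fun x => (G (sub3 ((0, 0), 0) Q, x))%:E) by exact: (measurable_fun_pair2 _ mG).
have e2 := h2 _ mQ (fun x => G0 (_, x)); rewrite mul1e in e2; rewrite -e2.
apply: eq_integral => P _; congr EFin; rewrite /G /W /=.
have e3 : sub3 (add3 zeta P) (sub3 (0, 0, 0) Q) = add3 zeta (add3 P Q).
  by rewrite /sub3 /add3 /=; congr (_, _, _); ring.
have e4 : sub3 zeta (sub3 (0, 0, 0) Q) = add3 zeta Q.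
  by rewrite /sub3 /add3 /=; congr (_, _, _); ring.
rewrite e3 e4; reflexivity.
Qed.

(** Of the two modulation factors one is bounded by 1 and the other is integrated in time; the
    frequency brackets then form a planar convolution of total exponent 4 s > 2. This serves to put
    the transform of u conj(v) in L^2. *)
Lemma bilinear_weights (s be : R) : 1 < 2 * s -> 1 < be ->
  exists2 C, 0 <= C & forall y : E,
  (\int[mu3]_x (weight_inv2 (2 * s) be x * weight_inv2 (2 * s) be (sub3 x y))%:E <= C%:E)%E.
Proof.
move=> s1 b1; have [M M0 hM] := jb_integral b1.
have s0 : 0 <= 2 * s by lra.
have ss : 2 < 2 * s + 2 * s by lra.
have [C C0 hC] := jb2_convolution s0 s0 ss.
exists (M * C); first by rewrite mulr_ge0.
move=> y; pose z : R * R := (- y.1.1, - y.1.2).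
pose J (p : E2 R) := jb2 (2 * s) (add2 p (0, 0)) * jb2 (2 * s) (add2 p z).
have mJ : measurable_fun setT J by rewrite /J; apply: measurable_funM; exact: measurable_jb2_add.
have J0 p : 0 <= J p by apply: mulr_ge0; exact: jb2_ge0.
have b0 : 0 <= be by lra.
pose F (x : E2 R * mR R) := J x.1 * jb be (x.2 + normsq2 x.1).
have mF : measurable_fun setT F.
  apply: measurable_funM; first exact: (measurableT_comp mJ measurable_fst).
  by do !measurability_step.
have F0 x : 0 <= F x by apply: mulr_ge0; [exact: J0|exact: jb_ge0].
apply: (@le_trans _ _ (\int[prodm mu2 lam]_x (F x)%:E)%E).
  apply: nnint_le; [exact: measurableT| | |exact: mF|].
  - apply: measurable_funM; apply: measurable_weight_inv2; first exact: measurable_id.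
    by apply: measurable_sub3; [exact: measurable_id|exact: measurable_cst].
  - by move=> x; apply: mulr_ge0; exact: weight_inv2_ge0.
  move=> x _; rewrite /F /J /weight_inv2.
  have -> : add2 x.1 (0, 0) = x.1 by rewrite /add2 !addr0 -surjective_pairing.
  have -> : (sub3 x y).1 = add2 x.1 z by [].
  have h1 := jb_le1 ((sub3 x y).2 + normsq2 (add2 x.1 z)) b0.
  have h0 := jb_ge0 be ((sub3 x y).2 + normsq2 (add2 x.1 z)).
  have h2 := jb_ge0 be (x.2 + normsq2 x.1).
  have h3 := jb2_ge0 (2 * s) x.1; have h4 := jb2_ge0 (2 * s) (add2 x.1 z).
  move: (jb be _) (jb be _) (jb2 _ _) (jb2 _ _) h1 h0 h2 h3 h4 => p1 p2 p3 p4 h1 h0 h2 h3 h4.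
  rewrite (_ : p4 * p1 * (p3 * p2) = (p4 * p3 * p1) * p2); last by ring.
  by rewrite ler_piMr// !mulr_ge0.
apply: (tonelli1_le (h := fun p => M * J p)); [exact: mF|exact: F0|exact: (measurable_funM (measurable_cst M) mJ)| |].
- move=> p; rewrite /F /= nnintZ; [|exact: measurableT|exact: J0| |by move=> x; exact: jb_ge0].
    rewrite [leRHS](_ : _ = (J p)%:E * M%:E)%E; last by rewrite -EFinM mulrC.
    apply: lee_wpmul2l; first by rewrite lee_fin; exact: J0.
    by rewrite integral_jb_shift.
  by do !measurability_step.
- rewrite nnintZ; [|exact: measurableT|exact: M0|exact: mJ|exact: J0].
  by rewrite EFinM; apply: lee_wpmul2l; [rewrite lee_fin|exact: hC].
Qed.

End weighted_estimates.

(** * Cauchy-Schwarz with weights *)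

Section weighted_schwarz.
Context {R : realType}.
Local Notation mu3 := (mu3 R).
Local Notation E := (E3 R).

Lemma le_square_integral d (T : measurableType d) (m : {measure set T -> \bar R}) (f g : T -> R) (w C : R) :
  measurable_fun setT f -> measurable_fun setT g -> (forall x, 0 <= f x) -> (forall x, 0 <= g x) ->
  0 <= w -> (\int[m]_x (w * f x ^+ 2)%:E <= C%:E)%E ->
  (w%:E * ((\int[m]_x (f x * g x)%:E) * (\int[m]_x (f x * g x)%:E)) <= C%:E * \int[m]_x (g x ^+ 2)%:E)%E.
Proof.
move=> mf mg f0 g0 w0 hC.
apply: le_trans (_ : (w%:E * ((\int[m]_x (f x ^+ 2)%:E) * (\int[m]_x (g x ^+ 2)%:E)) <= _)%E).
  by apply: lee_wpmul2l; [rewrite lee_fin|exact: cauchy_schwarz_integral].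
rewrite muleA; apply: lee_wpmul2r.
  by apply: integral_ge0 => x _; rewrite lee_fin sqr_ge0.
rewrite -nnintZ; [exact: hC|exact: measurableT|exact: w0|exact: measurable_funX|].
by move=> x; exact: sqr_ge0.
Qed.

Lemma integral_shift (t : E -> E) (f : E -> R) (F : R) : scales mu3 t 1 -> measurable_fun setT f ->
  (\int[mu3]_x (f x ^+ 2)%:E = F%:E)%E -> (\int[mu3]_x (f (t x) ^+ 2)%:E = F%:E)%E.
Proof.
move=> [_ ht] mf <-.
have m2 : measurable_fun setT (fun x => (f x ^+ 2)%:E).
  by apply/measurable_EFinP; exact: (measurable_funX 2%N mf).
have p2 x : (0 <= (f x ^+ 2)%:E)%E by rewrite lee_fin sqr_ge0.
by have := ht _ m2 p2; rewrite mul1e.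
Qed.

Lemma nnintZr d (T : measurableType d) (m : {measure set T -> \bar R}) (f : T -> R) (c : R) :
  0 <= c -> measurable_fun setT f -> (forall x, 0 <= f x) ->
  (\int[m]_x (f x * c)%:E = (\int[m]_x (f x)%:E) * c%:E)%E.
Proof.
move=> c0 mf f0; rewrite muleC -nnintZ; [|exact: measurableT|exact: c0|exact: mf|exact: f0].
by apply: eq_integral => x _; rewrite mulrC.
Qed.

Variables f g h : E -> R.
Variables F G H : R.
Hypotheses (mf : measurable_fun setT f) (mg : measurable_fun setT g) (mh : measurable_fun setT h).
Hypotheses (f0 : forall x, 0 <= f x) (g0 : forall x, 0 <= g x) (h0 : forall x, 0 <= h x).
Hypotheses (hF : (\int[mu3]_x (f x ^+ 2)%:E = F%:E)%E) (hG : (\int[mu3]_x (g x ^+ 2)%:E = G%:E)%E)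
  (hH : (\int[mu3]_x (h x ^+ 2)%:E = H%:E)%E).

Let F0 : 0 <= F. Proof. by rewrite -lee_fin -hF; apply: integral_ge0 => x _; rewrite lee_fin sqr_ge0. Qed.
Let G0 : 0 <= G. Proof. by rewrite -lee_fin -hG; apply: integral_ge0 => x _; rewrite lee_fin sqr_ge0. Qed.
Let H0 : 0 <= H. Proof. by rewrite -lee_fin -hH; apply: integral_ge0 => x _; rewrite lee_fin sqr_ge0. Qed.

Let ms21 : measurable_fun setT (fun z : E * E => sub3 z.2 z.1).
Proof. by apply: measurable_sub3; [exact: measurable_snd|exact: measurable_fst]. Qed.

Let mg21 : measurable_fun setT (fun z : E * E => g (sub3 z.2 z.1)).
Proof. exact: (measurableT_comp mg ms21). Qed.

Let mf2 : measurable_fun setT (fun z : E * E => f z.2).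
Proof. exact: (measurableT_comp mf measurable_snd). Qed.

Let mfg : measurable_fun setT (fun z : E * E => f z.2 * g (sub3 z.2 z.1)).
Proof. exact: (measurable_funM mf2 mg21). Qed.

Lemma bilinear_square : (\int[prodm mu3 mu3]_z ((f z.2 * g (sub3 z.2 z.1)) ^+ 2)%:E = (F * G)%:E)%E.
Proof.
have m2 : measurable_fun setT (fun z : E * E => ((f z.2 * g (sub3 z.2 z.1)) ^+ 2)%:E).
  by apply/measurable_EFinP; exact: (measurable_funX 2%N mfg).
rewrite (tonelli2 mu3 mu3 m2); last by move=> z; rewrite lee_fin sqr_ge0.
rewrite (_ : (fun x => _) = (fun x : E => (f x ^+ 2 * G)%:E)); last first.
  apply/funext => x /=.
  under eq_integral do rewrite exprMn.
  rewrite nnintZ; [|exact: measurableT|exact: sqr_ge0| |by move=> y; exact: sqr_ge0]; last first.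
    by apply: measurable_funX; apply: (measurableT_comp mg); apply: measurable_sub3; [exact: measurable_cst|exact: measurable_id].
  by rewrite (integral_shift (scales_sub3 x) mg hG).
by rewrite nnintZr// ?hF//; [exact: measurable_funX|move=> x; exact: sqr_ge0].
Qed.

Let Q (z : E * E) (zeta : E) := f z.2 * g (sub3 z.2 z.1) * h (sub3 zeta z.1).

Let mQ : measurable_fun setT (fun p : E * (E * E) => Q p.2 p.1).
Proof.
apply: measurable_funM; first exact: (measurableT_comp mfg measurable_snd).
apply: (measurableT_comp mh); apply: measurable_sub3; first exact: measurable_fst.
exact: (measurableT_comp measurable_fst measurable_snd).
Qed.

Lemma trilinear_square :
  (\int[mu3]_zeta \int[prodm mu3 mu3]_z (Q z zeta ^+ 2)%:E = (F * G * H)%:E)%E.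
Proof.
have m2 : measurable_fun setT (fun p : E * (E * E) => (Q p.2 p.1 ^+ 2)%:E).
  by apply/measurable_EFinP; exact: (measurable_funX 2%N mQ).
have p2 (p : E * (E * E)) : (0 <= (Q p.2 p.1 ^+ 2)%:E)%E by rewrite lee_fin sqr_ge0.
apply: etrans (tonelli_swap mu3 (prodm mu3 mu3) m2 p2) _.
rewrite (_ : (fun z => _) = (fun z : E * E => ((f z.2 * g (sub3 z.2 z.1)) ^+ 2 * H)%:E)); last first.
  apply/funext => z; rewrite /Q.
  under eq_integral do rewrite exprMn /fst /snd.
  rewrite nnintZ; [|exact: measurableT|exact: sqr_ge0| |by move=> y; exact: sqr_ge0]; last first.
    by apply: measurable_funX; apply: (measurableT_comp mh); apply: measurable_sub3; [exact: measurable_id|exact: measurable_cst].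
  by rewrite (integral_shift (scales_sub3r z.1) mh hH).
by rewrite nnintZr ?bilinear_square//; [exact: measurable_funX|move=> x; exact: sqr_ge0].
Qed.

Variable q : E -> R.
Hypotheses (mq : measurable_fun setT q) (q0 : forall x, 0 <= q x).

(** Here [q] is an inverse weight, and [f], [g] are moduli of transforms already multiplied by the
    weight. Cauchy-Schwarz at fixed y separates the [q] factors, bounded by C, from a product whose
    total integral is F G. *)
Lemma bilinear_weighted_schwarz (C : R) : 0 <= C ->
  (forall y, \int[mu3]_x (1 * (q x * q (sub3 x y)) ^+ 2)%:E <= C%:E)%E ->
  let S y := (\int[mu3]_x (q x * q (sub3 x y) * (f x * g (sub3 x y)))%:E)%E in
  measurable_fun setT S /\ (\int[mu3]_y (S y * S y) <= (C * (F * G))%:E)%E.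
Proof.
move=> C0 hC S.
have m2 : measurable_fun setT (fun z : E * E => ((f z.2 * g (sub3 z.2 z.1)) ^+ 2)%:E).
  by apply/measurable_EFinP; exact: (measurable_funX 2%N mfg).
have p2 (z : E * E) : (0 <= ((f z.2 * g (sub3 z.2 z.1)) ^+ 2)%:E)%E by rewrite lee_fin sqr_ge0.
have mqq : measurable_fun setT (fun z : E * E => q z.2 * q (sub3 z.2 z.1)).
  apply: measurable_funM; first exact: (measurableT_comp mq measurable_snd).
  exact: (measurableT_comp mq ms21).
have fg0 (z : E * E) : 0 <= f z.2 * g (sub3 z.2 z.1) by exact: mulr_ge0.
have qq0 (z : E * E) : 0 <= q z.2 * q (sub3 z.2 z.1) by exact: mulr_ge0.
have mS : measurable_fun setT S.
  apply: (measurable_integral1 mu3 (f := fun z : E * E => (q z.2 * q (sub3 z.2 z.1) * (f z.2 * g (sub3 z.2 z.1)))%:E)).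
    by apply/measurable_EFinP; exact: (measurable_funM mqq mfg).
  by move=> z; rewrite lee_fin; apply: mulr_ge0.
split; first exact: mS.
have S0 y : (0 <= S y)%E.
  by apply: integral_ge0 => x _; rewrite lee_fin; apply: mulr_ge0; [exact: (qq0 (y, x))|exact: (fg0 (y, x))].
have mI := measurable_integral1 mu3 m2 p2.
have I0 y : (0 <= \int[mu3]_x ((f x * g (sub3 x y)) ^+ 2)%:E)%E.
  by apply: integral_ge0 => x _; exact: (p2 (y, x)).
have le1 y : (S y * S y <= C%:E * \int[mu3]_x ((f x * g (sub3 x y)) ^+ 2)%:E)%E.
  have m1 : measurable_fun setT (fun x => q x * q (sub3 x y)) by exact: (measurable_fun_pair2 y mqq).
  have m1' : measurable_fun setT (fun x => f x * g (sub3 x y)) by exact: (measurable_fun_pair2 y mfg).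
  have := le_square_integral m1 m1' (fun x => qq0 (y, x)) (fun x => fg0 (y, x)) ler01 (hC y).
  by rewrite mul1e.
have b := bilinear_square; rewrite (tonelli1 mu3 mu3 m2 p2) in b.
apply: le_trans (_ : (\int[mu3]_y (C%:E * \int[mu3]_x ((f x * g (sub3 x y)) ^+ 2)%:E) <= _)%E).
  apply: ge0_le_integralT; [exact: emeasurable_funM|exact: emeasurable_funM| |exact: le1].
  by move=> y; apply: mule_ge0; exact: S0.
by rewrite ge0_integralZl_EFin// b.
Qed.

Variable w : E -> R.
Hypotheses (mw : measurable_fun setT w) (w0 : forall x, 0 <= w x).

(** Same mechanism for three functions. The weight [w] of the output norm is attached to the [q]
    factors before Cauchy-Schwarz, so that the hypothesis on C is exactly the uniform trilinear
    bound. *)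
Lemma trilinear_weighted_schwarz (C : R) : 0 <= C ->
  (forall zeta, \int[prodm mu3 mu3]_z (w zeta * (q z.2 * q (sub3 z.2 z.1) * q (sub3 zeta z.1)) ^+ 2)%:E <= C%:E)%E ->
  let T zeta := (\int[prodm mu3 mu3]_z (q z.2 * q (sub3 z.2 z.1) * q (sub3 zeta z.1) *
     (f z.2 * g (sub3 z.2 z.1) * h (sub3 zeta z.1)))%:E)%E in
  measurable_fun setT T /\ (\int[mu3]_zeta ((w zeta)%:E * (T zeta * T zeta)) <= (C * (F * G * H))%:E)%E.
Proof.
move=> C0 hC T.
have m2 : measurable_fun setT (fun p : E * (E * E) => (Q p.2 p.1 ^+ 2)%:E).
  by apply/measurable_EFinP; exact: (measurable_funX 2%N mQ).
have p2 (p : E * (E * E)) : (0 <= (Q p.2 p.1 ^+ 2)%:E)%E by rewrite lee_fin sqr_ge0.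
have Q0 zeta z : 0 <= Q z zeta by apply: mulr_ge0; [apply: mulr_ge0|].
pose q3 (z : E * E) zeta := q z.2 * q (sub3 z.2 z.1) * q (sub3 zeta z.1).
have mqq : measurable_fun setT (fun z : E * E => q z.2 * q (sub3 z.2 z.1)).
  apply: measurable_funM; first exact: (measurableT_comp mq measurable_snd).
  exact: (measurableT_comp mq ms21).
have mq3 : measurable_fun setT (fun p : E * (E * E) => q3 p.2 p.1).
  apply: measurable_funM; first exact: (measurableT_comp mqq measurable_snd).
  apply: (measurableT_comp mq); apply: measurable_sub3; first exact: measurable_fst.
  exact: (measurableT_comp measurable_fst measurable_snd).
have q30 zeta z : 0 <= q3 z zeta by apply: mulr_ge0; [apply: mulr_ge0|].
have mT : measurable_fun setT T.
  apply: (measurable_integral1 (prodm mu3 mu3) (f := fun p : E * (E * E) => (q3 p.2 p.1 * Q p.2 p.1)%:E)).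
    by apply/measurable_EFinP; exact: (measurable_funM mq3 mQ).
  by move=> p; rewrite lee_fin; apply: mulr_ge0; [exact: q30|exact: Q0].
split; first exact: mT.
have T0 zeta : (0 <= T zeta)%E.
  by apply: integral_ge0 => z _; rewrite lee_fin; apply: mulr_ge0; [exact: (q30 zeta z)|exact: (Q0 zeta z)].
have mI := measurable_integral1 (prodm mu3 mu3) m2 p2.
have I0 zeta : (0 <= \int[prodm mu3 mu3]_z (Q z zeta ^+ 2)%:E)%E.
  by apply: integral_ge0 => z _; exact: (p2 (zeta, z)).
have le1 zeta : ((w zeta)%:E * (T zeta * T zeta) <= C%:E * \int[prodm mu3 mu3]_z (Q z zeta ^+ 2)%:E)%E.
  have m1 : measurable_fun setT (fun z => q3 z zeta) by exact: (measurable_fun_pair2 zeta mq3).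
  have m1' : measurable_fun setT (fun z => Q z zeta) by exact: (measurable_fun_pair2 zeta mQ).
  exact: (le_square_integral m1 m1' (q30 zeta) (Q0 zeta) (w0 zeta) (hC zeta)).
have mWT : measurable_fun setT (fun zeta => (w zeta)%:E * (T zeta * T zeta))%E.
  by apply: emeasurable_funM; [exact/measurable_EFinP|exact: emeasurable_funM].
apply: le_trans (_ : (\int[mu3]_zeta (C%:E * \int[prodm mu3 mu3]_z (Q z zeta ^+ 2)%:E) <= _)%E).
  apply: ge0_le_integralT; [exact: mWT|exact: emeasurable_funM| |exact: le1].
  by move=> y; apply: mule_ge0; [rewrite lee_fin; exact: w0|apply: mule_ge0; exact: T0].
by rewrite ge0_integralZl_EFin// trilinear_square.
Qed.

End weighted_schwarz.

(** * Bourgain norms *)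

Section bourgain_norm.
Context {R : realType}.
Local Notation mu3 := (mu3 R).
Local Notation E := (E3 R).
Implicit Types (s b : R) (U : E -> R[i]).

Lemma Xweight_gt0 s b (zeta : E) : 0 < Xweight s b zeta.
Proof. by rewrite mulr_gt0// powR_gt0// bracket_gt0. Qed.

Lemma XweightE s b (zeta : E) : Xweight s b zeta = jb2 (- s) zeta.1 * jb (- b) (zeta.2 + normsq2 zeta.1).
Proof. by rewrite jb2E jbE !opprK. Qed.

Lemma measurable_Xweight s b : measurable_fun [set: E] (Xweight s b).
Proof.
rewrite (funext (XweightE s b)); apply: measurable_funM.
  by apply: measurable_jb2; exact: measurable_fst.
by do !measurability_step.
Qed.

Lemma Xweight_ge1 s b (zeta : E) : 0 <= s -> 0 <= b -> 1 <= Xweight s b zeta.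
Proof.
move=> s0 b0; rewrite -[leLHS]mulr1; apply: ler_pM => //.
- by rewrite -(powRr0 (bracket (Num.sqrt (normsq2 zeta.1)))); apply: ler_powR; [exact: bracket_ge1|].
- by rewrite -(powRr0 (bracket (zeta.2 + normsq2 zeta.1))); apply: ler_powR; [exact: bracket_ge1|].
Qed.

Lemma Xweight_sqr s b (zeta : E) :
  Xweight s b zeta ^+ 2 = jb2 (- (2 * s)) zeta.1 * jb (- (2 * b)) (zeta.2 + normsq2 zeta.1).
Proof.
have e (x : R) : - (2 * x) = - x + - x by ring.
by rewrite XweightE expr2 mulrACA -jb2D -jbD !e.
Qed.

Lemma Xweight_inv_sqr s b (zeta : E) : (Xweight s b zeta)^-1 ^+ 2 = weight_inv2 (2 * s) (2 * b) zeta.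
Proof.
have h : weight_inv2 (2 * s) (2 * b) zeta * Xweight s b zeta ^+ 2 = 1.
  rewrite Xweight_sqr /weight_inv2 mulrACA -jb2D -jbD !subrr jb2E jbE oppr0.
  by rewrite !powRr0 mulr1.
have n0 : Xweight s b zeta ^+ 2 != 0 by rewrite expf_neq0// gt_eqF// Xweight_gt0.
by apply: (mulIf n0); rewrite h exprVn mulVf.
Qed.

Lemma Xweight_normc_ge0 s b U (zeta : E) : 0 <= Xweight s b zeta * normc (U zeta).
Proof. by rewrite mulr_ge0 ?normc_ge0// ltW// Xweight_gt0. Qed.

Lemma measurable_Xweight_normc s b U : cmeas U ->
  measurable_fun setT (fun zeta => Xweight s b zeta * normc (U zeta)).
Proof. by move=> mU; apply: measurable_funM; [exact: measurable_Xweight|exact: measurable_normc]. Qed.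

Lemma weightedL2_ge0 s b U : (0 <= weightedL2 s b U)%E.
Proof. exact: Lnorm_ge0. Qed.

Lemma weightedL2_sqr s b U :
  (\int[mu3]_zeta ((Xweight s b zeta * normc (U zeta)) ^+ 2)%:E = weightedL2 s b U * weightedL2 s b U)%E.
Proof. exact: (integral_sqr_Lnorm mu3 (fun zeta => Xweight_normc_ge0 s b U zeta)). Qed.

Lemma weightedL2_le s b U (N : R) : 0 <= N ->
  (\int[mu3]_zeta ((Xweight s b zeta * normc (U zeta)) ^+ 2)%:E <= (N ^+ 2)%:E)%E ->
  (weightedL2 s b U <= N%:E)%E.
Proof.
move=> N0; rewrite weightedL2_sqr; have := weightedL2_ge0 s b U.
case: (weightedL2 s b U) => [r| |]//.
by rewrite !lee_fin => r0 h; rewrite -(@ler_pXn2r _ 2)// nnegrE.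
Qed.

(** The infimum runs over functions that agree almost everywhere, by [fourier_unique], so any one
    transform computes the norm. *)
Lemma Xnorm_weightedL2 s b (u : E -> R[i]) U : is_fourier u U -> Xnorm s b u = weightedL2 s b U.
Proof.
move=> uU; apply/eqP; rewrite eq_le; apply/andP; split.
  by apply: ereal_inf_lbound; exists U.
apply: le_ereal_inf_tmp => _ [V uV <-].
have [_ [mU _] _] := uU; have [_ [mV _] _] := uV.
rewrite le_eqVlt; apply/orP; left; apply/eqP.
have sq0 W : measurable_fun setT (fun zeta => (Xweight s b zeta * normc (W zeta))%:E) ->
  measurable_fun [set: E] (fun zeta => (`|(Xweight s b zeta * normc (W zeta))%:E| `^ 2)%E).
  by move=> mW; apply: (measurableT_comp (measurable_poweR _)); exact: measurableT_comp.
rewrite /weightedL2 unlock; congr (_ `^ _)%E; apply: ae_eq_integral.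
- exact: measurableT.
- by apply: sq0; apply/measurable_EFinP; exact: measurable_Xweight_normc.
- by apply: sq0; apply/measurable_EFinP; exact: measurable_Xweight_normc.
- by apply: ae_imply (fourier_unique uU uV) => zeta -> _.
Qed.

(** For nonnegative exponents the weight is at least 1, so a transform of finite weighted norm lies
    in L^2 and the L^2 theory applies. *)
Lemma Xspace_l2pair s b (u : E -> R[i]) : 0 <= s -> 0 <= b -> Xspace s b u ->
  exists U N, [/\ l2pair u U, 0 <= N, Xnorm s b u = N%:E &
    (\int[mu3]_zeta ((Xweight s b zeta * normc (U zeta)) ^+ 2)%:E = (N ^+ 2)%:E)%E].
Proof.
move=> s0 b0 /ereal_inf_lt[_ [U uU <-] fU].
have [_ [mU _] _] := uU.
have fin : weightedL2 s b U \is a fin_num by rewrite ge0_fin_numE// weightedL2_ge0.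
exists U, (fine (weightedL2 s b U)).
have e : (\int[mu3]_zeta ((Xweight s b zeta * normc (U zeta)) ^+ 2)%:E = (fine (weightedL2 s b U) ^+ 2)%:E)%E.
  by rewrite weightedL2_sqr expr2 EFinM !fineK.
split; [|exact: fine_ge0 (weightedL2_ge0 s b U)|by rewrite (Xnorm_weightedL2 _ _ uU) fineK|exact: e].
apply: (is_fourier_l2pair uU); split; first exact: mU.
apply: (@le_lt_trans _ _ (\int[mu3]_zeta ((Xweight s b zeta * normc (U zeta)) ^+ 2)%:E)%E); last by rewrite e ltry.
apply: ge0_le_integralT.
- exact: measurable_sqr_normc.
- by apply/measurable_EFinP; exact: (measurable_funX 2%N (measurable_Xweight_normc s b mU)).
- by move=> x; rewrite lee_fin sqr_ge0.
- move=> x; rewrite lee_fin ler_pXn2r ?nnegrE ?normc_ge0 ?Xweight_normc_ge0//.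
  by rewrite ler_peMl ?normc_ge0// Xweight_ge1.
Qed.

(** The system is solved by ga = 1/2 + m + n, k = 2 m and t = 2 s - ga, with m the positive part of
    a and n the minimum of s and 1. With these values ga - k = 1/2 - m + n, and all the constraints
    come down to m < 1/2 and m + 1/2 < n, up to multiples of eps. *)
Lemma exponent_choice (s a : R) : 2^-1 < s -> a < Num.min 2^-1 (s - 2^-1) ->
  exists2 eps0, 0 < eps0 & forall eps, 0 < eps -> eps < eps0 -> exists ga k t,
  [/\ 0 <= t, 2 * s = ga + t & 2 * (s + a) <= ga + k + t] /\
  [/\ 0 <= k, k <= 1 - 2 * eps, 0 < 1 - 2 * eps, 1 < ga - k & 2 < ga - k + (1 - 2 * eps)].
Proof.
move=> hs; rewrite lt_min => /andP[a1 a2].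
pose m := Num.max a 0; pose n := Num.min s 1.
have m0 : 0 <= m by rewrite le_max lexx orbT.
have am : a <= m by rewrite le_max lexx.
have m1 : m < 2^-1 by rewrite gt_max a1 invr_gt0 ltr0n.
have ms : m < s - 2^-1 by rewrite gt_max a2 subr_gt0.
have ns : n <= s by rewrite ge_min lexx.
have n1 : m + 2^-1 < n by rewrite lt_min; apply/andP; split; lra.
(* The first bound gives ga - k + (1 - 2 eps) > 2; the second gives k <= 1 - 2 eps and, as m >= 0,
   the positivity of 1 - 2 eps. *)
exists (Num.min ((n - m - 2^-1) / 2) (2^-1 - m)); first by rewrite lt_min; apply/andP; split; lra.
move=> eps e0; rewrite lt_min => /andP[e1 e2].
exists (2^-1 + m + n), (2 * m), (2 * s - (2^-1 + m + n)).
move: m n m0 am m1 ms ns n1 e1 e2 => m n m0 am m1 ms ns n1 e1 e2.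
by split; split; lra.
Qed.

(** The output exponent b - 1 = eps - 1/2 becomes 2 eps - 1 once squared, whence th = 1 - 2 eps; the
    input exponent 2 b = 1 + 2 eps exceeds 1, as integration in time demands. *)
Lemma weighted_trilinear (s a : R) : 2^-1 < s -> a < Num.min 2^-1 (s - 2^-1) ->
  exists2 eps0, 0 < eps0 & forall eps, 0 < eps -> eps < eps0 -> exists2 C, 0 <= C &
  forall zeta : E, (\int[prodm mu3 mu3]_z (Xweight (s + a) (2^-1 + eps - 1) zeta ^+ 2 *
   ((Xweight s (2^-1 + eps) z.2)^-1 * (Xweight s (2^-1 + eps) (sub3 z.2 z.1))^-1 *
    (Xweight s (2^-1 + eps) (sub3 zeta z.1))^-1) ^+ 2)%:E <= C%:E)%E.
Proof.
move=> hs ha; have [eps0 e00 he] := exponent_choice hs ha.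
exists eps0 => // eps e0 e1.
have [ga [k [t [[t0 es ea] [k0 kth th0 g1 gt]]]]] := he eps e0 e1.
have th1 : 1 - 2 * eps < 1 by lra.
have b1 : 1 < 2 * (2^-1 + eps) by lra.
have [C C0 hC] := trilinear_weights_conv t0 es ea k0 kth th0 th1 g1 gt b1.
exists C => // zeta; apply: le_trans (hC zeta).
rewrite le_eqVlt; apply/orP; left; apply/eqP; apply: eq_integral => z _; congr EFin.
rewrite Xweight_sqr !exprMn !Xweight_inv_sqr.
by rewrite (_ : - (2 * (2^-1 + eps - 1)) = 1 - 2 * eps)//; lra.
Qed.

Lemma weighted_bilinear (s b : R) : 2^-1 < s -> 2^-1 < b -> exists2 C, 0 <= C &
  forall y : E, (\int[mu3]_x (1 * ((Xweight s b x)^-1 * (Xweight s b (sub3 x y))^-1) ^+ 2)%:E <= C%:E)%E.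
Proof.
move=> hs hb; have s1 : 1 < 2 * s by lra.
have b1 : 1 < 2 * b by lra.
have [C C0 hC] := bilinear_weights s1 b1.
exists C => // y; apply: le_trans (hC y).
rewrite le_eqVlt; apply/orP; left; apply/eqP; apply: eq_integral => x _; congr EFin.
by rewrite mul1r exprMn !Xweight_inv_sqr.
Qed.

End bourgain_norm.

(** * Linearity of the L^2 Fourier transform *)

Section fourier_linear.
Context {R : realType}.
Local Notation E := (E3 R).
Local Notation mu3 := (mu3 R).
Local Notation K := ((2 * pi) ^+ 3 : R).
Implicit Types f g F G : E -> R[i].

Lemma is_fourier_ae f F G : is_fourier f F -> tempered G -> (\forall z \ae mu3, F z = G z) -> is_fourier f G.
Proof.
move=> [tf tF h] tG FG; split; [exact: tf|exact: tG|] => phi sphi.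
have [mphi _ _ _] := test_schwartz sphi.
rewrite h// !cintegralE; apply: ae_eq_Cint.
- by apply: cmeasM; [exact: tF.1|exact: cmeas_real].
- by apply: cmeasM; [exact: tG.1|exact: cmeas_real].
- by apply: ae_imply FG => z ->.
Qed.

Lemma approxF_linear n (a b : R[i]) F G (z : E) : L2 mu3 F -> L2 mu3 G ->
  approxF n (fun x => a * F x + b * G x) z = a * approxF n F z + b * approxF n G z.
Proof.
move=> lF lG.
have me : measurable_fun [set: E] (fun w : E => dot3 z w).
  by apply: measurable_dot3; [exact: measurable_cst|exact: measurable_id].
have iF := cintble_mul_expi (cintble_regularize n lF) me.
have iG := cintble_mul_expi (cintble_regularize n lG) me.
rewrite /approxF /extension -(CintZ a iF) -(CintZ b iG) -CintD; [|exact: cintbleZ|exact: cintbleZ].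
by apply: eq_Cint => w; rewrite /regularize; ring.
Qed.

Lemma cvg_combination0 (c d : R) (x y : nat -> R) : x @ \oo --> 0 -> y @ \oo --> 0 ->
  (fun n => 2 * (c * x n) + 2 * (d * y n)) @ \oo --> 0.
Proof.
move=> hx hy; rewrite -[X in _ --> X](_ : 2 * (c * 0) + 2 * (d * 0) = 0); last by ring.
by apply: cvgD; apply: cvgM; [exact: cvg_cst|apply: cvgM|exact: cvg_cst|apply: cvgM] => //; exact: cvg_cst.
Qed.

Lemma fine_le_combination (x y z : \bar R) (c d : R) :
  x \is a fin_num -> y \is a fin_num -> z \is a fin_num ->
  (x <= 2%:E * (c%:E * y) + 2%:E * (d%:E * z))%E ->
  fine x <= 2 * (c * fine y) + 2 * (d * fine z).
Proof. by case: x => // x; case: y => // y; case: z => // z _ _ _; rewrite -!EFinM -EFinD lee_fin. Qed.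

Lemma l2pair_linear (a b : R[i]) f F g G : l2pair f F -> l2pair g G ->
  l2pair (fun z => a * f z + b * g z) (fun x => a * F x + b * G x).
Proof.
move=> [lf lF cf] [lg lG cg].
have lD h k : L2 mu3 h -> L2 mu3 k -> L2 mu3 (fun x => a * h x + b * k x).
  by move=> lh lk; apply: L2D; exact: L2Z.
split; [exact: lD|exact: lD|].
pose df n z := K%:C%C * f z - approxF n F z.
pose dg n z := K%:C%C * g z - approxF n G z.
have ldf n : L2 mu3 (df n) by apply: L2B; [exact: L2Z|exact: L2_approxF].
have ldg n : L2 mu3 (dg n) by apply: L2B; [exact: L2Z|exact: L2_approxF].
have lim : (fun n => 2 * (normc a ^+ 2 * fine (N2 mu3 (df n))) + 2 * (normc b ^+ 2 * fine (N2 mu3 (dg n)))) @ \oo --> 0.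
  exact: (cvg_combination0 (normc a ^+ 2) (normc b ^+ 2) cf cg).
apply: (squeeze_cvgr _ (cvg_cst 0) lim); apply: nearW => n.
have e : (fun z => K%:C%C * (a * f z + b * g z) - approxF n (fun x => a * F x + b * G x) z) =
    (fun z => a * df n z + b * dg n z).
  by apply/funext => z; rewrite approxF_linear// /df /dg; ring.
rewrite e fine_ge0 ?N2_ge0// andTb.
have h := N2D mu3 (L2Z a (ldf n)).1 (L2Z b (ldg n)).1.
rewrite (N2Z _ a (ldf n).1) (N2Z _ b (ldg n).1) in h.
exact: (fine_le_combination (N2_fin (lD _ _ (ldf n) (ldg n))) (N2_fin (ldf n)) (N2_fin (ldg n)) h).
Qed.

End fourier_linear.

(** * Pointwise bounds for the convolutions of transforms *)

Section convolution_bounds.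
Context {R : realType}.
Local Notation E := (E3 R).
Local Notation mu3 := (mu3 R).
Local Notation K := ((2 * pi) ^+ 3 : R).
Local Notation zero3 := (((0 : R), 0), 0).

(** No integrability is assumed: if the right-hand side is infinite the bound holds for whatever
    default value [Cint] takes. *)
Lemma normc_Cint_le d (T : measurableType d) (m : {measure set T -> \bar R}) (f : T -> R[i]) : cmeas f ->
  ((normc (Cint m f))%:E <= \int[m]_x (normc (f x))%:E)%E.
Proof.
move=> mf; have [fi|] := ltP (\int[m]_x (normc (f x))%:E)%E +oo%E; last first.
  by rewrite leye_eq => /eqP ->; exact: leey.
have i := cintbleP mf fi.
apply: le_trans (_ : (Rintegral m setT (fun x => normc (f x)))%:E <= _)%E; first by rewrite lee_fin normc_Cint.
rewrite /Rintegral fineK// ge0_fin_numE//.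
by apply: integral_ge0 => x _; rewrite lee_fin normc_ge0.
Qed.

Variables (s b : R) (U V W : E -> R[i]).
Hypotheses (mU : cmeas U) (mV : cmeas V) (mW : cmeas W).
Local Notation p := (Xweight s b).

(** The transform of conj(v) when F is that of v, as in [l2pair_conj]. *)
Definition conj_reflect (F : E -> R[i]) (x : E) : R[i] := conjc (F (sub3 zero3 x)).

Lemma cmeas_conj_reflect : cmeas (conj_reflect V).
Proof.
by apply: cmeasJ; apply: (cmeas_comp mV); apply: measurable_sub3; [exact: measurable_cst|exact: measurable_id].
Qed.

Lemma weight_cancel2 (x y : E) (r t : R) :
  (p x)^-1 * (p y)^-1 * (p x * r * (p y * t)) = r * t.
Proof.
have px : p x != 0 by rewrite gt_eqF ?Xweight_gt0.
have py : p y != 0 by rewrite gt_eqF ?Xweight_gt0.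
by rewrite mulrACA !mulKf.
Qed.

Lemma weight_cancel3 (x y z : E) (r t v : R) :
  (p x)^-1 * (p y)^-1 * (p z)^-1 * (p x * r * (p y * t) * (p z * v)) = r * t * v.
Proof. by rewrite mulrACA weight_cancel2 mulKf// gt_eqF ?Xweight_gt0. Qed.

Lemma normc_fconv_conj_reflect (y : E) :
  ((normc (fconv U (conj_reflect V) y))%:E <=
   \int[mu3]_x (normc (U x) * normc (V (sub3 x y)))%:E)%E.
Proof.
have m : cmeas (fun x => U x * conj_reflect V (sub3 y x)).
  apply: cmeasM; first exact: mU.
  by apply: (cmeas_comp cmeas_conj_reflect); apply: measurable_sub3; [exact: measurable_cst|exact: measurable_id].
apply: (le_trans (normc_Cint_le mu3 m)).
rewrite le_eqVlt; apply/orP; left; apply/eqP; apply: eq_integral => x _.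
rewrite normcM /conj_reflect normc_conj; congr (_ * normc (V _))%:E.
by rewrite /sub3 /=; congr (_, _, _); ring.
Qed.

(** [H] stands for the transform of (c1 I + c2 K)(u conj(v)), which enters only through its modulus:
    the multiplier is reduced to the constant [M], and no cancellation in its symbol is used. *)
Lemma normc_fconv_triple (H : E -> R[i]) (M : R) (zeta : E) : 0 <= M -> cmeas H ->
  (forall y, normc (H y) <= M * normc (fconv U (conj_reflect V) y)) ->
  ((normc (fconv H W zeta))%:E <=
   M%:E * \int[prodm mu3 mu3]_z (normc (U z.2) * normc (V (sub3 z.2 z.1)) * normc (W (sub3 zeta z.1)))%:E)%E.
Proof.
move=> M0 mH hH.
have nU := measurable_normc mU; have nV := measurable_normc mV; have nW := measurable_normc mW.
have mWz : measurable_fun setT (fun y : E => normc (W (sub3 zeta y))).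
  by apply: (measurableT_comp nW); apply: measurable_sub3; [exact: measurable_cst|exact: measurable_id].
have mUV : measurable_fun setT (fun z : E * E => normc (U z.2) * normc (V (sub3 z.2 z.1))).
  apply: measurable_funM; first exact: (measurableT_comp nU measurable_snd).
  by apply: (measurableT_comp nV); apply: measurable_sub3; [exact: measurable_snd|exact: measurable_fst].
have mUVW : measurable_fun setT (fun z : E * E => normc (U z.2) * normc (V (sub3 z.2 z.1)) * normc (W (sub3 zeta z.1))).
  by apply: (measurable_funM mUV); exact: (measurableT_comp mWz measurable_fst).
have pUV (z : E * E) : 0 <= normc (U z.2) * normc (V (sub3 z.2 z.1)) by rewrite mulr_ge0 ?normc_ge0.
have pUVW (z : E * E) : 0 <= normc (U z.2) * normc (V (sub3 z.2 z.1)) * normc (W (sub3 zeta z.1)) by rewrite mulr_ge0 ?normc_ge0 ?pUV.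
have m : cmeas (fun y => H y * W (sub3 zeta y)).
  apply: cmeasM; first exact: mH.
  by apply: (cmeas_comp mW); apply: measurable_sub3; [exact: measurable_cst|exact: measurable_id].
apply: (le_trans (normc_Cint_le mu3 m)).
have mI : measurable_fun setT (fun z : E * E => (M * (normc (U z.2) * normc (V (sub3 z.2 z.1)) * normc (W (sub3 zeta z.1))))%:E).
  by apply/measurable_EFinP; exact: (measurable_funM (measurable_cst M) mUVW).
have pI (z : E * E) : (0 <= (M * (normc (U z.2) * normc (V (sub3 z.2 z.1)) * normc (W (sub3 zeta z.1))))%:E)%E.
  by rewrite lee_fin; apply: mulr_ge0; [exact: M0|exact: pUVW].
rewrite -nnintZ; [|exact: measurableT|exact: M0|exact: mUVW|exact: pUVW].
rewrite (tonelli1 mu3 mu3 mI pI).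
apply: ge0_le_integralT.
- by apply/measurable_EFinP; exact: measurable_normc.
- exact: (measurable_integral1 mu3 mI pI).
- by move=> y; rewrite lee_fin normc_ge0.
move=> y; rewrite normcM EFinM /=.
apply: le_trans (_ : ((M * normc (fconv U (conj_reflect V) y))%:E * (normc (W (sub3 zeta y)))%:E <= _)%E).
  by apply: lee_wpmul2r; [rewrite lee_fin normc_ge0|rewrite lee_fin; exact: hH].
have mUVy : measurable_fun setT (fun x => normc (U x) * normc (V (sub3 x y))) by exact: (measurable_fun_pair2 y mUV).
rewrite (_ : (fun x => _) = (fun x => (M * normc (W (sub3 zeta y)) * (normc (U x) * normc (V (sub3 x y))))%:E)); last first.
  by apply/funext => x; congr EFin; ring.
have Mw0 : 0 <= M * normc (W (sub3 zeta y)) by rewrite mulr_ge0 ?normc_ge0.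
rewrite nnintZ; [|exact: measurableT|exact: Mw0|exact: mUVy|by move=> x; exact: (pUV (y, x))].
rewrite -EFinM mulrAC EFinM; apply: lee_wpmul2l; first by rewrite lee_fin.
exact: normc_fconv_conj_reflect.
Qed.

End convolution_bounds.

(** * Weighted L^2 bounds for the convolutions *)

Section weighted_convolution.
Context {R : realType}.
Local Notation E := (E3 R).
Local Notation mu3 := (mu3 R).

Variables (s b : R) (U V W : E -> R[i]) (NU NV NW : R).
Hypotheses (mU : cmeas U) (mV : cmeas V) (mW : cmeas W).
Local Notation p := (Xweight s b).
Hypotheses
  (hU : (\int[mu3]_zeta ((p zeta * normc (U zeta)) ^+ 2)%:E = (NU ^+ 2)%:E)%E)
  (hV : (\int[mu3]_zeta ((p zeta * normc (V zeta)) ^+ 2)%:E = (NV ^+ 2)%:E)%E)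
  (hW : (\int[mu3]_zeta ((p zeta * normc (W zeta)) ^+ 2)%:E = (NW ^+ 2)%:E)%E).

Let mq : measurable_fun [set: E] (fun x => (p x)^-1).
Proof.
rewrite (_ : (fun x => _) = fun x => Xweight (- s) (- b) x); first exact: measurable_Xweight.
apply/funext => x; rewrite /Xweight !powRN; exact: invfM.
Qed.

Let q0 (x : E) : 0 <= (p x)^-1.
Proof. by rewrite invr_ge0 ltW// Xweight_gt0. Qed.

(** Multiplying and dividing by the weights puts the convolution of moduli in the form required by
    [bilinear_weighted_schwarz], whose bound is finite. *)
Lemma L2_fconv_conj_reflect (C : R) : 0 <= C ->
  (forall y : E, \int[mu3]_x (1 * ((p x)^-1 * (p (sub3 x y))^-1) ^+ 2)%:E <= C%:E)%E ->
  L2 mu3 (fconv U (conj_reflect V)).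
Proof.
move=> C0 hC.
have mc : cmeas (fconv U (conj_reflect V)) by apply: cmeas_fconv; [exact: mU|exact: cmeas_conj_reflect].
split; first exact: mc.
pose S y := (\int[mu3]_x ((p x)^-1 * (p (sub3 x y))^-1 *
  (p x * normc (U x) * (p (sub3 x y) * normc (V (sub3 x y)))))%:E)%E.
have [mS hS] : measurable_fun setT S /\ (\int[mu3]_y (S y * S y) <= (C * (NU ^+ 2 * NV ^+ 2))%:E)%E.
  apply: (bilinear_weighted_schwarz (measurable_Xweight_normc s b mU) (measurable_Xweight_normc s b mV)
  (Xweight_normc_ge0 s b U) (Xweight_normc_ge0 s b V) hU hV mq q0 C0 hC).
apply: (le_lt_trans _ (le_lt_trans hS (ltry _))).
apply: ge0_le_integralT; [exact: measurable_sqr_normc|exact: emeasurable_funM|by move=> x; rewrite lee_fin sqr_ge0|].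
move=> y; have h := normc_fconv_conj_reflect mU mV y.
rewrite expr2 EFinM.
have e : S y = (\int[mu3]_x (normc (U x) * normc (V (sub3 x y)))%:E)%E.
  by apply: eq_integral => x _; rewrite weight_cancel2.
by rewrite e; apply: lee_pmul => //; rewrite lee_fin normc_ge0.
Qed.

(** The weights of U, V and W are inserted and divided out again, so that [T] is the integral
    bounded by [trilinear_weighted_schwarz]; the constants c and M factor out squared. *)
Lemma weighted_fconv_bound (s' b' C c M : R) (H : E -> R[i]) : 0 <= C -> 0 <= c -> 0 <= M ->
  (forall zeta : E, \int[prodm mu3 mu3]_z (Xweight s' b' zeta ^+ 2 *
   ((p z.2)^-1 * (p (sub3 z.2 z.1))^-1 * (p (sub3 zeta z.1))^-1) ^+ 2)%:E <= C%:E)%E ->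
  cmeas H -> (forall y, normc (H y) <= M * normc (fconv U (conj_reflect V) y)) ->
  (\int[mu3]_zeta ((Xweight s' b' zeta * normc (c%:C%C * fconv H W zeta)) ^+ 2)%:E <=
   ((c * M) ^+ 2 * (C * (NU ^+ 2 * NV ^+ 2 * NW ^+ 2)))%:E)%E.
Proof.
move=> C0 c0 M0 hC mH hH.
have mw : measurable_fun [set: E] (fun zeta => Xweight s' b' zeta ^+ 2).
  by apply: measurable_funX; exact: measurable_Xweight.
have w0 (zeta : E) : 0 <= Xweight s' b' zeta ^+ 2 by exact: sqr_ge0.
pose T (zeta : E) := (\int[prodm mu3 mu3]_z ((p z.2)^-1 * (p (sub3 z.2 z.1))^-1 * (p (sub3 zeta z.1))^-1 *
  (p z.2 * normc (U z.2) * (p (sub3 z.2 z.1) * normc (V (sub3 z.2 z.1))) *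
   (p (sub3 zeta z.1) * normc (W (sub3 zeta z.1)))))%:E)%E.
have [mT hT] : measurable_fun setT T /\
    (\int[mu3]_zeta ((Xweight s' b' zeta ^+ 2)%:E * (T zeta * T zeta)) <= (C * (NU ^+ 2 * NV ^+ 2 * NW ^+ 2))%:E)%E.
  apply: (trilinear_weighted_schwarz (measurable_Xweight_normc s b mU) (measurable_Xweight_normc s b mV) (measurable_Xweight_normc s b mW)
  (Xweight_normc_ge0 s b U) (Xweight_normc_ge0 s b V) (Xweight_normc_ge0 s b W) hU hV hW mq q0 mw w0 C0 hC).
have cM0 : 0 <= (c * M) ^+ 2 by exact: sqr_ge0.
have T0 zeta : (0 <= T zeta)%E.
  apply: integral_ge0 => z _; rewrite lee_fin /= weight_cancel3.
  by rewrite !mulr_ge0 ?normc_ge0.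
have mc : cmeas (fconv H W) by apply: cmeas_fconv; [exact: mH|exact: mW].
have mWT : measurable_fun setT (fun zeta => (Xweight s' b' zeta ^+ 2)%:E * (T zeta * T zeta))%E.
  by apply: emeasurable_funM; [exact/measurable_EFinP|exact: emeasurable_funM].
have WT0 zeta : (0 <= (Xweight s' b' zeta ^+ 2)%:E * (T zeta * T zeta))%E.
  by apply: mule_ge0; [rewrite lee_fin; exact: w0|apply: mule_ge0; exact: T0].
apply: (@le_trans _ _ (\int[mu3]_zeta (((c * M) ^+ 2)%:E * ((Xweight s' b' zeta ^+ 2)%:E * (T zeta * T zeta))))%E); last first.
  rewrite ge0_integralZl_EFin; [|exact: measurableT|by move=> zeta _; exact: WT0|exact: mWT|exact: cM0].
  by rewrite [leRHS]EFinM; apply: lee_wpmul2l; [rewrite lee_fin; exact: cM0|exact: hT].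
apply: ge0_le_integralT.
- apply/measurable_EFinP; apply: (measurable_funX 2%N); apply: measurable_Xweight_normc.
  by apply: (cmeasM (f := cst _)); [exact: cmeas_cst|exact: mc].
- by apply: emeasurable_funM; [exact: measurable_cst|exact: mWT].
- by move=> zeta; rewrite lee_fin sqr_ge0.
move=> zeta; have h := normc_fconv_triple mU mV mW zeta M0 mH hH.
have e : T zeta = (\int[prodm mu3 mu3]_z (normc (U z.2) * normc (V (sub3 z.2 z.1)) * normc (W (sub3 zeta z.1)))%:E)%E.
  by apply: eq_integral => z _; rewrite weight_cancel3.
rewrite -e in h.
have n0 : (0 <= (normc (fconv H W zeta))%:E)%E by rewrite lee_fin normc_ge0.
have h2 := lee_pmul n0 n0 h h.
rewrite muleACA -EFinM in h2; rewrite normcM normcR (ger0_norm c0).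
rewrite (_ : (Xweight s' b' zeta * (c * normc (fconv H W zeta))) ^+ 2 =
  c ^+ 2 * Xweight s' b' zeta ^+ 2 * (normc (fconv H W zeta) * normc (fconv H W zeta))); last by ring.
rewrite EFinM; apply: (@le_trans _ _ ((c ^+ 2 * Xweight s' b' zeta ^+ 2)%:E * ((M * M)%:E * (T zeta * T zeta)))%E).
  by apply: lee_wpmul2l; [rewrite lee_fin; apply: mulr_ge0; exact: sqr_ge0|rewrite EFinM; exact: h2].
by rewrite !muleA -!EFinM (_ : c ^+ 2 * Xweight s' b' zeta ^+ 2 * (M * M) = (c * M) ^+ 2 * Xweight s' b' zeta ^+ 2)//; ring.
Qed.

End weighted_convolution.

(** * The symbol of K *)

Section symbol.
Context {R : realType}.
Local Notation E := (E3 R).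
Local Notation mu3 := (mu3 R).

Lemma alpha_ge0 (xi : R * R) : 0 <= alpha xi.
Proof. by rewrite divr_ge0 ?sqr_ge0 ?normsq2_ge0. Qed.

Lemma alpha_le1 (xi : R * R) : alpha xi <= 1.
Proof.
rewrite /alpha; have [->|n0] := eqVneq (normsq2 xi) 0; first by rewrite invr0 mulr0.
by rewrite ler_pdivrMr ?mul1r ?lerDl ?sqr_ge0// lt_neqAle eq_sym n0 normsq2_ge0.
Qed.

Lemma measurable_alpha : measurable_fun [set: E] (fun zeta : E => alpha zeta.1).
Proof.
(* The inverse is written as a real power, a function known to be measurable on the whole line,
   singular point included. *)
rewrite (_ : (fun zeta : E => _) = fun zeta : E => zeta.1.1 ^+ 2 * normsq2 zeta.1 `^ (-1)); last first.
  by apply/funext => zeta; rewrite powR_inv1// normsq2_ge0.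
apply: measurable_funM.
  by apply: measurable_funX; exact: (measurableT_comp measurable_fst measurable_fst).
by apply: (measurableT_comp (measurable_powR _)); apply: measurable_normsq2; exact: measurable_fst.
Qed.

Lemma L2_symbol (F : E -> R[i]) : L2 mu3 F -> L2 mu3 (fun zeta => (alpha zeta.1)%:C%C * F zeta).
Proof.
move=> lF; apply: (L2_le _ lF).
  by apply: cmeasM; [exact: (cmeas_real measurable_alpha)|exact: lF.1].
move=> zeta; rewrite normcM normcR ger0_norm ?alpha_ge0//.
by rewrite ler_piMl ?normc_ge0// alpha_le1.
Qed.

Lemma normc_symbol (c1 c2 : R) (F : E -> R[i]) (zeta : E) :
  normc (c1%:C%C * F zeta + c2%:C%C * ((alpha zeta.1)%:C%C * F zeta)) <= (`|c1| + `|c2|) * normc (F zeta).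
Proof.
apply: (le_trans (normcD _ _)); rewrite !normcM !normcR mulrDl lerD2l.
rewrite ler_wpM2l// ger0_norm ?alpha_ge0// ler_piMl ?normc_ge0// alpha_le1//.
Qed.

End symbol.

Unset Implicit Arguments.
Local Open Scope complex_scope.

Theorem proposition1p2 (R : realType) (s a : R)
    (hs : 2^-1 < s) (ha : a < Num.min 2^-1 (s - 2^-1)) :
  exists2 eps0 : R, 0 < eps0 &
  forall eps : R, 0 < eps -> eps < eps0 ->
  forall c1 c2 : R,
  let b := 2^-1 + eps in
  exists2 C : R, 0 < C &
  forall u v w : R * R * R -> R[i],
    Xspace s b u -> Xspace s b v -> Xspace s b w ->
    let uvbar := fun z => u z * conjc (v z) in
    (exists h, is_c1I_c2K c1 c2 uvbar h) /\
    (forall h, is_c1I_c2K c1 c2 uvbar h ->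
       (Xnorm (s + a) (b - 1) (fun z => (h z * w z)%R)
        <= C%:E * Xnorm s b u * Xnorm s b v * Xnorm s b w)%E).
Proof.
have [eps0 e00 hT] := weighted_trilinear hs ha.
exists eps0 => // eps e0 e1 c1 c2 b.
have [CT CT0 hCT] := hT eps e0 e1.
have hb : 2^-1 < b by rewrite /b ltrDl.
have [CB CB0 hCB] := weighted_bilinear hs hb.
(* Normalization of the convolution theorem. It enters twice: in [M] for the product u conj(v), and
   once more for the product with w. *)
pose k := ((2 * pi) ^+ 3 : R)^-1.
have k0 : 0 <= k by rewrite invr_ge0 ltW// K_gt0.
pose M := (`|c1| + `|c2|) * k.
have M0 : 0 <= M by rewrite mulr_ge0// addr_ge0.
have D0 : 0 <= k * M * Num.sqrt CT by rewrite !mulr_ge0// sqrtr_ge0.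
(* The added 1 makes the constant positive even when c1 = c2 = 0. *)
exists (k * M * Num.sqrt CT + 1); first by rewrite ltr_wpDl.
move=> u v w Xu Xv Xw uvbar.
have i0 : 0 < 2^-1 :> R by rewrite invr_gt0.
have s0 : 0 <= s by rewrite ltW// (lt_trans i0).
have b0 : 0 <= b by rewrite ltW// (lt_trans i0).
have [U [NU [pu NU0 eu iu]]] := Xspace_l2pair s0 b0 Xu.
have [V [NV [pv NV0 ev iv]]] := Xspace_l2pair s0 b0 Xv.
have [W [NW [pw NW0 ew iw]]] := Xspace_l2pair s0 b0 Xw.
have [_ [mU _] _] := pu; have [_ [mV _] _] := pv; have [_ [mW _] _] := pw.
pose F0 y := k%:C * fconv U (conj_reflect V) y.
have lF0 : L2 (mu3 R) F0 by apply: L2Z; exact: (L2_fconv_conj_reflect mU mV iu iv CB0 hCB).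
(* The product rule yields only a distributional transform of the integrable function u conj(v); as
   this transform is in L^2, so is u conj(v) itself, and the product rule can be used again with
   w. *)
have pF0 : l2pair uvbar F0 := is_fourier_l2pair (is_fourier_product pu (l2pair_conj pv)) lF0.
have laF0 := L2_symbol lF0.
split.
  (* The symbol is bounded, so it keeps the transform in L^2, and K(u conj(v)) exists as the L^2
     function with that transform. *)
  have [g pg] := l2pair_exists laF0.
  exists (fun z => c1%:C * uvbar z + c2%:C * g z); exists g => //.
  by exists F0; exact: l2pair_is_fourier.
move=> h [g [F fF gF] ->].
(* An arbitrary h comes with its own transform of u conj(v), equal to [F0] almost everywhere only;
   the transform of its K part is adjusted accordingly. *)
have FF0 := fourier_unique fF (l2pair_is_fourier pF0).
have gF0 : is_fourier g (fun zeta => (alpha zeta.1)%:C * F0 zeta).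
  by apply: (is_fourier_ae gF (tempered_L2 laF0)); apply: ae_imply FF0 => zeta ->.
have ph := l2pair_linear c1%:C c2%:C pF0 (is_fourier_l2pair gF0 laF0).
have [_ [mH _] _] := ph.
have fhw := is_fourier_product ph pw.
rewrite (Xnorm_weightedL2 _ _ fhw) eu ev ew -!EFinM.
apply: weightedL2_le; first by rewrite !mulr_ge0// addr_ge0.
have hH y : normc (c1%:C * F0 y + c2%:C * ((alpha y.1)%:C * F0 y)) <= M * normc (fconv U (conj_reflect V) y).
  apply: (le_trans (normc_symbol c1 c2 F0 y)).
  have -> : normc (F0 y) = k * normc (fconv U (conj_reflect V) y) by rewrite normcM normcR (ger0_norm k0).
  by rewrite /M [leLHS]mulrA.
apply: (le_trans (weighted_fconv_bound mU mV mW iu iv iw CT0 k0 M0 hCT mH hH)).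
rewrite lee_fin.
have -> : (k * M) ^+ 2 * (CT * (NU ^+ 2 * NV ^+ 2 * NW ^+ 2)) = (k * M * Num.sqrt CT * (NU * NV * NW)) ^+ 2.
  by rewrite -{1}(sqr_sqrtr CT0); ring.
have n0 : 0 <= NU * NV * NW by rewrite !mulr_ge0.
have -> : (k * M * Num.sqrt CT + 1) * NU * NV * NW = (k * M * Num.sqrt CT + 1) * (NU * NV * NW) by ring.
move: (k * M * Num.sqrt CT) (NU * NV * NW) D0 n0 => D N D0 n0.
have D1 : 0 <= D + 1 by rewrite addr_ge0.
rewrite lerXn2r ?nnegrE; [|exact: mulr_ge0|exact: mulr_ge0|].
  by [].
by apply: ler_wpM2r; [|rewrite lerDl].
Qed.
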